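(* Let $k\ge 1$ be an integer, let $P_k(x)=\sum_{N=0}^{k^2} c_N(k)\,x^{k^2-N}$ be the polynomial defined in the context, and let $0\le N\le k^2$. Then \[ c_N(k)=\frac{1}{(k^2-N)!}\sum_{\substack{\kappa,\lambda\\ |\kappa|+|\lambda|=N}} d_{\kappa\lambda}(k)\,\dim\!\big(\lambda,\widetilde{\kappa}^{(k)}\big), \] the sum running over ordered pairs of partitions $(\kappa,\lambda)$ of combined weight $N$ (a summand in which $\kappa$ does not fit inside the $k\times k$ square is $0$). Moreover, for every $r\ge1$ and all partitions $\mu,\nu$, the quantity $V_r^{\mu\nu}(k)$ defined in the context is a polynomial in $k$ with rational coefficients, of degree at most $2r$.
   Context: Partitions: a partition $\lambda=(\lambda_1\ge\lambda_2\ge\cdots)$ of nonnegative integers with finitely many nonzero parts; $|\lambda|=\sum\lambda_i$, $\ell(\lambda)$ the number of nonzero parts, $\lambda^t$ the conjugate partition, $\phi$ the empty partition, $\lambda\vdash n$ means $|\lambda|=n$. For partitions $\mu,\nu$, $\dim(\mu,\nu)$ is the number of sequences $\mu=\mu^0\subset\mu^1\subset\cdots\subset\mu^m=\nu$ of Young diagrams, each obtained from the previous by adding exactly one box (i.e. the number of standard tableaux of skew shape $\nu/\mu$); it is $0$ if the diagram of $\mu$ is not contained in that of $\nu$. If $\kappa$ fits in the $k\times k$ square ($\ell(\kappa)\le k$, $\kappa_1\le k$), its complement $\widetilde{\kappa}^{(k)}$ is the partition whose conjugate has parts $(k-\kappa_k,k-\kappa_{k-1},\dots,k-\kappa_1)$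 (padding $\kappa$ with zeros); it has weight $k^2-|\kappa|$ (diagrams of $\kappa$ and of $(\widetilde{\kappa}^{(k)})^t$ rotated by $180^\circ$ tile the $k\times k$ square). Symmetric functions (Macdonald's conventions): $p_r=\sum_i x_i^r$, $p_\mu=\prod_i p_{\mu_i}$, $p_\phi=1$; $z_\mu=\prod_{j\ge1} j^{M_j}M_j!$ with $M_j$ the number of parts of $\mu$ equal to $j$; $h_n=\sum_{\mu\vdash n} z_\mu^{-1}p_\mu$; $s_\lambda$ Schur functions; $m_\mu(y_1,\dots,y_n)=\sum y^a$ over distinct permutations $a$ of $(\mu_1,\dots,\mu_{\ell(\mu)},0,\dots,0)$ (zero if $\ell(\mu)>n$, and $m_\phi=1$). The polynomial $P_k$: for complex $\alpha=(\alpha_1,\dots,\alpha_k)$, $\beta=(\beta_1,\dots,\beta_k)$ set $F_k(\alpha;\beta)=\prod_{p\ \mathrm{prime}}\sum_{u\ge0} h_u(p^{-\alpha_1},\dots,p^{-\alpha_k})\,h_u(p^{\beta_1},\dots,p^{\beta_k})\,p^{-u}$, absolutely convergent for small real parts with $\mathrm{Re}(\alpha_i-\beta_j)>0$ and continued meromorphically near $0$ (with $\prod_{i,j}(\alpha_i-\beta_j)F_k$ holomorphic near $0$). For $\delta=(\delta_1,\dots,\delta_{2k})$ and real $x$, let $Q_k(x;\delta)=\sum_{S\subset\{1,\dots,2k\},|S|=k} e^{-x\sum_{j\notin S}\delta_j}F_k\big((\delta_i)_{i\in S};(\delta_j)_{j\notin S}\big)$ and $P_k(x)=\lim_{\delta\to0}Q_k(x;\delta)$,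 a polynomial of degree at most $k^2$ (this is the output of the Conrey–Farmer–Keating–Rubinstein–Snaith recipe for $\int_0^T|\zeta(1/2+it)|^{2k}dt\approx\int_0^T P_k(\log\frac{t}{2\pi})dt$). Write $P_k(x)=\sum_{N=0}^{k^2}c_N(k)x^{k^2-N}$. Prime zeta coefficients: $\zeta_{\mathcal P}(s)=\sum_p p^{-s}$ ($\mathrm{Re}\,s>1$). For integers $r\ge2$, $\zeta_{\mathcal P}(r+s)=\sum_{n\ge0}C_r(n)s^n$; for $r=1$, $\zeta_{\mathcal P}(1+s)=-\log s+\sum_{n\ge0}C_1(n)s^n$ near $s=0$. Constants: define rational numbers $f_{\kappa\lambda}$ (for nonempty $\kappa,\lambda$ with $|\kappa|=|\lambda|$) by the formal identity, in algebraically independent power sums $p_r(X),p_r(Y)$, $\log\Big(\sum_{n\ge0}h_n(X)h_n(Y)T^n\Big)=\sum_{|\kappa|=|\lambda|\ge1} f_{\kappa\lambda}\,p_\kappa(X)p_\lambda(Y)T^{|\kappa|}$. For $r\ge1$ and partitions $\mu,\nu$ (possibly empty), let $V_r^{\mu\nu}(k)=\frac{(|\mu|+|\nu|)!}{\prod_i\mu_i!\prod_j\nu_j!}\sum_{\kappa,\lambda\vdash r} f_{\kappa\lambda}\,m_\mu(\kappa_1,\dots,\kappa_{\ell(\kappa)})\,m_\nu(\lambda_1,\dots,\lambda_{\ell(\lambda)})\,k^{\ell(\kappa)+\ell(\lambda)-\ell(\mu)-\ell(\nu)}$, $W_{\mu\nu}(k)=\sum_{r\ge1}V_r^{\mu\nu}(k)\,C_r(|\mu|+|\nu|)$,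 and define $d_{\kappa\lambda}(k)$ by the identity in the completion of $\Lambda(X)\otimes\Lambda(Y)$: $\exp\Big(\sum_{\mu,\nu}W_{\mu\nu}(k)\,p_\mu(X)p_\nu(Y)\Big)=\sum_{\kappa,\lambda}d_{\kappa\lambda}(k)\,s_\kappa(X)s_\lambda(Y)$ (sums over all pairs of partitions, including empty ones).
   Formalization: The series defining W_{μν}(k) diverges for k ≥ 3 (e.g. μ=ν=φ, k=3), so W_{μν}(k)=Σ_r V_r^{μν}(k) C_r(|μ|+|ν|) is taken as its Borel sum, which equals the ordinary sum whenever the series converges (in particular for k ≤ 2). *)

(* Defs.v *)
Set Warnings "-notation-overridden,-ambiguous-paths,-notation-incompatible-prefix".
From HB Require Import structures.
From mathcomp Require Import all_boot all_order all_algebra.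
From mathcomp Require Import all_classical all_reals all_analysis.
From mathcomp Require Import complex.
From mathcomp Require monalg.
(* The notations of monalg clash with those of mathcomp-analysis. *)
Import -(notations) monalg.
Import Order.TTheory GRing.Theory Num.Theory numFieldNormedType.Exports.

Set Implicit Arguments.
Unset Strict Implicit.
Unset Printing Implicit Defensive.

Local Open Scope classical_set_scope.
Local Open Scope ring_scope.

Section Partitions.
Local Open Scope nat_scope.

(* A partition is the weakly decreasing sequence of its nonzero parts, so
   [size] is its length, [sumn] its weight and [::] the empty partition. *)
Definition is_part (s : seq nat) : bool := sorted geq s && (0 \notin s).

(* A partition of n, padded with zeros, is a decreasing n-tuple of
   integers in [0, n] with sum n. *)
Definition parts (n : nat) : seq (seq nat) :=
  [seq [seq i <- s | i != 0]
     | s <- [seq [seq val j | j <- tval t] | t <- enum {: n.-tuple 'I_n.+1}]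
     & sorted geq s && (sumn s == n)].

Definition conj_part (s : seq nat) : seq nat :=
  mkseq (fun j => count (fun x => j < x) s) (head 0 s).

Definition fits (k : nat) (kap : seq nat) : bool :=
  (size kap <= k) && (head 0 kap <= k).

(* Parts beyond [size kap] are read as 0 by [nth]. *)
Definition compl_part (k : nat) (kap : seq nat) : seq nat :=
  conj_part [seq x <- mkseq (fun i => k - nth 0 kap (k.-1 - i)) k | x != 0].

(* Number of chains of m one-box additions leading from mu to nu: adding a
   box to row i of mu must give a partition again, and i = size mu opens a
   new row. *)
Fixpoint nb_chains (m : nat) (mu nu : seq nat) : nat :=
  if m is m'.+1 then
    \sum_(i < (size mu).+1 | is_part (incr_nth mu i))
       nb_chains m' (incr_nth mu i) nu
  else (mu == nu : nat).

Definition dim_skew (mu nu : seq nat) : nat :=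
  nb_chains (sumn nu - sumn mu) mu nu.

Definition zpart (mu : seq nat) : nat :=
  \prod_(j <- undup mu) (j ^ count_mem j mu * (count_mem j mu)`!).

(* The monomial symmetric function m_mu evaluated at the entries of y;
   [permutations] lists the distinct permutations. *)
Definition monomial_sym (mu y : seq nat) : nat :=
  if size mu <= size y then
    \sum_(a <- permutations (mu ++ nseq (size y - size mu) 0))
       \prod_(i < size y) nth 0 y i ^ nth 0 a i
  else 0.

End Partitions.

Section SymmetricFunctions.
Variables (K : fieldType) (A : comAlgType K).

(* [p] is the sequence of power sums of the alphabet; [p 0] is not used. *)
Definition pprod (p : nat -> A) (mu : seq nat) : A := \prod_(i <- mu) p i.

Definition hsym (p : nat -> A) (n : nat) : A :=
  \sum_(mu <- parts n) (zpart mu)%:R^-1 *: pprod p mu.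

(* Jacobi-Trudi determinant of the h_(lam_i - i + j), with h_n = 0 for n < 0 *)
Definition schur (p : nat -> A) (lam : seq nat) : A :=
  \det (\matrix_(i < size lam, j < size lam)
    if (i <= nth 0 lam i + j)%N then hsym p (nth 0 lam i + j - i)%N else 0).

End SymmetricFunctions.

(* Lambda(X) (x) Lambda(Y) over K, as the polynomial ring in the
   independent power sums p_r(X) (index inl r) and p_r(Y) (index inr r). *)
Definition symXY (K : fieldType) : comAlgType K :=
  malg (cmonom (nat + nat)%type) K.

Definition pX (K : fieldType) (r : nat) : symXY K := mkmalgU (ucm (inl r)) 1.
Definition pY (K : fieldType) (r : nat) : symXY K := mkmalgU (ucm (inr r)) 1.

(* Coefficient of p_mu(X) p_nu(Y) *)
Definition pcoef (K : fieldType) (mu nu : seq nat) (g : symXY K) : K :=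
  mcoeff (mmul (\big[mmul/mone]_(i <- mu) ucm (inl i))
               (\big[mmul/mone]_(i <- nu) ucm (inr i))) g.

Section ArithmeticConstants.

Definition cauchy_trunc (n : nat) : {poly symXY rat} :=
  \sum_(1 <= m < n.+1) (hsym (@pX rat) m * hsym (@pY rat) m) *: 'X^m.

(* Coefficient of T^n in log (1 + U) = sum_(j >= 1) (-1)^(j-1) U^j / j, where
   U = sum_(m >= 1) h_m(X) h_m(Y) T^m; only m <= n and j <= n contribute. *)
Definition log_cauchy_coef (n : nat) : symXY rat :=
  \sum_(1 <= j < n.+1)
    ((-1) ^+ j.-1 / j%:R : rat) *: (cauchy_trunc n ^+ j)`_n.

(* Meaningful for |kap| = |lam| >= 1. *)
Definition fcoef (kap lam : seq nat) : rat :=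
  pcoef kap lam (log_cauchy_coef (sumn kap)).

(* The exponent of k is a (possibly negative) integer. *)
Definition Vcoef (r : nat) (mu nu : seq nat) (k : nat) : rat :=
  ((sumn mu + sumn nu)`!)%:R
    / (\prod_(i <- mu) i`! * \prod_(j <- nu) j`!)%N%:R
  * \sum_(kap <- parts r) \sum_(lam <- parts r)
      fcoef kap lam * (monomial_sym mu kap)%:R * (monomial_sym nu lam)%:R
      * (k%:R : rat) ^ ((size kap)%:Z + (size lam)%:Z
                        - (size mu)%:Z - (size nu)%:Z).

End ArithmeticConstants.

(* R[i] under a name that gives access to the topology that
   mathcomp-analysis puts on every numFieldType. *)
Definition cplx (R : realType) : numClosedFieldType := R[i].

Section Analysis.
Variable R : realType.
Local Notation C := (cplx R).

Definition toC (x : R) : C := (x%:C)%C.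
Definition re (z : C) : R := complex.Re z.
Definition im (z : C) : R := complex.Im z.

Definition cexp (z : C) : C :=
  toC (expR (re z)) * ((cos (im z) +i* sin (im z))%C : C).

(* The principal logarithm on the half-plane Re z > 0. *)
Definition clog (z : C) : C := ((ln (Num.sqrt (re z ^+ 2 + im z ^+ 2)))
                                  +i* atan (im z / re z))%C.

Definition npow (p : nat) (s : C) : C := cexp (s * toC (ln p%:R)).

Definition prime_zeta (s : C) : C :=
  limn (fun n => \sum_(p < n | prime p) npow p (- s)).

Definition is_prime_zeta_coefs (r : nat) (c : nat -> C) : Prop :=
  \forall s \near (0 : C), (r = 1%N -> 0 < re s) ->
    (series (fun n => c n * s ^+ n) : nat -> C) @ \oo -->
      (prime_zeta (r%:R + s) + (if r == 1%N then clog s else 0)).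

Definition Ccoef (r : nat) : nat -> C :=
  xget (fun=> 0) [set c | is_prime_zeta_coefs r c].

(* Borel sum of sum_(n >= 0) a_n, that is the limit as x -> +oo of
   e^(-x) sum_n s_n x^n / n! with s_n = a_0 + ... + a_n.  It is the ordinary
   sum whenever the series converges. *)
Definition borel_mean (a : nat -> C) (x : R) : C :=
  toC (expR (- x))
  * limn (series (fun n => (\sum_(i < n.+1) a i) * toC (x ^+ n / n`!%:R))).

Definition borel_sum (a : nat -> C) : C := lim (borel_mean a x @[x --> +oo]).

(* The sum over r >= 1 is taken in the sense of Borel.  It converges in the
   ordinary sense for k <= 2.  For k >= 3, sum_u h_u(1^k)^2 T^u has a zero in
   -1/2 < T < 0, which makes its logarithm sum_r V_r^(0,0)(k) T^r diverge at
   T = 1/2 and hence also the series of the V_r^(0,0)(k) C_r(0), as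
   C_r(0) ~ 2^(-r). *)
Definition Wcoef (k : nat) (mu nu : seq nat) : C :=
  borel_sum (fun r => ratr (Vcoef r.+1 mu nu k)
                      * Ccoef r.+1 (sumn mu + sumn nu)%N).

(* The part of sum_(mu, nu) W_(mu, nu) p_mu(X) p_nu(Y) in total degrees
   1, ..., D *)
Definition W_trunc (k D : nat) : symXY C :=
  \sum_(1 <= e < D.+1) \sum_(a < e.+1)
    \sum_(mu <- parts a) \sum_(nu <- parts (e - a))
      Wcoef k mu nu *: (pprod (@pX C) mu * pprod (@pY C) nu).

(* Coefficient of p_mu(X) p_nu(Y) in exp (sum W p p): the terms of the
   exponential series of the part without constant term that have total
   degree D use at most D factors of degree at most D. *)
Definition exp_W_coef (k : nat) (mu nu : seq nat) : C :=
  let D := (sumn mu + sumn nu)%N in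
  cexp (Wcoef k [::] [::])
  * pcoef mu nu (\sum_(j < D.+1) (j`!)%:R^-1 *: W_trunc k D ^+ j).

(* Equality of the coefficients of p_mu(X) p_nu(Y); s_kap(X) s_lam(Y) is
   homogeneous of bidegree (|kap|, |lam|). *)
Definition is_schur_expansion (k : nat) (d : seq nat -> seq nat -> C) : Prop :=
  forall mu nu, is_part mu -> is_part nu ->
    exp_W_coef k mu nu =
    \sum_(kap <- parts (sumn mu)) \sum_(lam <- parts (sumn nu))
      d kap lam * pcoef mu nu (schur (@pX C) kap * schur (@pY C) lam).

Definition dcoef (k : nat) : seq nat -> seq nat -> C :=
  xget (fun _ _ => 0) [set d | is_schur_expansion k d].

Definition power_sum (k : nat) (x : 'rV[C]_k) (r : nat) : C^o :=
  \sum_(i < k) x ord0 i ^+ r.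

Definition local_factor (k p : nat) (alpha beta : 'rV[C]_k) : C :=
  limn (series (fun u =>
    (hsym (power_sum (\row_i npow p (- alpha ord0 i))) u : C)
    * (hsym (power_sum (\row_i npow p (beta ord0 i))) u : C)
    / p%:R ^+ u)).

Definition euler_product (k : nat) (alpha beta : 'rV[C]_k) : C :=
  limn (fun n => \prod_(p < n | prime p) local_factor p alpha beta).

Definition cmonomial (n : nat) (m : {ffun 'I_n -> nat}) (z : 'rV[C]_n) : C :=
  \prod_i z ord0 i ^+ m i.

(* H is, on some polydisc centred at 0, the sum of an absolutely convergent
   power series in n variables. *)
Definition holomorphic_near0 (n : nat) (H : 'rV[C]_n -> C) : Prop :=
  exists a : {ffun 'I_n -> nat} -> C, \forall z \near (0 : 'rV[C]_n),
    let term (m : {ffun 'I_n -> nat}) := a m * cmonomial m z in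
    let box d (G : {ffun 'I_n -> nat} -> C) :=
      \sum_(m : {ffun 'I_n -> 'I_d}) G [ffun i => m i : nat] in
    (exists M : C, forall d, box d (fun m => `|term m|) <= M) /\
    (box d term @[d --> \oo] --> H z).

Definition polar_product (k : nat) (alpha beta : 'rV[C]_k) : C :=
  \prod_(i < k) \prod_(j < k) (alpha ord0 i - beta ord0 j).

(* The values of F near 0 and off the polar divisor are those of the
   meromorphic continuation of the Euler product; its values elsewhere are
   irrelevant. *)
Definition is_continuation (k : nat) (F : 'rV[C]_k -> 'rV[C]_k -> C) : Prop :=
  (\forall z \near (0 : 'rV[C]_(k + k)),
     (forall i j, 0 < re (lsubmx z ord0 i - rsubmx z ord0 j)) ->
     F (lsubmx z) (rsubmx z) = euler_product (lsubmx z) (rsubmx z)) /\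
  exists2 H : 'rV[C]_(k + k) -> C, holomorphic_near0 H &
    \forall z \near (0 : 'rV[C]_(k + k)),
      polar_product (lsubmx z) (rsubmx z) != 0 ->
      polar_product (lsubmx z) (rsubmx z) * F (lsubmx z) (rsubmx z) = H z.

Definition Fk (k : nat) : 'rV[C]_k -> 'rV[C]_k -> C :=
  xget (fun _ _ => 0) [set F | is_continuation F].

(* The subfamily of delta indexed by S, in increasing order. *)
Definition subfamily (k n : nat) (S : {set 'I_n}) (delta : 'rV[C]_n) : 'rV[C]_k :=
  \row_(i < k) [seq delta ord0 j | j <- enum S]`_i.

Definition Qk (k : nat) (x : R) (delta : 'rV[C]_(2 * k)) : C :=
  \sum_(S : {set 'I_(2 * k)} | #|S| == k)
    cexp (- toC x * \sum_(j in ~: S) delta ord0 j)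
    * Fk (subfamily k S delta) (subfamily k (~: S) delta).

(* The limit is over delta with distinct entries, where all the summands of
   Q_k are defined. *)
Definition is_moment_poly (k : nat) (P : {poly C}) : Prop :=
  (size P <= (k ^ 2).+1)%N /\
  forall x : R,
    Qk x delta @[delta --> within [set delta : 'rV[C]_(2 * k) |
                                     injective (delta ord0)]
                                  (nbhs (0 : 'rV[C]_(2 * k)))]
    --> P.[toC x].

Definition Pk (k : nat) : {poly C} := xget 0 [set P | is_moment_poly k P].

Definition moment_coef (k N : nat) : C := (Pk k)`_(k ^ 2 - N).

End Analysis.

(* Main.v *)
(* Scale the arguments by a formal variable t, so that the alphabets of the local factor
   at p become p^(-alpha_i t) and p^(beta_j t). Their power sums p_r are series in r t log p,
   and the coefficient of t^e in the logarithm of the local factor is a polynomial in p_mu(alpha)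
   and p_nu(-beta), |mu| + |nu| = e, whose coefficients are the series
   (-log p)^e / e! * sum_r V_r^(mu nu)(k) p^-r. For e >= 1 such a series is a rational function of
   T = p^-1 whose denominator is a product of factors 1 - rho T with rho real and rho <= 1, because
   the numerator of sum_n C(n+k-1,k-1)^2 T^n has only real negative roots (an argument of
   Gauss-Lucas type); for e = 0 it is a logarithm of such functions. It may therefore be summed
   over r by Borel means, also for the small primes where it diverges; summing over p then gives W.
   The term r = 1 is divergent over p and supplies the poles: it is taken out as a product of values
   of zeta(1 + alpha_i - beta_j), which accounts for the constants C_1(n). Hence
   prod (alpha_i - beta_j) F_k = sum d_(kappa lambda) s_kappa(alpha) s_lambda(-beta) near 0.

   In Q_k, expand e^(-x sum delta_j) and multiply by s_lambda with the Pieri rule, which produces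
   the numbers of chains. The sum over S of s_kappa s_nu / prod (delta_i - delta_j) is, by Laplace
   expansion of a bialternant, a determinant of the h_m(delta): it is a homogeneous polynomial of
   degree |kappa| + |nu| - k^2, which vanishes for |kappa| + |nu| < k^2 and is (-1)^|nu| or 0 for
   |kappa| + |nu| = k^2, according to whether nu is the complement of kappa. As delta -> 0 only
   the degree k^2 survives; the terms of higher degree are controlled by a Cauchy estimate on a
   torus with distinct radii. *)
Require Import Defs.
From HB Require Import structures.
From mathcomp Require Import all_boot all_order all_algebra.
From mathcomp Require Import all_classical all_reals all_analysis.
From mathcomp Require Import complex finmap ring lra zify perm.
From mathcomp Require monalg.
Import -(notations) monalg.
Import Order.TTheory GRing.Theory Num.Theory numFieldNormedType.Exports.

Set Implicit Arguments.
Unset Strict Implicit.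
Unset Printing Implicit Defensive.

Local Open Scope ring_scope.

(** * Formal power series *)

(** Only series in one variable occur: t is the scale of the exponents, T marks the degree, and
    series in t are evaluated at t = 1. Identities between exponentials are proved by comparing
    logarithmic derivatives under t d/dt or T d/dT, so that no logarithm of a function has to be
    chosen. Where the series in r diverges at T = 1 / p, its Borel mean is recognised as the value
    at 1 / p of a rational function; such values are compatible with sums and products, and so the
    formal identity for the logarithm of the Cauchy series survives evaluation. A branch of the
    complex logarithm has to be tracked for the constants C_1(n): the exponentials agree, and
    continuity along vertical segments removes the multiples of 2 pi i. The constants C_r(n), the
    function F_k and the polynomial P_k are chosen from a specification, hence need existence and
    uniqueness. For F_k it is the homogeneous components of prod (alpha_i - beta_j) F_k that are
    unique, being determined on the open cone where all Re (alpha_i - beta_j) > 0. *)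

Record fps (A : Type) := Fps { fpn :> nat -> A }.

HB.instance Definition _ (A : Type) := gen_eqMixin (fps A).
HB.instance Definition _ (A : Type) := gen_choiceMixin (fps A).

Lemma fpsP (A : Type) (f g : fps A) : (forall n, f n = g n) -> f = g.
Proof. by case: f g => [f] [g] /= fg; congr Fps; apply: funext. Qed.

(* Locked: simplification must not unfold products of series. *)
HB.lock Definition fpsM (A : comNzRingType) (f g : fps A) : fps A :=
  Fps (fun n => \sum_(i < n.+1) f i * g (n - i)%N).

Arguments fpsM {A} f g.

Section FpsRing.
Variable A : comNzRingType.
Implicit Types f g h : fps A.

Definition fps0 : fps A := Fps (fun=> 0).
Definition fps1 : fps A := Fps (fun n => (n == 0%N)%:R).
Definition fpsD f g : fps A := Fps (fun n => f n + g n).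
Definition fpsN f : fps A := Fps (fun n => - f n).

Lemma fpsME f g n : fpsM f g n = \sum_(i < n.+1) f i * g (n - i)%N.
Proof. by rewrite fpsM.unlock. Qed.

Lemma fpsDE f g n : fpsD f g n = f n + g n. Proof. by []. Qed.

Fact fpsDA : associative fpsD.
Proof. by move=> f g h; apply: fpsP => n; rewrite /fpsD /= addrA. Qed.
Fact fpsDC : commutative fpsD.
Proof. by move=> f g; apply: fpsP => n; rewrite /fpsD /= addrC. Qed.
Fact fps0D : left_id fps0 fpsD.
Proof. by move=> f; apply: fpsP => n; rewrite /fpsD /= add0r. Qed.
Fact fpsND : left_inverse fps0 fpsN fpsD.
Proof. by move=> f; apply: fpsP => n; rewrite /fpsD /= addNr. Qed.

HB.instance Definition _ :=
  GRing.isZmodule.Build (fps A) fpsDA fpsDC fps0D fpsND.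

Definition ftrunc N f : {poly A} := \poly_(i < N) f i.

Lemma fpsM_trunc N f g n : (n < N)%N ->
  fpsM f g n = (ftrunc N f * ftrunc N g)`_n.
Proof.
move=> nN; rewrite fpsME coefM /=; apply: eq_bigr => i _.
have iN : (i < N)%N by apply: leq_ltn_trans nN; rewrite -ltnS.
have niN : (n - i < N)%N by apply: leq_ltn_trans nN; apply: leq_subr.
by rewrite !coef_poly iN niN.
Qed.

Fact fpsMC : commutative (@fpsM A).
Proof. by move=> f g; apply: fpsP => n; rewrite !(fpsM_trunc _ _ (ltnSn n)) mulrC. Qed.

Fact fpsMA : associative (@fpsM A).
Proof.
move=> f g h; apply: fpsP => n.
have step (p : {poly A}) (u v : fps A) :
    (p * ftrunc n.+1 (fpsM u v))`_n
    = (p * (ftrunc n.+1 u * ftrunc n.+1 v))`_n.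
  rewrite !coefM; apply: eq_bigr => i _; congr (_ * _).
  rewrite coef_poly ltnS leq_subr.
  by apply: fpsM_trunc; rewrite ltnS leq_subr.
rewrite (fpsM_trunc _ _ (ltnSn n)) step [RHS](fpsM_trunc _ _ (ltnSn n)).
by rewrite [in RHS]mulrC step mulrA mulrC.
Qed.

Fact fps1M : left_id fps1 (@fpsM A).
Proof.
move=> f; apply: fpsP => n; rewrite fpsME.
rewrite big_ord_recl /= subn0 mul1r big1 ?addr0 // => i _.
by rewrite mul0r.
Qed.

Fact fpsMDl : left_distributive (@fpsM A) fpsD.
Proof.
move=> f g h; apply: fpsP => n; rewrite fpsME fpsDE !fpsME -big_split /=.
by apply: eq_bigr => i _; rewrite mulrDl.
Qed.

Fact fps1_neq0 : fps1 != 0 :> fps A.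
Proof.
apply/eqP => /(congr1 (fun f : fps A => f 0%N)) e.
by have /eqP := oner_neq0 A; apply; exact: e.
Qed.

HB.instance Definition _ :=
  GRing.Zmodule_isComNzRing.Build (fps A) fpsMA fpsMC fps1M fpsMDl fps1_neq0.

Lemma fpn0 n : (0 : fps A) n = 0. Proof. by []. Qed.
Lemma fpn1 n : (1 : fps A) n = (n == 0%N)%:R. Proof. by []. Qed.
Lemma fpnD f g n : (f + g) n = f n + g n. Proof. by []. Qed.
Lemma fpnN f n : (- f) n = - f n. Proof. by []. Qed.
Lemma fpnB f g n : (f - g) n = f n - g n. Proof. by []. Qed.
Lemma fpnM f g n : (f * g) n = \sum_(i < n.+1) f i * g (n - i)%N.
Proof. exact: fpsME. Qed.

Lemma fpn_sum I (r : seq I) P (F : I -> fps A) n :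
  (\sum_(i <- r | P i) F i) n = \sum_(i <- r | P i) F i n.
Proof. exact: (big_morph (fun f : fps A => f n)). Qed.

Lemma fpnMn f m n : (f *+ m) n = f n *+ m.
Proof. by elim: m => [|m IH]; rewrite ?mulr0n // !mulrS fpnD IH. Qed.

Lemma fpnM0 f g : (f * g) 0%N = f 0%N * g 0%N.
Proof. by rewrite fpnM big_ord1. Qed.

Lemma fpn_prod0 I (r : seq I) P (F : I -> fps A) :
  (\prod_(i <- r | P i) F i) 0%N = \prod_(i <- r | P i) F i 0%N.
Proof. by apply: (big_morph (fun f : fps A => f 0%N)) => // f g; rewrite fpnM0. Qed.

Definition fpoly (p : {poly A}) : fps A := Fps (fun n => p`_n).

Fact fpoly_is_zmod_morphism : zmod_morphism fpoly.
Proof. by move=> p q; apply: fpsP => n; rewrite fpnB /= coefB. Qed.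
Fact fpoly_is_monoid_morphism : monoid_morphism fpoly.
Proof.
split=> [|p q]; apply: fpsP => n; first by rewrite fpn1 /= coef1.
by rewrite fpnM /= coefM.
Qed.
HB.instance Definition _ :=
  GRing.isZmodMorphism.Build {poly A} (fps A) fpoly fpoly_is_zmod_morphism.
HB.instance Definition _ :=
  GRing.isMonoidMorphism.Build {poly A} (fps A) fpoly fpoly_is_monoid_morphism.

Definition fpC (a : A) : fps A := fpoly a%:P.
Fact fpC_is_zmod_morphism : zmod_morphism fpC.
Proof. by move=> a b; rewrite /fpC polyCB rmorphB. Qed.
Fact fpC_is_monoid_morphism : monoid_morphism fpC.
Proof. by split=> [|a b]; rewrite /fpC ?polyCM ?rmorphM ?rmorph1. Qed.
HB.instance Definition _ :=
  GRing.isZmodMorphism.Build A (fps A) fpC fpC_is_zmod_morphism.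
HB.instance Definition _ :=
  GRing.isMonoidMorphism.Build A (fps A) fpC fpC_is_monoid_morphism.

Lemma fpnC a n : fpC a n = if n == 0%N then a else 0.
Proof. by rewrite /fpC /= coefC. Qed.

Lemma fpnCM a f n : (fpC a * f) n = a * f n.
Proof.
rewrite fpnM big_ord_recl fpnC /= subn0 big1 ?addr0 // => i _.
by rewrite /= coefC mul0r.
Qed.

Definition fpX : fps A := fpoly 'X.

Lemma fpnXM f n : (fpX * f) n = if n is n'.+1 then f n' else 0.
Proof.
rewrite fpnM; case: n => [|n]; first by rewrite big_ord1 /= coefX mul0r.
rewrite big_ord_recl big_ord_recl /= !coefX /= mul0r add0r mul1r subSS subn0.
by rewrite big1 ?addr0 // => i _; rewrite coefX /= mul0r.
Qed.

Lemma fpX_inj : injective (fun f => fpX * f).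
Proof.
move=> f g fg; apply: fpsP => n.
by have /(congr1 (fun h : fps A => h n.+1)) := fg; rewrite !fpnXM.
Qed.

(** The derivation T d/dT. Unlike d/dT it keeps the index, so logarithmic derivatives are compared
    coefficient by coefficient without shifts. *)
Definition feuler f : fps A := Fps (fun n => f n *+ n).

Lemma feulerE f n : feuler f n = f n *+ n. Proof. by []. Qed.

Fact feuler_is_zmod_morphism : zmod_morphism feuler.
Proof. by move=> f g; apply: fpsP => n; rewrite fpnB !feulerE fpnB mulrnBl. Qed.
HB.instance Definition _ :=
  GRing.isZmodMorphism.Build (fps A) (fps A) feuler feuler_is_zmod_morphism.

Lemma feulerM f g : feuler (f * g) = feuler f * g + f * feuler g.
Proof.
apply: fpsP => n; rewrite fpnD !fpnM feulerE fpnM -big_split /= -sumrMnl.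
apply: eq_bigr => i _; rewrite mulrnAl mulrnAr -mulrnDr.
by rewrite subnKC // -ltnS.
Qed.

Lemma feuler1 : feuler 1 = 0.
Proof. by apply: fpsP => -[|n]; rewrite feulerE ?mulr0n // fpn1 mul0rn. Qed.

Lemma feuler_fpC a : feuler (fpC a) = 0.
Proof. by apply: fpsP => -[|n]; rewrite feulerE fpnC ?mulr0n //= mul0rn. Qed.

Lemma feulerX f n : feuler (f ^+ n.+1) = f ^+ n * feuler f *+ n.+1.
Proof.
elim: n => [|n IH]; first by rewrite expr1 expr0 mul1r mulr1n.
rewrite exprS feulerM IH mulrnAr [in RHS]mulrS.
by congr (_ + _ *+ _); rewrite ?mulrA -?exprS // [RHS]mulrC.
Qed.

Lemma feuler_fpoly p : feuler (fpoly p) = fpX * fpoly p^`().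
Proof.
apply: fpsP => -[|n]; rewrite feulerE fpnXM //= ?mulr0n //.
by rewrite coef_deriv.
Qed.

End FpsRing.
Arguments fpX {A}.

Section FpsMap.
Variables (A B : comNzRingType) (phi : {rmorphism A -> B}).

Definition fmap_fps (f : fps A) : fps B := Fps (fun n => phi (f n)).
Fact fmap_fps_is_zmod_morphism : zmod_morphism fmap_fps.
Proof. by move=> f g; apply: fpsP => n; rewrite fpnB /= rmorphB. Qed.
Fact fmap_fps_is_monoid_morphism : monoid_morphism fmap_fps.
Proof.
split=> [|f g]; apply: fpsP => n; first by rewrite fpn1 /= rmorph_nat.
rewrite fpnM /= fpnM rmorph_sum; apply: eq_bigr => i _; by rewrite rmorphM.
Qed.
HB.instance Definition _ :=
  GRing.isZmodMorphism.Build (fps A) (fps B) fmap_fps fmap_fps_is_zmod_morphism.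
HB.instance Definition _ :=
  GRing.isMonoidMorphism.Build (fps A) (fps B) fmap_fps
    fmap_fps_is_monoid_morphism.
End FpsMap.

Section FpsScale.
Variables (A : comNzRingType) (c : A).

Definition fscale (f : fps A) : fps A := Fps (fun n => c ^+ n * f n).
Fact fscale_is_zmod_morphism : zmod_morphism fscale.
Proof. by move=> f g; apply: fpsP => n; rewrite fpnB /= mulrBr. Qed.
Fact fscale_is_monoid_morphism : monoid_morphism fscale.
Proof.
split=> [|f g]; apply: fpsP => n.
  by rewrite fpn1 /=; case: n => [|n]; rewrite ?mul1r // mulr0.
rewrite fpnM /= fpnM mulr_sumr; apply: eq_bigr => i _.
by rewrite mulrACA -exprD subnKC // -ltnS.
Qed.
HB.instance Definition _ :=
  GRing.isZmodMorphism.Build (fps A) (fps A) fscale fscale_is_zmod_morphism.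
HB.instance Definition _ :=
  GRing.isMonoidMorphism.Build (fps A) (fps A) fscale fscale_is_monoid_morphism.
End FpsScale.

(** Cancellation of positive integers is all the divisibility that Newton's recursion needs to
    determine its solution. It passes to [fps B], where no scalar multiplication by a field is set
    up. *)
Definition torsion_free (B : comNzRingType) :=
  forall (n : nat) (x : B), x *+ n.+1 = 0 -> x = 0.

Lemma torsion_free_inj (B : comNzRingType) : torsion_free B ->
  forall n, injective (fun x : B => x *+ n.+1).
Proof.
move=> tf n x y xy; apply/eqP; rewrite -subr_eq0; apply/eqP.
by apply: (tf n); rewrite mulrnBl xy subrr.
Qed.

Lemma torsion_free_fps (B : comNzRingType) :
  torsion_free B -> torsion_free (fps B).
Proof.
move=> tf n f f0; apply: fpsP => m; apply: (tf n).
by rewrite -fpnMn f0.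
Qed.

Lemma torsion_free_alg (K : numFieldType) (B : comAlgType K) : torsion_free B.
Proof.
move=> n x; rewrite -scaler_nat => /eqP; rewrite scaler_eq0 pnatr_eq0 /=.
by move/eqP.
Qed.

(* [newton P H] says that sum H_n T^n = exp (sum P_r T^r / r). *)
Definition newton (B : comNzRingType) (P H : nat -> B) :=
  H 0%N = 1 /\ forall n, H n *+ n = \sum_(1 <= r < n.+1) P r * H (n - r)%N.

Section Newton.
Variable B : comNzRingType.
Hypothesis tf : torsion_free B.

Lemma newton_uniq (P H G : nat -> B) : newton P H -> newton P G -> H =1 G.
Proof.
move=> [H0 HP] [G0 GP] n; elim/ltn_ind: n => -[|n] IH; first by rewrite H0 G0.
apply: (torsion_free_inj tf (n := n)); rewrite HP GP.
apply: eq_big_nat => r /andP[r0 rn]; congr (_ * _); apply: IH.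
by rewrite ltn_subrL r0.
Qed.

Lemma newton_feuler (P H : nat -> B) : newton P H <->
  H 0%N = 1 /\ feuler (Fps H) = Fps (fun r => if r is 0 then 0 else P r) * Fps H.
Proof.
rewrite /newton; split=> -[H0 HP]; split=> //.
  apply: fpsP => n; rewrite feulerE fpnM /= HP big_ord_recl mul0r add0r.
  by rewrite big_add1 big_mkord.
move=> n; have /(congr1 (fun f : fps B => f n)) := HP.
rewrite feulerE fpnM /= => ->; rewrite big_ord_recl mul0r add0r.
by rewrite big_add1 big_mkord.
Qed.

Lemma newton_mul (P Q H G : nat -> B) : newton P H -> newton Q G ->
  newton (fun r => P r + Q r) (fun n => \sum_(i < n.+1) H i * G (n - i)%N).
Proof.
move=> /newton_feuler [H0 HP] /newton_feuler [G0 GQ]; apply/newton_feuler.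
split; first by rewrite big_ord1 H0 G0 mulr1.
have -> : Fps (fun n => \sum_(i < n.+1) H i * G (n - i)%N) = Fps H * Fps G.
  by apply: fpsP => n; rewrite fpnM.
rewrite feulerM HP GQ [in Fps H * _]mulrCA -mulrA -mulrDl; congr (_ * _).
by apply: fpsP => -[|r]; rewrite fpnD //= addr0.
Qed.

(** If H = exp L then D H = D L * H. The derivation D acts on the coefficients, not on T; it will be
    the Euler operator in t. *)
Lemma newton_deriv (D : B -> B) (L H : nat -> B) :
    {morph D : x y / x + y} -> (forall x y, D (x * y) = D x * y + x * D y) ->
  newton (fun r => L r *+ r) H ->
  forall n, D (H n) = \sum_(1 <= r < n.+1) D (L r) * H (n - r)%N.
Proof.
move=> DD DM [H0 HL].
have D0 : D 0 = 0 by apply: (addrI (D 0)); rewrite -DD !addr0.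
have D1 : D 1 = 0 by apply: (addrI (D 1)); rewrite -{1}(mulr1 (D 1)) -{2}(mul1r (D 1)) -DM mulr1 addr0.
have Dn x n : D (x *+ n) = D x *+ n.
  by elim: n => [|n IH]; rewrite ?mulr0n // !mulrS DD IH.
have Dsum I (r : seq I) (F : I -> B) : D (\sum_(i <- r) F i) = \sum_(i <- r) D (F i).
  exact: (big_morph D).
elim/ltn_ind => -[|n] IH; first by rewrite H0 D1 big_geq.
apply: (torsion_free_inj tf (n := n)); rewrite /= -Dn HL Dsum /=.
under eq_bigr do rewrite DM Dn.
rewrite big_split /= -sumrMnl.
(* By induction both sides run over the pairs i, s >= 1 with i + s <= n + 1; for fixed s the sum
   over i is the recursion for H at n + 1 - s. *)
have -> : \sum_(1 <= i < n.+2) (L i *+ i) * D (H (n.+1 - i)%N)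
   = \sum_(1 <= s < n.+2) D (L s) * H (n.+1 - s)%N *+ (n.+1 - s).
  transitivity (\sum_(1 <= i < n.+2) \sum_(1 <= s < n.+2 | (i + s <= n.+1)%N)
      (L i *+ i) * (D (L s) * H (n.+1 - i - s)%N)).
    apply: eq_big_nat => i /andP[i1 iN].
    rewrite IH ?ltn_subrL ?i1 // mulr_sumr.
    rewrite (@big_nat_widen _ _ _ _ (n.+1 - i).+1 n.+2); last by lia.
    rewrite big_nat_cond [RHS]big_nat_cond; apply: eq_bigl => s.
    by apply/idP/idP; lia.
  rewrite (exchange_big_dep xpredT) //=; apply: eq_big_nat => s /andP[s1 sN].
  rewrite -mulrnAr HL mulr_sumr.
  rewrite [RHS](@big_nat_widen _ _ _ _ _ n.+2); last by lia.
  rewrite big_nat_cond [RHS]big_nat_cond; apply: eq_big => [i|i].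
    by apply/idP/idP; lia.
  move=> _; rewrite mulrCA; congr (_ * (_ * H _)); lia.
rewrite -big_split /=; apply: eq_big_nat => r /andP[r1 rN].
by rewrite mulrnAl -mulrnDr subnKC.
Qed.

End Newton.

(** * Partitions and the functions h_n *)

Section PartitionLists.
Local Open Scope nat_scope.
Implicit Types mu nu s : seq nat.

Lemma geq_trans : transitive geq.
Proof. by move=> a b c ba cb; apply: leq_trans cb ba. Qed.
Lemma geq_anti : antisymmetric geq.
Proof. by move=> a b /= h; apply: anti_leq; rewrite andbC. Qed.
Lemma geq_total : total geq.
Proof. by move=> a b; apply: leq_total. Qed.

Lemma sorted_geq_pad s : sorted geq s ->
  s = [seq i <- s | i != 0] ++ nseq (size s - size [seq i <- s | i != 0]) 0.
Proof.
elim: s => //= x s IH sx; have {IH}e := IH (path_sorted sx).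
case: x sx => [|x] sx /=; last by rewrite subSS -e.
have s0 : all (pred1 0) s.
  apply/allP => y /(allP (order_path_min geq_trans sx)) /=.
  by rewrite leqn0.
have -> : [seq i <- s | i != 0] = [::].
  apply/eqP; rewrite -(negbK (_ == _)) -has_filter; apply/hasPn => y.
  by move/(allP s0) => /= ->.
by rewrite subn0 /=; congr cons; apply/all_pred1P.
Qed.

Lemma sumn_filter_neq0 s : sumn [seq i <- s | i != 0] = sumn s.
Proof. by elim: s => //= x s <-; case: x. Qed.

Lemma is_part_filter s : sorted geq s -> is_part [seq i <- s | i != 0].
Proof.
move=> ss; rewrite /is_part sorted_filter //=; last exact: geq_trans.
by rewrite mem_filter eqxx.
Qed.

Lemma part_size mu : is_part mu -> size mu <= sumn mu.
Proof.
case/andP=> _; elim: mu => //= x mu IH; rewrite inE negb_or => /andP[x0 /IH h].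
by case: x x0 => // x _; rewrite addSn ltnS (leq_trans h) // leq_addl.
Qed.

Lemma leq_sumn (x : nat) s : x \in s -> x <= sumn s.
Proof.
elim: s => //= y s IH; rewrite inE => /orP[/eqP->|/IH h]; first exact: leq_addr.
exact: leq_trans h (leq_addl _ _).
Qed.

Lemma sorted_geq_cat_nseq0 s n : sorted geq s -> sorted geq (s ++ nseq n 0).
Proof.
case: s => [|x s] /=; first by move=> _; elim: n => //= -[|n].
elim: s x => [|y s IH] x /=; last by case/andP=> -> /IH.
by move=> _; elim: n x => //= n IH x; apply: IH.
Qed.

Lemma mem_parts n mu : (mu \in parts n) = is_part mu && (sumn mu == n).
Proof.
apply/mapP/andP => [[s] | [pmu /eqP smu]].
  rewrite mem_filter => /andP[/andP[ss /eqP sn] _] ->.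
  by rewrite is_part_filter // sumn_filter_neq0 sn.
have szmu : size mu <= n by rewrite -smu part_size.
exists (mu ++ nseq (n - size mu) 0).
  rewrite mem_filter sorted_geq_cat_nseq0 ?sumn_cat ?sumn_nseq ?mul0n ?addn0 ?smu ?eqxx /=;
    last by case/andP: pmu.
  apply/mapP.
  have sz : size (mu ++ nseq (n - size mu) 0) = n.
    by rewrite size_cat size_nseq subnKC.
  have /eqP szt : size [seq (inord j : 'I_n.+1) | j <- mu ++ nseq (n - size mu) 0] = n.
    by rewrite size_map.
  exists (Tuple szt); first by rewrite mem_enum.
  rewrite /= -map_comp -[LHS]map_id; apply/eq_in_map => j jin /=.
  rewrite inordK // ltnS -smu.
  move: jin; rewrite mem_cat => /orP[/leq_sumn //|]; rewrite mem_nseq.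
  by case/andP=> _ /eqP->.
rewrite filter_cat filter_nseq /= cats0.
by apply/esym/all_filterP/allP => x xm; case: x xm pmu => // xm /andP[_ /negP[]].
Qed.

Lemma eq_parts (T : Type) (idx : T) (op : T -> T -> T) n (F G : seq nat -> T) :
  (forall mu, is_part mu -> sumn mu = n -> F mu = G mu) ->
  \big[op/idx]_(mu <- parts n) F mu = \big[op/idx]_(mu <- parts n) G mu.
Proof.
move=> FG; rewrite big_seq [RHS]big_seq; apply: eq_bigr => mu.
by rewrite mem_parts => /andP[? /eqP]; apply: FG.
Qed.

Lemma parts_uniq n : uniq (parts n).
Proof.
rewrite map_inj_in_uniq.
  rewrite filter_uniq // map_inj_uniq ?enum_uniq // => t u /= tu.
  by apply/val_inj/(inj_map val_inj).
move=> s1 s2; rewrite !mem_filter => /andP[/andP[ss1 _] /mapP[t1 _ e1]].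
move=> /andP[/andP[ss2 _] /mapP[t2 _ e2]] e.
rewrite (sorted_geq_pad ss1) (sorted_geq_pad ss2) e.
by rewrite e1 e2 !size_map !size_tuple.
Qed.

Lemma parts0 : parts 0 = [:: [::]].
Proof.
apply: perm_small_eq => //; apply: uniq_perm => //; first exact: parts_uniq.
move=> mu; rewrite mem_parts mem_seq1; apply/andP/eqP => [[pmu /eqP s0]|-> //].
by have := part_size pmu; rewrite s0 leqn0 => /nilP.
Qed.

Definition pins (r : nat) mu := sort geq (r :: mu).

Lemma perm_pins r mu : perm_eq (pins r mu) (r :: mu).
Proof. by rewrite perm_sort. Qed.

Lemma is_part_pins r mu : is_part (pins r mu) = (r != 0) && (0 \notin mu).
Proof.
rewrite /is_part sort_sorted ?(perm_mem (perm_pins r mu)) ?inE ?negb_or //=.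
by rewrite eq_sym.
Qed.

Lemma sumn_pins r mu : sumn (pins r mu) = r + sumn mu.
Proof. by rewrite (perm_sumn (perm_pins r mu)). Qed.

Lemma part_perm_eq mu nu : is_part mu -> is_part nu -> perm_eq mu nu -> mu = nu.
Proof.
by case/andP=> smu _ /andP[snu _]; apply: (sorted_eq geq_trans geq_anti smu snu).
Qed.

Lemma is_part_rem r mu : is_part mu -> is_part (rem r mu).
Proof.
case/andP=> ss n0; apply/andP; split.
  by apply: (subseq_sorted geq_trans _ ss); apply: rem_subseq.
by apply: contra n0; apply: mem_rem.
Qed.

(** The map [pins r] is a bijection onto the partitions of n that contain r, with inverse
    [rem r]. *)
Lemma big_pins (V : nmodType) (G : seq nat -> V) n r : 0 < r <= n ->
  (\sum_(nu <- parts (n - r)) G (pins r nu)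
   = \sum_(mu <- parts n | r \in mu) G mu)%R.
Proof.
case/andP=> r0 rn; rewrite -[RHS]big_filter.
rewrite -[LHS](big_map (pins r) predT); apply: perm_big.
apply: uniq_perm.
- rewrite map_inj_in_uniq ?parts_uniq // => nu1 nu2.
  rewrite !mem_parts => /andP[p1 _] /andP[p2 _] e; apply: part_perm_eq => //.
  by rewrite -(perm_cons r) -(seq.permPl (perm_pins r nu1)) e perm_pins.
- by rewrite filter_uniq ?parts_uniq.
move=> mu; rewrite mem_filter; apply/mapP/andP.
  case=> nu; rewrite mem_parts => /andP[/andP[_ n0] /eqP sn] ->.
  rewrite (perm_mem (perm_pins r nu)) mem_head; split=> //.
  by rewrite mem_parts is_part_pins n0 sumn_pins sn subnKC // -lt0n r0 eqxx.
case=> rmu; rewrite mem_parts => /andP[pmu /eqP smu].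
exists (rem r mu).
  rewrite mem_parts is_part_rem //=.
  by have /perm_sumn /= := perm_to_rem rmu; rewrite smu => ->; rewrite addKn.
apply: part_perm_eq => //.
  rewrite is_part_pins -lt0n r0 /=.
  by case/andP: (is_part_rem r pmu).
rewrite perm_sym; apply: perm_trans (perm_pins _ _) _.
by rewrite perm_sym perm_to_rem.
Qed.

Lemma sumn_count N mu : {in mu, forall x, x <= N} ->
  sumn mu = \sum_(1 <= r < N.+1) r * count_mem r mu.
Proof.
elim: mu => [|x mu IH] H; first by rewrite big1 // => i _; rewrite muln0.
rewrite /= IH; last by move=> y ym; apply: H; rewrite inE ym orbT.
under [RHS]eq_bigr do rewrite mulnDr.
rewrite big_split /=; congr (_ + _).
case: x H => [|x] H; first by rewrite big1_seq // => -[|i] /=; rewrite ?mem_index_iota //= muln0.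
rewrite (bigD1_seq x.+1) ?iota_uniq //=; last by rewrite mem_index_iota /= ltnS H ?mem_head.
rewrite eqxx muln1 big1 ?addn0 // => i /negPf; rewrite eq_sym => ->; exact: muln0.
Qed.

Lemma zpartE N mu : 0 \notin mu -> {in mu, forall x, x <= N} ->
  zpart mu = \prod_(1 <= j < N.+1) (j ^ count_mem j mu * (count_mem j mu)`!).
Proof.
move=> n0 H; rewrite (bigID (mem mu)) /= mulnC big1; last first.
  by move=> i /count_memPn ->.
rewrite mul1n -big_filter; apply: perm_big; apply: uniq_perm.
- exact: undup_uniq.
- by rewrite filter_uniq ?iota_uniq.
move=> j; rewrite mem_undup mem_filter mem_index_iota.
case jmu: (j \in mu) => //=; rewrite ltnS H // andbT.
by case: j jmu => //; rewrite (negPf n0).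
Qed.

(** Raising the multiplicity M of r by one multiplies r^M M! by r (M + 1), and this factor is r
    times the new multiplicity: the weight of r in Newton's identity. *)
Lemma zpart_pins r mu : 0 < r -> 0 \notin mu ->
  zpart (pins r mu) = zpart mu * (r * (count_mem r mu).+1).
Proof.
move=> r0 n0; set N := r + sumn mu.
have HN : {in mu, forall x, x <= N}.
  by move=> x /leq_sumn h; rewrite (leq_trans h) // leq_addl.
have HN' : {in pins r mu, forall x, x <= N}.
  by move=> x; rewrite (perm_mem (perm_pins _ _)) inE => /orP[/eqP->|/HN//]; rewrite leq_addr.
have n0' : 0 \notin pins r mu.
  by rewrite (perm_mem (perm_pins _ _)) inE negb_or n0 andbT eq_sym -lt0n.
rewrite (zpartE n0 HN) (zpartE n0' HN').
have cE j : count_mem j (pins r mu) = (r == j) + count_mem j mu.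
  by rewrite (seq.permP (perm_pins r mu)).
have rN : r \in index_iota 1 N.+1 by rewrite mem_index_iota r0 ltnS leq_addr.
rewrite (bigD1_seq r) ?iota_uniq //= [X in _ = X * _](bigD1_seq r) ?iota_uniq //=.
rewrite cE eqxx add1n factS expnS.
have -> : \prod_(1 <= i < N.+1 | i != r) (i ^ count_mem i (pins r mu) * (count_mem i (pins r mu))`!)
   = \prod_(1 <= i < N.+1 | i != r) (i ^ count_mem i mu * (count_mem i mu)`!).
  by apply: eq_bigr => i ir; rewrite cE eq_sym (negPf ir).
ring.
Qed.

End PartitionLists.

Section Hsym.
Variables (K : numFieldType) (A : comAlgType K) (p : nat -> A).

Lemma pprod_perm mu nu : perm_eq mu nu -> pprod p mu = pprod p nu.
Proof. by move=> e; apply: perm_big. Qed.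

Lemma pprod_cons r mu : pprod p (r :: mu) = p r * pprod p mu.
Proof. exact: big_cons. Qed.

Lemma hsym0 : hsym p 0 = 1.
Proof.
by rewrite /hsym parts0 big_seq1 /zpart /pprod /= !big_nil invr1 scale1r.
Qed.

(** In the sum over r a partition mu of n occurs once for each of its part sizes r, with weight r
    M_r / z_mu; these weights add up to n / z_mu. *)
Lemma hsym_newton : newton p (hsym p).
Proof.
split; first exact: hsym0.
move=> n.
transitivity (\sum_(1 <= r < n.+1) \sum_(mu <- parts n | r \in mu)
   ((r * count_mem r mu)%:R / (zpart mu)%:R : K) *: pprod p mu); last first.
  apply: eq_big_nat => r /andP[r1 rn].
  rewrite /hsym mulr_sumr -(@big_pins _ (fun mu => ((r * count_mem r mu)%:R / (zpart mu)%:R : K) *: pprod p mu)) ?r1 //.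
  apply: eq_big_seq => nu; rewrite mem_parts => /andP[/andP[_ n0] _].
  rewrite (pprod_perm (perm_pins r nu)) pprod_cons -scalerAr; congr (_ *: _).
  rewrite zpart_pins // (seq.permP (perm_pins r nu)) /= eqxx add1n [X in _ / X]natrM.
  have rc : (r * (count_mem r nu).+1)%:R != 0 :> K.
    by rewrite pnatr_eq0 muln_eq0 /= orbF -lt0n.
  by rewrite invfM mulrCA mulfV // mulr1.
rewrite (exchange_big_dep xpredT) //= /hsym -sumrMnl.
apply: eq_big_seq => mu; rewrite mem_parts => /andP[/andP[_ n0] /eqP smu].
rewrite (eq_bigr (fun r => (((r * count_mem r mu)%:R) : K) *: ((zpart mu)%:R^-1 *: pprod p mu))); last first.
  by move=> r _; rewrite scalerA.
rewrite -scaler_suml -scaler_nat; congr (_ *: _).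
rewrite -natr_sum; congr (_%:R).
rewrite -{1}smu (@sumn_count n); last by rewrite -smu => x /leq_sumn.
rewrite big_mkcond [RHS]big_mkcond /=; apply: eq_bigr => r _.
by case: ifP => // /negbT /count_memPn ->; rewrite muln0.
Qed.

End Hsym.

(** * Alternants and the Jacobi-Trudi determinant *)

Section Alternants.
Variables (K : numFieldType) (n : nat) (x : 'I_n -> K) (H : nat -> K).
Hypothesis newH : newton (fun r => \sum_i x i ^+ r) H.

Definition alternant (m : 'I_n -> nat) : K := \det (\matrix_(l, j) x l ^+ m j).

Definition staircase (j : 'I_n) : nat := (n.-1 - j)%N.

Definition vander : K := alternant staircase.

Lemma alternant_rep m i j : i != j -> m i = m j -> alternant m = 0.
Proof.
move=> ij mij; rewrite /alternant -det_tr; apply: (determinant_alternate ij) => l.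
by rewrite !mxE mij.
Qed.

Let geom (a : K) : fps K := Fps (fun m => a ^+ m).
Let lin (a : K) : {poly K} := 1 - a *: 'X.

Lemma geom_lin a : geom a * fpoly (lin a) = 1.
Proof.
apply: fpsP => m; rewrite fpn1 mulrC rmorphB rmorph1 mulrBl mul1r -mul_polyC rmorphM -mulrA /= -/(fpC a) -/fpX.
rewrite fpnCM fpnXM /=; case: m => [|m]; first by rewrite mulr0 subr0 expr0.
by rewrite exprS subrr.
Qed.

Lemma torsion_free_numField : torsion_free K.
Proof. by move=> m y /eqP; rewrite mulrn_eq0 /= => /eqP. Qed.

(** The logarithmic derivatives of the two factors, plus and minus the sum of p_r T^r, cancel, so
    the product is constant. *)
Lemma hsym_elem : Fps H * fpoly (\prod_i lin (x i)) = 1.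
Proof.
have [H0 HP] := (newton_feuler _ _).1 newH.
pose G (a : K) : fps K := Fps (fun r => if r is 0 then 0 else a ^+ r).
have GL a : G a * fpoly (lin a) = fpC a * fpX.
  have -> : G a = geom a - 1.
    by apply: fpsP => -[|r]; rewrite fpnB fpn1 /= ?expr0 ?subrr ?subr0.
  rewrite mulrBl geom_lin mul1r rmorphB rmorph1 opprB addrC subrK.
  by rewrite -mul_polyC rmorphM.
have eL (s : seq 'I_n) : feuler (fpoly (\prod_(i <- s) lin (x i)))
    = - (\sum_(i <- s) G (x i)) * fpoly (\prod_(i <- s) lin (x i)).
  elim: s => [|i s IH]; first by rewrite !big_nil rmorph1 oppr0 mul0r feuler1.
  rewrite !big_cons rmorphM /= feulerM IH.
  have -> : feuler (fpoly (lin (x i))) = - (G (x i) * fpoly (lin (x i))).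
    rewrite GL feuler_fpoly derivB derivC sub0r derivZ derivX alg_polyC rmorphN.
    by rewrite mulrN mulrC.
  by rewrite opprD; ring.
have e0 : feuler (Fps H * fpoly (\prod_i lin (x i))) = 0.
  rewrite feulerM HP eL.
  have -> : Fps (fun r => if r is 0 then 0 else \sum_i x i ^+ r) = \sum_(i <- index_enum 'I_n) G (x i).
    apply: fpsP => r; rewrite fpn_sum /=; case: r => [|r] //=.
    by rewrite big1.
  by ring.
apply: fpsP => m; rewrite fpn1; case: m => [|m].
  rewrite fpnM0 /= H0 mul1r -horner_coef0 horner_prod big1 // => i _.
  by rewrite /lin hornerD hornerN hornerZ hornerX hornerC mulr0 subr0.
apply: (torsion_free_numField (n := m)); move/(congr1 (fun f : fps K => f m.+1)): e0.
by rewrite feulerE.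
Qed.

Definition elem_but (l : 'I_n) : {poly K} := \prod_(i | i != l) lin (x i).

Lemma hsym_elem_but l : Fps H * fpoly (elem_but l) = geom (x l).
Proof.
rewrite -[LHS]mulr1 -(geom_lin (x l)) mulrACA [in LHS]mulrC.
have -> : fpoly (elem_but l) * fpoly (lin (x l)) = fpoly (\prod_i lin (x i)).
  by rewrite -rmorphM [in RHS](bigD1 l) //= mulrC.
by rewrite mulrA [X in X * _ = _]mulrC hsym_elem mul1r.
Qed.

Lemma size_lin_prod (P : pred 'I_n) : (size (\prod_(i | P i) lin (x i))%R <= #|P|.+1)%N.
Proof.
rewrite cardE -big_enum /=; elim: (enum P) => [|i s IH].
  by rewrite big_nil size_poly1.
rewrite big_cons; apply: leq_trans (size_polyMleq _ _) _.
have l2 : (size (lin (x i)) <= 2)%N.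
  rewrite /lin; apply: leq_trans (size_polyD _ _) _.
  rewrite size_poly1 size_polyN geq_max /=.
  by apply: leq_trans (size_scale_leq _ _) _; rewrite size_polyX.
by rewrite -subn1 leq_subLR (leq_trans (leq_add l2 IH)).
Qed.

Definition hshift (m r : nat) : K := if (r <= m)%N then H (m - r)%N else 0.

(** Coefficient of T^m in 1 / (1 - x_l T), written as the product of the series of the h_n with
    prod_(i != l) (1 - x_i T). The coefficients on the right depend on l but not on m, which factors
    the matrix of an alternant. *)
Lemma power_elem_but l m : x l ^+ m = \sum_(r < n) (elem_but l)`_r * hshift m r.
Proof.
transitivity ((Fps H * fpoly (elem_but l)) m); first by rewrite hsym_elem_but.
rewrite fpnM /=.
have sE : (size (elem_but l) <= n)%N.
  apply: leq_trans (size_lin_prod _) _.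
  by rewrite cardC1 card_ord; case: (n) l => // -[].
rewrite (reindex_inj rev_ord_inj) /=.
rewrite -(big_mkord xpredT (fun r => (elem_but l)`_r * hshift m r)).
rewrite -(big_mkord xpredT (fun i => H (m.+1 - i.+1)%N * (elem_but l)`_(m - (m.+1 - i.+1))%N)).
transitivity (\sum_(0 <= r < n + m.+1) (elem_but l)`_r * hshift m r); last first.
  rewrite (big_cat_nat _ (n := n)) ?leq_addr //= [X in _ + X]big1_seq ?addr0 // => r.
  rewrite mem_index_iota => /andP[_ /andP[h _]].
  by rewrite nth_default ?mul0r // (leq_trans sE).
rewrite [RHS](big_cat_nat _ (n := m.+1)) ?leq_addl //= [X in _ + X]big1_seq ?addr0; last first.
  move=> r; rewrite mem_index_iota => /andP[_ /andP[h _]].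
  by rewrite /hshift leqNgt h mulr0.
apply: eq_big_nat => r /andP[_ rm]; rewrite /hshift -ltnS rm subSS mulrC subKn //.
Qed.

Definition hmat (m : 'I_n -> nat) := \matrix_(r < n, j < n) hshift (m j) (n.-1 - r).

(** The matrix of powers is E times the matrix of the h's, with E independent of the exponents. For
    staircase exponents the second factor is unitriangular, so det E is the Vandermonde
    determinant. *)
Lemma alternant_hmat m : alternant m = vander * \det (hmat m).
Proof.
pose E := \matrix_(l < n, r < n) (elem_but l)`_(n.-1 - r).
have EM m' : alternant m' = \det E * \det (hmat m').
  rewrite -det_mulmx; congr (\det _); apply/matrixP => l j; rewrite !mxE.
  rewrite power_elem_but (reindex_inj rev_ord_inj) /=; apply: eq_bigr => r _.
  by rewrite !mxE; congr (_`_ _ * hshift _ _); have := ltn_ord r; lia.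
rewrite EM /vander EM; congr (_ * _).
have -> : \det (hmat staircase) = 1; last by rewrite mulr1.
rewrite det_trig.
  by rewrite big1 // => i _; rewrite mxE /hshift leqnn subnn; case: newH.
apply/is_trig_mxP => i j ij; rewrite mxE /hshift /staircase.
by case: ifP => // h; exfalso; move: h; have := ltn_ord j; lia.
Qed.

(** Term by term in the Leibniz expansion: in the term of s the variable x_i carries the exponent m
    (s i), and s i runs over all columns. *)
Lemma alternant_incr m :
  (\sum_i x i) * alternant m
  = \sum_j alternant (fun i => (m i + (i == j))%N).
Proof.
rewrite /alternant /determinant exchange_big mulr_sumr /=; apply: eq_bigr => s _.
rewrite -mulr_sumr mulrCA; congr (_ * _).
rewrite mulr_suml (reindex_inj (@perm_inj _ s)) /=.
rewrite [RHS](reindex_inj (@perm_inj _ s)) /=.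
rewrite (reindex_inj (@perm_inj _ s^-1%g)) /=.
apply: eq_bigr => j _; rewrite permKV.
rewrite [RHS](bigD1 j) //= [X in _ * X](bigD1 j) //= !mxE eqxx exprD expr1 mulrCA mulrA.
congr (_ * _ * _).
apply: eq_bigr => i ij; rewrite !mxE (inj_eq (@perm_inj _ s)) (negPf ij) addn0.
by [].
Qed.

End Alternants.

Section JacobiTrudi.
Variables (K : numFieldType) (n : nat) (x : 'I_n -> K).
Notation psum := (fun r => \sum_i x i ^+ r : K^o).

Definition jt_mx (A : comAlgType K) (p : nat -> A) (lam : seq nat) N :=
  \matrix_(i < N, j < N)
    if (i <= nth 0%N lam i + j)%N then hsym p (nth 0%N lam i + j - i)%N else 0.

(** A zero part adds a last row whose only nonzero entry is h_0 = 1 on the diagonal. *)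
Lemma det_jt_mx (A : comAlgType K) (p : nat -> A) lam N : (size lam <= N)%N ->
  \det (jt_mx p lam N) = schur p lam.
Proof.
move=> /subnKC <-; elim: (N - size lam)%N => [|d IH]; first by rewrite addn0.
rewrite addnS (expand_det_row _ ord_max) (bigD1 ord_max) //= [X in _ + X]big1 ?addr0.
  rewrite mxE /= nth_default ?leq_addr // add0n leqnn subnn hsym0 mul1r.
  rewrite /cofactor -signr_odd addnn odd_double mul1r -IH; congr (\det _).
  apply/matrixP => i j; rewrite !mxE !lift_max.
  by [].
move=> j jm; rewrite mxE /= nth_default ?leq_addr // add0n.
case: ifP; last by rewrite mul0r.
have := ltn_ord j; rewrite ltnS => h1 h2; case/negP: jm.
by apply/eqP/val_inj => /=; apply/eqP; rewrite eqn_leq h1 h2.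
Qed.

Lemma schur_alternant lam : (size lam <= n)%N ->
  vander x * (schur psum lam : K^o) = alternant x (fun j => (nth 0%N lam j + staircase j)%N).
Proof.
move=> sl; rewrite (alternant_hmat (hsym_newton psum)); congr (_ * _).
rewrite -(det_jt_mx _ sl) -det_tr; congr (\det _); apply/matrixP => i j.
rewrite !mxE /hshift /staircase.
have := ltn_ord i; have := ltn_ord j => hj hi.
have -> : (j <= nth 0%N lam j + i)%N = (n.-1 - i <= nth 0%N lam j + (n.-1 - j))%N.
  by apply/idP/idP; lia.
case: ifP => // h; congr (hsym _ _); lia.
Qed.

(** The coefficients of E = prod (1 - x_i T), at most n + 1 of them, form a vector killed by the
    Jacobi-Trudi matrix: each entry of the product is a coefficient of H E = 1 in a degree M, which
    is positive because all parts are. *)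
Lemma schur_gt_vars lam : is_part lam -> (n < size lam)%N ->
  schur psum lam = 0 :> K^o.
Proof.
move=> /andP[_ n0] sl; set L := size lam.
pose E : {poly K} := \prod_i (1 - x i *: 'X).
have HE := hsym_elem (hsym_newton psum); rewrite -/E in HE.
have sE : (size E <= n.+1)%N by have := size_lin_prod x predT; rewrite card_ord.
apply/eqP; rewrite -(det_jt_mx _ (leqnn L)) -det_tr.
apply/(@det0P K); exists (\row_(j < L) E`_(L.-1 - j)).
  have L0 : (0 < L)%N by apply: leq_ltn_trans sl.
  have L1 : (L.-1 < L)%N by rewrite prednK.
  apply/eqP => /rowP /(_ (Ordinal L1))/eqP.
  rewrite !mxE /= subnn -horner_coef0 horner_prod big1 ?oner_eq0 // => i _.
  by rewrite hornerD hornerN hornerZ hornerX hornerC mulr0 subr0.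
apply/rowP => i; rewrite !mxE; have iL := ltn_ord i.
have lam_i : (0 < nth 0%N lam i)%N.
  by rewrite lt0n; apply: contra n0 => /eqP <-; apply: mem_nth.
set M := (nth 0%N lam i + L.-1 - i)%N.
have M0 : (0 < M)%N by rewrite /M; lia.
transitivity ((Fps (hsym psum : nat -> K) * fpoly E) M); last by rewrite HE fpn1 gtn_eqF.
rewrite fpnM /=.
rewrite (reindex_inj rev_ord_inj) /= [RHS](reindex_inj rev_ord_inj) /=.
pose F r := E`_r * (if (r <= M)%N then hsym psum (M - r)%N : K else 0).
transitivity (\sum_(0 <= r < L) F r).
  rewrite big_mkord; apply: eq_bigr => r _; rewrite !mxE /F.
  have := ltn_ord r => rL.
  have -> : (L.-1 - (L - r.+1))%N = r by lia.
  have -> : (i <= nth 0%N lam i + (L - r.+1))%N = (r <= M)%N by rewrite /M; apply/idP/idP; lia.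
  case: ifP => // h; congr (_ * hsym _ _); rewrite /M /=; lia.
have -> : \sum_(i < M.+1) (hsym psum (M.+1 - i.+1)%N : K) * E`_(M - (M.+1 - i.+1)) = \sum_(0 <= r < M.+1) F r.
  rewrite big_mkord; apply: eq_bigr => r _; rewrite /F -ltnS ltn_ord subSS mulrC.
  by rewrite subKn // -ltnS.
transitivity (\sum_(0 <= r < L + M.+1) F r).
  rewrite [RHS](big_cat_nat _ (n := L)) ?leq_addr //= [X in _ = _ + X]big1_seq ?addr0 // => r.
  rewrite mem_index_iota => /andP[_ /andP[h _]].
  by rewrite /F nth_default ?mul0r // (leq_trans sE) // (leq_trans sl).
rewrite (big_cat_nat _ (n := M.+1)) ?leq_addl //= [X in _ + X]big1_seq ?addr0 // => r.
rewrite mem_index_iota => /andP[_ /andP[h _]].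
by rewrite /F leqNgt h mulr0.
Qed.

(** The Pieri rule for one box, kept multiplied by the Vandermonde so that the variables may
    coincide. If adding a box to row j does not give a partition, two exponents of the alternant
    become equal; rows beyond the number of variables give zero by [schur_gt_vars]. *)
Lemma schur_pieri lam : is_part lam ->
  (\sum_i x i) * (vander x * (schur psum lam : K))
  = \sum_(i < (size lam).+1 | is_part (incr_nth lam i))
      vander x * (schur psum (incr_nth lam i) : K).
Proof.
move=> pl; have [sl|sl] := leqP (size lam) n; last first.
  rewrite schur_gt_vars // !mulr0 big1 // => i pi.
  rewrite schur_gt_vars ?mulr0 // size_incr_nth.
  by case: (ltnP i) => // h; rewrite (leq_trans sl) // (leq_trans h).
rewrite (schur_alternant sl) alternant_incr.
pose F i := vander x * (schur psum (incr_nth lam i) : K).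
have Fbig i : (n <= i)%N -> (i <= size lam)%N -> is_part (incr_nth lam i) -> F i = 0.
  move=> ni il pi; rewrite /F schur_gt_vars ?mulr0 // size_incr_nth.
  case: (ltnP i) => h; lia.
have Falt (j : 'I_n) : alternant x (fun i => (nth 0%N lam i + staircase i + (i == j))%N)
    = if (j <= size lam)%N && is_part (incr_nth lam j) then F j else 0.
  case: ifP => [/andP[jl pj]|].
    rewrite /F schur_alternant.
      rewrite /alternant; congr (\det _); apply/matrixP => a b; rewrite !mxE nth_incr_nth.
      by congr (_ ^+ _); rewrite addnAC [(_ + (b == j))%N]addnC eq_sym.
    by rewrite size_incr_nth; case: ifP => // _; apply: ltn_ord.
  move=> npj.
  have jpos : (0 < j)%N.
    rewrite lt0n; apply/eqP => j0; move: npj; rewrite j0 /=.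
    case: (lam) pl => [|a s] //= /andP[ss h]; rewrite /is_part /=.
    rewrite inE negb_or /= => /negP; apply; move: ss h; rewrite inE negb_or => ss /andP[_ ->].
    rewrite andbT; case: s ss => //= b s /andP[h ->]; rewrite andbT; apply: leq_trans h _; exact: leqnSn.
  (* Then columns j - 1 and j have the same exponent, since the added box makes up for the step of
     the staircase. *)
  have eqj : nth 0%N lam j.-1 = nth 0%N lam j.
    apply/eqP; rewrite eqn_leq; apply/andP; split; last first.
      case/andP: pl => ss _; have [h|h] := ltnP j (size lam); last by rewrite [X in (X <= _)%N]nth_default.
      have /= := sorted_ltn_nth geq_trans 0%N ss; apply; rewrite ?inE //; lia.
    rewrite leqNgt; apply/negP => lt; move/negP: npj; apply.
    have jl : (j <= size lam)%N.
      by rewrite leqNgt; apply/negP => h; move: lt; rewrite [X in (_ < X)%N]nth_default //; lia.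
    rewrite jl /=; apply/andP; split; last first.
      apply/negP => /(nthP 0%N) [i il /eqP]; rewrite nth_incr_nth addn_eq0 => /andP[/eqP h /eqP h2].
      move: il; rewrite size_incr_nth; case: ifP => jl2 il.
        case/andP: pl => _ /negP; apply; rewrite -h2; apply: mem_nth.
        by move: il; rewrite ?jl2.
      have h3 : (i < size lam)%N.
        have : j != i :> nat by apply/eqP => e; move: h; rewrite e eqxx.
        move: il jl jl2; lia.
      by case/andP: pl => _ /negP; apply; rewrite -h2; apply: mem_nth.
    apply/(sortedP 0%N) => i il; rewrite /= !nth_incr_nth.
    case/andP: pl => ss _.
    have [h|h] := ltnP i.+1 (size lam).
      have h1 : (nth 0%N lam i.+1 <= nth 0%N lam i)%N by have /(sortedP 0%N) := ss; apply.
      case: (eqVneq (j : nat) i.+1) => [e|_]; last by rewrite add0n (leq_trans h1) ?leq_addl.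
      have -> : (j == i :> nat) = false by rewrite e; apply/negbTE; rewrite gtn_eqF.
      by move: lt; rewrite e /= add0n add1n.
    rewrite [nth 0%N lam i.+1]nth_default // addn0.
    case: (eqVneq (j : nat) i.+1) => // e.
    have : (0 < nth 0%N lam i)%N by move: lt; rewrite e /= => /(leq_ltn_trans (leq0n _)).
    by move=> h1; rewrite (leq_trans h1) ?leq_addl.
  have j1n : (j.-1 < n)%N by apply: leq_ltn_trans (leq_pred _) (ltn_ord j).
  apply: (@alternant_rep _ _ _ _ (Ordinal j1n) j).
    by apply/eqP => /(congr1 val) /=; lia.
  rewrite eqxx /= eqj /staircase /=.
  have -> : (Ordinal j1n == j) = false by apply/negbTE/eqP => /(congr1 val) /=; lia.
  have := ltn_ord j; lia.
rewrite (eq_bigr _ (fun j _ => Falt j)).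
transitivity (\sum_(0 <= j < (size lam).+1 + n | (j < n)%N && (j <= size lam)%N && is_part (incr_nth lam j)) F j).
  rewrite -big_mkcond -(big_mkord (fun j => (j <= size lam)%N && is_part (incr_nth lam j)) F).
  rewrite (@big_nat_widen _ _ _ _ n ((size lam).+1 + n)) ?leq_addl //.
  by apply: eq_bigl => j; rewrite andbC andbA.
rewrite -(big_mkord (fun j => is_part (incr_nth lam j)) F).
rewrite (@big_nat_widen _ _ _ _ (size lam).+1 ((size lam).+1 + n)) ?leq_addr //.
rewrite big_mkcond [RHS]big_mkcond; apply: eq_bigr => j _; rewrite ltnS.
have [jn|jn] := ltnP j n; first by rewrite /= andbC.
by rewrite /=; case: ifP => // /andP[pj jl]; rewrite Fbig.
Qed.

End JacobiTrudi.

(** * Evaluations of the ring of power sums *)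

Section EvXY.
Variables (K : fieldType) (S : comNzRingType) (phi : {rmorphism K -> S}).
Variables u v : nat -> S.

Let w (i : nat + nat) : S := match i with inl r => u r | inr r => v r end.

Definition monXY (m : cmonom (nat + nat)%type) : S :=
  \prod_(i <- finsupp m) match i with inl r => u r | inr r => v r end ^+ m i.

Lemma monXYw (d : {fset (nat + nat)%type}) (m : cmonom (nat + nat)%type) : (finsupp m `<=` d)%fset ->
  monXY m = \prod_(i <- d) w i ^+ m i.
Proof.
move=> h; rewrite /monXY; apply: (big_fset_incl _ h) => i _.
by rewrite -cmE_eq0 => /eqP ->; rewrite expr0.
Qed.

Fact monXY_mmorphism : monalg.mmorphism monXY.
Proof.
split=> [m1 m2|].
  rewrite (monXYw (d := (finsupp m1 `|` finsupp m2)%fset)); last first.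
    by rewrite mdomD.
  rewrite (monXYw (d := (finsupp m1 `|` finsupp m2)%fset) (fsubsetUl _ _)).
  rewrite (monXYw (d := (finsupp m1 `|` finsupp m2)%fset) (fsubsetUr _ _)).
  rewrite -big_split /=; apply: eq_bigr => i _.
  by rewrite cmM exprD.
by rewrite /monXY mdom1 big_seq_fset0.
Qed.

HB.instance Definition _ :=
  monalg.isMultiplicative.Build (cmonom (nat + nat)%type) S monXY monXY_mmorphism.

Definition evXY : symXY K -> S := mmap phi monXY.

Lemma monXYU i : monXY (ucm i) = w i.
Proof. by rewrite /monXY mdomU big_seq_fset1 cmUU expr1. Qed.

Lemma evXY_pX r : evXY (pX K r) = u r.
Proof. by rewrite /evXY /pX mmapU /= rmorph1 mul1r monXYU. Qed.

Lemma evXY_pY r : evXY (pY K r) = v r.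
Proof. by rewrite /evXY /pY mmapU /= rmorph1 mul1r monXYU. Qed.

Lemma evXYZ c (g : symXY K) : evXY (c *: g) = phi c * evXY g.
Proof. by rewrite /evXY mmapZ. Qed.

Fact evXY_is_zmod_morphism : zmod_morphism evXY.
Proof. exact: (rmorphB (mmap phi monXY)). Qed.

Fact evXY_is_monoid_morphism : monoid_morphism evXY.
Proof. by split; [exact: (rmorph1 (mmap phi monXY))|exact: (rmorphM (mmap phi monXY))]. Qed.

End EvXY.

(* Unification must not look through the malg structure of symXY. *)
Opaque symXY evXY.

Section EvXYTheory.
Variables (K : fieldType) (S : comNzRingType) (phi : {rmorphism K -> S}).
Variables u v : nat -> S.
Notation ev := (evXY phi u v).

HB.instance Definition _ := GRing.isZmodMorphism.Build (symXY K) S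
  (evXY phi u v) (evXY_is_zmod_morphism phi u v).
HB.instance Definition _ := GRing.isMonoidMorphism.Build (symXY K) S
  (evXY phi u v) (evXY_is_monoid_morphism phi u v).

Lemma evXY_pprodX mu : ev (pprod (@pX K) mu) = \prod_(i <- mu) u i.
Proof. by rewrite /pprod rmorph_prod; apply: eq_bigr => i _; exact: evXY_pX. Qed.

Lemma evXY_pprodY mu : ev (pprod (@pY K) mu) = \prod_(i <- mu) v i.
Proof. by rewrite /pprod rmorph_prod; apply: eq_bigr => i _; exact: evXY_pY. Qed.

End EvXYTheory.

Section Spanned.
Variable K : fieldType.
Implicit Types (g : symXY K) (x : seq nat * seq nat).

Definition ppXY x : symXY K := pprod (@pX K) x.1 * pprod (@pY K) x.2.

Definition mmXY x : cmonom (nat + nat)%type :=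
  mmul (\big[mmul/mone]_(i <- x.1) ucm (inl i))
       (\big[mmul/mone]_(i <- x.2) ucm (inr i)).

Lemma ppXYE x : ppXY x = mkmalgU (mmXY x) 1.
Proof.
have UM (m1 m2 : cmonom (nat + nat)%type) :
    (mkmalgU m1 1 : symXY K) * mkmalgU m2 1 = mkmalgU (mmul m1 m2) 1.
  by rewrite malgM_def fgmulUU mulr1.
have U1 : (mkmalgU mone 1 : symXY K) = 1 by [].
rewrite /ppXY /mmXY -UM; congr (_ * _).
  rewrite /pprod; elim: x.1 => [|i s IH]; last by rewrite !big_cons IH -UM.
  by rewrite !big_nil U1.
rewrite /pprod; elim: x.2 => [|i s IH]; last by rewrite !big_cons IH -UM.
by rewrite !big_nil U1.
Qed.

Lemma mmXY_inl x r : mmXY x (inl r) = count_mem r x.1.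
Proof.
rewrite cmM.
have -> : (\big[mmul/mone]_(i <- x.2) ucm (inr i)) (inl r) = 0%N.
  by elim: x.2 => [|i s IH]; rewrite ?big_nil ?cm1 // big_cons cmM IH cmU.
rewrite addn0; elim: x.1 => [|i s IH]; first by rewrite big_nil cm1.
by rewrite big_cons cmM IH cmU.
Qed.

Lemma mmXY_inr x r : mmXY x (inr r) = count_mem r x.2.
Proof.
rewrite cmM.
have -> : (\big[mmul/mone]_(i <- x.1) ucm (inl i)) (inr r) = 0%N.
  by elim: x.1 => [|i s IH]; rewrite ?big_nil ?cm1 // big_cons cmM IH cmU.
rewrite add0n; elim: x.2 => [|i s IH]; first by rewrite big_nil cm1.
by rewrite big_cons cmM IH cmU.
Qed.

Definition is_part2 x := is_part x.1 && is_part x.2.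

Lemma mmXY_inj x y : is_part2 x -> is_part2 y -> mmXY x = mmXY y -> x = y.
Proof.
case: x y => [x1 xpow_two] [y1 y2] /andP[/= px1 px2] /andP[/= py1 py2] e.
by congr (_, _); apply: part_perm_eq => //; apply/allP => r _ /=; apply/eqP;
  [have := mmXY_inl (x1, xpow_two) r | have := mmXY_inr (x1, xpow_two) r]; rewrite e
  (mmXY_inl, mmXY_inr) => ->.
Qed.

Lemma pcoef_ppXY x y : is_part2 x -> is_part2 y ->
  pcoef x.1 x.2 (ppXY y) = (x == y)%:R.
Proof.
move=> px py; rewrite ppXYE /pcoef mcoeffU -/(mmXY x) eq_sym.
congr (_%:R); congr nat_of_bool; apply/eqP/eqP => [e|-> //].
exact: mmXY_inj.
Qed.

Lemma pcoefD mu nu g h : pcoef mu nu (g + h) = pcoef mu nu g + pcoef mu nu h.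
Proof. exact: mcoeffD. Qed.
Lemma pcoefZ mu nu c g : pcoef mu nu (c *: g) = c * pcoef mu nu g.
Proof. exact: mcoeffZ. Qed.
Lemma pcoef_sum mu nu I (r : seq I) P (F : I -> symXY K) :
  pcoef mu nu (\sum_(i <- r | P i) F i) = \sum_(i <- r | P i) pcoef mu nu (F i).
Proof.
by apply: (big_morph (pcoef mu nu)) => [g h|]; [exact: pcoefD|exact: mcoeff0].
Qed.

(** An element supported on L, expressed through its own coefficients; this form is linear and
    yields the expansion without a choice of coefficients. *)
Definition spanned (L : seq (seq nat * seq nat)) g :=
  g = \sum_(x <- L) pcoef x.1 x.2 g *: ppXY x.

Lemma spanned_lin L I (r : seq I) (c : I -> K) (f : I -> seq nat * seq nat) :
  uniq L -> all is_part2 L -> {in map f r, forall x, x \in L} ->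
  spanned L (\sum_(i <- r) c i *: ppXY (f i)).
Proof.
move=> uL pL; rewrite /spanned; elim: r => [|i r IH] H.
  rewrite !big_nil big1 // => x _; rewrite /pcoef mcoeff0 scale0r //.
rewrite !big_cons {1}IH; last by move=> x xr; apply: H; rewrite inE xr orbT.
have fL : f i \in L by apply: H; rewrite mem_head.
under [RHS]eq_bigr do rewrite pcoefD pcoefZ scalerDl.
rewrite big_split /=; congr (_ + _).
rewrite (bigD1_seq (f i)) //= pcoef_ppXY ?(allP pL) // eqxx mulr1.
rewrite big1_seq ?addr0 // => x /andP[xf xL].
by rewrite pcoef_ppXY ?(allP pL) // (negPf xf) mulr0 scale0r.
Qed.

Lemma spanned_sum L I (r : seq I) (P : pred I) (F : I -> symXY K) :
  (forall i, P i -> spanned L (F i)) -> spanned L (\sum_(i <- r | P i) F i).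
Proof.
move=> H; rewrite /spanned {1}(eq_bigr _ H) exchange_big; apply: eq_bigr => x _.
by rewrite pcoef_sum scaler_suml.
Qed.

Lemma spannedZ L c g : spanned L g -> spanned L (c *: g).
Proof.
move=> H; rewrite /spanned {1}H scaler_sumr; apply: eq_bigr => x _.
by rewrite pcoefZ scalerA.
Qed.

Definition merge2 x y := (sort geq (x.1 ++ y.1), sort geq (x.2 ++ y.2)).

Lemma ppXY_merge2 x y : ppXY x * ppXY y = ppXY (merge2 x y).
Proof.
rewrite /ppXY /merge2 /= mulrACA; congr (_ * _).
  by rewrite /pprod (perm_big _ (permEl (perm_sort geq _))) big_cat.
by rewrite /pprod (perm_big _ (permEl (perm_sort geq _))) big_cat.
Qed.

Lemma spannedM L1 L2 L g h : uniq L -> all is_part2 L ->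
  {in L1 & L2, forall x y, merge2 x y \in L} ->
  spanned L1 g -> spanned L2 h -> spanned L (g * h).
Proof.
move=> uL pL H Hg Hh; rewrite Hg Hh big_distrlr /=.
rewrite big_seq; apply: spanned_sum => x xL1.
under eq_bigr do rewrite -scalerAl -scalerAr scalerA ppXY_merge2.
apply: spanned_lin => // z /mapP[y yL2 ->].
exact: H.
Qed.

Definition pairs2 a b := [seq (mu, nu) | mu <- parts a, nu <- parts b].
Definition pairs_tot e := flatten [seq pairs2 a (e - a) | a <- iota 0 e.+1].

Lemma mem_pairs2 a b x : (x \in pairs2 a b) =
  [&& is_part2 x, sumn x.1 == a & sumn x.2 == b].
Proof.
apply/allpairsP/idP => [[[mu nu] /= [h1 h2 ->]]|].
  move: h1 h2; rewrite !mem_parts /is_part2 /= => /andP[-> ->] /andP[-> ->] //.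
case/and3P=> /andP[h1 h2] h3 h4; exists x; rewrite !mem_parts h1 h2 h3 h4.
by split=> //; case: (x).
Qed.

Lemma pairs2_uniq a b : uniq (pairs2 a b).
Proof. by apply: allpairs_uniq => [||[? ?] [? ?] _ _ [-> ->]] //; apply: parts_uniq. Qed.

Lemma mem_pairs_tot e x : (x \in pairs_tot e) =
  is_part2 x && (sumn x.1 + sumn x.2 == e)%N.
Proof.
apply/flatten_mapP/idP => [[a]|/andP[px /eqP sx]].
  rewrite mem_iota mem_pairs2 => /andP[_ ae] /and3P[-> /eqP-> /eqP->] /=.
  by rewrite subnKC.
exists (sumn x.1); first by rewrite mem_iota /= add0n ltnS -sx leq_addr.
by rewrite mem_pairs2 px eqxx -sx addKn eqxx.
Qed.

Lemma pairs_tot_uniq e : uniq (pairs_tot e).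
Proof.
rewrite /pairs_tot; have := iota_uniq 0 e.+1; elim: (iota _ _) => //= a s IH.
case/andP=> as_ us; rewrite cat_uniq pairs2_uniq IH // andbT /=.
apply/hasPn => x /flatten_mapP[b bs]; rewrite !mem_pairs2 => /and3P[_ /eqP eb _].
apply/negP => /and3P[_ /eqP e1 _]; move/negP: as_; apply.
by rewrite -e1 eb.
Qed.

Lemma pairs2_part a b : all is_part2 (pairs2 a b).
Proof. by apply/allP => x; rewrite mem_pairs2 => /andP[]. Qed.

Lemma is_part2_merge2 x y : is_part2 x -> is_part2 y -> is_part2 (merge2 x y).
Proof.
rewrite /is_part2 /is_part /= => /andP[/andP[_ h1] /andP[_ h2]].
move=> /andP[/andP[_ h3] /andP[_ h4]].
by rewrite !sort_sorted ?geq_total //= !mem_sort !mem_cat !negb_or h1 h2 h3 h4.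
Qed.

Lemma sumn_sort_cat s t : sumn (sort geq (s ++ t)) = (sumn s + sumn t)%N.
Proof. by rewrite (perm_sumn (permEl (perm_sort _ _))) sumn_cat. Qed.

Lemma spanned2M a b a' b' g h : spanned (pairs2 a b) g ->
  spanned (pairs2 a' b') h -> spanned (pairs2 (a + a') (b + b')) (g * h).
Proof.
apply: spannedM; rewrite ?pairs2_uniq ?pairs2_part // => x y.
rewrite !mem_pairs2 => /and3P[px /eqP<- /eqP<-] /and3P[py /eqP<- /eqP<-].
by rewrite is_part2_merge2 // !sumn_sort_cat !eqxx.
Qed.

Lemma spanned_ppXY L x : uniq L -> all is_part2 L -> x \in L -> spanned L (ppXY x).
Proof.
move=> uL pL xL; have := @spanned_lin L _ [:: x] (fun=> 1) id uL pL.
by rewrite big_seq1 scale1r; apply => y; rewrite inE => /eqP->.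
Qed.

Lemma pprod_nil2 (A : comAlgType K) (p q : nat -> A) :
  pprod p [::] * pprod q [::] = 1.
Proof. by rewrite /pprod !big_nil mulr1. Qed.

Lemma spanned21 : spanned (pairs2 0 0) 1.
Proof.
rewrite -(pprod_nil2 (@pX K) (@pY K)) -/(ppXY ([::], [::])).
by apply: spanned_ppXY; rewrite ?pairs2_uniq ?pairs2_part // mem_pairs2.
Qed.

End Spanned.

Section HsymSpan.
Variable K : numFieldType.

Lemma spanned_hsymX n : spanned (pairs2 n 0) (hsym (@pX K) n).
Proof.
rewrite /hsym (_ : \sum_(mu <- parts n) _ =
   \sum_(mu <- parts n) ((zpart mu)%:R^-1 : K) *: ppXY K (mu, [::])); last first.
  by apply: eq_bigr => mu _; rewrite /ppXY /= /pprod big_nil mulr1.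
apply: spanned_lin; rewrite ?pairs2_uniq ?pairs2_part // => x /mapP[mu].
by rewrite mem_parts mem_pairs2 => /andP[pm /eqP sm] -> /=; rewrite /is_part2 /= pm sm eqxx.
Qed.

Lemma spanned_hsymY n : spanned (pairs2 0 n) (hsym (@pY K) n).
Proof.
rewrite /hsym (_ : \sum_(mu <- parts n) _ =
   \sum_(mu <- parts n) ((zpart mu)%:R^-1 : K) *: ppXY K ([::], mu)); last first.
  by apply: eq_bigr => mu _; rewrite /ppXY /= /pprod big_nil mul1r.
apply: spanned_lin; rewrite ?pairs2_uniq ?pairs2_part // => x /mapP[mu].
by rewrite mem_parts mem_pairs2 => /andP[pm /eqP sm] -> /=; rewrite /is_part2 /= pm sm eqxx.
Qed.

End HsymSpan.

Lemma sign_scale (K : fieldType) (B : comAlgType K) j (x : B) :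
  ((-1) ^+ j : K) *: x = (-1) ^+ j * x.
Proof.
elim: j => [|j IH]; first by rewrite !expr0 scale1r mul1r.
by rewrite !exprS -mulrA -scalerA IH scaleN1r mulN1r.
Qed.

(** * The logarithm of the Cauchy series *)

Section LogCauchy.
Notation A := (symXY rat).

Definition UXY n : A := hsym (@pX rat) n * hsym (@pY rat) n.

Lemma spanned_UXY n : spanned (pairs2 n n) (UXY n).
Proof. by have := spanned2M (spanned_hsymX rat n) (spanned_hsymY rat n); rewrite addn0 add0n. Qed.

Lemma spanned_cauchy_pow N j n : spanned (pairs2 n n) (cauchy_trunc N ^+ j)`_n.
Proof.
elim: j n => [|j IH] n.
  rewrite expr0 coef1; case: n => [|n]; first exact: spanned21.
  have := @spanned_lin rat (pairs2 n.+1 n.+1) _ [::] (fun=> 0) id.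
  by rewrite big_nil; apply=> //; [exact: pairs2_uniq|exact: pairs2_part].
rewrite exprS coefM; apply: spanned_sum => i _.
have e : (i + (n - i))%N = n by rewrite subnKC // -ltnS.
rewrite -[in pairs2 _ _]e; apply: spanned2M => //; rewrite /cauchy_trunc coef_sum big_seq.
apply: spanned_sum => m _; rewrite coefZ coefXn mulr_natr.
case: eqP => [->|_]; first by rewrite mulr1n; apply: spanned_UXY.
rewrite mulr0n; have := @spanned_lin rat (pairs2 i i) _ [::] (fun=> 0) id.
by rewrite big_nil; apply=> //; [exact: pairs2_uniq|exact: pairs2_part].
Qed.

(** The coefficient of T^n is homogeneous of bidegree (n, n), so the numbers [fcoef] with |kap| =
    |lam| = n describe it completely. *)
Lemma log_cauchy_expand n : log_cauchy_coef n =
  \sum_(kap <- parts n) \sum_(lam <- parts n)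
    fcoef kap lam *: (pprod (@pX rat) kap * pprod (@pY rat) lam).
Proof.
have -> : log_cauchy_coef n = \sum_(x <- pairs2 n n)
    pcoef x.1 x.2 (log_cauchy_coef n) *: ppXY rat x.
  apply: spanned_sum => j _; apply: spannedZ; exact: spanned_cauchy_pow.
rewrite big_allpairs; apply: eq_big_seq => kap; rewrite mem_parts => /andP[_ /eqP sk].
by apply: eq_bigr => lam _; rewrite /fcoef sk.
Qed.

Definition fvanish (f : fps A) a := forall n, (n < a)%N -> f n = 0.

Lemma fvanishM f g a b : fvanish f a -> fvanish g b -> fvanish (f * g) (a + b).
Proof.
move=> fa gb n nab; rewrite fpnM big1 // => i _.
have [ia|ia] := ltnP i a; first by rewrite fa // mul0r.
by rewrite gb ?mulr0 //; have := ltn_ord i; lia.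
Qed.

Lemma fvanishX f a j : fvanish f a -> fvanish (f ^+ j) (a * j).
Proof.
move=> fa; elim: j => [|j IH]; first by rewrite muln0.
by rewrite exprS mulnS; apply: fvanishM.
Qed.

(** With 1 + c the Cauchy series, T d/dT of log (1 + c) is T c' / (1 + c). The finite geometric sum
    [SN] inverts 1 + c up to (-c)^n, and this error does not reach the coefficient of T^n. *)
Lemma log_cauchy_newton : newton (fun r => log_cauchy_coef r *+ r) UXY.
Proof.
have U0 : UXY 0 = 1.
  have h0 (B : comAlgType rat) (p q : nat -> B) : hsym p 0 * hsym q 0 = 1.
    by rewrite !hsym0 mulr1.
  exact: h0.
split=> // n.
pose c : fps A := Fps UXY - 1.
have c0 : fvanish c 1 by case=> // _; rewrite fpnB fpn1 /= U0 subrr.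
have dc0 : fvanish (feuler c) 1 by case=> // _; rewrite feulerE mulr0n.
have trunc_pow N j m : (m <= N)%N -> (cauchy_trunc N ^+ j)`_m = (c ^+ j) m.
  elim: j m => [|j IH] m mN; first by rewrite !expr0 coef1 fpn1.
  rewrite !exprS coefM fpnM; apply: eq_bigr => i _.
  rewrite IH; last by apply: leq_trans mN; apply: leq_subr.
  congr (_ * _); rewrite /cauchy_trunc coef_sum.
  have iN : (i <= N)%N by apply: leq_trans mN; rewrite -ltnS.
  rewrite fpnB fpn1 /=; case: (posnP i) => [->|i0].
    rewrite U0 subrr big1_seq // => k; rewrite mem_index_iota => /andP[_ /andP[k0 _]].
    by rewrite coefZ coefXn ltn_eqF // mulr0.
  rewrite subr0 (bigD1_seq (i : nat)) ?iota_uniq //=; last by rewrite mem_index_iota i0 ltnS.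
  rewrite coefZ coefXn eqxx mulr1 big1 ?addr0 // => k ki.
  by rewrite coefZ coefXn eq_sym (negPf ki) mulr0.
pose SN : fps A := \sum_(0 <= j < n) (- c) ^+ j.
have SNc : SN * (1 + c) = 1 - (- c) ^+ n.
  rewrite /SN; elim: (n) => [|m IH]; first by rewrite big_geq // mul0r expr0 subrr.
  rewrite big_nat_recr //= mulrDl IH exprS; ring.
have Lr r : (r <= n)%N -> log_cauchy_coef r *+ r = (SN * feuler c) r.
  move=> rn; rewrite /log_cauchy_coef -sumrMnl.
  transitivity (\sum_(1 <= j < r.+1) ((- c) ^+ j.-1 * feuler c) r).
    apply: eq_big_nat => -[//|j] /andP[_ jr] /=.
    rewrite trunc_pow // scalerMnr -feulerE feulerX fpnMn -scaler_nat scalerA.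
    rewrite mulfVK ?pnatr_eq0 // (exprNn c) -mulrA.
    have -> : ((-1) ^+ j : fps A) = fpC ((-1) ^+ j) by rewrite rmorphXn rmorphN1.
    by rewrite fpnCM sign_scale.
  rewrite /SN mulr_suml fpn_sum big_add1 /=.
  rewrite [RHS](big_cat_nat _ (n := r)) //= [X in _ = _ + X]big1_seq ?addr0 //.
  move=> j; rewrite mem_index_iota => /andP[_ /andP[rj _]].
  have := fvanishM (@fvanishX c 1 j c0) dc0 (n := r); rewrite mul1n addn1 ltnS => /(_ rj) h.
  rewrite (exprNn c) -mulrA.
  have -> : ((-1) ^+ j : fps A) = fpC ((-1) ^+ j) by rewrite rmorphXn rmorphN1.
  by rewrite fpnCM h mulr0.
have c1 : 1 + c = Fps UXY by rewrite /c addrC subrK.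
have -> : \sum_(1 <= r < n.+1) log_cauchy_coef r *+ r * UXY (n - r)
    = (SN * feuler c * (1 + c)) n.
  rewrite c1.
  rewrite fpnM big_ord_recl /=.
  have -> : (SN * feuler c) 0%N = 0 by rewrite fpnM0 dc0 // mulr0.
  rewrite mul0r add0r big_add1 /= big_mkord; apply: eq_bigr => i _.
  by rewrite /bump leq0n add1n Lr.
rewrite mulrAC SNc mulrBl mul1r fpnB.
(* The power of c vanishes to order n and T c' to order 1. *)
have -> : ((- c) ^+ n * feuler c) n = 0.
  have := fvanishM (@fvanishX c 1 n c0) dc0 (n := n); rewrite mul1n addn1 => /(_ (ltnSn n)) h.
  rewrite (exprNn c) -mulrA.
  have -> : ((-1) ^+ n : fps A) = fpC ((-1) ^+ n) by rewrite rmorphXn rmorphN1.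
  by rewrite fpnCM h mulr0.
rewrite subr0 feulerE fpnB fpn1 /=; case: (n) => [|m]; first by rewrite !mulr0n.
by rewrite subr0.
Qed.

End LogCauchy.

(** * The coefficients V *)

Section ProdExpand.
Variable A : comNzRingType.

Lemma fpn_prod_trunc I (s : seq I) (F : I -> fps A) N n : (n < N)%N ->
  (\prod_(i <- s) F i) n = (\prod_(i <- s) ftrunc N (F i))`_n.
Proof.
move=> nN; elim: s n nN => [|i s IH] n nN; first by rewrite !big_nil fpn1 coef1.
rewrite !big_cons fpnM coefM; apply: eq_bigr => j _.
have jn : (j <= n)%N by rewrite -ltnS.
by rewrite coef_poly (leq_ltn_trans jn nN) IH // (leq_ltn_trans (leq_subr _ _)).
Qed.

Lemma fpn_prod_ffun l (F : 'I_l -> fps A) e :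
  (\prod_i F i) e
  = \sum_(g : {ffun 'I_l -> 'I_e.+1} | (\sum_i (g i : nat) == e)%N) \prod_i F i (g i).
Proof.
rewrite (fpn_prod_trunc _ _ (ltnSn e)).
under eq_bigr do rewrite /ftrunc poly_def.
rewrite bigA_distr_bigA /= coef_sum [RHS]big_mkcond; apply: eq_bigr => g _.
under eq_bigr do rewrite -mul_polyC.
rewrite big_split /= -rmorph_prod /= coefCM.
have -> : \prod_(i < l) 'X^(g i) = 'X^(\sum_(i < l) g i) :> {poly A}.
  by rewrite -expr_sum.
by rewrite coefXn eq_sym; case: ifP => _; rewrite ?mulr1 ?mulr0.
Qed.

End ProdExpand.

Section PowerSumSeries.
Variables (K : numFieldType) (A : comAlgType K).
Implicit Types (a b : nat -> A).

(* p_r of an alphabet whose exponents t have power sums a_n: the series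
   sum_n a_n r^n t^n / n! *)
Definition psum_fps a r : fps A := Fps (fun n => ((r ^ n)%:R / n`!%:R : K) *: a n).

(** A term of the expanded product is a sequence of exponents, one for each part of kap. Its nonzero
    entries form a partition mu of e; the sequences belonging to mu are the distinct permutations of
    mu padded with zeros, whence m_mu(kap), and each zero contributes a factor a_0. *)
Lemma psum_fps_prod a kap e :
  (\prod_(r <- kap) psum_fps a r) e
  = \sum_(mu <- parts e)
      ((monomial_sym mu kap)%:R / (\prod_(i <- mu) i`!)%N%:R : K)
      *: (a 0%N ^+ (size kap - size mu) * pprod a mu).
Proof.
set l := size kap.
rewrite (big_nth 0%N) big_mkord fpn_prod_ffun -/l.
pose s (g : {ffun 'I_l -> 'I_e.+1}) : seq nat := [seq (g i : nat) | i <- enum 'I_l].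
have ssz g : size (s g) = l by rewrite size_map size_enum_ord.
have snth g (i : 'I_l) : nth 0%N (s g) i = g i.
  by rewrite (nth_map i) ?size_enum_ord // nth_ord_enum.
have ssum g : sumn (s g) = (\sum_i (g i : nat))%N.
  by rewrite sumnE big_map big_enum.
have sinj : injective s.
  move=> g h gh; apply/ffunP => i; apply/val_inj => /=.
  by rewrite -!snth gh.
pose part g := [seq x <- sort geq (s g) | x != 0%N].
have part_part g : is_part (part g).
  by apply/is_part_filter/sort_sorted/geq_total.
have sum_part g : sumn (part g) = (\sum_i (g i : nat))%N.
  by rewrite sumn_filter_neq0 (perm_sumn (permEl (perm_sort _ _))) ssum.
pose G (t : seq nat) : A := \prod_(i < l) (((nth 0%N kap i ^ nth 0%N t i)%:R / (nth 0%N t i)`!%:R : K) *: a (nth 0%N t i)).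
transitivity (\sum_(mu <- parts e) \sum_(g | part g == mu) G (s g)).
  rewrite (exchange_big_dep xpredT) //= big_mkcond; apply: eq_bigr => g _.
  rewrite (eq_bigl (pred1 (part g))); last by move=> mu; rewrite /= eq_sym.
  case: ifP => ge; last first.
    rewrite big1_seq // => mu /andP[/eqP-> /=].
    by rewrite mem_parts sum_part ge andbF.
  have pe : part g \in parts e by rewrite mem_parts part_part sum_part ge.
  rewrite -[RHS]big_filter.
  have -> : [seq mu <- parts e | pred1 (part g) mu] = [:: part g].
    by apply: filter_pred1_uniq; rewrite ?parts_uniq.
  rewrite big_seq1.
  by apply: eq_bigr => i _; rewrite /psum_fps /= snth.
apply: eq_big_seq => mu; rewrite mem_parts => /andP[pmu /eqP smu].
rewrite /monomial_sym -/l; case: leqP => lmu; last first.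
  rewrite mul0r scale0r big_pred0 // => g; apply/eqP => e'.
  move: lmu; rewrite -e' ltnNge => /negP; apply.
  by rewrite /part size_filter (leq_trans (count_size _ _)) // size_sort ssz.
set z := (mu ++ nseq (l - size mu) 0)%N.
transitivity (\sum_(t <- permutations z) G t).
  rewrite -big_filter -[LHS](big_map s xpredT G); apply: perm_big.
  apply: uniq_perm; rewrite ?permutations_uniq ?map_inj_uniq ?filter_uniq ?index_enum_uniq //.
  move=> t; rewrite mem_permutations; apply/mapP/idP.
    case=> g; rewrite mem_filter => /andP[/eqP pg _] ->.
    have ss : sorted geq (sort geq (s g)) by apply/sort_sorted/geq_total.
    rewrite -(permPl (permEl (perm_sort geq (s g)))) {1}(sorted_geq_pad ss) -/(part g) pg.
    by rewrite size_sort ssz.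
  move=> tz.
  have tsz : size t = l by rewrite (perm_size tz) size_cat size_nseq subnKC.
  have tle i : (nth 0%N t i < e.+1)%N.
    have [it|it] := ltnP i (size t); last by rewrite nth_default.
    rewrite ltnS -smu.
    have -> : sumn mu = sumn t.
      by rewrite (perm_sumn tz) sumn_cat sumn_nseq mul0n addn0.
    by apply/leq_sumn/mem_nth.
  pose g : {ffun 'I_l -> 'I_e.+1} := [ffun i : 'I_l => inord (nth 0%N t i)].
  have gt : s g = t.
    apply: (@eq_from_nth _ 0%N); rewrite ssz ?tsz // => i il.
    by rewrite (snth g (Ordinal il)) ffunE inordK.
  exists g => //; rewrite mem_filter mem_index_enum andbT /part gt.
  have pp : perm_eq [seq x <- sort geq t | x != 0%N] mu.
    apply: (@perm_trans _ [seq x <- z | x != 0%N]).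
      by apply: perm_filter; rewrite (permPl (permEl (perm_sort _ _))).
    rewrite /z filter_cat filter_nseq /= cats0 (_ : [seq x <- mu | x != 0%N] = mu) //.
    by apply/all_filterP/allP => x xm; case: x xm pmu => // xm /andP[_ /negP[]].
  apply/eqP/part_perm_eq => //.
  by apply/is_part_filter/sort_sorted/geq_total.
pose P := \prod_(x <- z) (((x`!)%:R^-1 : K) *: a x).
have GP t : t \in permutations z ->
    G t = ((\prod_(i < l) nth 0%N kap i ^ nth 0%N t i)%N%:R : K) *: P.
  rewrite mem_permutations => tz.
  have tsz : size t = l by rewrite (perm_size tz) size_cat size_nseq subnKC.
  rewrite /P -(perm_big _ tz) (big_nth 0%N) big_mkord tsz natr_prod.
  rewrite -scaler_prod /G; apply: eq_bigr => i _.
  by rewrite scalerA.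
rewrite (eq_big_seq _ GP) -scaler_suml -natr_sum -scalerA; congr (_ *: _).
have nz d (F : nat -> A) : \prod_(x <- nseq d 0%N) F x = F 0%N ^+ d.
  by elim: d => [|d IH]; rewrite /= ?big_nil ?big_cons ?expr0 // IH exprS.
rewrite /P /z big_cat /= scaler_prod nz fact0 invr1 scale1r -scalerAl mulrC.
by rewrite prodfV natr_prod.
Qed.

End PowerSumSeries.

Section Vcoef.

Lemma monomial_sym_gt mu kap : (size kap < size mu)%N -> monomial_sym mu kap = 0%N.
Proof. by move=> h; rewrite /monomial_sym leqNgt h. Qed.

(** Where an integer exponent of k might be negative, mu or nu has more parts than there are
    variables and the monomial symmetric function vanishes. *)
Lemma VcoefE r mu nu k : Vcoef r mu nu k =
  ((sumn mu + sumn nu)`!)%:R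
    / (\prod_(i <- mu) i`! * \prod_(j <- nu) j`!)%N%:R
  * \sum_(kap <- parts r) \sum_(lam <- parts r)
      fcoef kap lam * (monomial_sym mu kap)%:R * (monomial_sym nu lam)%:R
      * (k%:R : rat) ^+ ((size kap - size mu) + (size lam - size nu)).
Proof.
congr (_ * _); apply: eq_bigr => kap _; apply: eq_bigr => lam _.
have [h1|h1] := ltnP (size kap) (size mu); first by rewrite monomial_sym_gt // mulr0 !mul0r.
have [h2|h2] := ltnP (size lam) (size nu); first by rewrite [X in _ * X%:R]monomial_sym_gt // mulr0 !mul0r.
congr (_ * _).
have -> : (size kap)%:Z + (size lam)%:Z - (size mu)%:Z - (size nu)%:Z
   = ((size kap - size mu) + (size lam - size nu))%N%:Z by lia.
by [].
Qed.

(** A partition of r has at most r parts, which bounds the exponents of k left by [VcoefE]. *)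
Lemma Vcoef_poly r mu nu : exists2 q : {poly rat}, (size q <= (2 * r).+1)%N &
  forall k, Vcoef r mu nu k = q.[k%:R].
Proof.
exists ((((sumn mu + sumn nu)`!)%:R
    / (\prod_(i <- mu) i`! * \prod_(j <- nu) j`!)%N%:R) *:
  \sum_(kap <- parts r) \sum_(lam <- parts r)
      (fcoef kap lam * (monomial_sym mu kap)%:R * (monomial_sym nu lam)%:R)
      *: 'X^((size kap - size mu) + (size lam - size nu))).
  apply: leq_trans (size_scale_leq _ _) _.
  apply/leq_sizeP => j rj; rewrite coef_sum big1_seq // => kap /andP[_].
  rewrite mem_parts => /andP[/part_size + /eqP sk]; rewrite sk => lk.
  rewrite coef_sum big1_seq // => lam /andP[_].
  rewrite mem_parts => /andP[/part_size + /eqP sl]; rewrite sl => ll.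
  rewrite coefZ coefXn gtn_eqF ?mulr0 //; apply: leq_trans rj; rewrite ltnS; lia.
move=> k; rewrite VcoefE hornerZ horner_sum; congr (_ * _).
apply: eq_bigr => kap _; rewrite horner_sum; apply: eq_bigr => lam _.
by rewrite hornerZ hornerXn.
Qed.

Variables (K : numFieldType) (A : comAlgType K) (k : nat) (a b : nat -> A).
Hypotheses (a0 : a 0%N = k%:R) (b0 : b 0%N = k%:R).

(** The origin of the numbers V: the coefficient of T^r in the logarithm, evaluated at alphabets of
    k formal exponentials. The values a_0 = b_0 = k supply the powers of k. *)
Lemma lam_coef r e :
  (\sum_(kap <- parts r) \sum_(lam <- parts r)
     fpC ((ratr (fcoef kap lam) : K)%:A)
     * (\prod_(i <- kap) psum_fps a i * \prod_(i <- lam) psum_fps b i)) e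
  = \sum_(x <- pairs_tot e)
      (ratr (Vcoef r x.1 x.2 k) / e`!%:R : K) *: (pprod a x.1 * pprod b x.2).
Proof.
have kA n (x : A) : (k%:R : A) ^+ n * x = ((k%:R : K) ^+ n) *: x.
  have -> : (k%:R : A) ^+ n = in_alg A (k%:R ^+ n) by rewrite rmorphXn rmorph_nat.
  exact: mulr_algl.
have sc f c1 d1 c2 d2 (x y : A) : f%:A * (c1 *: (d1 *: x) * (c2 *: (d2 *: y)))
    = (f * (c1 * d1) * (c2 * d2)) *: (x * y).
  by rewrite mulr_algl !scalerA -scalerAl -scalerAr !scalerA !mulrA.
rewrite fpn_sum.
transitivity (\sum_(kap <- parts r) \sum_(lam <- parts r) \sum_(x <- pairs_tot e)
   (ratr (fcoef kap lam) * (((monomial_sym x.1 kap)%:R / (\prod_(i <- x.1) i`!)%N%:R)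
     * ((monomial_sym x.2 lam)%:R / (\prod_(i <- x.2) i`!)%N%:R)
     * k%:R ^+ ((size kap - size x.1) + (size lam - size x.2))) : K) *: (pprod a x.1 * pprod b x.2)).
  apply: eq_bigr => kap _; rewrite fpn_sum; apply: eq_bigr => lam _.
  rewrite fpnCM fpnM mulr_sumr /pairs_tot big_flatten big_map -[iota 0 e.+1]/(index_iota 0 e.+1) big_mkord.
  apply: eq_bigr => i _; rewrite big_allpairs !psum_fps_prod big_distrlr mulr_sumr.
  apply: eq_bigr => mu _; rewrite mulr_sumr; apply: eq_bigr => nu _ /=.
  rewrite a0 b0; move: (ratr _) => f.
  rewrite !kA sc; congr (_ *: _).
  by rewrite exprD; ring.
under eq_bigr do rewrite exchange_big.
rewrite exchange_big /=; apply: eq_big_seq => x; rewrite mem_pairs_tot => /andP[_ /eqP sx].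
under eq_bigr do rewrite -scaler_suml.
rewrite -scaler_suml; congr (_ *: _).
rewrite VcoefE sx rmorphM /= fmorph_div /= !ratr_nat mulrAC [X in X / _ * _]mulrC.
rewrite mulfK ?pnatr_eq0 ?gtn_eqF ?fact_gt0 // rmorph_sum mulr_sumr.
apply: eq_bigr => kap _; rewrite rmorph_sum mulr_sumr; apply: eq_bigr => lam _.
by rewrite /= !rmorphM /= rmorphXn /= !ratr_nat ?natrM invfM; ring.
Qed.

End Vcoef.

Local Open Scope classical_set_scope.

(** * Series of complex numbers *)

Section GenericLimits.
Variables (K : numClosedFieldType) (T : Type) (F : set_system T).
Implicit Types f g : T -> K.

Lemma cvgK_unique {FF : ProperFilter F} f (l l' : K) :
  f @ F --> l -> f @ F --> l' -> l = l'.
Proof. by move=> h h'; apply: (@cvg_unique _ _ (f @ F)). Qed.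
Lemma cvgK_lim {FF : ProperFilter F} f (l : K) : f @ F --> l -> lim (f @ F) = l.
Proof. by move=> h; apply: cvg_lim. Qed.
Lemma cvgKD {FF : Filter F} f g (l l' : K) :
  f @ F --> l -> g @ F --> l' -> (fun x => f x + g x) @ F --> l + l'.
Proof. exact: cvgD. Qed.
Lemma cvgKB {FF : Filter F} f g (l l' : K) :
  f @ F --> l -> g @ F --> l' -> (fun x => f x - g x) @ F --> l - l'.
Proof. exact: cvgB. Qed.
Lemma cvgKM {FF : Filter F} f g (l l' : K) :
  f @ F --> l -> g @ F --> l' -> (fun x => f x * g x) @ F --> l * l'.
Proof. exact: cvgM. Qed.
Lemma cvgK_cst {FF : Filter F} (l : K) : (fun=> l) @ F --> l.
Proof. exact: cvg_cst. Qed.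
Lemma cvgK_sum {FF : Filter F} I (r : seq I) (f : I -> T -> K) (l : I -> K) :
  (forall i, f i @ F --> l i) ->
  (fun x => \sum_(i <- r) f i x) @ F --> \sum_(i <- r) l i.
Proof.
move=> h; elim: r => [|i r IH].
  by under eq_fun do rewrite big_nil; rewrite big_nil; apply: cvgK_cst.
under eq_fun do rewrite big_cons; rewrite big_cons; exact: cvgKD.
Qed.
End GenericLimits.

Section Modulus.
Variable R : realType.
Notation C := (cplx R).
Implicit Types (z w : C).

(** The modulus as a real number; the norm of a complex number is itself complex. *)
Definition nm z : R := re `|z|.

Lemma normE z : `|z| = toC (nm z).
Proof. by rewrite /nm /toC /re RRe_real ?normr_real. Qed.

Lemma toC_inj : injective (@toC R).
Proof. exact: complexI. Qed.

Fact toC_is_zmod_morphism : zmod_morphism (@toC R).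
Proof. exact: (rmorphB (real_complex R)). Qed.
Fact toC_is_monoid_morphism : monoid_morphism (@toC R).
Proof. split; [exact: (rmorph1 (real_complex R))|exact: (rmorphM (real_complex R))]. Qed.
HB.instance Definition _ := GRing.isZmodMorphism.Build R C (@toC R) toC_is_zmod_morphism.
HB.instance Definition _ := GRing.isMonoidMorphism.Build R C (@toC R) toC_is_monoid_morphism.

Lemma toC_le (x y : R) : (toC x <= toC y) = (x <= y). Proof. exact: lecR. Qed.
Lemma toC_lt (x y : R) : (toC x < toC y) = (x < y). Proof. exact: ltcR. Qed.

Lemma re_toC (x : R) : re (toC x) = x. Proof. by []. Qed.
Lemma im_toC (x : R) : im (toC x) = 0. Proof. by []. Qed.
Lemma reD z w : re (z + w) = re z + re w. Proof. by case: z w => [? ?] [? ?]. Qed.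
Lemma imD z w : im (z + w) = im z + im w. Proof. by case: z w => [? ?] [? ?]. Qed.
Lemma reN z : re (- z) = - re z. Proof. by case: z. Qed.
Lemma imN z : im (- z) = - im z. Proof. by case: z. Qed.
Lemma reB z w : re (z - w) = re z - re w. Proof. by rewrite reD reN. Qed.
Lemma imB z w : im (z - w) = im z - im w. Proof. by rewrite imD imN. Qed.
Lemma reM z w : re (z * w) = re z * re w - im z * im w.
Proof. by case: z w => [? ?] [? ?]. Qed.
Lemma imM z w : im (z * w) = re z * im w + im z * re w.
Proof. by case: z w => [? ?] [? ?]. Qed.
Lemma re_sum I (r : seq I) P (F : I -> C) :
  re (\sum_(i <- r | P i) F i) = \sum_(i <- r | P i) re (F i).
Proof. by apply: (big_morph (@re R)) => // z w; apply: reD. Qed.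
Lemma im_sum I (r : seq I) P (F : I -> C) :
  im (\sum_(i <- r | P i) F i) = \sum_(i <- r | P i) im (F i).
Proof. by apply: (big_morph (@im R)) => // z w; apply: imD. Qed.
Lemma complex_eq z w : re z = re w -> im z = im w -> z = w.
Proof. by case: z w => [a b] [c d] /= -> ->. Qed.

Lemma nm_ge0 z : 0 <= nm z.
Proof. by rewrite -toC_le -normE rmorph0 normr_ge0. Qed.
Lemma nmM z w : nm (z * w) = nm z * nm w.
Proof. by apply: toC_inj; rewrite rmorphM /= -!normE normrM. Qed.
Lemma nmD z w : nm (z + w) <= nm z + nm w.
Proof. by rewrite -toC_le rmorphD /= -!normE ler_normD. Qed.
Lemma nmN z : nm (- z) = nm z.
Proof. by rewrite /nm normrN. Qed.
Lemma nmB z w : nm (z - w) <= nm z + nm w.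
Proof. by rewrite (le_trans (nmD _ _)) ?nmN. Qed.
Lemma nmC z w : nm (z - w) = nm (w - z).
Proof. by rewrite /nm distrC. Qed.
Lemma nm0 : nm 0 = 0. Proof. by rewrite /nm normr0. Qed.
Lemma nm1 : nm 1 = 1. Proof. by rewrite /nm normr1. Qed.
Lemma nm_eq0 z : (nm z == 0) = (z == 0).
Proof. by rewrite -(inj_eq toC_inj) -normE rmorph0 normr_eq0. Qed.
Lemma nmV z : nm z^-1 = (nm z)^-1.
Proof. by apply: toC_inj; rewrite fmorphV /= -!normE normfV. Qed.
Lemma nmX z n : nm (z ^+ n) = nm z ^+ n.
Proof. by apply: toC_inj; rewrite rmorphXn /= -!normE normrX. Qed.
Lemma nm_toC (x : R) : nm (toC x) = `|x|.
Proof.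
apply: toC_inj; rewrite -normE normc_def /toC /= expr0n addr0 sqrtr_sqr //.
Qed.
Lemma nm_nat n : nm n%:R = n%:R.
Proof. by rewrite -(rmorph_nat (@toC R)) nm_toC normr_nat. Qed.
Lemma nm_sum I (r : seq I) P (F : I -> C) :
  nm (\sum_(i <- r | P i) F i) <= \sum_(i <- r | P i) nm (F i).
Proof.
elim/big_rec2: _ => [|i x z _ h]; first by rewrite nm0.
by rewrite (le_trans (nmD _ _)) // lerD2l.
Qed.
Lemma nm_prod I (r : seq I) P (F : I -> C) :
  nm (\prod_(i <- r | P i) F i) = \prod_(i <- r | P i) nm (F i).
Proof. by apply: (big_morph nm); [exact: nmM|exact: nm1]. Qed.
Lemma nmMn z n : nm (z *+ n) = nm z *+ n.
Proof. by rewrite -mulr_natr nmM nm_nat mulr_natr. Qed.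
Lemma re_le_nm z : `|re z| <= nm z.
Proof. by rewrite -toC_le -normE; apply: normc_ge_Re. Qed.
Lemma nm_le z : nm z <= `|re z| + `|im z|.
Proof.
have e : z = toC (re z) + 'i%C * toC (im z) by exact: complexE.
rewrite {1}e (le_trans (nmD _ _)) // nmM !nm_toC lerD2l.
have -> : nm ('i%C : C) = 1.
  by apply: toC_inj; rewrite -normE normc_def /= expr0n expr1n add0r sqrtr1.
by rewrite mul1r.
Qed.
Lemma im_le_nm z : `|im z| <= nm z.
Proof.
have := re_le_nm ('i%C * z); rewrite nmM.
have -> : nm ('i%C : C) = 1.
  by apply: toC_inj; rewrite -normE normc_def /= expr0n expr1n add0r sqrtr1.
by rewrite mul1r reM /= mul0r sub0r mul1r normrN.
Qed.
Lemma nmB_ge z w : nm z - nm w <= nm (z - w).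
Proof. by rewrite lerBlDr -{1}(subrK w z) nmD. Qed.

Lemma nm_sqr z : nm z ^+ 2 = re z ^+ 2 + im z ^+ 2.
Proof.
have -> : nm z = Num.sqrt (re z ^+ 2 + im z ^+ 2).
  by apply: toC_inj; rewrite -normE normc_def.
by rewrite sqr_sqrtr // addr_ge0 // sqr_ge0.
Qed.

Lemma nm_dist z w : `|nm z - nm w| <= nm (z - w).
Proof. by rewrite ler_norml; have := nmB_ge z w; have := nmB_ge w z; rewrite nmC; lra. Qed.

Lemma complex_ex (x y : R) : exists z, re z = x /\ im z = y.
Proof. by exists (x +i* y)%C. Qed.

Lemma cvgCP T (F : set_system T) {FF : Filter F} (f : T -> C) (l : C) :
  (f @ F --> l) <-> (forall e : R, 0 < e -> \forall x \near F, nm (f x - l) < e).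
Proof.
split=> [/cvgrPdist_lt h e e0|h].
  have /h : 0 < toC e by rewrite -[0](rmorph0 (@toC R)) toC_lt.
  by apply: filterS => x; rewrite normE toC_lt nmC.
apply/cvgrPdist_lt => e e0.
have er : e = toC (re e) by rewrite /toC /re RRe_real ?gtr0_real.
have re0 : 0 < re e by rewrite -toC_lt rmorph0 -er.
have := h _ re0; apply: filterS => x.
by rewrite er normE toC_lt nmC.
Qed.

Lemma cvgC_re T (F : set_system T) {FF : Filter F} (f : T -> C) (l : C) :
  f @ F --> l -> (fun x => re (f x)) @ F --> re l.
Proof.
move=> /cvgCP h; apply/cvgrPdist_lt => e /h; apply: filterS => x.
by apply: le_lt_trans; rewrite -reB (le_trans (re_le_nm _)) // nmC.
Qed.
Lemma cvgC_im T (F : set_system T) {FF : Filter F} (f : T -> C) (l : C) :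
  f @ F --> l -> (fun x => im (f x)) @ F --> im l.
Proof.
move=> /cvgCP h; apply/cvgrPdist_lt => e /h; apply: filterS => x.
by apply: le_lt_trans; rewrite -imB (le_trans (im_le_nm _)) // nmC.
Qed.
Lemma cvgC_reim T (F : set_system T) {FF : Filter F} (f : T -> C) (l : C) :
  (fun x => re (f x)) @ F --> re l -> (fun x => im (f x)) @ F --> im l -> f @ F --> l.
Proof.
move=> /cvgrPdist_lt h1 /cvgrPdist_lt h2; apply/cvgCP => e e0.
have e20 : 0 < e / 2 by rewrite divr_gt0.
near=> x; apply: le_lt_trans (nm_le _) _; rewrite (splitr e) ltrD //.
  by rewrite reB distrC; near: x; apply: h1.
by rewrite imB distrC; near: x; apply: h2.
Unshelve. all: by end_near. Qed.
Lemma cvg_toC T (F : set_system T) {FF : Filter F} (f : T -> R) (l : R) :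
  f @ F --> l -> (fun x => toC (f x)) @ F --> (toC l : C).
Proof. by move=> h; apply: cvgC_reim => //=; apply: cvg_cst. Qed.

Lemma cvgC_unique T (F : set_system T) {FF : ProperFilter F} (f : T -> C) (l l' : C) :
  f @ F --> l -> f @ F --> l' -> l = l'.
Proof. exact: cvgK_unique. Qed.

Lemma cvg_nm T (F : set_system T) {FF : Filter F} (f : T -> C) (l : C) :
  f @ F --> l -> (fun x => nm (f x)) @ F --> nm l.
Proof.
move=> /cvgCP h; apply/cvgrPdist_lt => e /h; apply: filterS => x.
by apply: le_lt_trans; rewrite nmC nm_dist.
Qed.

Lemma nm_cvg_le T (F : set_system T) {FF : ProperFilter F} (f : T -> C) l (M : R) :
  f @ F --> l -> (\forall x \near F, nm (f x) <= M) -> nm l <= M.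
Proof.
move=> /cvgCP h hM; rewrite leNgt; apply/negP => Ml.
have e0 : 0 < nm l - M by rewrite subr_gt0.
have [x [h1 h2]] := filter_ex (filterI (h _ e0) hM).
by have := nmB_ge l (f x); rewrite nmC; move: h1 h2; lra.
Qed.

End Modulus.

Opaque cplx.

Section Sums.
Variable R : realType.
Notation C := (cplx R).
Implicit Types a b : nat -> C.

Record sums a (l : C) : Prop := Sums { sums_cvg : (series a : nat -> C) @ \oo --> l }.

Lemma seriesE a n : series a n = \sum_(i < n) a i.
Proof. by rewrite /series /= big_mkord. Qed.

Lemma sumsP a l : sums a l <->
  forall e : R, 0 < e -> exists N, forall n, (N <= n)%N -> nm (\sum_(i < n) a i - l) < e.
Proof.
split=> [[/cvgCP h] e /h [N _ HN]|h].
  by exists N => n Nn; have := HN n Nn; rewrite /= seriesE.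
split; apply/cvgCP => e /h [N HN]; exists N => // n /= /HN.
by rewrite seriesE.
Qed.

Lemma sums_lim a l : sums a l -> limn (series a) = l.
Proof. by case=> h; exact (cvgK_lim h). Qed.
Lemma sums_uniq a l l' : sums a l -> sums a l' -> l = l'.
Proof. by case=> h [h']; exact (cvgC_unique h h'). Qed.
Lemma sums_ext a b l : a =1 b -> sums a l -> sums b l.
Proof. by move=> /funext ->. Qed.
Lemma sumsD a b l l' : sums a l -> sums b l' -> sums (fun n => a n + b n) (l + l').
Proof.
move=> [ha] [hb]; split; rewrite (_ : series _ = fun n => series a n + series b n).
  exact (cvgKD ha hb).
by apply/funext => n; rewrite !seriesE big_split.
Qed.
Lemma sumsZ (c : C) a l : sums a l -> sums (fun n => c * a n) (c * l).
Proof.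
move=> [ha]; split; rewrite (_ : series _ = fun n => c * series a n).
  exact (cvgKM (@cvgK_cst _ _ _ _ c) ha).
by apply/funext => n; rewrite !seriesE mulr_sumr.
Qed.
Lemma sumsN a l : sums a l -> sums (fun n => - a n) (- l).
Proof.
move=> /(@sumsZ (-1) a l); rewrite mulN1r; apply: sums_ext => n; by rewrite mulN1r.
Qed.
Lemma sums0 : sums (fun=> 0) 0.
Proof.
apply/sumsP => e e0; exists 0%N => n _.
by rewrite big1 // subrr nm0.
Qed.
Lemma sums_finsum I (r : seq I) (f : I -> nat -> C) (l : I -> C) :
  (forall i, sums (f i) (l i)) -> sums (fun n => \sum_(i <- r) f i n) (\sum_(i <- r) l i).
Proof.
move=> h; elim: r => [|i r IH].
  by rewrite big_nil; apply: sums_ext sums0 => n; rewrite big_nil.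
rewrite big_cons; apply: sums_ext (sumsD (h i) IH) => n; by rewrite big_cons.
Qed.
Lemma sums_finite a N : (forall n, (N <= n)%N -> a n = 0) -> sums a (\sum_(i < N) a i).
Proof.
move=> a0; apply/sumsP => e e0; exists N => n Nn.
rewrite -(subnKC Nn) big_split_ord /= [X in _ + X - _]big1 ?addr0 ?subrr ?nm0 // => i _.
by rewrite a0 // leq_addr.
Qed.
Lemma sums_shift a l : sums (fun n => a n.+1) l <-> sums a (a 0%N + l).
Proof.
split=> /sumsP h; apply/sumsP => e /h [N HN].
  exists N.+1 => -[//|n] Nn; rewrite big_ord_recl /= opprD addrACA subrr add0r.
  exact: HN.
exists N => n Nn; have := HN n.+1 (leq_trans Nn (leqnSn _)).
by rewrite big_ord_recl /= opprD addrACA subrr add0r.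
Qed.
Lemma sums_nm_le a l (M : R) : sums a l -> (forall N, nm (\sum_(i < N) a i) <= M) -> nm l <= M.
Proof.
move=> [h] hM; apply: (nm_cvg_le h); apply: nearW => n; rewrite seriesE; exact: hM.
Qed.

(** Absolute convergence is carried as an explicit bound on partial sums, the form that dominated
    convergence and double series consume. *)
Definition bsum (b : nat -> R) M := forall N, \sum_(i < N) b i <= M.

Lemma bsum_ge0 (b : nat -> R) M : bsum b M -> 0 <= M.
Proof. by move=> /(_ 0%N); rewrite big_ord0. Qed.

Lemma bsum_tail (b : nat -> R) M : (forall n, 0 <= b n) -> bsum b M ->
  forall e, 0 < e -> exists N, forall n, \sum_(i < n) b (N + i)%N < e.
Proof.
move=> b0 bM e e0.
have cb : cvgn (series b).
  apply: nondecreasing_is_cvgn; first exact: nondecreasing_series.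
  by exists M => _ [n _ <-]; rewrite /series /= big_mkord.
have /cvgrPdist_lt /(_ _ e0) [N _ HN] := cb.
exists N => n.
have le_lim m : series b m <= limn (series b).
  exact: nondecreasing_cvgn_le (nondecreasing_series (fun i _ _ => b0 i)) cb m.
have := HN N (leqnn _); rewrite /= ger0_norm ?subr_ge0 //.
apply: le_lt_trans; rewrite lerBrDl; apply: le_trans (le_lim (N + n)%N).
by rewrite /series /= !big_mkord big_split_ord.
Qed.

Lemma sums_abs a M : bsum (fun n => nm (a n)) M -> exists2 l, sums a l & nm l <= M.
Proof.
move=> aM.
have cvgR (f : nat -> R) : (forall n, `|f n| <= nm (a n)) -> cvgn (series f).
  move=> fa; apply: normed_cvg; apply: nondecreasing_is_cvgn.
    by apply: nondecreasing_series => i _ _; apply: normr_ge0.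
  exists M => _ [n _ <-]; apply: le_trans (aM n); rewrite /series /= -(big_mkord xpredT (fun n => nm (a n))).
  by apply: ler_sum => i _; apply: fa.
have c1 := cvgR _ (fun n => re_le_nm (a n)).
have c2 := cvgR _ (fun n => im_le_nm (a n)).
have [l [l1 l2]] := complex_ex (limn (series (fun n => re (a n))))
  (limn (series (fun n => im (a n)))).
suff sl : sums a l.
  by exists l => //; apply: (sums_nm_le sl) => N; exact: le_trans (nm_sum _ _ _) (aM N).
split; apply: cvgC_reim; rewrite ?l1 ?l2.
  rewrite (_ : (fun x => _) = series (fun n => re (a n))) //.
  by apply/funext => n; rewrite seriesE re_sum /series /= big_mkord.
rewrite (_ : (fun x => _) = series (fun n => im (a n))) //.
by apply/funext => n; rewrite seriesE im_sum /series /= big_mkord.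
Qed.

Lemma bsum_le (b c : nat -> R) M : (forall n, b n <= c n) -> bsum c M -> bsum b M.
Proof. by move=> bc cM N; apply: le_trans (cM N); apply: ler_sum => i _. Qed.

Lemma bsum_comp (b : nat -> R) M i : (forall n, 0 <= b n) -> bsum b M -> b i <= M.
Proof.
move=> b0 bM; apply: le_trans (bM i.+1); rewrite big_ord_recr /= lerDr.
by apply: sumr_ge0.
Qed.

(* Dominated convergence for series. *)
Lemma tannery T (F : set_system T) {FF : Filter F} (a : nat -> T -> C) (al : nat -> C)
    (b : nat -> R) M (s : T -> C) (sg : C) : (forall n, 0 <= b n) -> bsum b M ->
  (\forall x \near F, (forall n, nm (a n x) <= b n) /\ sums (a ^~ x) (s x)) ->
  (forall n, nm (al n) <= b n) ->
  (forall n, a n x @[x --> F] --> al n) -> sums al sg -> s x @[x --> F] --> sg.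
Proof.
move=> b0 bM ab alb acv alsg; apply/cvgCP => e e0.
have e30 : 0 < e / 3%:R by rewrite divr_gt0.
have [N HN] := bsum_tail b0 bM e30.
have fin : (fun x => \sum_(i < N) a i x) @ F --> \sum_(i < N) al i.
  exact (@cvgK_sum _ _ F _ _ _ (fun i : 'I_N => a i) (fun i => al i) (fun i => acv i)).
have tl (c : nat -> C) (l : C) : (forall n, nm (c n) <= b n) -> sums c l ->
    nm (l - \sum_(i < N) c i) <= e / 3%:R.
  move=> cb cl; apply: (@nm_cvg_le _ _ \oo _ (fun n => series c n - \sum_(i < N) c i)).
    exact (cvgKB (sums_cvg cl) (@cvgK_cst _ _ _ _ _)).
  exists N => // n /= Nn; rewrite seriesE -(subnKC Nn) big_split_ord /= [X in X - _]addrC addrK.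
  apply: le_trans (nm_sum _ _ _) _; apply: le_trans (ltW (HN (n - N)%N)).
  by apply: ler_sum => i _; apply: cb.
near=> x.
have [axb sx] : (forall n, nm (a n x) <= b n) /\ sums (a ^~ x) (s x) by near: x.
have t1 := tl _ _ axb sx; have t2 := tl _ _ alb alsg.
have t3 : nm (\sum_(i < N) a i x - \sum_(i < N) al i) < e / 3%:R.
  by near: x; move/cvgCP: fin; apply.
have -> : s x - sg = (s x - \sum_(i < N) a i x)
   + (\sum_(i < N) a i x - \sum_(i < N) al i) - (sg - \sum_(i < N) al i).
  by ring.
apply: le_lt_trans (nmB _ _) _; apply: le_lt_trans (lerD (nmD _ _) (lexx _)) _.
have : e = e / 3%:R + e / 3%:R + e / 3%:R by field.
by move: t1 t2 t3; lra.
Unshelve. all: by end_near. Qed.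

(** Dominated convergence of the row sums as the number n of columns grows: the first n columns are
    summed by finite additivity, and row i is dominated by b i throughout. *)
Lemma fubini_sums (a : nat -> nat -> C) (b : nat -> R) M (r c : nat -> C) (sg : C) :
  (forall i, bsum (fun j => nm (a i j)) (b i)) -> bsum b M ->
  (forall i, sums (a i) (r i)) -> (forall j, sums (a ^~ j) (c j)) ->
  sums r sg -> sums c sg.
Proof.
move=> ab bM ra ca rs.
have b0 i : 0 <= b i by apply: bsum_ge0 (ab i).
split; refine (@tannery _ \oo _ (fun i n => series (a i) n) r b M (series c) sg b0 bM _ _ (fun i => sums_cvg (ra i)) rs).
  apply: nearW => n; split=> [i|].
    by rewrite seriesE (le_trans (nm_sum _ _ _)) //; exact: ab.
  rewrite seriesE; have := sums_finsum (index_enum 'I_n) (fun j : 'I_n => ca j).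
  by apply: sums_ext => i; rewrite seriesE.
by move=> i; apply: sums_nm_le (ra i) _ => N; apply: le_trans (nm_sum _ _ _) (ab i N).
Qed.

Lemma fubini_sums_ex (a : nat -> nat -> C) (b : nat -> R) M :
  (forall i, bsum (fun j => nm (a i j)) (b i)) -> bsum b M ->
  forall j, exists2 l, sums (a ^~ j) l & nm l <= M.
Proof.
move=> ab bM j; apply: sums_abs; apply: bsum_le bM => i.
exact: (@bsum_comp (fun n => nm (a i n)) _ j (fun n => nm_ge0 _) (ab i)).
Qed.

End Sums.

Section EvSeries.
Variable R : realType.
Notation C := (cplx R).
Implicit Types f g : fps C.

(** The norm of the algebra of absolutely convergent series at t = 1. Other arguments are reached by
    rescaling the variable with [fscale]. *)
Definition l1 f M := bsum (fun n => nm (f n)) M.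

Lemma l1M f g M N : l1 f M -> l1 g N -> l1 (f * g) (M * N).
Proof.
move=> fM gN n.
have M0 := bsum_ge0 fM; have N0 := bsum_ge0 gN.
apply: le_trans (_ : (\sum_(i < n) nm (f i)) * (\sum_(i < n) nm (g i)) <= _); last first.
  by apply: ler_pM => //; apply: sumr_ge0 => i _; apply: nm_ge0.
rewrite big_distrlr /=.
apply: le_trans (_ : \sum_(m < n) \sum_(i < n | (i <= m)%N) nm (f i) * nm (g (m - i)%N) <= _).
  apply: ler_sum => m _; rewrite fpnM (le_trans (nm_sum _ _ _)) //.
  rewrite -(big_mkord xpredT (fun i => nm (f i * g (m - i)%N))).
  rewrite (@big_nat_widen _ _ _ 0 m.+1 n) ?ltn_ord //= big_mkord.
  rewrite [X in _ <= X]big_mkcond [X in X <= _]big_mkcond /=.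
  by apply: ler_sum => i _; rewrite ltnS; case: ifP => _; rewrite ?nmM.
rewrite (exchange_big_dep xpredT) //=; apply: ler_sum => i _.
rewrite -mulr_sumr -[X in _ <= X]mulr_sumr ler_wpM2l ?nm_ge0 //.
rewrite -(big_mkord (fun m => (i <= m)%N) (fun m => nm (g (m - i)%N))).
rewrite -(big_mkord xpredT (fun m => nm (g m))).
have iN := ltn_ord i.
rewrite (big_cat_nat _ (n := i)) ?(ltnW iN) //= big1_seq ?add0r; last first.
  move=> m; rewrite mem_index_iota => /and3P[h1 _ h2]; lia.
rewrite -{1}[i : nat]add0n big_addn [X in _ <= X](big_cat_nat _ (n := (n - i)%N)) ?leq_subr //=.
rewrite big_mkcond /=.
apply: le_trans (_ : \sum_(0 <= m < n - i) nm (g m) <= _).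
  by apply: ler_sum => m _; rewrite leq_addl addnK.
by rewrite lerDl; apply: sumr_ge0 => m _; apply: nm_ge0.
Qed.

Lemma l1D f g M N : l1 f M -> l1 g N -> l1 (f + g) (M + N).
Proof.
move=> fM gN n; apply: le_trans (lerD (fM n) (gN n)); rewrite -big_split /=.
by apply: ler_sum => i _; apply: nmD.
Qed.

Lemma l1X f M n : l1 f M -> l1 (f ^+ n) (M ^+ n).
Proof.
move=> fM; elim: n => [|n IH]; last by rewrite !exprS; apply: l1M.
move=> [|N]; first by rewrite big_ord0 expr0.
rewrite !expr0 big_ord_recl fpn1 nm1 big1 ?addr0 // => i _.
by rewrite fpn1 nm0.
Qed.

Lemma sumsM f g M N (l l' : C) : l1 f M -> l1 g N -> sums f l -> sums g l' ->
  sums (f * g) (l * l').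
Proof.
move=> fM gN fl gl.
(* Row i is g shifted by i and multiplied by f_i; column n sums to the coefficient n of the
   product. *)
pose a i n := if (i <= n)%N then f i * g (n - i)%N else 0.
have rowb i : bsum (fun n => nm (a i n)) (nm (f i) * N).
  move=> n; have [ni|ni] := leqP n i.
    rewrite big1 => [|m _]; last first.
      by rewrite /a leqNgt (leq_trans (ltn_ord m)) //= nm0.
    by rewrite mulr_ge0 ?nm_ge0 //; exact: bsum_ge0 gN.
  rewrite -(subnKC (ltnW ni)) big_split_ord /= big1 ?add0r => [|m _]; last first.
    by rewrite /a leqNgt ltn_ord /= nm0.
  apply: le_trans (ler_wpM2l (nm_ge0 (f i)) (gN (n - i)%N)).
  by rewrite mulr_sumr; apply: ler_sum => m _; rewrite /a leq_addr addKn nmM.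
have sh (b : nat -> C) x i : sums b x -> sums (fun n => if (i <= n)%N then b (n - i)%N else 0) x.
  elim: i b x => [|i IH] b x hb; first by apply: sums_ext hb => n; rewrite subn0.
  have := (sums_shift (fun n => if (i < n)%N then b (n - i.+1)%N else 0) x).1.
  rewrite add0r; apply; exact: IH.
refine (@fubini_sums R a (fun i => nm (f i) * N) (M * N) (fun i => f i * l') _ _ rowb _ _ _ _).
- by move=> n; rewrite -mulr_suml ler_wpM2r ?fM //; exact: bsum_ge0 gN.
- move=> i; apply: sums_ext (sumsZ (f i) (sh _ _ i gl)) => n.
  by rewrite /a; case: ifP => _; rewrite ?mulr0.
- move=> n; rewrite fpnM.
  have -> : \sum_(i < n.+1) f i * g (n - i)%N = \sum_(i < n.+1) a i n.
    by apply: eq_bigr => i _; rewrite /a -ltnS ltn_ord.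
  by apply: sums_finite => i h; rewrite /a leqNgt h.
- by rewrite mulrC; apply: sums_ext (sumsZ l' fl) => i; rewrite mulrC.
Qed.

End EvSeries.

(** * Exponentials *)

Section FormalExp.
Variable K : numFieldType.
Implicit Types f g y : fps K.

(** Since L has no constant term, each coefficient of a solution is determined by the earlier ones.
    This replaces logarithms when two products of exponentials are compared. *)
Lemma ode_uniq (L y z : fps K) : L 0%N = 0 -> feuler y = L * y ->
  feuler z = L * z -> y 0%N = z 0%N -> y = z.
Proof.
move=> L0 yL zL yz; apply: fpsP => n; elim/ltn_ind: n => -[//|n] IH.
apply: (torsion_free_inj (@torsion_free_numField K) (n := n)).
rewrite -!feulerE yL zL !fpnM big_ord_recl [RHS]big_ord_recl L0 !mul0r !add0r.
by apply: eq_bigr => i _; rewrite IH // /= /bump leq0n; lia.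
Qed.

Definition expsum N f : fps K := \sum_(j < N) fpC (j`!%:R^-1) * f ^+ j.
(** The exponential of a series without constant term: powers beyond the n-th do not reach the
    coefficient n. *)
Definition fexp0 f : fps K := Fps (fun n => expsum n.+1 f n).

Lemma fps_vanishX f j n : f 0%N = 0 -> (n < j)%N -> (f ^+ j) n = 0.
Proof.
move=> f0; elim: j n => // j IH n nj; rewrite exprS fpnM big1 // => i _.
have [->|i0] := posnP i; first by rewrite f0 mul0r.
by rewrite IH ?mulr0 //; have := ltn_ord i; lia.
Qed.

Lemma expsum_stable f N n : f 0%N = 0 -> (n < N)%N -> expsum N f n = fexp0 f n.
Proof.
move=> f0 nN; rewrite /= /expsum !fpn_sum.
rewrite -!(big_mkord xpredT (fun j => (fpC (j`!%:R^-1) * f ^+ j) n)).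
rewrite (big_cat_nat _ (n := n.+1)) //= [X in _ + X]big1_seq ?addr0 // => j.
rewrite mem_index_iota => /andP[_ /andP[nj _]].
by rewrite fpnCM fps_vanishX ?mulr0.
Qed.

Lemma feuler_fexp0 f : f 0%N = 0 -> feuler (fexp0 f) = feuler f * fexp0 f.
Proof.
move=> f0; apply: fpsP => n; rewrite feulerE.
have -> : fexp0 f n *+ n = feuler (expsum n.+1 f) n by [].
have -> : feuler (expsum n.+1 f) = feuler f * expsum n f.
  rewrite /expsum raddf_sum big_ord_recl /= expr0 mulr1 feuler_fpC add0r mulr_sumr.
  apply: eq_bigr => j _; rewrite feulerM feuler_fpC mul0r add0r feulerX.
  have c : fpC (j.+1`!%:R^-1 : K) *+ j.+1 = fpC (j`!%:R^-1).
    rewrite -rmorphMn /=; congr fpC.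
    by rewrite factS natrM invfM -mulr_natr mulrAC mulVf ?mul1r ?pnatr_eq0.
  rewrite /bump leq0n add1n mulrnAr -mulrnAl c.
  by rewrite [RHS]mulrC -mulrA.
rewrite !fpnM !big_ord_recl feulerE mulr0n !mul0r; congr (_ + _).
case: n => [|n]; first by rewrite !big_ord0.
apply: eq_bigr => i _; congr (_ * _); apply: expsum_stable => //=.
by rewrite /bump leq0n; lia.
Qed.

Lemma fexp0_0 f : fexp0 f 0%N = 1.
Proof. by rewrite /= /expsum big_ord1 expr0 mulr1 fpnC fact0 invr1. Qed.

Definition expfps (z : K) : fps K := Fps (fun n => z ^+ n / n`!%:R).

Lemma feuler_expfps z : feuler (expfps z) = (fpC z * fpX) * expfps z.
Proof.
apply: fpsP => n; rewrite feulerE -mulrA fpnCM fpnXM /=.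
case: n => [|n]; first by rewrite mulr0n mulr0.
rewrite exprS factS natrM invfM -[LHS]mulr_natr -!mulrA; congr (z * (_ * _)).
by rewrite mulrCA mulVf ?mulr1 // pnatr_eq0.
Qed.

Lemma expfpsD z w : expfps (z + w) = expfps z * expfps w.
Proof.
apply: (@ode_uniq (fpC (z + w) * fpX)).
- by rewrite fpnCM /= coefX mulr0.
- exact: feuler_expfps.
- by rewrite feulerM !feuler_expfps rmorphD /=; ring.
- by rewrite fpnM0 /= !expr0 fact0 invr1 !mulr1.
Qed.

End FormalExp.

Section ComplexExp.
Variable R : realType.
Notation C := (cplx R).
Implicit Types (z w : C) (f g : fps C).

Lemma exp_partial_le (x : R) N : 0 <= x -> \sum_(i < N) x ^+ i / i`!%:R <= expR x.
Proof.
move=> x0.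
have := nondecreasing_cvgn_le (nondecreasing_series (fun i _ _ => exp_coeff_ge0 i x0))
  (is_cvg_series_exp_coeff x) N.
by rewrite /series /= big_mkord /expR.
Qed.

Lemma l1_expfps z : l1 (expfps z) (expR (nm z)).
Proof.
move=> N; apply: le_trans (exp_partial_le N (nm_ge0 z)).
by apply: ler_sum => i _; rewrite /= nmM nmX nmV nm_nat.
Qed.

Lemma sums_expfps_real (x : R) : sums (expfps (toC x)) (toC (expR x)).
Proof.
split; rewrite (_ : series _ = fun n => toC (series (exp_coeff x) n)).
  by apply: cvg_toC; exact: is_cvg_series_exp_coeff.
apply/funext => n; rewrite seriesE /series /= big_mkord rmorph_sum.
by apply: eq_bigr => i _; rewrite fmorph_div rmorphXn rmorph_nat.
Qed.

Transparent cplx.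
Definition ciunit : C := 'i%C.
Lemma ciunit2 : ciunit ^+ 2 = -1. Proof. exact: sqr_i. Qed.
Lemma reI z : re (ciunit * z) = - im z.
Proof. by rewrite reM /= mul0r sub0r mul1r. Qed.
Lemma imI z : im (ciunit * z) = re z.
Proof. by rewrite imM /= mul0r add0r mul1r. Qed.
Lemma cexpE z : cexp z = toC (expR (re z)) * (toC (cos (im z)) + ciunit * toC (sin (im z))).
Proof.
rewrite /cexp; congr (_ * _); apply: complex_eq.
  by rewrite reD reI im_toC oppr0 addr0.
by rewrite imD imI im_toC add0r.
Qed.
Lemma complexEI z : z = toC (re z) + ciunit * toC (im z).
Proof. by apply: complex_eq; rewrite ?(reD, imD) ?(reI, imI) !(re_toC, im_toC) ?oppr0 ?addr0 ?add0r. Qed.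
Opaque cplx ciunit.

Lemma ciunitX n (y : R) : (ciunit * toC y) ^+ n
  = toC ((~~ odd n)%:R * (-1) ^+ n./2 * y ^+ n)
    + ciunit * toC ((odd n)%:R * (-1) ^+ n.-1./2 * y ^+ n).
Proof.
rewrite exprMn.
have e : ciunit ^+ n = ciunit ^+ odd n * (-1) ^+ n./2.
  by rewrite -{1}(odd_double_half n) exprD -muln2 mulnC exprM ciunit2.
rewrite e; have [h|h] := boolP (odd n); rewrite /= ?(mul0r, mul1r, rmorph0, mulr0, addr0, add0r, expr0, expr1).
  have -> : n.-1./2 = n./2 by rewrite -{1}(odd_double_half n) h add1n /= doubleK.
  by rewrite rmorphM !rmorphXn rmorphN1 -mulrA.
by rewrite rmorphM !rmorphXn rmorphN1.
Qed.

Lemma sums_expfps_imag (y : R) :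
  sums (expfps (ciunit * toC y)) (toC (cos y) + ciunit * toC (sin y)).
Proof.
have term n : expfps (ciunit * toC y) n = toC (cos_coeff y n) + ciunit * toC (sin_coeff y n).
  rewrite /= ciunitX mulrDl -[X in _ + X]mulrA; congr (_ + ciunit * _).
    by rewrite /cos_coeff /= -(rmorph_nat (@toC R)) -fmorphV -rmorphM.
  by rewrite /sin_coeff /= -(rmorph_nat (@toC R)) -fmorphV -rmorphM.
split; rewrite (_ : series _ = fun n => toC (series (cos_coeff y) n) + ciunit * toC (series (sin_coeff y) n)).
  refine (cvgKD (cvg_toC _) (cvgKM (@cvgK_cst _ _ _ _ ciunit) (cvg_toC _))).
    by rewrite unlock; exact: is_cvg_series_cos_coeff.
  by rewrite unlock; exact: is_cvg_series_sin_coeff.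
apply/funext => n; rewrite seriesE /series /= !big_mkord !rmorph_sum mulr_sumr -big_split /=.
by apply: eq_bigr => i _; rewrite -term.
Qed.

Lemma sums_expfps z : sums (expfps z) (cexp z).
Proof.
rewrite cexpE {1}(complexEI z) expfpsD.
exact: sumsM (l1_expfps _) (l1_expfps _) (sums_expfps_real _) (sums_expfps_imag _).
Qed.

Lemma cexpD z w : cexp (z + w) = cexp z * cexp w.
Proof.
apply: sums_uniq (sums_expfps _) _; rewrite expfpsD.
exact: sumsM (l1_expfps _) (l1_expfps _) (sums_expfps _) (sums_expfps _).
Qed.

Lemma cexp0 : cexp (0 : C) = 1.
Proof.
apply: sums_uniq (sums_expfps _) _.
have := sums_finite (a := expfps (0 : C)) (N := 1); rewrite big_ord1 /= expr0 fact0 invr1 mulr1.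
by apply=> -[//|n] _; rewrite /= expr0n mul0r.
Qed.

Lemma cexpN_mul z : cexp (- z) * cexp z = 1.
Proof. by rewrite -cexpD addNr cexp0. Qed.

Lemma cexp_neq0 z : cexp z != 0.
Proof.
apply/eqP => e; have := cexpN_mul z; rewrite e mulr0 => /eqP.
by rewrite eq_sym oner_eq0.
Qed.

Lemma cexpN z : cexp (- z) = (cexp z)^-1.
Proof. by apply: (mulIf (cexp_neq0 z)); rewrite cexpN_mul mulVf ?cexp_neq0. Qed.

Lemma cexp_sum I (r : seq I) P (F : I -> C) :
  cexp (\sum_(i <- r | P i) F i) = \prod_(i <- r | P i) cexp (F i).
Proof. by apply: (big_morph (@cexp R)); [exact: cexpD|exact: cexp0]. Qed.

Lemma cexpMn z n : cexp (z *+ n) = cexp z ^+ n.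
Proof. by elim: n => [|n IH]; rewrite ?mulr0n ?cexp0 // mulrS cexpD IH exprS. Qed.

Lemma cexp_toC (x : R) : cexp (toC x) = toC (expR x).
Proof. exact: sums_uniq (sums_expfps _) (sums_expfps_real x). Qed.

Lemma nm_cexp z : nm (cexp z) = expR (re z).
Proof.
rewrite cexpE nmM nm_toC ger0_norm ?expR_ge0 //.
set w := _ + _; suff -> : nm w = 1 by rewrite mulr1.
have e : nm w ^+ 2 = 1.
  by rewrite nm_sqr /w reD imD reI imI !re_toC !im_toC oppr0 addr0 add0r cos2Dsin2.
by move: (nm_ge0 w) e; nra.
Qed.

Lemma nm_cexp_le z : nm (cexp z) <= expR (nm z).
Proof. by rewrite nm_cexp ler_expR (le_trans (ler_norm _)) // re_le_nm. Qed.

Lemma cvg_cexp T (F : set_system T) {FF : Filter F} (f : T -> C) (l : C) :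
  f @ F --> l -> (fun x => cexp (f x)) @ F --> cexp l.
Proof.
move=> fl; rewrite (_ : (fun x => _) = fun x => toC (expR (re (f x))) *
   (toC (cos (im (f x))) + ciunit * toC (sin (im (f x))))); last first.
  by apply/funext => x; rewrite cexpE.
rewrite cexpE.
have cr : (fun x => re (f x)) @ F --> re l by exact (cvgC_re fl).
have ci : (fun x => im (f x)) @ F --> im l by exact (cvgC_im fl).
refine (cvgKM (cvg_toC _) (cvgKD (cvg_toC _) (cvgKM (@cvgK_cst _ _ _ _ ciunit) (cvg_toC _)))).
- exact (cvg_comp _ _ cr (@continuous_expR R _)).
- exact (cvg_comp _ _ ci (@continuous_cos R _)).
- exact (cvg_comp _ _ ci (@continuous_sin R _)).
Qed.

(** The constant term is exponentiated numerically and the remainder formally. *)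
Definition fexp (f : fps C) : fps C := fpC (cexp (f 0%N)) * fexp0 (f - fpC (f 0%N)).

Lemma fexp_sub0 (f : fps C) : (f - fpC (f 0%N)) 0%N = 0.
Proof. by rewrite fpnB fpnC subrr. Qed.

Lemma feuler_fexp f : feuler (fexp f) = feuler f * fexp f.
Proof.
rewrite /fexp feulerM feuler_fpC mul0r add0r feuler_fexp0 ?fexp_sub0 //.
by rewrite raddfB /= feuler_fpC subr0 mulrCA.
Qed.

Lemma fexp_coef0 f : fexp f 0%N = cexp (f 0%N).
Proof. by rewrite /fexp fpnCM fexp0_0 mulr1. Qed.

Lemma l1_sub0 f M : l1 f M -> l1 (f - fpC (f 0%N)) (M - nm (f 0%N)).
Proof.
move=> fM [|N].
  by rewrite big_ord0 subr_ge0; have := fM 1%N; rewrite big_ord1.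
rewrite lerBrDr; apply: le_trans (fM N.+1).
rewrite !big_ord_recl (_ : (f - fpC (f 0%N)) ord0 = 0) ?fexp_sub0 // nm0 add0r addrC lerD2l.
by apply: ler_sum => i _; rewrite fpnB fpnC /= subr0.
Qed.

Lemma sums_sub0 f l : sums f l -> sums (f - fpC (f 0%N)) (l - f 0%N).
Proof.
move=> fl; apply: sums_ext (sumsD fl (sumsN _)) => [n|].
  reflexivity.
have := sums_finite (a := fpC (f 0%N)) (N := 1); rewrite big_ord1 (fpnC (f 0%N) 0).
by apply=> -[//|n] _; rewrite fpnC.
Qed.

Lemma fexp0_sums f l M : f 0%N = 0 -> l1 f M -> sums f l ->
  sums (fexp0 f) (cexp l) /\ l1 (fexp0 f) (expR M).
Proof.
move=> f0 fM fl; have M0 := bsum_ge0 fM.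
pose a j n : C := j`!%:R^-1 * (f ^+ j) n.
have rowb j : bsum (fun n => nm (a j n)) (M ^+ j / j`!%:R).
  move=> N; rewrite mulrC; under eq_bigr do rewrite nmM nmV nm_nat.
  by rewrite -mulr_sumr ler_wpM2l ?invr_ge0 ?ler0n //; apply: l1X.
have bb : bsum (fun j => M ^+ j / j`!%:R) (expR M).
  by move=> N; apply: exp_partial_le.
have col n : sums (a ^~ n) (fexp0 f n).
  rewrite /= /expsum fpn_sum.
  rewrite (eq_bigr (fun j : 'I_n.+1 => a j n)) => [|j _]; last by rewrite fpnCM.
  by apply: sums_finite => j nj; rewrite /a fps_vanishX ?mulr0.
have powl j : sums (f ^+ j) (l ^+ j).
  elim: j => [|j IH]; last by rewrite !exprS; exact: sumsM fM (l1X _ fM) fl IH.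
  have := sums_finite (a := (1 : fps C)) (N := 1); rewrite big_ord1 fpn1 eqxx expr0.
  by apply=> -[|n] //; rewrite fpn1.
split.
  refine (@fubini_sums R a (fun j => M ^+ j / j`!%:R) (expR M) (fun j => j`!%:R^-1 * l ^+ j) _ _ rowb bb _ col _).
    by move=> j; apply: sumsZ.
  by apply: sums_ext (sums_expfps l) => j; rewrite /= mulrC.
move=> N.
apply: le_trans (_ : \sum_(n < N) \sum_(j < N) nm (a j n) <= _).
  apply: ler_sum => n _; rewrite -(@expsum_stable _ _ N) // /expsum fpn_sum.
  apply: le_trans (nm_sum _ _ _) _; apply: ler_sum => j _.
  by rewrite fpnCM.
rewrite exchange_big /=; apply: le_trans (bb N).
by apply: ler_sum => j _; apply: rowb.
Qed.

Lemma sums_fexp f l M : l1 f M -> sums f l -> sums (fexp f) (cexp l).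
Proof.
move=> fM fl.
have [h _] := fexp0_sums (fexp_sub0 f) (l1_sub0 fM) (sums_sub0 fl).
have -> : cexp l = cexp (f 0%N) * cexp (l - f 0%N) by rewrite -cexpD addrC subrK.
by apply: sums_ext (sumsZ _ h) => n; rewrite /fexp fpnCM.
Qed.

Lemma l1_fexp f M : l1 f M -> l1 (fexp f) (expR M).
Proof.
move=> fM; have [l fl _] := sums_abs fM.
have [_ h] := fexp0_sums (fexp_sub0 f) (l1_sub0 fM) (sums_sub0 fl).
move=> N; apply: le_trans (_ : expR (nm (f 0%N)) * expR (M - nm (f 0%N)) <= _); last first.
  by rewrite -expRD addrC subrK.
apply: le_trans (_ : nm (cexp (f 0%N)) * expR (M - nm (f 0%N)) <= _); last first.
  by rewrite ler_wpM2r ?expR_ge0 // nm_cexp_le.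
under eq_bigr do rewrite /fexp fpnCM nmM.
by rewrite -mulr_sumr ler_wpM2l ?nm_ge0.
Qed.

End ComplexExp.

Local Close Scope classical_set_scope.
(** * Rationality of the generating series of the V *)

Section PolySeq.
Variable A : comNzRingType.
Implicit Types f g : nat -> A.

Definition psum_seq f n := \sum_(m < n) f m.

(** Combinations of binomial coefficients in n, generated by indefinite summation: each summation
    multiplies the generating series by T / (1 - T), so rationality is immediate by induction. *)
Inductive polyseq : (nat -> A) -> Prop :=
| polyseq_cst a : polyseq (fun=> a)
| polyseq_psum f : polyseq f -> polyseq (psum_seq f)
| polyseq_add f g : polyseq f -> polyseq g -> polyseq (fun n => f n + g n).

Lemma polyseq_ext f g : f =1 g -> polyseq f -> polyseq g.
Proof. by move=> /funext ->. Qed.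

Lemma polyseq_sum I (r : seq I) (F : I -> nat -> A) :
  (forall i, polyseq (F i)) -> polyseq (fun n => \sum_(i <- r) F i n).
Proof.
move=> h; elim: r => [|i r IH].
  by apply: polyseq_ext (polyseq_cst 0) => n; rewrite big_nil.
by apply: polyseq_ext (polyseq_add (h i) IH) => n; rewrite big_cons.
Qed.

Lemma polyseq_scale a f : polyseq f -> polyseq (fun n => a * f n).
Proof.
elim=> [b|g _ IH|g h _ IHg _ IHh]; first exact: polyseq_cst.
  by apply: polyseq_ext (polyseq_psum IH) => n; rewrite /psum_seq mulr_sumr.
by apply: polyseq_ext (polyseq_add IHg IHh) => n; rewrite mulrDr.
Qed.

Lemma psum_telescope F n : F 0%N = 0 -> psum_seq (fun m => F m.+1 - F m) n = F n.
Proof.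
move=> F0; elim: n => [|n IH]; first by rewrite /psum_seq big_ord0.
rewrite [LHS]big_ord_recr /= -[X in X + _]/(psum_seq (fun m => F m.+1 - F m) n).
by rewrite IH addrC subrK.
Qed.

(** Summation by parts. The difference of a product of two indefinite sums is a sum of products with
    one summation fewer. *)
Lemma polyseq_mul f g : polyseq f -> polyseq g -> polyseq (fun n => f n * g n).
Proof.
move=> pf; elim: pf g => [a|f' pf' IHf|f1 f2 _ IH1 _ IH2] g pg.
- exact: polyseq_scale.
- elim: pg => [b|g' pg' IHg|g1 g2 _ IH1 _ IH2].
  + by apply: polyseq_ext (polyseq_scale b (polyseq_psum pf')) => n; rewrite mulrC.
  + have h := polyseq_add (polyseq_add (IHf _ (polyseq_psum pg')) (IHf _ pg')) IHg.
    apply: polyseq_ext (polyseq_psum h) => n.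
    rewrite -(@psum_telescope (fun n => psum_seq f' n * psum_seq g' n)); last first.
      by rewrite /psum_seq big_ord0 mul0r.
    apply: eq_bigr => m _; rewrite /psum_seq !big_ord_recr /= mulrDl !mulrDr.
    by move: (\sum_(i < m) f' i) (\sum_(i < m) g' i) => u v; ring.
  + by apply: polyseq_ext (polyseq_add IH1 IH2) => n; rewrite mulrDr.
- by apply: polyseq_ext (polyseq_add (IH1 g pg) (IH2 g pg)) => n; rewrite mulrDl.
Qed.

Lemma polyseq_nat : polyseq (fun n => n%:R).
Proof.
apply: polyseq_ext (polyseq_psum (polyseq_cst 1)) => n.
by rewrite /psum_seq sumr_const card_ord.
Qed.

Lemma polyseq_natX j : polyseq (fun n => n%:R ^+ j).
Proof.
elim: j => [|j IH]; first by apply: polyseq_ext (polyseq_cst 1) => n; rewrite expr0.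
by apply: polyseq_ext (polyseq_mul polyseq_nat IH) => n; rewrite exprS.
Qed.

Definition geo : fps A := Fps (fun=> 1).

Lemma geoM f : geo * Fps f = Fps (fun n => \sum_(m < n.+1) f m).
Proof.
apply: fpsP => n; rewrite fpnM /= (reindex_inj rev_ord_inj) /=.
by apply: eq_bigr => i _; rewrite mul1r subSS subKn // -ltnS.
Qed.

Lemma XgeoM f : fpX * geo * Fps f = Fps (psum_seq f).
Proof.
rewrite -mulrA geoM; apply: fpsP => -[|n]; rewrite fpnXM //=.
by rewrite /psum_seq big_ord0.
Qed.

Lemma geo1 : geo * fpoly (1 - 'X) = 1.
Proof.
rewrite rmorphB rmorph1 mulrBr mulr1 mulrC -/fpX; apply: fpsP => n.
rewrite fpnB fpnXM fpn1; case: n => [|n]; rewrite /= ?subr0 //.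
by rewrite subrr.
Qed.

Lemma polyseq_conv f g : polyseq f -> polyseq g -> polyseq (Fps f * Fps g).
Proof.
move=> pf pg; elim: pf => [a|f' pf' IH|f1 f2 _ IH1 _ IH2].
- have -> : Fps (fun=> a) = fpC a * geo by apply: fpsP => n; rewrite fpnCM mulr1.
  rewrite -mulrA geoM.
  apply: polyseq_ext (polyseq_scale a (polyseq_add (polyseq_psum pg) pg)) => n.
  by rewrite fpnCM /= /psum_seq big_ord_recr.
- rewrite -XgeoM -mulrA; have -> : Fps f' * Fps g = Fps (Fps f' * Fps g).
    by apply: fpsP.
  by rewrite XgeoM /=; apply: polyseq_psum.
- have -> : Fps (fun n => f1 n + f2 n) = Fps f1 + Fps f2 by apply: fpsP.
  by rewrite mulrDl; apply: polyseq_add.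
Qed.

Lemma polyseq_rat f : polyseq f -> exists l (N : {poly A}),
  fpoly ((1 - 'X) ^+ l) * Fps f = fpoly N.
Proof.
elim=> [a|g _ [l [N e]]|g h _ [l [N e]] _ [l' [N' e']]].
- exists 1%N, a%:P; rewrite expr1.
  have -> : Fps (fun=> a) = fpC a * geo by apply: fpsP => n; rewrite fpnCM mulr1.
  by rewrite mulrC -mulrA geo1 mulr1.
- exists l.+1, ('X * N); rewrite -XgeoM exprS !rmorphM /= -e mulrACA.
  by rewrite [X in X * _ = _]mulrC -[fpX * geo * _]mulrA geo1 mulr1.
- exists (l + l')%N, ((1 - 'X) ^+ l' * N + (1 - 'X) ^+ l * N').
  have -> : Fps (fun n => g n + h n) = Fps g + Fps h by apply: fpsP.
  by rewrite rmorphD !rmorphM /= -e -e' exprD rmorphM mulrDr mulrCA !mulrA.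
Qed.

End PolySeq.

Section NewtonExtra.
Variable B : comNzRingType.

Lemma newton_ext (P Q H G : nat -> B) : (forall r, (0 < r)%N -> P r = Q r) ->
  H =1 G -> newton P H -> newton Q G.
Proof.
move=> PQ /funext <- [H0 HP]; split=> // n; rewrite HP.
by apply: eq_big_nat => r /andP[r0 _]; rewrite PQ.
Qed.

Lemma newton_inj (P Q H : nat -> B) : newton P H -> newton Q H ->
  forall r, (0 < r)%N -> P r = Q r.
Proof.
move=> [H0 HP] [_ HQ]; elim/ltn_ind => -[//|r] IH _.
have h := HP r.+1; rewrite HQ in h; move: h.
rewrite [X in X = _]big_nat_recr //= [X in _ = X]big_nat_recr //= subnn H0 !mulr1.
have -> : \sum_(1 <= i < r.+1) Q i * H (r.+1 - i)%N = \sum_(1 <= i < r.+1) P i * H (r.+1 - i)%N.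
  by apply: eq_big_nat => i /andP[i0 ir]; rewrite IH.
by move/addrI.
Qed.

End NewtonExtra.

Lemma cancel_div (F : fieldType) (x y z d : F) : x != 0 -> z != 0 ->
  d * (x * y / z / x) = y * (d / z).
Proof. by move=> x0 z0; field; apply/andP. Qed.

Section HCoef.
Variables (K : numFieldType) (A : comAlgType K) (m : nat) (a : nat -> A).
Hypothesis a0 : a 0%N = m.+1%:R.
Variable H : nat -> fps A.
Hypothesis newH : newton (psum_fps a) H.

(** The alphabet of m + 1 ones. *)
Lemma newton_bin : newton (fun=> m.+1%:R) (fun n => 'C(n + m, n)%:R : A).
Proof.
split; first by rewrite bin0.
move=> n; rewrite -mulr_sumr.
have -> : \sum_(1 <= r < n.+1) ('C(n - r + m, n - r)%:R : A)
    = (\sum_(i < n) 'C(i + m, i))%N%:R.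
  rewrite natr_sum big_add1 /= big_mkord (reindex_inj rev_ord_inj) /=.
  apply: eq_bigr => i _; have := ltn_ord i => h.
  by have -> : (n - (n - i.+1).+1)%N = i by clear -h; lia.
rewrite -natrM -mulrnA; congr (_ *+ _); rewrite mulnC.
elim: n => [|n IH]; first by rewrite big_ord0 mul0n muln0.
rewrite big_ord_recr /= mulnDr -IH -mulnDl addSn -mul_bin_diag /= addnC.
by congr (_ * _)%N; rewrite addnS addnC.
Qed.

Lemma H_coef0 n : H n 0%N = 'C(n + m, n)%:R.
Proof.
have nH : newton (fun=> m.+1%:R) (fun n' => H n' 0%N).
  case: newH => H0 HP; split; first by rewrite H0 fpn1.
  move=> n'; have /(congr1 (fun f : fps A => f 0%N)) := HP n'.
  rewrite fpnMn fpn_sum => ->; apply: eq_bigr => r _.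
  by rewrite fpnM0 /= expn0 fact0 divr1 scale1r a0.
exact: (newton_uniq (@torsion_free_alg K A) nH newton_bin n).
Qed.

Lemma polyseq_bin d : polyseq (fun n => 'C(n + d, n)%:R : A).
Proof.
elim: d => [|d IH]; first by apply: polyseq_ext (polyseq_cst 1) => n; rewrite addn0 binn.
apply: polyseq_ext (polyseq_add (polyseq_psum IH) IH) => n.
elim: n => [|n IHn]; first by rewrite /psum_seq big_ord0 add0r !bin0.
rewrite /psum_seq big_ord_recr /= -/(psum_seq _ n) IHn -natrD; congr (_%:R).
by rewrite addSn [in RHS]addnS binS addnC addnS addSn.
Qed.

(** Induction on e. Applying t d/dt to sum H_n T^n = exp (sum P_r T^r / r) expresses (e + 1) H_(n,
    e+1) through convolutions of r^(j-1) with the lower columns e + 1 - j, and these stay polynomial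
    in n. *)
Lemma polyseq_H e : polyseq (fun n => H n e).
Proof.
elim/ltn_ind: e => -[|e] IH.
  by apply: polyseq_ext (polyseq_bin m) => n; rewrite H_coef0.
pose L r : fps A := Fps (fun n => ((r ^ n)%:R / n`!%:R / r%:R : K) *: a n).
have newL : newton (fun r => L r *+ r) H.
  apply: newton_ext newH => // r r0; apply: fpsP => n; rewrite fpnMn /=.
  rewrite -[RHS]scaler_nat scalerA mulrCA mulfV ?mulr1 //.
  by rewrite pnatr_eq0 -lt0n.
have dH := newton_deriv (torsion_free_fps (@torsion_free_alg K A))
  (raddfD (@feuler A)) (@feulerM A) newL.
pose c j : A := (j%:R / j`!%:R : K) *: a j.
(* For j >= 2 the factor r^(j-1) vanishes at r = 0, so the sum over r >= 1 is a full convolution.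
   For j = 1 it is 0^0 = 1 there, and the convolution with T / (1 - T) is taken instead; j = 0 is
   killed by c_0 = 0. *)
pose q j : nat -> A := if j is j'.+2 then Fps (fun r => r%:R ^+ j'.+1) * Fps (fun n => H n (e.+1 - j)%N)
   else fpX * geo A * Fps (fun n => H n e).
have pq j : (j < e.+2)%N -> polyseq (q j).
  case: j => [|[|j]] je; rewrite /q.
  - rewrite XgeoM; apply: polyseq_psum; exact: IH.
  - rewrite XgeoM; apply: polyseq_psum; exact: IH.
  - apply: polyseq_conv; first exact: polyseq_natX.
    by apply: IH; lia.
have key n : H n e.+1 *+ e.+1 = \sum_(j < e.+2) c j * q j n.
  rewrite -feulerE dH fpn_sum.
  under eq_bigr do rewrite fpnM.
  rewrite exchange_big; apply: eq_bigr => j _.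
  case: j => -[|[|j]] je; rewrite /c /q /=.
  - by rewrite big1 ?mul0r ?scale0r ?mul0r // => r _; rewrite mulr0n mul0r.
  - rewrite XgeoM /psum_seq mulr_sumr big_add1 /= big_mkord (reindex_inj rev_ord_inj) /=.
    apply: eq_bigr => i _; have := ltn_ord i => iN.
    have -> : (n - (n - i.+1).+1)%N = i by lia.
    rewrite subSS subn0 mulr1n expn1 (_ : 1`! = 1%N) // !divr1 mulfV ?scale1r //.
  - rewrite fpnM mulr_sumr [RHS]big_ord_recl /= expr0n mul0r mulr0 add0r big_add1 /= big_mkord.
    apply: eq_bigr => i _; rewrite /bump leq0n add1n mulrA; congr (_ * _).
    rewrite -natrX mulr_natr -[LHS]scaler_nat -[RHS]scaler_nat !scalerA.
    congr (_ *: _); rewrite expnS natrM; apply: cancel_div; rewrite pnatr_eq0 //.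
    by rewrite -lt0n fact_gt0.
have e1 : (e.+1%:R : K) != 0 by rewrite pnatr_eq0.
apply: polyseq_ext (polyseq_scale ((e.+1%:R^-1 : K)%:A) (_ : polyseq (fun n => \sum_(j < e.+2) c j * q j n))) => [n|].
  by rewrite -key mulrnAr -mulrnAl -scaler_nat scalerA mulfV // scale1r mul1r.
apply: polyseq_sum => j; apply: polyseq_scale; exact: pq.
Qed.

End HCoef.

Lemma deriv_prod_lin (F : fieldType) (s : seq F) (T : F) :
  (\prod_(w <- s) ('X - w%:P)).[T] != 0 ->
  (\prod_(w <- s) ('X - w%:P))^`().[T]
  = (\prod_(w <- s) ('X - w%:P)).[T] * \sum_(w <- s) (T - w)^-1.
Proof.
elim: s => [|w s IH]; first by rewrite !big_nil derivC horner0 mulr0.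
rewrite !big_cons hornerM hornerXsubC mulf_eq0 negb_or => /andP[h1 /IH h2].
rewrite derivM derivXsubC mul1r hornerD hornerM hornerXsubC h2 mulrDr.
by rewrite mulrAC mulfV // mul1r mulrA.
Qed.

(** Divide (1 - T) N' + l N = 0 by N and use (1 - T) / (T - w) = (1 - w) / (T - w) - 1. *)
Lemma root_step_sum (F : numFieldType) (s : seq F) (l : nat) (T : F) : (size s < l)%N ->
  (\prod_(w <- s) ('X - w%:P)).[T] != 0 ->
  root ((1 - 'X) * (\prod_(w <- s) ('X - w%:P))^`() + (\prod_(w <- s) ('X - w%:P)) *+ l) T ->
  \sum_(w <- s) (1 - w) / (T - w) = - (l - size s)%:R.
Proof.
set N := \prod_(w <- s) _ => sl N0.
rewrite /root hornerD hornerM hornerMn deriv_prod_lin // -/N.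
rewrite hornerD hornerN hornerX hornerC => /eqP e.
have NT w : w \in s -> T - w != 0.
  move=> ws; apply: contra N0; rewrite subr_eq0 => /eqP ->.
  by rewrite -/(root N w) root_prod_XsubC.
have {}e : (1 - T) * (\sum_(w <- s) (T - w)^-1) + l%:R = 0.
  by apply: (mulfI N0); rewrite mulr0 mulrDr mulr_natr [X in X + _]mulrCA e.
have -> : \sum_(w <- s) (1 - w) / (T - w) = (1 - T) * (\sum_(w <- s) (T - w)^-1) + (size s)%:R.
  have -> : (size s)%:R = \sum_(w <- s) 1 :> F by rewrite big_const_seq count_predT iter_addr_0.
  rewrite mulr_sumr -big_split /=.
  rewrite big_seq [RHS]big_seq; apply: eq_bigr => w /NT h.
  by rewrite -[X in _ = _ + X](mulfV h) -mulrDl addrA subrK.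
rewrite natrB 1?ltnW // opprB.
by move/eqP: e; rewrite addr_eq0 => /eqP ->; rewrite addrC.
Qed.

(** * Real negative roots of the numerator of the series of C(n+m, m)^2 *)

Section Narayana.
Variable R : realType.
Notation C := (cplx R).

Definition Dpoly (l : seq R) : {poly C} := \prod_(r <- l) (1 - toC r *: 'X).

Lemma re_nat n : re (n%:R : C) = n%:R.
Proof. by rewrite -(rmorph_nat (@toC R)) re_toC. Qed.

Lemma im_nat n : im (n%:R : C) = 0.
Proof. by rewrite -(rmorph_nat (@toC R)) im_toC. Qed.

Lemma re1 : re (1 : C) = 1. Proof. by rewrite (re_nat 1). Qed.
Lemma im1 : im (1 : C) = 0. Proof. by rewrite (im_nat 1). Qed.

Lemma reimV (z : C) : re z^-1 = re z / (nm z ^+ 2) /\ im z^-1 = - im z / (nm z ^+ 2).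
Proof. rewrite nm_sqr. case: z => a b; split; [by [] | exact: esym (mulNr _ _)]. Qed.

(** With w real and nonpositive the weights q_w = (1 - w) / |T - w|^2 are positive. In
    [root_step_sum] the imaginary part reads Im T * sum q_w = 0, and the real part says that sum q_w
    (Re T - w) is negative, which excludes Re T > 0 as well as an empty list of roots. *)
Lemma root_step (s : seq C) (l : nat) (T : C) : (size s < l)%N ->
  {in s, forall w, im w = 0 /\ re w <= 0} ->
  root ((1 - 'X) * (\prod_(w <- s) ('X - w%:P))^`() + (\prod_(w <- s) ('X - w%:P)) *+ l) T ->
  im T = 0 /\ re T <= 0.
Proof.
move=> sl sneg rT; have [N0|N0] := eqVneq (\prod_(w <- s) ('X - w%:P)).[T] 0.
  by apply: sneg; rewrite -root_prod_XsubC; apply/rootP.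
have e := root_step_sum sl N0 rT.
have NT w : w \in s -> T - w != 0.
  move=> ws; apply: contra N0; rewrite subr_eq0 => /eqP ->.
  by rewrite -rootE root_prod_XsubC.
pose q w := (1 - re w) / nm (T - w) ^+ 2.
have q0 w : w \in s -> 0 < q w.
  move=> ws; have [_ w0] := sneg w ws; rewrite divr_gt0 //; first by lra.
  by rewrite exprn_gt0 // lt_neqAle nm_ge0 eq_sym nm_eq0 NT.
have reE : \sum_(w <- s) q w * (re T - re w) = - (l - size s)%:R.
  have /(congr1 (@re R)) := e; rewrite re_sum reN re_nat => <-.
  rewrite big_seq [RHS]big_seq; apply: eq_bigr => w ws.
  have [iw _] := sneg w ws; have [rV _] := reimV (T - w).
  have r1 : re (1 - w) = 1 - re w by rewrite reB re1.
  have i1 : im (1 - w) = 0 by rewrite imB im1 iw subrr.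
  by rewrite reM r1 i1 mul0r subr0 rV reB /q mulrAC mulrA.
have imE : im T * \sum_(w <- s) q w = 0.
  have /(congr1 (@im R)) := e; rewrite im_sum imN im_nat oppr0 => h.
  apply/eqP; rewrite -oppr_eq0; apply/eqP; rewrite -[RHS]h mulr_sumr -sumrN.
  rewrite big_seq [RHS]big_seq; apply: eq_bigr => w ws.
  have [iw _] := sneg w ws; have [_ iV] := reimV (T - w).
  have r1 : re (1 - w) = 1 - re w by rewrite reB re1.
  have i1 : im (1 - w) = 0 by rewrite imB im1 iw subrr.
  rewrite imM r1 i1 mul0r addr0 iV imB iw subr0 /q.
  by rewrite mulNr mulrN mulrCA.
have nat0 : (0 : R) < (l - size s)%:R by rewrite ltr0n subn_gt0.
split; last first.
  rewrite leNgt; apply/negP => T0; suff : 0 <= - (l - size s)%:R :> R by lra.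
  rewrite -reE big_seq; apply: sumr_ge0 => w ws.
  have [_ w0] := sneg w ws; apply: mulr_ge0; first exact/ltW/q0.
  by lra.
move/eqP: imE; rewrite mulf_eq0 => /orP[/eqP //|/eqP].
case: s sneg sl q0 reE nat0 {e rT N0 NT} => [|w s] sneg sl q0 reE nat0.
  by move: reE; rewrite big_nil => reE; lra.
rewrite big_cons => h; have := q0 w (mem_head _ _); rewrite -h ltNge => /negP[].
rewrite lerDl big_seq; apply: sumr_ge0 => w' ws; apply/ltW/q0.
by rewrite inE ws orbT.
Qed.

Lemma fpoly_1X_bin m : fpoly ((1 - 'X) ^+ m.+1) * Fps (fun n => 'C(n, m)%:R) = fpoly 'X^m :> fps C.
Proof.
elim: m => [|m IH].
  rewrite expr1 expr0 rmorph1 -[RHS](geo1 C) mulrC; congr (_ * _).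
  by apply: fpsP => n; rewrite /= bin0.
rewrite exprSr rmorphM /= -mulrA.
have -> : fpoly (1 - 'X) * Fps (fun n => 'C(n, m.+1)%:R) = fpX * Fps (fun n => 'C(n, m)%:R) :> fps C.
  apply: fpsP => n; rewrite rmorphB rmorph1 mulrBl mul1r fpnB !fpnXM /=.
  case: n => [|n]; first by rewrite bin0n subr0.
  by rewrite binS natrD addrAC subrr add0r.
by rewrite mulrCA IH -rmorphM -exprS.
Qed.

Lemma deriv_1X l : ((1 - 'X) ^+ l)^`() = - ((1 - 'X) ^+ l.-1 *+ l) :> {poly C}.
Proof. by rewrite deriv_exp derivB derivX -polyC1 derivC sub0r mulN1r mulNrn. Qed.

(** The ordinary derivative d/dT. *)
Definition shiftD (g : fps C) : fps C := Fps (fun n => g n.+1 *+ n.+1).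

Lemma shiftD_alg (B : comNzRingType) (y Y g s : B) n :
  y * (y * Y) * s = y * (- (Y *+ n) * g + y * Y * s) + (y * Y * g) *+ n.
Proof.
rewrite -[Y *+ n]mulr_natr -[_ * g *+ n]mulr_natr.
by move: (n%:R) => c; ring.
Qed.

Lemma shiftD_step l (g : fps C) N : (0 < l)%N -> fpoly ((1 - 'X) ^+ l) * g = fpoly N ->
  fpoly ((1 - 'X) ^+ l.+1) * shiftD g = fpoly ((1 - 'X) * N^`() + N *+ l).
Proof.
case: l => // l _ e; have h := congr1 (@feuler C) e.
have Xg : feuler g = fpX * shiftD g.
  by apply: fpsP => -[|n]; rewrite feulerE fpnXM.
rewrite feulerM !feuler_fpoly Xg deriv_1X -mulrA [X in _ + X]mulrCA -mulrDr in h.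
have {}h : _ = fpoly N^`() := fpX_inj h.
have -> : fpoly ((1 - 'X) * N^`() + N *+ l.+1)
    = fpoly (1 - 'X) * fpoly N^`() + fpoly N *+ l.+1 by rewrite rmorphD rmorphM rmorphMn.
rewrite -h -e /= rmorphN rmorphMn !exprS !rmorphM /=; exact: shiftD_alg.
Qed.

(** Start from T^m / (1 - T)^(m+1), whose numerator has only the root 0, and differentiate i times.
    Each derivative raises the order of the pole by one; the numerator keeps degree m, because its
    leading coefficient is multiplied by l - m > 0, and its roots remain real and nonpositive by
    [root_step]. *)
Lemma shiftD_iter m i : exists s : seq C, exists2 c : C,
  [/\ size s = m, {in s, forall w, im w = 0 /\ re w <= 0} & c != 0] &
  fpoly ((1 - 'X) ^+ (m.+1 + i)) * iter i shiftD (Fps (fun n => 'C(n, m)%:R))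
  = fpoly (c *: \prod_(w <- s) ('X - w%:P)).
Proof.
elim: i => [|i [s [c [sm sneg c0] e]]].
  exists (nseq m 0), 1; last first.
    rewrite scale1r addn0 fpoly_1X_bin; congr fpoly.
    by elim: (m) => [|n IH]; rewrite ?big_nil ?expr0 //= big_cons exprS IH polyC0 subr0.
  split; rewrite ?size_nseq ?oner_eq0 // => w; rewrite mem_nseq => /andP[_ /eqP ->].
  by rewrite -[0]/(0%:R) re_nat im_nat.
have {e} := shiftD_step (ltn_addr i (ltn0Sn m)) e; rewrite -addnS => e.
set P := \prod_(w <- s) ('X - w%:P) in e.
set l := (m.+1 + i)%N in e.
have eP : (1 - 'X) * (c *: P)^`() + (c *: P) *+ l = c *: ((1 - 'X) * P^`() + P *+ l).
  by rewrite derivZ scalerDr scalerAr scalerMnr.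
have sP : size P = m.+1 by rewrite size_prod_XsubC sm.
have mP : P`_m = 1.
  by have := monic_prod_XsubC s xpredT id; rewrite monicE lead_coefE -/P sP /= => /eqP.
pose Q := (1 - 'X) * P^`() + P *+ l.
have sP' : (size P^`() <= m)%N.
  by rewrite -ltnS -sP lt_size_deriv // -size_poly_eq0 sP.
have sQ' : (size Q <= m.+1)%N.
  apply: leq_trans (size_polyD _ _) _; rewrite geq_max; apply/andP; split.
    apply: leq_trans (size_polyMleq _ _) _.
    rewrite -opprB size_polyN -polyC1 size_XsubC; lia.
  by rewrite -scaler_nat; apply: leq_trans (size_scale_leq _ _) _; rewrite sP.
have mQ : Q`_m = (l - m)%:R.
  rewrite coefD coefMn mP mulrBl mul1r coefB coef_deriv coefXM.
  rewrite (nth_default 0 (s := P) (n := m.+1)) ?sP // mul0rn sub0r natrB; last by rewrite /l; lia.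
  rewrite addrC; congr (_ - _); case: (m) mP => [|m'] mP //=.
  by rewrite coef_deriv mP.
have Qm : Q`_m != 0 by rewrite mQ pnatr_eq0 /l; lia.
have sQ : size Q = m.+1.
  apply/eqP; rewrite eqn_leq sQ' ltnNge; apply/negP => h.
  by move: Qm; rewrite nth_default ?eqxx.
have [rs Qrs] := closed_field_poly_normal Q.
have lQ : lead_coef Q != 0 by rewrite lead_coefE sQ.
exists rs, (c * lead_coef Q); last by rewrite e eP -scalerA -Qrs.
split; last by rewrite mulf_neq0.
  by have := sQ; rewrite Qrs size_scale // size_prod_XsubC => -[].
move=> w wrs; apply: (@root_step s l) => //; first by rewrite sm /l; lia.
by rewrite -/P -/Q Qrs rootZ // root_prod_XsubC.
Qed.

Lemma iter_shiftD m i n :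
  iter i shiftD (Fps (fun n => 'C(n, m)%:R)) n = ((n + i) ^_ i * 'C(n + i, m))%:R.
Proof.
elim: i n => [|i IH] n; first by rewrite /= addn0 mul1n.
rewrite iterS /= IH -mulrnA; congr (_%:R).
by rewrite ffactnSr addSnnS mulnAC; congr (_ * _ * _)%N; lia.
Qed.

(** The m-th derivative of sum C(n, m) T^n has the coefficients m! C(n+m, m)^2. The numerator, a
    Narayana polynomial of type B, takes the value 1 at T = 0; so 0 is not a root and the
    reciprocals of the roots exist. *)
Lemma narayana m : exists2 rho : seq R, all (fun r => r <= 0) rho &
  fpoly (Dpoly rho)
  = fpoly ((1 - 'X) ^+ (2 * m).+1) * Fps (fun n => ('C(n + m, n) ^ 2)%:R).
Proof.
have [s [c [sm sneg c0] e]] := shiftD_iter m m.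
have m0 : (m`!%:R : C) != 0 by rewrite pnatr_eq0 -lt0n fact_gt0.
have {}e : fpoly ((1 - 'X) ^+ (2 * m).+1) * Fps (fun n => ('C(n + m, n) ^ 2)%:R)
    = fpoly ((c / m`!%:R) *: \prod_(w <- s) ('X - w%:P)).
  move: e; have -> : iter m shiftD (Fps (fun n => 'C(n, m)%:R))
      = fpC m`!%:R * Fps (fun n => ('C(n + m, n) ^ 2)%:R).
    apply: fpsP => n; rewrite iter_shiftD fpnCM /= -natrM -bin_ffact.
    rewrite (_ : 'C(n + m, m) = 'C(n + m, n)); first by rewrite mulnAC mulnC.
    by rewrite -(bin_sub (leq_addr m n)) addnC addnK.
  rewrite (_ : m.+1 + m = (2 * m).+1)%N; last by lia.
  move=> e; apply: (can_inj (g := fun f => fpC m`!%:R^-1 * f) (f := fun f => fpC m`!%:R * f)).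
    by move=> f; rewrite mulrA -rmorphM mulVf // rmorph1 mul1r.
  rewrite /= mulrCA e -[fpC _]/(fpoly _) -rmorphM mul_polyC scalerA.
  by rewrite [_ * (c / _)]mulrC mulfVK.
set P := \prod_(w <- s) _ in e.
have P0 : c / m`!%:R * P.[0] = 1.
  have /(congr1 (fun f : fps C => f 0%N)) := e; rewrite fpnM0 /= ?bin0 ?exp1n mulr1.
  rewrite coefZ -!horner_coef0 => <-.
  by rewrite horner_exp hornerD hornerN hornerX hornerC subr0 expr1n.
have s0 w : w \in s -> w != 0.
  move=> ws; apply/eqP => w0; have : root P 0 by rewrite root_prod_XsubC -w0.
  by move/rootP => h; move/eqP: P0; rewrite h mulr0 eq_sym oner_eq0.
exists [seq (re w)^-1 | w <- s].
  apply/allP => _ /mapP[w ws ->]; have [_ w0] := sneg w ws; by rewrite invr_le0.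
rewrite e; congr fpoly.
have -> : Dpoly [seq (re w)^-1 | w <- s] = (\prod_(w <- s) (- w^-1)) *: P.
  rewrite /Dpoly big_map -scaler_prod big_seq [RHS]big_seq; apply: eq_bigr => w ws.
  have [iw _] := sneg w ws.
  have -> : toC (re w)^-1 = w^-1.
    by rewrite fmorphV; congr (_^-1); apply: complex_eq; rewrite // im_toC iw.
  rewrite scalerBr -[X in _ = _ - X]mul_polyC -polyCM mulNr mulVf ?s0 // polyCN opprK.
  by rewrite polyC1 scaleNr addrC.
congr (_ *: _); apply: (mulIf (x := P.[0])).
  by apply/eqP => h; move/eqP: P0; rewrite h mulr0 eq_sym oner_eq0.
rewrite P0 horner_prod -big_split /= big_seq big1 // => w ws.
by rewrite hornerXsubC sub0r mulrNN mulVf // s0.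
Qed.

End Narayana.

(* The alphabets are here formal exponentials e^(x_i t): the aim is that, for e >= 1,
   the coefficients of t^e in log (sum_n h_n(X) h_n(Y) T^n) form a rational series in T. *)
Section LogSeries.
Variables (K : numFieldType) (A : comAlgType K) (a b : nat -> A).

Definition phiA : {rmorphism rat -> fps A} :=
  [the {rmorphism rat -> fps A} of @fpC A \o (in_alg A \o (ratr : rat -> K))].

Definition evAB : symXY rat -> fps A := evXY phiA (psum_fps a) (psum_fps b).
HB.instance Definition _ := GRing.RMorphism.copy evAB evAB.

Lemma newton_morph (B B' : comNzRingType) (f : {rmorphism B -> B'}) (P H : nat -> B) :
  newton P H -> newton (f \o P) (f \o H).
Proof.
move=> [H0 HP]; split=> [|n]; first by rewrite /= H0 rmorph1.
by rewrite /= -rmorphMn HP rmorph_sum; apply: eq_bigr => r _; rewrite rmorphM.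
Qed.

Definition hserX n := evAB (hsym (@pX rat) n).
Definition hserY n := evAB (hsym (@pY rat) n).
Definition lser r := evAB (log_cauchy_coef r).

Lemma newton_hserX : newton (psum_fps a) hserX.
Proof.
have := newton_morph evAB (hsym_newton (@pX rat)).
by apply: newton_ext => // r _; exact: evXY_pX.
Qed.

Lemma newton_hserY : newton (psum_fps b) hserY.
Proof.
have := newton_morph evAB (hsym_newton (@pY rat)).
by apply: newton_ext => // r _; exact: evXY_pY.
Qed.

Lemma newton_lser : newton (fun r => lser r *+ r) (fun n => hserX n * hserY n).
Proof.
have := newton_morph evAB log_cauchy_newton.
by apply: newton_ext => [r _|n]; rewrite /= ?rmorphMn //; exact: rmorphM.
Qed.

Lemma evABZ c g : evAB (c *: g) = phiA c * evAB g.
Proof. exact: evXYZ. Qed.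

Lemma lserE r : lser r = \sum_(kap <- parts r) \sum_(lam <- parts r)
     fpC ((ratr (fcoef kap lam) : K)%:A)
     * (\prod_(i <- kap) psum_fps a i * \prod_(i <- lam) psum_fps b i).
Proof.
rewrite /lser log_cauchy_expand rmorph_sum; apply: eq_bigr => kap _ /=.
rewrite rmorph_sum; apply: eq_bigr => lam _ /=; rewrite evABZ; congr (_ * _).
by rewrite rmorphM; congr (_ * _); [exact: evXY_pprodX|exact: evXY_pprodY].
Qed.

Variable m : nat.
Hypotheses (a0 : a 0%N = m.+1%:R) (b0 : b 0%N = m.+1%:R).

Lemma lser_coef r e : lser r e = \sum_(x <- pairs_tot e)
  (ratr (Vcoef r x.1 x.2 m.+1) / e`!%:R : K) *: (pprod a x.1 * pprod b x.2).
Proof. by rewrite lserE; apply: lam_coef. Qed.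

Definition useq n e := (hserX n * hserY n) e.

Lemma polyseq_useq e : polyseq (fun n => useq n e).
Proof.
apply: polyseq_ext (_ : polyseq (fun n => \sum_(i < e.+1) hserX n i * hserY n (e - i)%N)) => [n|].
  by rewrite /useq fpnM.
apply: polyseq_sum => i; apply: polyseq_mul.
  exact: (polyseq_H a0 newton_hserX).
exact: (polyseq_H b0 newton_hserY).
Qed.

Lemma useq0 n : useq n 0 = ('C(n + m, n) ^ 2)%:R.
Proof.
transitivity (hserX n 0%N * hserY n 0%N); first exact: fpnM0.
rewrite natrX expr2; congr (_ * _).
  exact: (H_coef0 a0 newton_hserX).
exact: (H_coef0 b0 newton_hserY).
Qed.

Definition lcol e : fps A := Fps (fun r => if r is 0 then 0 else lser r e).

(** The equation t dU/dt = (t d/dt log U) U, read for fixed powers of t as an identity between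
    series in T. *)
Lemma useq_lcol e :
  Fps (useq ^~ e) *+ e = \sum_(j < e.+1) lcol j *+ j * Fps (useq ^~ (e - j)%N).
Proof.
apply: fpsP => n; rewrite fpnMn fpn_sum /= -feulerE.
have dH := newton_deriv (torsion_free_fps (@torsion_free_alg K A))
  (raddfD (@feuler A)) (@feulerM A) newton_lser.
rewrite dH fpn_sum.
transitivity (\sum_(1 <= r < n.+1) \sum_(j < e.+1) feuler (lser r) j * useq (n - r) (e - j)).
  by apply: eq_bigr => r _; rewrite fpnM.
rewrite exchange_big; apply: eq_bigr => j _.
rewrite fpnM [RHS]big_ord_recl fpnMn /= mul0rn mul0r add0r big_add1 /= big_mkord.
by apply: eq_bigr => i _; rewrite fpnMn /bump leq0n add1n.
Qed.

End LogSeries.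

(** * Rationality in T of the columns of the logarithm *)

Section RationalSeries.
Variables (R : realType).
Notation C := (cplx R).

Section Class.
Variable A : comAlgType C.
Implicit Types f g : fps A.

(** The bound r <= 1 gives r / p <= 1 / 2 at every prime, as the Borel means require; there is no
    lower bound on r. *)
Definition ratl f := exists l : seq R, all (fun r => r <= 1) l /\
  exists N : {poly A}, fpoly (map_poly (in_alg A) (Dpoly l)) * f = fpoly N.

Lemma Dpoly_cat (l l' : seq R) : Dpoly (l ++ l') = Dpoly l * Dpoly l'.
Proof. by rewrite /Dpoly big_cat. Qed.

Lemma ratlD f g : ratl f -> ratl g -> ratl (f + g).
Proof.
move=> [l [l1 [N e]]] [l' [l1' [N' e']]]; exists (l ++ l'); split; first by rewrite all_cat l1.
exists (map_poly (in_alg A) (Dpoly l') * N + map_poly (in_alg A) (Dpoly l) * N').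
rewrite rmorphD !rmorphM /= -e -e' Dpoly_cat !rmorphM /=.
rewrite mulrDr; congr (_ + _); last by rewrite mulrA.
by rewrite [X in X * f = _]mulrC mulrA.
Qed.

Lemma ratlM f g : ratl f -> ratl g -> ratl (f * g).
Proof.
move=> [l [l1 [N e]]] [l' [l1' [N' e']]]; exists (l ++ l'); split; first by rewrite all_cat l1.
exists (N * N'); rewrite !rmorphM /= -e -e' Dpoly_cat !rmorphM /=.
by rewrite mulrACA.
Qed.

Lemma ratl_fpoly N : ratl (fpoly N).
Proof. by exists [::]; split=> //; exists N; rewrite /Dpoly big_nil rmorph1 rmorph1 mul1r. Qed.

Lemma ratl_div l f : all (fun r => r <= 1) l ->
  ratl (fpoly (map_poly (in_alg A) (Dpoly l)) * f) -> ratl f.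
Proof.
move=> l1 [l' [l1' [N e]]]; exists (l' ++ l); split; first by rewrite all_cat l1'.
by exists N; rewrite Dpoly_cat !rmorphM /= -e mulrA.
Qed.

Lemma ratl_sum I (r : seq I) (P : pred I) (F : I -> fps A) :
  (forall i, P i -> ratl (F i)) -> ratl (\sum_(i <- r | P i) F i).
Proof.
move=> h; elim/big_rec: _ => [|i f Pi]; last exact: ratlD (h i Pi).
by have := ratl_fpoly 0; rewrite rmorph0.
Qed.

Lemma ratl_Mn f n : ratl f -> ratl (f *+ n).
Proof.
move=> h; elim: n => [|n IH]; last by rewrite mulrS; apply: ratlD.
by have := ratl_fpoly 0; rewrite rmorph0.
Qed.

Lemma Dpoly_nseq n : Dpoly (nseq n (1 : R)) = (1 - 'X) ^+ n.
Proof.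
rewrite /Dpoly; elim: n => [|n IH]; first by rewrite big_nil.
by rewrite big_cons IH exprS rmorph1 scale1r.
Qed.

Lemma map_1X n : map_poly (in_alg A) ((1 - 'X) ^+ n) = (1 - 'X) ^+ n.
Proof. by rewrite rmorphXn rmorphB /= rmorph1 map_polyX. Qed.

Lemma all_nseq1 n : all (fun r => r <= 1) (nseq n (1 : R)).
Proof. by apply/allP => r; rewrite mem_nseq => /andP[_ /eqP ->]. Qed.

Lemma ratl_polyseq f : polyseq f -> ratl f.
Proof.
move=> /polyseq_rat [l [N e]]; exists (nseq l 1); split; first exact: all_nseq1.
by exists N; rewrite Dpoly_nseq map_1X -e; congr (_ * _); apply: fpsP.
Qed.

Lemma ratl_cancel f n : ratl (f *+ n.+1) -> ratl f.
Proof.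
move=> h; have -> : f = fpoly ((n.+1%:R^-1 : C)%:A)%:P * (f *+ n.+1).
  rewrite mulrnAr -mulrnAl.
  apply: fpsP => i; rewrite -[fpoly _]/(fpC _) -rmorphMn fpnCM.
  by rewrite -scaler_nat scalerA mulfV ?pnatr_eq0 // scale1r mul1r.
by apply: ratlM; first exact: ratl_fpoly.
Qed.

End Class.

Section Coefficients.
Variables (A : comAlgType C) (a b : nat -> A) (m : nat).
Hypotheses (a0 : a 0%N = m.+1%:R) (b0 : b 0%N = m.+1%:R).

(** In [useq_lcol] the top column is multiplied by the column U_0, equal to D_rho / (1 - T)^(2m+1),
    and all other terms are rational by induction. Solving for the top column divides by D_rho,
    which is allowed since rho <= 0. *)
Lemma ratl_lcol e : ratl (lcol a b e.+1).
Proof.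
elim/ltn_ind: e => e IH.
have [rho rho0 rhoE] := narayana R m.
have := useq_lcol a b e.+1; rewrite big_ord_recr /= subnn => h.
have u0 : fpoly (map_poly (in_alg A) (Dpoly rho))
    = fpoly ((1 - 'X) ^+ (2 * m).+1) * Fps (fun n => useq a b n 0).
  have := congr1 (fmap_fps (in_alg A)) rhoE; rewrite rmorphM.
  have fE (p : {poly C}) : fmap_fps (in_alg A) (fpoly p) = fpoly (map_poly (in_alg A) p).
    by apply: fpsP => n; rewrite /= coef_map.
  rewrite /= !fE map_1X => ->; congr (_ * _); apply: fpsP => n.
  rewrite [RHS](useq0 a0 b0).
  exact: (rmorph_nat (in_alg A)).
apply: (@ratl_cancel A _ e); apply: (@ratl_div A rho).
  by apply: sub_all rho0 => r r0; apply: le_trans r0 _.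
rewrite u0 -mulrA; apply: ratlM; first exact: ratl_fpoly.
rewrite mulrC; have -> : lcol a b e.+1 *+ e.+1 * Fps (useq a b ^~ 0%N) =
   Fps (useq a b ^~ e.+1) *+ e.+1
   + fpoly (-1) * \sum_(i < e.+1) lcol a b i *+ i * Fps (useq a b ^~ (e.+1 - i)%N).
  by rewrite h rmorphN1 mulN1r addrAC subrr add0r.
apply: ratlD; first exact: ratl_Mn (ratl_polyseq (f := Fps _) (polyseq_useq a0 b0 _)).
apply: ratlM; first exact: ratl_fpoly.
apply: ratl_sum => -[[|i] ie] _ /=; first by rewrite mulr0n mul0r; have := ratl_fpoly (0 : {poly A}); rewrite rmorph0.
apply: ratlM; last exact: (ratl_polyseq (f := Fps _) (polyseq_useq a0 b0 _)).
by apply: ratl_Mn; apply: IH.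
Qed.

End Coefficients.

Lemma pcoef0 (K : fieldType) mu nu : pcoef mu nu (0 : symXY K) = 0.
Proof.
have -> : (0 : symXY K) = 0 *: 1 by rewrite scale0r.
by rewrite pcoefZ mul0r.
Qed.

(** The previous result for the universal alphabets, from which the coefficient of p_mu(X) p_nu(Y)
    is read off. *)
Lemma Vcoef_rational m mu nu : is_part mu -> is_part nu -> (0 < sumn mu + sumn nu)%N ->
  exists l : seq R, all (fun r => r <= 1) l /\ exists N : {poly C},
    fpoly (Dpoly l) * Fps (fun r => if r is 0 then 0 else ratr (Vcoef r mu nu m.+1)) = fpoly N.
Proof.
move=> pmu pnu; case e0 : (sumn mu + sumn nu)%N => [//|e] _.
(* The indeterminate p_0 is replaced by the number of variables. *)
pose cst (p : nat -> symXY C) n : symXY C := if n is 0 then m.+1%:R else p n.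
have [l [l1 [N eN]]] := @ratl_lcol (symXY C) (cst (@pX C)) (cst (@pY C)) m erefl erefl e.
exists l; split=> //.
exists (\poly_(i < size N) (pcoef mu nu N`_i * e.+1`!%:R)); apply: fpsP => n.
have -> : (fpoly (\poly_(i < size N) (pcoef mu nu N`_i * e.+1`!%:R))) n = pcoef mu nu N`_n * e.+1`!%:R.
  rewrite /= coef_poly; case: ltnP => // h; rewrite [N`_n]nth_default //.
  by rewrite pcoef0 mul0r.
have -> : N`_n = fpoly N n by [].
rewrite -eN !fpnM pcoef_sum mulr_suml; apply: eq_bigr => i _.
rewrite [fpoly (map_poly _ _) _]coef_map /= -scalerAl mul1r pcoefZ -mulrA; congr (_ * _).
case: (n - i)%N => [|r]; first by rewrite pcoef0 mul0r.
rewrite (@lser_coef _ _ _ _ m) // pcoef_sum.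
have cP p x : is_part x -> pprod (cst p) x = pprod p x.
  move=> /andP[_ x0]; rewrite /pprod; apply: eq_big_seq => -[|i'] // h.
  by rewrite h in x0.
have px : is_part2 (mu, nu) by rewrite /is_part2 pmu pnu.
rewrite (eq_big_seq (fun x => ratr (Vcoef r.+1 x.1 x.2 m.+1) / e.+1`!%:R * ((mu, nu) == x)%:R)).
  rewrite (bigD1_seq (mu, nu)) ?pairs_tot_uniq //=; last first.
    by rewrite mem_pairs_tot px e0 eqxx.
  rewrite eqxx mulr1 big1 ?addr0 => [|x /negPf xm]; last by rewrite eq_sym xm mulr0.
  by rewrite mulfVK // pnatr_eq0 -lt0n fact_gt0.
move=> x; rewrite mem_pairs_tot => /andP[pxx _]; rewrite pcoefZ; congr (_ * _).
have -> : pprod (cst (@pX C)) x.1 * pprod (cst (@pY C)) x.2 = ppXY C x.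
  by case/andP: pxx => h1 h2; congr (_ * _); apply: cP.
exact: (@pcoef_ppXY C (mu, nu) x px pxx).
Qed.

Lemma newton_lin (B : comNzRingType) (c : B) :
  newton (fun r => - c ^+ r) (fpoly (1 - c *: 'X)).
Proof.
apply/newton_feuler; split; first by rewrite /= coefB coef1 coefZ coefX mulr0 subr0.
have e : Fps (fpoly (1 - c *: 'X)) = 1 - fpC c * fpX.
  by apply: fpsP => n; rewrite fpnB fpnCM /= coefB coefZ coef1.
rewrite e [RHS]mulrBr mulr1 [in RHS]mulrCA [X in _ = _ - fpC c * X]mulrC raddfB /= feuler1 sub0r.
apply: fpsP => n; rewrite [LHS](_ : _ = - ((fpC c * fpX) n *+ n)) // fpnB !fpnCM fpnXM /= coefX.
case: n => [|[|n]] /=; rewrite ?mulr0 ?mul0rn ?subrr ?oppr0 ?mulr1 ?subr0 ?expr1 //.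
  by rewrite mulr1n addr0.
by rewrite mulrN -exprS opprK addrC subrr.
Qed.

Lemma newton_fpsM (B : comNzRingType) (P Q : nat -> B) (f g : fps B) : newton P f -> newton Q g ->
  newton (fun r => P r + Q r) (f * g).
Proof.
move=> nf ng; apply: newton_ext (newton_mul nf ng) => // n.
by rewrite fpnM.
Qed.

Lemma newton_fps1 (B : comNzRingType) : newton (fun=> 0) (1 : fps B).
Proof.
split=> [|n]; first by rewrite fpn1.
rewrite fpn1 big1 => [|r _]; last by rewrite mul0r.
by case: n => [|n]; rewrite ?mulr0n ?mul0rn.
Qed.

Lemma newton_geo (B : comNzRingType) l : newton (fun=> l%:R) (geo B ^+ l).
Proof.
elim: l => [|l IH]; first by rewrite expr0; exact: newton_fps1.
have g : newton (fun=> 1) (geo B).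
  split=> // n; under eq_bigr do rewrite mul1r.
  by rewrite sumr_const_nat subn1.
by rewrite exprS; apply: newton_ext (newton_fpsM g IH) => // r _; rewrite -natr1 addrC.
Qed.

Lemma newton_Dpoly (l : seq R) :
  newton (fun r => - \sum_(x <- l) toC x ^+ r) (fpoly (Dpoly l)).
Proof.
elim: l => [|x l IH].
  rewrite /Dpoly big_nil rmorph1; apply: newton_ext (newton_fps1 C) => // r _.
  by rewrite big_nil oppr0.
rewrite /Dpoly big_cons rmorphM; apply: newton_ext (newton_fpsM (newton_lin (toC x)) IH) => // r _.
by rewrite big_cons opprD.
Qed.

(** In degree e = 0 the series is a logarithm and only r V_r has a rational generating series.
    Newton's relation for U_0, written as a quotient of linear factors, makes r V_r a difference of
    power sums. *)
Lemma Vcoef00 m : exists rho : seq R, [/\ all (fun r => r <= 0) rho,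
  fpoly (Dpoly rho) = fpoly ((1 - 'X) ^+ (2 * m).+1) * Fps (fun n => ('C(n + m, n) ^ 2)%:R) &
  forall r, (0 < r)%N -> (ratr (Vcoef r [::] [::] m.+1) *+ r : C)
     = (2 * m).+1%:R - \sum_(x <- rho) toC x ^+ r].
Proof.
have [rho rho0 rhoE] := narayana R m; exists rho; split=> // r r0.
pose A : comAlgType C := C^o; pose a (n : nat) : A := m.+1%:R.
have n1 : newton (fun r => lser a a r 0%N *+ r) (fun n => ('C(n + m, n) ^ 2)%:R : A).
  have [H0 HP] := newton_lser a a; split; first by rewrite bin0.
  have u0 n : ('C(n + m, n) ^ 2)%:R = (hserX a a n * hserY a a n) 0%N.
    by rewrite -[RHS]/(useq a a n 0) (@useq0 _ A a a m).
  move=> n; have /(congr1 (fun f : fps A => f 0%N)) := HP n.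
  rewrite fpnMn fpn_sum u0 => ->; apply: eq_bigr => i _.
  by rewrite fpnM0 fpnMn u0.
have n2 : newton (fun r => - (\sum_(x <- rho) toC x ^+ r) + (2 * m).+1%:R)
    (fun n => ('C(n + m, n) ^ 2)%:R : A).
  apply: newton_ext (newton_fpsM (newton_Dpoly rho) (newton_geo C (2 * m).+1)) => // n.
  rewrite rhoE mulrAC rmorphXn /= -exprMn_comm; last exact: mulrC.
  by rewrite [_ * geo C]mulrC geo1 expr1n mul1r.
have := newton_inj n1 n2 r0; rewrite addrC => <-.
rewrite (@lser_coef _ A a a m) //; congr (_ *+ _).
rewrite /pairs_tot /= cats0 /pairs2 parts0 /= big_seq1 /= fact0 divr1 /pprod !big_nil mulr1.
by rewrite [RHS]mulr1.
Qed.

End RationalSeries.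

Local Open Scope classical_set_scope.

(** * Borel means *)

Section Growth.
Variable R : realType.
Notation C := (cplx R).
Implicit Types (s f g : nat -> C).

(** Geometric growth of the partial sums makes their exponential generating function entire, so that
    Borel means are values of convergent series. *)
Definition growth s := exists K M : R, [/\ 0 <= K, 0 <= M & forall n, nm (s n) <= K * M ^+ n].

Lemma growthD f g : growth f -> growth g -> growth (fun n => f n + g n).
Proof.
move=> [K [M [K0 M0 h]]] [K' [M' [K0' M0' h']]]; exists (K + K'), (M + M').
split; [exact: addr_ge0|exact: addr_ge0|] => n; rewrite mulrDl.
apply: le_trans (nmD _ _) _; apply: lerD; [apply: le_trans (h n) _|apply: le_trans (h' n) _];
  by apply: ler_wpM2l => //; apply: lerXn2r; rewrite ?nnegrE ?addr_ge0 // (lerDl, lerDr).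
Qed.

Lemma growthZ c f : growth f -> growth (fun n => c * f n).
Proof.
move=> [K [M [K0 M0 h]]]; exists (nm c * K), M; split=> //.
  by rewrite mulr_ge0 // nm_ge0.
by move=> n; rewrite nmM -mulrA ler_wpM2l ?nm_ge0.
Qed.

Lemma growth_ext f g : f =1 g -> growth f -> growth g.
Proof. by move=> /funext ->. Qed.

Lemma growth_cst c : growth (fun=> c).
Proof. by exists (nm c), 1; split=> // [|n]; rewrite ?nm_ge0 // expr1n mulr1. Qed.

Lemma growth_exp c : growth (fun n => c ^+ n).
Proof. by exists 1, (nm c); split=> // [|n]; rewrite ?nm_ge0 // nmX mul1r. Qed.

Lemma growth_conv (f g : fps C) : growth f -> growth g -> growth (f * g).
Proof.
move=> [K [M [K0 M0 h]]] [K' [M' [K0' M0' h']]]; exists (K * K'), (M' + M).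
split; [exact: mulr_ge0|exact: addr_ge0|] => n; rewrite fpnM exprDn mulr_sumr.
apply: le_trans (nm_sum _ _ _) _; apply: ler_sum => i _; rewrite nmM.
apply: le_trans (ler_pM (nm_ge0 _) (nm_ge0 _) (h i) (h' (n - i)%N)) _.
rewrite mulrACA ler_wpM2l ?mulr_ge0 // [leLHS]mulrC -[leRHS]mulr_natr.
by rewrite ler_peMr ?mulr_ge0 ?exprn_ge0 // ler1n bin_gt0 -ltnS ltn_ord.
Qed.

Lemma growth_mul f g : growth f -> growth g -> growth (fun n => f n * g n).
Proof.
move=> [K [M [K0 M0 h]]] [K' [M' [K0' M0' h']]]; exists (K * K'), (M * M').
split=> [||n]; rewrite ?mulr_ge0 // nmM exprMn mulrACA.
by apply: ler_pM; rewrite ?nm_ge0.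
Qed.

Lemma growth_fpoly (N : {poly C}) : growth (fpoly N).
Proof.
exists (\sum_(i < size N) nm N`_i), 1; split=> // [|n].
  by apply: sumr_ge0 => i _; apply: nm_ge0.
rewrite expr1n mulr1 /=; have [nN|nN] := ltnP n (size N).
  rewrite (bigD1 (Ordinal nN)) //= lerDl; apply: sumr_ge0 => i _; apply: nm_ge0.
by rewrite nth_default // nm0; apply: sumr_ge0 => i _; apply: nm_ge0.
Qed.

Lemma growth_sum I (r : seq I) (F : I -> nat -> C) :
  (forall i, growth (F i)) -> growth (fun n => \sum_(i <- r) F i n).
Proof.
move=> h; elim: r => [|i r IH].
  by apply: growth_ext (growth_cst 0) => n; rewrite big_nil.
by apply: growth_ext (growthD (h i) IH) => n; rewrite big_cons.
Qed.

Lemma growth_shift f : growth f -> growth (fun n => f n.+1).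
Proof.
move=> [K [M [K0 M0 h]]]; exists (K * M), M; split=> // [|n]; first exact: mulr_ge0.
by rewrite -mulrA -exprS.
Qed.

Lemma growth_psum f : growth f -> growth (fun n => \sum_(i < n.+1) f i).
Proof.
move=> h; have h1 : growth (geo C) by exact: growth_cst.
by apply: growth_ext (growth_conv h1 (g := Fps f) h) => n; rewrite geoM.
Qed.

Definition egf s (x : R) : C := limn (series (fun n => s n * toC (x ^+ n / n`!%:R))).

Lemma egf_sums s x : growth s -> sums (fun n => s n * toC (x ^+ n / n`!%:R)) (egf s x).
Proof.
move=> [K [M [K0 M0 h]]].
have [|l sl _] := @sums_abs R (fun n => s n * toC (x ^+ n / n`!%:R)) (K * expR (M * `|x|)).
  move=> N; apply: le_trans (_ : \sum_(i < N) K * ((M * `|x|) ^+ i / i`!%:R) <= _).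
    apply: ler_sum => i _; rewrite nmM nm_toC normrM normrX normfV normr_nat exprMn.
    by rewrite -[M ^+ i * _ / _]mulrA [leRHS]mulrA ler_wpM2r // mulr_ge0.
  by rewrite -mulr_sumr ler_wpM2l // exp_partial_le // mulr_ge0.
by rewrite /egf (sums_lim sl).
Qed.

Definition egmean s (x : R) : C := toC (expR (- x)) * egf s x.

(** Here s is the sequence of partial sums. Growth is part of the notion because [egf] is a
    meaningful value only then, and means could not be added without it. *)
Record avg s (l : C) : Prop := Avg {
  avg_growth : growth s;
  avg_cvg : egmean s x @[x --> +oo%R] --> l }.

Lemma avg_borel (a : nat -> C) l : avg (fun n => \sum_(i < n.+1) a i) l -> borel_sum a = l.
Proof. by move=> [_ h]; exact: (cvgK_lim h). Qed.

Lemma avg_uniq s l l' : avg s l -> avg s l' -> l = l'.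
Proof. by move=> [_ h] [_ h']; exact: (cvgK_unique h h'). Qed.

Lemma avg_ext s s' l : s =1 s' -> avg s l -> avg s' l.
Proof. by move=> /funext ->. Qed.

Lemma avgD s s' l l' : avg s l -> avg s' l' -> avg (fun n => s n + s' n) (l + l').
Proof.
move=> [g h] [g' h']; split; first exact: growthD.
rewrite (_ : egmean _ = fun x => egmean s x + egmean s' x); first exact (cvgKD h h').
apply/funext => x; rewrite /egmean -mulrDr; congr (_ * _).
apply: sums_uniq (egf_sums _ (growthD g g')) _.
by apply: sums_ext (sumsD (egf_sums x g) (egf_sums x g')) => n; rewrite mulrDl.
Qed.

Lemma avgZ c s l : avg s l -> avg (fun n => c * s n) (c * l).
Proof.
move=> [g h]; split; first exact: growthZ.
rewrite (_ : egmean _ = fun x => c * egmean s x); first exact (cvgKM (@cvgK_cst _ _ _ _ c) h).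
apply/funext => x; rewrite /egmean mulrCA; congr (_ * _).
apply: sums_uniq (egf_sums _ (growthZ c g)) _.
by apply: sums_ext (sumsZ c (egf_sums x g)) => n; rewrite mulrA.
Qed.

Lemma avg_cst c : avg (fun=> c) c.
Proof.
split; first exact: growth_cst.
rewrite (_ : egmean _ = fun=> c); first exact (@cvgK_cst _ _ _ _ c).
apply/funext => x; rewrite /egmean.
have -> : egf (fun=> c) x = c * toC (expR x).
  apply: sums_uniq (egf_sums _ (growth_cst c)) _.
  by apply: sums_ext (sumsZ c (sums_expfps_real x)) => n; rewrite /= rmorphM rmorphXn fmorphV rmorph_nat.
by rewrite mulrCA -rmorphM -expRD addNr expR0 rmorph1 mulr1.
Qed.

Lemma avg_sum I (r : seq I) (F : I -> nat -> C) (l : I -> C) :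
  (forall i, avg (F i) (l i)) -> avg (fun n => \sum_(i <- r) F i n) (\sum_(i <- r) l i).
Proof.
move=> h; elim: r => [|i r IH].
  by rewrite big_nil; apply: avg_ext (avg_cst 0) => n; rewrite big_nil.
by rewrite big_cons; apply: avg_ext (avgD (h i) IH) => n; rewrite big_cons.
Qed.

(** Any rate below 1 would do; 3 / 4 leaves room for powers of x above the rate 1 / 2 of the
    functions to be treated. *)
Lemma avg0_bound s (B : R) : growth s ->
  (forall x, 0 <= x -> nm (egf s x) <= B * expR (x * (3 / 4))) -> avg s 0.
Proof.
move=> g h; split=> //; apply/cvgCP => e e0.
have B0 : 0 <= B by have := le_trans (nm_ge0 _) (h 0 (lexx 0)); rewrite mul0r expR0 mulr1.
near=> x; rewrite subr0 nmM nm_toC ger0_norm ?expR_ge0 //.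
have x0 : 0 < x by near: x; apply: nbhs_pinfty_gt.
have xe : 4 * (B + 1) / e < x by near: x; apply: nbhs_pinfty_gt; rewrite num_real.
apply: le_lt_trans (ler_wpM2l (expR_ge0 _) (h x (ltW x0))) _.
rewrite mulrCA -expRD (_ : - x + x * (3 / 4) = - (x / 4)); last by field.
rewrite expRN ltr_pdivrMr ?expR_gt0 //.
have := expR_ge1Dx (x / 4); move: xe; rewrite ltr_pdivrMr // => h1 h2.
apply: lt_le_trans (ler_wpM2l (ltW e0) h2); lra.
Unshelve. all: by end_near. Qed.

(** Regularity of the method: the finitely many terms far from the limit contribute a polynomial in
    x, which e^(-x) kills; the others contribute at most e / 2. *)
Lemma avg_regular s (l : C) : s @ \oo --> l -> avg s l.
Proof.
move=> sl; have [B sB] : exists B : R, forall n, nm (s n - l) <= B.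
  have /cvgCP := sl => /(_ 1 ltr01) [N _ HN].
  exists (1 + \sum_(i < N) nm (s i - l)) => n; have [Nn|nN] := leqP N n.
    have h := HN n Nn; apply: le_trans (ltW h) _; rewrite lerDl; apply: sumr_ge0 => i _; exact: nm_ge0.
  rewrite (bigD1 (Ordinal nN)) //= addrCA lerDl addr_ge0 //.
  by apply: sumr_ge0 => i _; exact: nm_ge0.
have B0 : 0 <= B by apply: le_trans (sB 0%N); apply: nm_ge0.
pose d n := s n - l.
have gd : growth d by exists B, 1; split=> // n; rewrite expr1n mulr1; apply: sB.
suff d0 : avg d 0.
  by have := avgD d0 (avg_cst l); rewrite add0r; apply: avg_ext => n; rewrite /d subrK.
split; first exact: gd.
apply/cvgCP => e e0.
have e20 : 0 < e / 2 by rewrite divr_gt0.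
have /cvgCP /(_ _ e20) [N _ HN] := sl.
pose P := fun x : R => B * \sum_(i < N) x ^+ i / i`!%:R.
have PN : exists K : R, 0 <= K /\ forall x, 0 <= x -> P x <= K * expR (x * (3 / 4)).
  (* From x^i = (4 / 3)^i (3 x / 4)^i with i < N. *)
  exists (B * (4 / 3) ^+ N); split; first by rewrite mulr_ge0 // exprn_ge0 // divr_ge0.
  move=> x x0; rewrite /P -mulrA ler_wpM2l //.
  apply: le_trans (ler_wpM2l _ (exp_partial_le N (_ : 0 <= x * (3/4)))); last first.
  - by rewrite mulr_ge0.
  - by rewrite exprn_ge0.
  rewrite mulr_sumr; apply: ler_sum => i _; rewrite [(x * _) ^+ i]exprMn.
  have -> : (4 / 3) ^+ N * (x ^+ i * (3 / 4) ^+ i / i`!%:R)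
    = (4 / 3) ^+ (N - i) * (x ^+ i / i`!%:R) :> R.
    rewrite -[X in (4 / 3) ^+ X * _ = _](subnK (ltnW (ltn_ord i))) exprD.
    have e1 : (4 / 3) ^+ i * (3 / 4) ^+ i = 1 :> R.
      by rewrite -exprMn (_ : 4 / 3 * (3 / 4) = 1 :> R) ?expr1n //; field.
    by rewrite [x ^+ i * _ / _]mulrAC mulrACA e1 mulr1.
  by rewrite ler_peMl ?mulr_ge0 ?exprn_ge0 ?invr_ge0 // exprn_ege1 //; lra.
have [K [K0 PK]] := PN.
near=> x; rewrite subr0.
have x0 : 0 < x by near: x; apply: nbhs_pinfty_gt.
have xe : 8 * (K + 1) / e < x by near: x; apply: nbhs_pinfty_gt; rewrite num_real.
have bd : nm (egf d x) <= P x + e / 2 * expR x.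
  apply: (sums_nm_le (egf_sums x gd)) => n.
  apply: le_trans (nm_sum _ _ _) _.
  apply: le_trans (_ : \sum_(i < n) ((if (i < N)%N then B * (x ^+ i / i`!%:R) else 0)
       + e / 2 * (x ^+ i / i`!%:R)) <= _).
    apply: ler_sum => i _; rewrite nmM nm_toC.
    have p0 : 0 <= x ^+ i / i`!%:R by rewrite divr_ge0 ?exprn_ge0 // ltW.
    rewrite ger0_norm //; case: ltnP => iN.
      apply: le_trans (ler_wpM2r p0 (sB i)) _; rewrite lerDl.
      by rewrite mulr_ge0 // ltW.
    by rewrite add0r ler_wpM2r // ltW //; exact: HN.
  rewrite big_split /= -mulr_sumr; apply: lerD; last first.
    by rewrite ler_wpM2l ?(ltW e20) // exp_partial_le // ltW.
  rewrite -big_mkcond /= /P mulr_sumr.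
  rewrite -(big_mkord (fun i => (i < N)%N) (fun i => B * (x ^+ i / i`!%:R))).
  rewrite -(big_mkord xpredT (fun i => B * (x ^+ i / i`!%:R))).
  have F0 i : 0 <= B * (x ^+ i / i`!%:R).
    by rewrite mulr_ge0 // divr_ge0 // exprn_ge0 // ltW.
  have [nN|Nn] := leqP n N.
    rewrite (big_cat_nat (n := n) _ nN) //= big_nat_cond.
    rewrite (eq_bigl (fun i => (0 <= i < n)%N && true)); last first.
      by move=> i; rewrite andbT; case: (ltnP i n) => //= h; rewrite (leq_trans h nN).
    by rewrite -big_nat_cond lerDl; apply: sumr_ge0.
  rewrite (big_cat_nat (n := N) _ (ltnW Nn)) //= [X in _ + X]big_nat_cond [X in _ + X]big_pred0; last first.
    by move=> i; case: (ltnP i N) => h; rewrite ?andbF // [(N <= i)%N]leqNgt h.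
  by rewrite addr0 big_mkcond; apply: ler_sum_nat => i /andP[_ ->].
rewrite nmM nm_toC ger0_norm ?expR_ge0 //.
apply: le_lt_trans (ler_wpM2l (expR_ge0 _) (le_trans bd (lerD (PK _ (ltW x0)) (lexx _)))) _.
rewrite mulrDr [X in _ + X]mulrCA -expRD addNr expR0 mulr1 mulrCA -expRD.
rewrite (_ : - x + x * (3 / 4) = - (x / 4)); last by field.
rewrite -ltrBrDr (_ : e - e / 2 = e / 2); last by field.
rewrite expRN ltr_pdivrMr ?expR_gt0 //.
have := expR_ge1Dx (x / 4); move: xe; rewrite ltr_pdivrMr // => h1 h2.
apply: lt_le_trans (ler_wpM2l (ltW e20) h2); lra.
Unshelve. all: by end_near. Qed.

Lemma avg_sums (a : nat -> C) l : sums a l -> avg (fun n => \sum_(i < n.+1) a i) l.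
Proof.
move=> /sumsP h; apply: avg_regular; apply/cvgCP => e /h [N HN].
by exists N => // n /= Nn; apply: HN; apply: leqW.
Qed.

End Growth.

(** * Partial fractions and their Borel means *)

Section ExpPoly.
Variable R : realType.
Notation C := (cplx R).

(** The coefficients of T^j / (1 - q T)^(j+1); the truncated exponent is harmless, as the binomial
    coefficient vanishes for n < j. The exponential generating function is x^j / j! e^(q x). *)
Definition epoly j (q : R) : fps C := Fps (fun n => 'C(n, j)%:R * toC q ^+ (n - j)).

Definition lin1 (q : R) : fps C := 1 - fpC (toC q) * fpX.

Lemma lin1M q (f : fps C) n : (lin1 q * f) n = f n - (if n is n'.+1 then toC q * f n' else 0).
Proof.
rewrite /lin1 mulrBl mul1r fpnB -mulrA fpnCM fpnXM.
by case: n => [|n] //; rewrite mulr0.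
Qed.

Lemma lin1E q n : lin1 q n = if n is n'.+1 then (if n' is 0 then - toC q else 0) else 1.
Proof.
have := lin1M q 1 n; rewrite mulr1 => ->; rewrite fpn1.
case: n => [|[|n]] /=; rewrite ?subr0 // ?fpn1 /= ?mulr1 ?mulr0 ?sub0r ?subr0 ?oppr0 //.
Qed.

Lemma lin1_scale q (x y : R) n : y = q * x -> lin1 y n = toC x ^+ n * lin1 q n.
Proof.
have e1 := lin1E y n; have e2 := lin1E q n; case: n e1 e2 => [|[|n]] e1 e2 e.
- by rewrite expr0 mul1r; exact: etrans e1 (esym e2).
- rewrite expr1 [LHS]e1 [X in _ = _ * X]e2 e rmorphM mulrN; congr (- _).
  exact: mulrC.
- by rewrite [LHS]e1 [X in _ = _ * X]e2 mulr0.
Qed.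

Lemma epoly0 q : lin1 q * epoly 0 q = 1.
Proof.
apply: fpsP => -[|n]; rewrite lin1M fpn1 /= ?bin0 ?subn0 ?mul1r ?expr0 ?subr0 //.
by rewrite exprS subrr.
Qed.

Lemma epolyS j q : lin1 q * epoly j.+1 q = fpX * epoly j q.
Proof.
apply: fpsP => -[|n]; rewrite lin1M fpnXM /= ?bin0n ?mul0r ?subr0 //.
rewrite binS natrD subSS mulrDl.
have [jn|nj] := ltnP j n; last by rewrite bin_small ?ltnS // !mul0r mulr0 subr0 add0r.
rewrite addrAC -[RHS]add0r; congr (_ + _).
by rewrite mulrCA -exprS subnSK // subrr.
Qed.

Lemma lin1_inj q : injective (fun f => lin1 q * f).
Proof.
move=> f g fg; have : epoly 0 q * (lin1 q * f) = epoly 0 q * (lin1 q * g) by rewrite fg.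
by rewrite !mulrA [epoly 0 q * _]mulrC epoly0 !mul1r.
Qed.

Inductive exppoly : fps C -> Prop :=
| exppoly_gen j q : q <= 1 / 2 -> exppoly (epoly j q)
| exppoly_add f g : exppoly f -> exppoly g -> exppoly (f + g)
| exppoly_scale c f : exppoly f -> exppoly (fpC c * f).

Lemma lin_comb (B : comNzRingType) (u v x y X : B) :
  u * (1 - x * X) + v * (1 - y * X) = u + v - (u * x + v * y) * X.
Proof. ring. Qed.

(* Partial fractions: [A] and [S] stand for 1 - q T and 1 - s T. *)
Lemma pf0 (B : comNzRingType) (A S E0 F0 k1 k2 : B) : S * E0 = 1 -> A * F0 = 1 ->
  k1 * A + k2 * S = 1 -> S * (A * (k1 * E0 + k2 * F0)) = 1.
Proof.
move=> e1 e2 e3; transitivity (k1 * A * (S * E0) + k2 * S * (A * F0)); first by ring.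
by rewrite e1 e2 !mulr1.
Qed.

Lemma pfS (B : comNzRingType) (A S E X g1 g2 c : B) : c * (A - S) = X ->
  A * g1 = E -> S * g2 = E -> S * (A * (c * g2 + - c * g1)) = X * E.
Proof.
move=> <- e1 e2; transitivity (c * A * (S * g2) - c * S * (A * g1)); first by ring.
by rewrite e1 e2; ring.
Qed.

(** For a generator with parameter s different from q, induction on j with one step of partial
    fractions; for s = q the order of the pole rises. *)
Lemma exppoly_div f q : q <= 1 / 2 -> exppoly f -> exists2 g, exppoly g & lin1 q * g = f.
Proof.
move=> q2; elim=> [j s s2|f1 f2 _ [g1 e1 <-] _ [g2 e2 <-]|c f1 _ [g1 e1 <-]]; last first.
- by exists (fpC c * g1); [exact: exppoly_scale|rewrite mulrCA].
- by exists (g1 + g2); [exact: exppoly_add|rewrite mulrDr].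
(* This is T^j / (1 - s T)^(j+2), because 1 = (1 - s T) + s T. *)
have self (j0 : nat) (s0 : R) : s0 <= 1 / 2 -> exists2 g, exppoly g & lin1 s0 * g = epoly j0 s0.
  move=> s02; exists (epoly j0 s0 + fpC (toC s0) * epoly j0.+1 s0).
    by apply: exppoly_add; [|apply: exppoly_scale]; apply: exppoly_gen.
  rewrite mulrDr mulrCA epolyS mulrA -mulrDl [X in X * _](_ : _ = 1) ?mul1r //.
  by rewrite /lin1 subrK.
have [<-|sq] := eqVneq s q; first exact: self.
have d0 : toC (s - q) != 0 by rewrite -(rmorph0 (@toC R)) (inj_eq (@toC_inj R)) subr_eq0.
have sq0 : s - q != 0 by rewrite subr_eq0.
have linE (u v : R) : fpC (toC u) * lin1 q + fpC (toC v) * lin1 s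
    = fpC (toC (u + v)) - fpC (toC (u * q + v * s)) * fpX.
  by rewrite !rmorphD !rmorphM /=; exact: lin_comb.
elim: j => [|j [g1 eg1 h1]].
  exists (fpC (toC (s / (s - q))) * epoly 0 s + fpC (toC (- q / (s - q))) * epoly 0 q).
    by apply: exppoly_add; apply: exppoly_scale; apply: exppoly_gen.
  apply: (@lin1_inj s) => /=; transitivity (1 : fps C); last exact/esym/epoly0.
  refine (pf0 (epoly0 s) (epoly0 q) _).
  rewrite linE (_ : s / (s - q) + - q / (s - q) = 1); last by field.
  rewrite (_ : s / (s - q) * q + - q / (s - q) * s = 0); last by field.
  by rewrite !rmorph1 !rmorph0 mul0r subr0.
have [g2 eg2 h2] := self j s s2.
exists (fpC (toC (s - q)^-1) * g2 + fpC (- toC (s - q)^-1) * g1).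
  by apply: exppoly_add; apply: exppoly_scale.
apply: (@lin1_inj s) => /=; transitivity (fpX * epoly j s); last exact/esym/epolyS.
rewrite rmorphN; refine (pfS _ h1 h2).
rewrite mulrBr -mulNr -[- fpC _]rmorphN -(rmorphN (@toC R)) linE subrr.
rewrite (_ : (s - q)^-1 * q + - (s - q)^-1 * s = -1); last by field.
by rewrite !rmorph0 rmorphN1 rmorphN1 mulN1r sub0r opprK.
Qed.

(** The case q = 0: since 0^0 = 1, [epoly i 0] is T^i. *)
Lemma exppoly_fpoly N : exppoly (fpoly N).
Proof.
have -> : fpoly N = \sum_(i < size N) fpC N`_i * epoly i 0.
  apply: fpsP => n; rewrite fpn_sum /=.
  under eq_bigr do rewrite fpnCM /= rmorph0 expr0n.
  have [nN|nN] := ltnP n (size N); last first.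
    rewrite nth_default // big1 // => i _.
    rewrite (_ : (n - i == 0)%N = false) ?mulr0 //.
    by apply/negbTE; rewrite -lt0n subn_gt0; apply: leq_trans nN.
  rewrite (bigD1 (Ordinal nN)) //= binn subnn !mulr1 big1 ?addr0 // => i ni.
  have [ltin|leni] := ltnP i n; first by rewrite subn_eq0 leqNgt ltin !mulr0.
  by rewrite bin_small ?mul0r ?mulr0 // ltn_neqAle leni eq_sym; have := ni; rewrite -val_eqE => ->.
elim/big_ind: _ => [|f g|i _]; last by apply/exppoly_scale/exppoly_gen.
  have -> : (0 : fps C) = fpC 0 * epoly 0 0 by rewrite rmorph0 mul0r.
  by apply/exppoly_scale/exppoly_gen.
exact: exppoly_add.
Qed.

Lemma exppoly_quot (l : seq R) f N : all (fun q => q <= 1 / 2) l ->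
  (\prod_(q <- l) lin1 q) * f = fpoly N -> exppoly f.
Proof.
move=> lq; have : exppoly (fpoly N) by exact: exppoly_fpoly.
move: (fpoly N) => h; elim: l lq f h => [|q l IH] /= => [_|/andP[q2 lq]] f h eh.
  by rewrite big_nil mul1r => ->.
rewrite big_cons -mulrA => e.
have [g eg hg] := exppoly_div q2 eh.
by apply: (IH lq _ g eg); apply: (@lin1_inj q); rewrite /= e hg.
Qed.

Lemma sums_shiftn j (c : nat -> C) l : (forall n, (n < j)%N -> c n = 0) ->
  sums (fun n => c (j + n)%N) l -> sums c l.
Proof.
elim: j c => [|j IH] c c0 h; first by apply: sums_ext h => n.
rewrite -[l]add0r -(c0 0%N) //; apply/sums_shift; apply: IH => [n nj|]; first exact: c0.
by apply: sums_ext h => n.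
Qed.

Lemma bin_le_expn n j : ('C(n, j) <= 2 ^ n)%N.
Proof.
elim: n j => [|n IH] [|j]; rewrite ?bin0 ?expn_gt0 //.
by rewrite binS expnS mul2n -addnn leq_add.
Qed.

Lemma growth_epoly j q : growth (epoly j q).
Proof.
apply: growth_mul.
  exists 1, 2; split=> // n; rewrite mul1r nm_nat -natrX ler_nat; exact: bin_le_expn.
exists 1, (1 + `|q|); split=> // n.
rewrite mul1r nmX nm_toC; apply: le_trans (_ : (1 + `|q|) ^+ (n - j) <= _).
  by apply: lerXn2r; rewrite ?nnegrE ?addr_ge0 // lerDr.
by apply: ler_weXn2l; rewrite ?leq_subr // lerDl.
Qed.

Lemma egf_epoly j q x : sums (fun n => epoly j q n * toC (x ^+ n / n`!%:R))
  (toC (x ^+ j / j`!%:R * expR (q * x))).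
Proof.
apply: (@sums_shiftn j) => [n nj|]; first by rewrite /= bin_small // !mul0r.
rewrite rmorphM; apply: sums_ext (sumsZ (toC (x ^+ j / j`!%:R)) (sums_expfps_real (q * x))) => n.
rewrite /= addKn -(rmorph_nat (@toC R)) -!(rmorphXn (@toC R)) -(rmorph_nat (@toC R) n`!).
rewrite -(fmorphV (@toC R)) -!rmorphM; congr toC.
have := bin_fact (leq_addr n j); rewrite addKn => /(congr1 (fun i => i%:R : R)).
rewrite !natrM => h; have j0 : (j`!%:R : R) != 0 by rewrite pnatr_eq0 -lt0n fact_gt0.
have n0 : (n`!%:R : R) != 0 by rewrite pnatr_eq0 -lt0n fact_gt0.
have jn0 : ((j + n)`!%:R : R) != 0 by rewrite pnatr_eq0 -lt0n fact_gt0.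
rewrite exprMn exprD; move: h; set B := 'C(_, _)%:R; set J := j`!%:R; set N := n`!%:R.
set JN := (j + n)`!%:R => h.
have -> : B = JN / (J * N) by rewrite -h; field; rewrite /J /N j0 n0.
by field; rewrite /J /N /JN j0 n0 jn0.
Qed.

Lemma avg_epoly j q : q <= 1 / 2 -> avg (epoly j q) 0.
Proof.
(* From x^j / j! <= 4^j e^(x/4) and q x <= x / 2; the two rates add up to 3 / 4. *)
move=> q2; apply: (@avg0_bound _ _ (4 ^+ j)); first exact: growth_epoly.
move=> x x0; rewrite (sums_uniq (egf_sums x (growth_epoly j q)) (egf_epoly j q x)).
rewrite nm_toC ger0_norm; last by rewrite mulr_ge0 ?expR_ge0 // divr_ge0 // exprn_ge0.
rewrite (_ : x * (3 / 4) = x / 4 + x / 2); last by field.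
rewrite expRD mulrA; apply: ler_pM; rewrite ?expR_ge0 ?divr_ge0 ?exprn_ge0 //; last first.
  by rewrite ler_expR mulrC; apply: ler_wpM2l => //; rewrite -[2^-1]mul1r.
have x4 : 0 <= x / 4 by rewrite divr_ge0.
have h : (x / 4) ^+ j / j`!%:R <= expR (x / 4).
  apply: le_trans (exp_partial_le j.+1 x4); rewrite big_ord_recr /= lerDr.
  by apply: sumr_ge0 => i _; rewrite divr_ge0 // exprn_ge0.
apply: le_trans (ler_wpM2l _ h); last by rewrite exprn_ge0.
by rewrite mulrA -exprMn [4 * _]mulrC mulfVK.
Qed.

Lemma avg_exppoly f : exppoly f -> avg f 0.
Proof.
elim=> [j q|f1 f2 _ h1 _ h2|c f1 _ h]; first exact: avg_epoly.
  by have := avgD h1 h2; rewrite addr0.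
have := avgZ c h; rewrite mulr0; apply: avg_ext => n; by rewrite fpnCM.
Qed.

Definition lprod (l : seq R) : C := \prod_(q <- l) (1 - toC q).

Lemma lprod_neq0 l : all (fun q => q <= 1 / 2) l -> lprod l != 0.
Proof.
move=> /allP h; rewrite /lprod prodf_seq_neq0; apply/allP => q /h q2 /=.
rewrite -(rmorph1 (@toC R)) -rmorphB -(rmorph0 (@toC R)) (inj_eq (@toC_inj R)) subr_eq0.
by apply/eqP => q1; move: q2; rewrite -q1; lra.
Qed.

(** Partial sums have the generating series N / ((1 - T) D). Subtracting the constant v = N(1) /
    D(1) makes the numerator N - v D divisible by 1 - T, and what is left has mean 0. *)
Lemma avg_rational (l : seq R) (a : fps C) N : all (fun q => q <= 1 / 2) l ->
  (\prod_(q <- l) lin1 q) * a = fpoly N ->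
  avg (fun n => \sum_(i < n.+1) a i) (N.[1] / lprod l).
Proof.
move=> lq e; set v := N.[1] / lprod l.
pose Q : {poly C} := \prod_(q <- l) (1 - toC q *: 'X).
have QE : fpoly Q = \prod_(q <- l) lin1 q.
  rewrite /Q rmorph_prod; apply: eq_bigr => q _; rewrite rmorphB rmorph1 /lin1.
  by rewrite -mul_polyC rmorphM.
have Q1 : Q.[1] = lprod l.
  by rewrite /Q horner_prod; apply: eq_bigr => q _; rewrite !hornerE.
have /factor_theorem [M' eM] : root (N - v *: Q) 1.
  by rewrite rootE hornerD hornerN hornerZ Q1 /v divfK ?subrr // lprod_neq0.
pose r : fps C := geo C * a - fpC v * geo C.
have er : (\prod_(q <- l) lin1 q) * r = fpoly (- M').
  rewrite /r mulrBr mulrCA e mulrCA -QE.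
  have -> : geo C * fpoly N - fpC v * (fpoly Q * geo C) = geo C * fpoly (N - v *: Q).
    rewrite rmorphB mulrBr; congr (_ - _).
    by rewrite -[v *: Q]mul_polyC (rmorphM (@fpoly C)) [RHS]mulrC -[RHS]mulrA.
  by rewrite eM rmorphM mulrCA -[_ - 1%:P]opprB rmorphN mulrN polyC1 geo1 mulrN1 -rmorphN.
have := avgD (avg_exppoly (exppoly_quot lq er)) (avg_cst v).
rewrite add0r; apply: avg_ext => n.
rewrite /r; have -> : geo C * a = Fps (fun n => \sum_(i < n.+1) a i).
  by rewrite -(geoM a); congr (_ * _); apply: fpsP.
by rewrite fpnB fpnCM /= mulr1 subrK.
Qed.

End ExpPoly.

(** * Borel means of the logarithm *)

Section LogMean.
Variable R : realType.
Notation C := (cplx R).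

Definition logpoly n : {poly R} := \sum_(r < n.+1) r.+1%:R^-1 *: 'X^(r.+1).

Lemma deriv_logpoly n z : (1 - z) * (logpoly n)^`().[z] = 1 - z ^+ n.+1.
Proof.
rewrite /logpoly raddf_sum /= horner_sum.
rewrite (eq_bigr (fun r : 'I_n.+1 => z ^+ r)) => [|r _]; first by rewrite -[1 - z]opprB mulNr -subrX1 opprB.
by rewrite derivZ derivXn /= hornerZ hornerMn hornerXn -[z ^+ _ *+ _]mulr_natl mulrA mulVf ?mul1r ?pnatr_eq0.
Qed.

Lemma logpoly0 n : (logpoly n).[0] = 0.
Proof.
rewrite /logpoly horner_sum big1 // => r _.
by rewrite hornerZ hornerXn expr0n mulr0.
Qed.

(* g stands for the N-th partial sum in n of the egf of
   - ln (1 - z) - \sum_(r <= n + 1) z ^ r / r; its derivative in z is the N-th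
   partial sum of - z exp (z x) / (1 - z). *)
Lemma log_rem_bound (z0 x tau : R) N : z0 <= 1 / 2 -> 0 <= x ->
  (forall z, `|z| <= `|z0| -> `|\sum_(n < N) (z * x) ^+ n / n`!%:R - expR (z * x)| <= tau) ->
  `|\sum_(n < N) (- ln (1 - z0) - (logpoly n).[z0]) * (x ^+ n / n`!%:R)|
  <= 2 * z0 ^+ 2 * (expR (x / 2) + tau).
Proof.
move=> z2 x0 htau.
pose A : R := \sum_(n < N) x ^+ n / n`!%:R.
pose P : {poly R} := \sum_(n < N) (x ^+ n / n`!%:R) *: logpoly n.
pose g z := A * ln (1 - z) + P.[z].
pose dg z := - (z / (1 - z)) * \sum_(n < N) (z * x) ^+ n / n`!%:R.
have gE : \sum_(n < N) (- ln (1 - z0) - (logpoly n).[z0]) * (x ^+ n / n`!%:R) = - g z0.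
  rewrite /g /A /P horner_sum mulr_suml -big_split /= -sumrN; apply: eq_bigr => n _.
  by rewrite hornerZ; ring.
have g0 : g 0 = 0.
  rewrite /g subr0 ln1 mulr0 add0r /P horner_sum big1 // => n _.
  by rewrite hornerZ logpoly0 mulr0.
have dgE (z : R) : z <= 1 / 2 -> is_derive z 1 g (dg z).
  move=> z12; have z1 : 0 < 1 - z by lra.
  have d1 : is_derive (1 - z) 1 (@ln R) (1 - z)^-1 by exact: is_derive1_ln.
  have d2 : is_derive z 1 (fun z : R => 1 - z) (-1).
    by have := is_deriveB (is_derive_cst (1 : R) z 1) (is_derive_id z 1); rewrite sub0r.
  have d3 : is_derive z 1 (fun z => ln (1 - z)) ((1 - z)^-1 * -1).
    exact: (@is_derive1_comp _ (@ln R) (fun z : R => 1 - z) z _ _ d1 d2).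
  have d4 := is_deriveD (is_deriveZ A d3) (is_derive_poly P z).
  apply: is_derive_eq d4 _.
  rewrite /dg mulrN1 /P raddf_sum horner_sum /A.
  apply: (mulfI (lt0r_neq0 z1)); rewrite mulrDr.
  have -> : (1 - z) * ((\sum_(n < N) x ^+ n / n`!%:R) *: - (1 - z)^-1) = - \sum_(n < N) x ^+ n / n`!%:R.
    transitivity ((1 - z) * ((\sum_(n < N) x ^+ n / n`!%:R) * - (1 - z)^-1)) => //.
    by rewrite mulrCA mulrN mulfV ?mulrN1 // lt0r_neq0.
  rewrite [RHS]mulrA [X in _ = X * _](_ : _ = - z); last by field; rewrite lt0r_neq0.
  rewrite !mulr_sumr -sumrN -big_split /=; apply: eq_bigr => n _.
  by rewrite derivZ hornerZ mulrCA deriv_logpoly exprMn exprS; ring.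
rewrite gE normrN.
have bd (c : R) : `|c| <= `|z0| -> c <= 1 / 2 -> `|dg c * z0| <= 2 * z0 ^+ 2 * (expR (x / 2) + tau).
  move=> cz c2; have c1 : 0 < 1 - c by lra.
  rewrite /dg !normrM normrN normrM normfV (gtr0_norm c1) mulrAC.
  have -> : 2 * z0 ^+ 2 = (`|z0| * 2) * `|z0| by rewrite -[z0 ^+ 2]real_normK ?num_real //; ring.
  have t0 : 0 <= tau by apply: le_trans (htau c cz).
  apply: ler_pM; rewrite ?mulr_ge0 ?invr_ge0 // ?(ltW c1) //.
    rewrite ler_wpM2r //; apply: ler_pM; rewrite ?invr_ge0 ?(ltW c1) //.
    by rewrite -[2]invrK lef_pV2 ?posrE // ; lra.
  have := htau c cz; set S := \sum_(n < N) _ => h.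
  have e1 : expR (c * x) <= expR (x / 2).
    by rewrite ler_expR mulrC ler_wpM2l //; lra.
  have e0 := expR_ge0 (c * x).
  have : `|S| <= `|S - expR (c * x)| + `|expR (c * x)|.
    by rewrite -[X in `|X| <= _](subrK (expR (c * x))) ler_normD.
  by rewrite (ger0_norm e0); lra.
have cont (a b : R) : b <= 1 / 2 -> {within `[a, b], continuous g}.
  move=> b2; apply: derivable_within_continuous => z; rewrite in_itv /= => /andP[_ zb].
  exact: (@ex_derive _ _ _ _ _ _ _ (dgE z (le_trans zb b2))).
have [z00|z00] := leP 0 z0.
  have [c|c] := @MVT_segment _ g dg 0 z0 z00 _ (cont _ _ z2).
    by rewrite in_itv /= => /andP[_ cz]; apply: dgE; apply: le_trans (ltW cz) z2.
  rewrite in_itv /= => /andP[c0 cz]; rewrite g0 !subr0 => ->.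
  by apply: bd; [rewrite !ger0_norm|apply: le_trans z2].
have h0 : (0 : R) <= 1 / 2 by lra.
have [c|c] := @MVT_segment _ g dg z0 0 (ltW z00) _ (cont _ _ h0).
- by rewrite in_itv /= => /andP[_ cz]; apply: dgE; apply: le_trans (ltW cz) _.
rewrite in_itv /= => /andP[c0 cz]; rewrite g0 !sub0r mulrN => /oppr_inj ->.
apply: bd; last by lra.
by rewrite !ler0_norm ?(ltW z00) // lerN2.
Qed.

(** The range z < -1, where the series diverges, is the purpose. The remainder has an exponential
    generating function of size 2 z^2 e^(x/2), obtained from [log_rem_bound] for finite sums by
    letting the tail tau tend to 0. *)
Lemma avg_log (z : R) : z <= 1 / 2 ->
  avg (fun n => toC (logpoly n).[z]) (toC (- ln (1 - z))).
Proof.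
move=> z2; pose d n := toC (- ln (1 - z) - (logpoly n).[z]).
have gl : growth (fun n => toC (logpoly n).[z]).
  have g1 : growth (fun r => toC (r.+1%:R^-1 * z ^+ r.+1)).
    exists `|z|, `|z|; split=> // n; rewrite -exprS nm_toC normrM normrX normfV normr_nat.
    by rewrite ler_piMl ?exprn_ge0 // invf_le1 // ler1n.
  apply: growth_ext (growth_psum g1) => n; rewrite -rmorph_sum; congr toC.
  by rewrite /logpoly horner_sum; apply: eq_bigr => r _; rewrite hornerZ hornerXn.
have gd : growth d.
  apply: growth_ext (growthD (growth_cst (toC (- ln (1 - z)))) (growthZ (-1) gl)) => n.
  by rewrite /d rmorphB mulN1r.
suff h : avg d 0.
  have := avgD (avg_cst (toC (- ln (1 - z)))) (avgZ (-1) h); rewrite mulr0 addr0.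
  by apply: avg_ext => n; rewrite /d mulN1r -rmorphN -rmorphD opprB addrC subrK.
apply: (@avg0_bound _ _ (2 * z ^+ 2)) => // x x0.
have fin : nm (egf d x) <= 2 * z ^+ 2 * expR (x / 2).
  apply/ler_addgt0Pr => e e0.
  (* It bounds a tail of the exponential series at |z| x, hence uniformly in |w| <= |z|; with this
     choice 2 z^2 tau <= e. *)
  pose tau := e / (2 * z ^+ 2 + 1).
  have z20 : 0 <= z ^+ 2 by rewrite sqr_ge0.
  have tau0 : 0 < tau by rewrite divr_gt0 //; lra.
  have b0 n : 0 <= (`|z| * x) ^+ n / n`!%:R by rewrite divr_ge0 // exprn_ge0 // mulr_ge0.
  have bs : bsum (fun n => (`|z| * x) ^+ n / n`!%:R) (expR (`|z| * x)).
    by move=> N; apply: exp_partial_le; rewrite mulr_ge0.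
  have [N HN] := bsum_tail b0 bs tau0.
  apply: (@nm_cvg_le _ _ \oo _ (fun n => series (fun n => d n * toC (x ^+ n / n`!%:R)) n)).
    exact (sums_cvg (egf_sums x gd)).
  exists N => // n /= Nn; rewrite seriesE.
  have -> : \sum_(i < n) d i * toC (x ^+ i / i`!%:R)
     = toC (\sum_(i < n) (- ln (1 - z) - (logpoly i).[z]) * (x ^+ i / i`!%:R)).
    by rewrite rmorph_sum; apply: eq_bigr => i _; rewrite [RHS]rmorphM.
  rewrite nm_toC; apply: le_trans (log_rem_bound (tau := tau) z2 x0 _) _.
    move=> w wz; rewrite -nm_toC rmorphB nmC.
    apply: (@nm_cvg_le _ _ \oo _ (fun m => series (expfps (toC (w * x))) m
        - toC (\sum_(i < n) (w * x) ^+ i / i`!%:R))).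
      exact (cvgKB (sums_cvg (sums_expfps_real (w * x))) (@cvgK_cst _ _ _ _ _)).
    exists n => // m /= nm'; rewrite seriesE -(subnKC nm') big_split_ord /=.
    have -> : \sum_(i < n) toC (w * x) ^+ i / i`!%:R = toC (\sum_(i < n) (w * x) ^+ i / i`!%:R).
      by rewrite rmorph_sum; apply: eq_bigr => i _; rewrite [RHS]rmorphM /= [in RHS]rmorphXn fmorphV rmorph_nat.
    rewrite addrAC subrr add0r; apply: le_trans (nm_sum _ _ _) _.
    apply: le_trans (ltW (HN (m - N)%N)).
    have -> : (m - N = (n - N) + (m - n))%N by clear -Nn nm'; lia.
    rewrite big_split_ord /=; apply: le_trans (_ : _ <= \sum_(i < m - n)
        (`|z| * x) ^+ (N + (n - N + i)) / (N + (n - N + i))`!%:R) _; last first.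
      by rewrite lerDr; apply: sumr_ge0.
    apply: ler_sum => i _; rewrite addnA subnKC // nmM nmX nmV nm_nat nm_toC ler_wpM2r ?invr_ge0 //.
    by apply: lerXn2r; rewrite ?nnegrE ?mulr_ge0 // normrM (ger0_norm x0) ler_wpM2r.
  rewrite mulrDr lerD2l /tau mulrA ler_pdivrMr; last by lra.
  by rewrite mulrC ler_wpM2l ?(ltW e0) //; lra.
apply: le_trans fin _; apply: ler_wpM2l; first by rewrite mulr_ge0 ?sqr_ge0.
by rewrite ler_expR; apply: ler_wpM2l => //; lra.
Qed.

End LogMean.

(** * Values of rational series at a point of (0, 1/2] *)

Section RationalValues.
Variable R : realType.
Notation C := (cplx R).
Implicit Types (l : seq R) (f g : fps C) (x : R).

Lemma fpoly_Dpoly l : fpoly (Dpoly l) = \prod_(q <- l) lin1 q.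
Proof.
rewrite /Dpoly rmorph_prod; apply: eq_bigr => q _; rewrite rmorphB rmorph1 /lin1.
by rewrite -mul_polyC rmorphM.
Qed.

Lemma growth_quot l f N : fpoly (Dpoly l) * f = fpoly N -> growth f.
Proof.
rewrite fpoly_Dpoly; have : growth (fpoly N) by exact: growth_fpoly.
move: (fpoly N) => h; elim: l f h => [|q l IH] f h gh; first by rewrite big_nil mul1r => ->.
rewrite big_cons -mulrA => e; apply: (IH _ (epoly 0 q * h)) => //.
  by apply: growth_conv => //; exact: growth_epoly.
by rewrite -e mulrA [epoly 0 q * _]mulrC epoly0 mul1r.
Qed.

Lemma fpoly_inj : injective (@fpoly C).
Proof. by move=> p q pq; apply/polyP => i; exact: (congr1 (fun f : fps C => f i) pq). Qed.

(** The value at x of the rational function with expansion f, through any representation. For 0 < x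
    <= 1 / 2 the denominators do not vanish and the value is unique; it turns identities of formal
    series into identities of Borel means. *)
Definition rval x f (v : C) := exists l N, [/\ all (fun r => r <= 1) l,
  fpoly (Dpoly l) * f = fpoly N & v = N.[toC x] / (Dpoly l).[toC x]].

Variable x : R.
Hypotheses (x0 : 0 < x) (xpow_two : x <= 1 / 2).

Lemma Dpoly_half l : all (fun r => r <= 1) l -> all (fun q => q <= 1 / 2) [seq r * x | r <- l].
Proof.
move=> /allP h; apply/allP => _ /mapP[r /h r1 ->].
by apply: le_trans xpow_two; rewrite ler_piMl // ltW.
Qed.

Lemma Dpoly_lprod l : (Dpoly l).[toC x] = lprod [seq r * x | r <- l].
Proof.
rewrite /Dpoly /lprod horner_prod big_map; apply: eq_bigr => r _.
by rewrite hornerD hornerN hornerZ hornerX hornerC rmorphM.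
Qed.

Lemma Dpoly_neq0 l : all (fun r => r <= 1) l -> (Dpoly l).[toC x] != 0.
Proof. by move=> h; rewrite Dpoly_lprod lprod_neq0 // Dpoly_half. Qed.

Lemma rval_uniq f v v' : rval x f v -> rval x f v' -> v = v'.
Proof.
move=> [l [N [hl e ->]]] [l' [N' [hl' e' ->]]]; apply/eqP.
rewrite eqr_div ?Dpoly_neq0 //; apply/eqP; rewrite -!hornerM; congr (_.[_]).
apply: fpoly_inj; rewrite !rmorphM /= -e -e' mulrAC [RHS]mulrAC; congr (_ * _).
exact: mulrC.
Qed.

Lemma rvalD f g v w : rval x f v -> rval x g w -> rval x (f + g) (v + w).
Proof.
move=> [l [N [hl e ->]]] [l' [N' [hl' e' ->]]].
exists (l ++ l'), (N * Dpoly l' + N' * Dpoly l); split; first by rewrite all_cat hl.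
  rewrite rmorphD !rmorphM /= -e -e' Dpoly_cat rmorphM /= mulrDr.
  congr (_ + _); first by rewrite mulrAC.
  by rewrite [RHS]mulrAC; congr (_ * _); exact: mulrC.
by rewrite addf_div ?Dpoly_neq0 // Dpoly_cat hornerD !hornerM.
Qed.

Lemma rvalM f g v w : rval x f v -> rval x g w -> rval x (f * g) (v * w).
Proof.
move=> [l [N [hl e ->]]] [l' [N' [hl' e' ->]]].
exists (l ++ l'), (N * N'); split; first by rewrite all_cat hl.
  by rewrite rmorphM /= -e -e' Dpoly_cat rmorphM /= mulrACA.
by rewrite mulf_div Dpoly_cat !hornerM.
Qed.

Lemma rval_fpoly N : rval x (fpoly N) N.[toC x].
Proof. by exists [::], N; rewrite /Dpoly big_nil rmorph1 mul1r hornerC divr1. Qed.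

Lemma rvalZ c f v : rval x f v -> rval x (fpC c * f) (c * v).
Proof. by move=> h; have := rvalM (rval_fpoly c%:P) h; rewrite hornerC. Qed.

Lemma rval_sum I (r : seq I) (P : pred I) (F : I -> fps C) (v : I -> C) :
  (forall i, P i -> rval x (F i) (v i)) ->
  rval x (\sum_(i <- r | P i) F i) (\sum_(i <- r | P i) v i).
Proof.
move=> h; elim/big_rec2: _ => [|i w g Pi]; last exact: rvalD (h i Pi).
by have := rval_fpoly 0; rewrite rmorph0 horner0.
Qed.

Lemma rval_avg f v : rval x f v -> avg (fun n => \sum_(i < n.+1) f i * toC x ^+ i) v.
Proof.
move=> [l [N [hl e ->]]].
pose N' := \poly_(i < size N) (toC x ^+ i * N`_i).
have -> : N.[toC x] = N'.[1].
  rewrite horner_poly horner_coef; apply: eq_bigr => i _.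
  by rewrite expr1n mulr1 mulrC.
rewrite Dpoly_lprod; apply: avg_ext (avg_rational (a := fscale (toC x) f) (Dpoly_half hl) _) => [n|].
  by apply: eq_bigr => i _ /=; rewrite mulrC.
have -> : fpoly N' = fscale (toC x) (fpoly N).
  apply: fpsP => n; rewrite /= coef_poly; case: ltnP => // h.
  by rewrite nth_default // mulr0.
rewrite -e rmorphM /=; congr (_ * _); rewrite fpoly_Dpoly rmorph_prod big_map.
apply: eq_bigr => q _; apply: fpsP => n.
transitivity (toC x ^+ n * lin1 q n); last by [].
exact: lin1_scale (erefl _).
Qed.

Lemma rval_sums f v s : rval x f v -> sums (fun n => f n * toC x ^+ n) s -> v = s.
Proof. move=> /rval_avg h /avg_sums h'; exact: avg_uniq h h'. Qed.

(** Borel means are sensitive to a shift of the index. Since W is summed from r = 1, a factor T is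
    divided out before the mean is taken. *)
Lemma rval_avgS f v : f 0%N = 0 -> rval x f v ->
  avg (fun n => \sum_(i < n.+1) f i.+1 * toC x ^+ i.+1) v.
Proof.
move=> f0 [l [N [hl e vE]]].
have fE : f = fpX * Fps (fun n => f n.+1) by apply: fpsP => -[|n]; rewrite fpnXM.
have /factor_theorem [N' eN] : root N 0.
  by rewrite rootE horner_coef0 -[N`_0]/(fpoly N 0%N) -e fpnM0 f0 mulr0.
have e' : fpoly (Dpoly l) * Fps (fun n => f n.+1) = fpoly N'.
  apply: (@fpX_inj C) => /=; rewrite mulrCA -fE e eN polyC0 subr0 rmorphM /=.
  exact: mulrC.
have h : rval x (Fps (fun n => f n.+1)) (N'.[toC x] / (Dpoly l).[toC x]) by exists l, N'.
have := avgZ (toC x) (rval_avg h).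
have -> : toC x * (N'.[toC x] / (Dpoly l).[toC x]) = v.
  by rewrite vE eN hornerM hornerXsubC subr0 mulrA [toC x * _]mulrC.
apply: avg_ext => n; rewrite mulr_sumr; apply: eq_bigr => i _ /=.
by rewrite mulrCA exprS.
Qed.

End RationalValues.

Section BorelPrimes.
Variable R : realType.
Notation C := (cplx R).

Lemma geom_half N : \sum_(i < N) (1 / 2 : R) ^+ i <= 2.
Proof.
suff -> : \sum_(i < N) (1 / 2 : R) ^+ i = 2 - 2 * (1 / 2) ^+ N.
  by rewrite gerBl mulr_ge0 // exprn_ge0 // divr_ge0.
elim: N => [|N IH]; first by rewrite big_ord0 expr0; field.
by rewrite big_ord_recr /= IH exprS; field.
Qed.

(* For the finitely many small primes the series in r need not converge and is
   summed by Borel means; for the others the double series over r and p is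
   absolutely convergent. *)
Lemma borel_primes (ell c G v : nat -> C) (M2 : R) :
  growth G ->
  bsum (fun p => if prime p then nm (ell p) / p%:R ^+ 2 else 0) M2 ->
  (forall r, (0 < r)%N ->
     sums (fun p => if prime p then ell p * (p%:R^-1) ^+ r.+1 else 0) (c r)) ->
  (forall p, prime p -> avg (fun n => \sum_(i < n.+1) G i * (p%:R^-1) ^+ i.+1) (v p)) ->
  exists2 S, sums (fun p => if prime p then ell p * (v p - G 0%N / p%:R) else 0) S &
    avg (fun n => \sum_(i < n.+1) G i * c i) (G 0%N * c 0%N + S).
Proof.
move=> gG bM hc hv; have [K [M [K0 M0 GM]]] := gG.
(* For p >= n0 one has M / p <= 1 / 2, and the series in r is dominated by a geometric one of ratio
   1 / 2. *)
pose n0 := (Num.truncn (2 * M)).+2.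
have n0M p : (n0 <= p)%N -> 2 * M <= p%:R.
  move=> h; apply: le_trans (ltW (truncnS_gt _)) _.
  by rewrite ler_nat; apply: leq_trans h; rewrite /n0.
have n0p p : (n0 <= p)%N -> (0 : R) < p%:R by move=> h; rewrite ltr0n; apply: leq_trans h.
pose a p i : C := if prime p && (n0 <= p)%N && (0 < i)%N then ell p * (G i * (p%:R^-1) ^+ i.+1) else 0.
pose b (p : nat) : R := 2 * K * M * (if prime p then nm (ell p) / p%:R ^+ 2 else 0).
have term p i : (n0 <= p)%N -> nm (G i.+1 * (p%:R^-1) ^+ i.+2) <= K * M / p%:R ^+ 2 * (1 / 2) ^+ i.
  move=> np; have p0 := n0p p np; rewrite nmM nmX nmV nm_nat.
  apply: le_trans (ler_wpM2r _ (GM i.+1)) _; first by rewrite exprn_ge0 // invr_ge0 ltW.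
  have -> : K * M ^+ i.+1 * p%:R^-1 ^+ i.+2 = K * M / p%:R ^+ 2 * (M / p%:R) ^+ i.
    by rewrite exprMn !exprS expr0 mulr1 invfM; ring.
  apply: ler_wpM2l; first by rewrite mulr_ge0 ?mulr_ge0 // invr_ge0 exprn_ge0 // ltW.
  apply: lerXn2r; rewrite ?nnegrE ?divr_ge0 ?(ltW p0) //.
  by rewrite ler_pdivrMr //; have := n0M p np; lra.
have rows p : bsum (fun i => nm (a p i)) (b p).
  move=> [|N].
    rewrite big_ord0 /b !mulr_ge0 //; case: ifP => // _.
    by rewrite divr_ge0 ?nm_ge0 // exprn_ge0.
  rewrite big_ord_recl /a andbF nm0 add0r /b.
  case: (boolP (prime p)) => pp; last by rewrite big1 ?mulr0 // => i _; rewrite nm0.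
  have [np|np] := leqP n0 p; last first.
    rewrite big1 => [|i _]; last by rewrite nm0.
    by rewrite !mulr_ge0 ?nm_ge0 // invr_ge0 exprn_ge0.
  apply: le_trans (_ : \sum_(i < N) nm (ell p) * (K * M / p%:R ^+ 2) * (1 / 2) ^+ i <= _).
    apply: ler_sum => i _; rewrite nmM -mulrA ler_wpM2l ?nm_ge0 //; exact: term.
  rewrite -mulr_sumr; apply: le_trans (ler_wpM2l _ (geom_half N)) _.
    by rewrite !mulr_ge0 ?nm_ge0 // invr_ge0 exprn_ge0.
  by rewrite le_eqVlt; apply/orP; left; apply/eqP; ring.
have bB : bsum b (2 * K * M * M2).
  by move=> N; rewrite -mulr_sumr; apply: ler_wpM2l; [rewrite !mulr_ge0|exact: bM].
pose r p : C := if prime p && (n0 <= p)%N then ell p * (v p - G 0%N / p%:R) else 0.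
have rS p : sums (a p) (r p).
  rewrite /a /r; case: (boolP (prime p && (n0 <= p)%N)) => [/andP[pp np]|_]; last exact: sums0.
  have bs : bsum (fun i => nm (G i.+1 * (p%:R^-1) ^+ i.+2)) (K * M / p%:R ^+ 2 * 2).
    move=> N; apply: le_trans (ler_sum _ (fun (i : 'I_N) _ => term p i np)) _.
    rewrite -mulr_sumr ler_wpM2l ?geom_half // !mulr_ge0 // invr_ge0 exprn_ge0 //.
  have [w wS _] := sums_abs bs.
  have vE : v p = G 0%N * p%:R^-1 ^+ 1 + w.
    exact: avg_uniq (hv p pp) (avg_sums ((sums_shift (fun i => G i * p%:R^-1 ^+ i.+1) w).1 wS)).
  rewrite vE expr1 addrAC subrr add0r -[ell p * w]add0r.
  by apply/sums_shift => /=; apply: sums_ext (sumsZ (ell p) wS) => i.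
have [sg sgS _] : exists2 l, sums r l & nm l <= 2 * K * M * M2.
  apply: sums_abs => N; apply: le_trans (bB N); apply: ler_sum => p _.
  by apply: (sums_nm_le (rS p)) => n; apply: le_trans (nm_sum _ _ _) (rows p n).
pose small (i : nat) : C := \sum_(p < n0 | prime p) ell p * (p%:R^-1) ^+ i.+1.
pose c' i : C := if (0 < i)%N then G i * (c i - small i) else 0.
have colS i : sums (a ^~ i) (c' i).
  rewrite /a /c'; case: (posnP i) => [->|i0].
    by apply: (sums_ext _ (@sums0 R)) => p; rewrite andbF.
  have sm : sums (fun p => if prime p && (p < n0)%N then ell p * (p%:R^-1) ^+ i.+1 else 0) (small i).
    have := @sums_finite R (fun p => if prime p && (p < n0)%N then ell p * (p%:R^-1) ^+ i.+1 else 0) n0.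
    rewrite /small (eq_bigr (fun p : 'I_n0 => if prime p then ell p * (p%:R^-1) ^+ i.+1 else 0)).
      by rewrite -big_mkcond; apply => n nn0; rewrite ltnNge nn0 andbF.
    by move=> p _; rewrite ltn_ord andbT.
  apply: sums_ext (sumsZ (G i) (sumsD (hc i i0) (sumsN sm))) => p.
  rewrite andbT; case: (prime p) => /=; last by rewrite subr0 mulr0.
  by rewrite ltnNge; case: leqP => _ /=; rewrite ?subr0 ?subrr ?mulr0 // mulrCA.
have cS := fubini_sums rows bB rS colS sgS.
pose q p : C := ell p * (v p - G 0%N / p%:R).
exists (\sum_(p < n0 | prime p) q p + sg).
  have sm : sums (fun p => if prime p && (p < n0)%N then q p else 0) (\sum_(p < n0 | prime p) q p).
    have := @sums_finite R (fun p => if prime p && (p < n0)%N then q p else 0) n0.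
    rewrite (eq_bigr (fun p : 'I_n0 => if prime p then q p else 0)).
      by rewrite -big_mkcond; apply => n nn0; rewrite ltnNge nn0 andbF.
    by move=> p _; rewrite ltn_ord andbT.
  apply: sums_ext (sumsD sm sgS) => p; rewrite /r /q; case: (prime p) => /=; last by rewrite addr0.
  by rewrite ltnNge; case: leqP => _ /=; rewrite ?addr0 ?add0r.
have fin : avg (fun n => \sum_(p < n0) (if prime p then ell p else 0) * \sum_(i < n.+1) G i * (p%:R^-1) ^+ i.+1)
    (\sum_(p < n0) (if prime p then ell p else 0) * (if prime p then v p else 0)).
  apply: avg_sum => p; case: ifP => pp; last first.
    by apply: avg_ext (avg_cst (0 * 0)) => n; rewrite !mul0r.
  exact: avgZ (hv p pp).
have := avgD (avgD (avg_sums cS) (avg_cst (G 0%N * (c 0%N - small 0%N)))) fin.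
have -> : sg + G 0%N * (c 0%N - small 0%N)
   + \sum_(p < n0) (if prime p then ell p else 0) * (if prime p then v p else 0)
   = G 0%N * c 0%N + (\sum_(p < n0 | prime p) q p + sg).
  have -> : \sum_(p < n0) (if prime p then ell p else 0) * (if prime p then v p else 0)
     = \sum_(p < n0 | prime p) q p + G 0%N * small 0%N.
    rewrite /small mulr_sumr -big_split /= [RHS]big_mkcond; apply: eq_bigr => p _.
    by case: ifP => _; rewrite ?mul0r // /q expr1 mulrBr mulrCA subrK.
  rewrite mulrBr; set u := \sum_(p < n0 | _) _; set w := G 0%N * small _; set z := G 0%N * _.
  by rewrite addrACA subrK addrC; congr (_ + _); exact: addrC.
apply: avg_ext => n.
have -> : \sum_(p < n0) (if prime p then ell p else 0) * \sum_(i < n.+1) G i * p%:R^-1 ^+ i.+1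
   = \sum_(i < n.+1) G i * small i.
  under eq_bigr do rewrite mulr_sumr.
  rewrite exchange_big; apply: eq_bigr => i _; rewrite /small mulr_sumr [RHS]big_mkcond.
  by apply: eq_bigr => p _; case: ifP => _; rewrite ?mul0r // mulrCA.
rewrite big_ord_recl [X in _ + X = _]big_ord_recl [RHS]big_ord_recl /= /c' /=.
rewrite add0r mulrBr [X in _ + X = _]addrC addrACA subrK addrC; congr (_ + _).
by rewrite -big_split; apply: eq_bigr => i _; rewrite /= mulrBr subrK.
Qed.

End BorelPrimes.

(** * Dirichlet series and the constants C_r(n) *)

Lemma mulr_perm4 (B : comNzRingType) (u f v w : B) : u * f * v * w = v * (w * u * f).
Proof. ring. Qed.

Lemma sumsZr (R : realType) (c : cplx R) (a : nat -> cplx R) l :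
  sums a l -> sums (fun n => a n * c) (l * c).
Proof. by move=> h; rewrite mulrC; apply: sums_ext (sumsZ c h) => n; exact: mulrC. Qed.

Lemma mulr_perm5 (B : comNzRingType) (x v f w : B) : x * v * f * w = x * (v * w * f).
Proof. ring. Qed.

Section Npow.
Variable R : realType.
Notation C := (cplx R).
Implicit Types (s : C) (n p : nat) (x : R).

Lemma reM_toC s x : re (s * toC x) = re s * x.
Proof. by rewrite reM im_toC mulr0 subr0 re_toC. Qed.

Lemma nm_npow n s : nm (npow n s) = expR (re s * ln n%:R).
Proof. by rewrite /npow nm_cexp reM_toC. Qed.

Lemma npowD n s t : npow n (s + t) = npow n s * npow n t.
Proof. by rewrite /npow mulrDl cexpD. Qed.

Lemma npowM m n s : (0 < m)%N -> (0 < n)%N -> npow (m * n) s = npow m s * npow n s.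
Proof.
move=> m0 n0; rewrite /npow natrM lnM ?posrE ?ltr0n // rmorphD mulrDr; exact: cexpD.
Qed.

Lemma npow_nat n r : (0 < n)%N -> npow n (- r%:R : C) = (n%:R^-1) ^+ r.
Proof.
move=> n0; rewrite /npow -(rmorph_nat (@toC R)) -rmorphN -rmorphM cexp_toC.
rewrite mulNr -mulrN -lnV ?posrE ?ltr0n // expRM_natl lnK ?posrE ?invr_gt0 ?ltr0n //.
by rewrite rmorphXn fmorphV rmorph_nat.
Qed.

Lemma ln_nat_ge0 n : 0 <= ln (n%:R : R).
Proof. by case: n => [|n]; [rewrite ln0|rewrite ln_ge0 // ler1n]. Qed.

(** An elementary integral test for n^-(1 + eta), from e^u >= 1 + u and ln (1 + u) <= u. *)
Lemma pow_decr (eta : R) n : 0 < eta -> (0 < n)%N ->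
  eta * expR (- (1 + eta) * ln n.+1%:R) <= expR (- eta * ln n%:R) - expR (- eta * ln n.+1%:R).
Proof.
move=> eta0 n0; have N0 : (0 : R) < n.+1%:R by rewrite ltr0n.
have n0' : (0 : R) < n%:R by rewrite ltr0n.
have -> : - (1 + eta) * ln n.+1%:R = - ln (n.+1%:R : R) + - eta * ln n.+1%:R by ring.
rewrite expRD expRN lnK ?posrE // mulrA -lerBDr opprK -[X in _ + X]mul1r -mulrDl.
have -> : - eta * ln n%:R = eta * - ln (n%:R / n.+1%:R) + - eta * ln (n.+1%:R : R).
  by rewrite lnM ?posrE ?invr_gt0 // lnV ?posrE //; ring.
rewrite expRD ler_wpM2r ?expR_ge0 //.
apply: le_trans (expR_ge1Dx _); rewrite addrC lerD2l ler_wpM2l ?(ltW eta0) //.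
have -> : n%:R / n.+1%:R = 1 + - (n.+1%:R)^-1 :> R.
  by rewrite -[n%:R](addrK 1) natr1 mulrBl mulfV ?lt0r_neq0 // mul1r.
by rewrite lerNr; apply: le_ln1Dx; rewrite ltrN2 invf_lt1 // ltr1n.
Qed.

Lemma bsum_pow (eta : R) : 0 < eta ->
  bsum (fun n => if (0 < n)%N then expR (- (1 + eta) * ln n%:R) else 0) (1 + eta^-1).
Proof.
move=> eta0 N; apply: le_trans (_ : \sum_(n < N.+2) (if (0 < n)%N then expR (- (1 + eta) * ln n%:R) else 0 : R) <= _).
  by rewrite !big_ord_recr /= -addrA lerDl addr_ge0 //; case: ifP => _ //; rewrite expR_ge0.
rewrite 2!big_ord_recl /= add0r ln1 mulr0 expR0 lerD2l.
rewrite -(ler_pM2l eta0) mulfV ?lt0r_neq0 // mulr_sumr.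
suff : \sum_(i < N) eta * expR (- (1 + eta) * ln i.+2%:R)
    <= expR (- eta * ln 1%:R) - expR (- eta * ln (N.+1%:R : R)).
  by move=> h; apply: le_trans h _; rewrite ln1 mulr0 expR0 gerBl expR_ge0.
elim: N => [|N IH]; first by rewrite big_ord0 subrr.
rewrite big_ord_recr /=; apply: le_trans (lerD IH (pow_decr eta0 (ltn0Sn N))) _.
by rewrite addrA subrK.
Qed.

Definition psum_ (f : nat -> C) p : C := if prime p then f p else 0.

Lemma bsum_npow s : 1 < re s -> exists M,
  bsum (fun n => if (0 < n)%N then nm (npow n (- s)) else 0) M.
Proof.
move=> s1; have e0 : 0 < re s - 1 by rewrite subr_gt0.
eexists; apply: bsum_le (bsum_pow e0) => n; case: ifP => // _.
by rewrite nm_npow reN (_ : 1 + (re s - 1) = re s) //; ring.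
Qed.

Lemma pz_abs s : 1 < re s -> exists M, bsum (fun p => nm (psum_ (fun p => npow p (- s)) p)) M.
Proof.
move=> /bsum_npow [M hM]; exists M; apply: bsum_le hM => p; rewrite /psum_.
case: (boolP (prime p)) => [/prime_gt0 -> //|_]; rewrite nm0.
by case: ifP => // _; apply: nm_ge0.
Qed.

Lemma pz_sums s : 1 < re s -> sums (psum_ (fun p => npow p (- s))) (prime_zeta s).
Proof.
move=> /pz_abs [M hM]; have [l hl _] := sums_abs hM.
suff -> : prime_zeta s = l by [].
rewrite -(sums_lim hl) /prime_zeta; congr (limn _); apply/funext => n.
by rewrite seriesE big_mkcond.
Qed.

Lemma lnX_le n e : (ln (n%:R : R)) ^+ e / e`!%:R <= 2 ^+ e * expR (ln n%:R / 2).
Proof.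
have h0 : 0 <= ln (n%:R : R) / 2 by rewrite divr_ge0 // ln_nat_ge0.
have h : (ln (n%:R : R) / 2) ^+ e / e`!%:R <= expR (ln n%:R / 2).
  apply: le_trans (exp_partial_le e.+1 h0); rewrite big_ord_recr /= lerDr.
  by apply: sumr_ge0 => i _; rewrite divr_ge0 // exprn_ge0.
apply: le_trans (ler_wpM2l _ h); last by rewrite exprn_ge0.
by rewrite mulrA -exprMn mulrC [2 * _]mulrC mulfVK // mulrC.
Qed.

(** The Taylor coefficients of p^(-s) at s = 0. *)
Definition ell e p : C := (- toC (ln p%:R)) ^+ e / e`!%:R.

Lemma nm_ell e p : nm (ell e p) = (ln (p%:R : R)) ^+ e / e`!%:R.
Proof. by rewrite /ell nmM nmX nmN nm_toC nmV nm_nat ger0_norm // ln_nat_ge0. Qed.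

Lemma bsum_ell e : exists M : R, bsum (fun p => if prime p then nm (ell e p) / p%:R ^+ 2 else 0) M.
Proof.
have h2 : (0 : R) < 1 / 2 by rewrite divr_gt0.
exists (2 ^+ e * (1 + (1 / 2)^-1)) => N.
apply: le_trans (ler_wpM2l _ (bsum_pow h2 N)); last by rewrite exprn_ge0.
rewrite mulr_sumr; apply: ler_sum => p _; case: ifP => pp; last first.
  by case: ifP => _; rewrite ?mulr0 // mulr_ge0 ?exprn_ge0 ?expR_ge0.
have p0 := prime_gt0 pp; rewrite p0 nm_ell.
apply: le_trans (ler_wpM2r _ (lnX_le p e)) _; first by rewrite invr_ge0 exprn_ge0.
rewrite -mulrA ler_wpM2l ?exprn_ge0 //.
have -> : (p%:R ^+ 2)^-1 = expR (- (2 * ln (p%:R : R))).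
  by rewrite expRN expRM_natl lnK // posrE ltr0n.
by rewrite -expRD ler_expR; lra.
Qed.

Lemma near0_ball (P : C -> Prop) : (exists2 e : R, 0 < e & forall s, nm s < e -> P s) ->
  \forall s \near (0 : C), P s.
Proof.
move=> [e e0 h]; have h0 : (id @ nbhs (0 : C)) --> (0 : C) by exact: cvg_id.
have /cvgCP := h0 => /(_ e e0); apply: filterS => s; rewrite subr0; exact: h.
Qed.

Lemma ball_near0 (P : C -> Prop) : (\forall s \near (0 : C), P s) ->
  exists2 e : R, 0 < e & forall s, nm s < e -> P s.
Proof.
move=> /nbhs_ballP [e /= e0 h]; have er : toC (re e) = e.
  by apply: complex_eq; rewrite // im_toC; have /ltW/ger0_Im := e0.
exists (re e); first by rewrite -toC_lt er rmorph0.
move=> s se; apply: h; rewrite -ball_normE /= sub0r normrN normE.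
by rewrite -er toC_lt.
Qed.

Definition Chigh r n : C := limn (series (psum_ (fun p => ell n p * (p%:R^-1) ^+ r))).

Lemma Chigh_sums r n : (2 <= r)%N ->
  sums (psum_ (fun p => ell n p * (p%:R^-1) ^+ r)) (Chigh r n).
Proof.
move=> r2; have [M hM] := bsum_ell n.
have [|l hl _] := @sums_abs _ (psum_ (fun p => ell n p * (p%:R^-1) ^+ r)) M.
  apply: bsum_le hM => p; rewrite /psum_; case: ifP => pp; last by rewrite nm0.
  rewrite nmM nmX nmV nm_nat ler_wpM2l ?nm_ge0 // -exprVn.
  apply: ler_wiXn2l => //; rewrite ?invr_ge0 // invf_le1 ?ltr0n ?prime_gt0 //.
  by rewrite ler1n prime_gt0.
by rewrite /Chigh (sums_lim hl).
Qed.

(** Expand p^(-s) and exchange the sums over p and n. The double series is dominated by the prime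
    zeta function at r - |s|, which exceeds 1 for |s| < 1 / 2. *)
Lemma Chigh_coefs r : (2 <= r)%N -> is_prime_zeta_coefs r (Chigh r).
Proof.
move=> r2; apply: near0_ball; exists (1 / 2); first by rewrite divr_gt0.
move=> s s2 _; rewrite (_ : r == 1%N = false) ?addr0; last by case: r r2 => [|[|]].
have rs : 1 < re (r%:R + s).
  have := re_le_nm s; rewrite reD re_nat ler_norml => /andP[h _].
  have : (2 : R) <= r%:R by rewrite ler_nat.
  by lra.
suff : sums (fun n => Chigh r n * s ^+ n) (prime_zeta (r%:R + s)) by case.
pose a p n : C := psum_ (fun p => ell n p * (p%:R^-1) ^+ r * s ^+ n) p.
pose t : C := toC (r%:R - nm s).
have r2' : (2 : R) <= r%:R by rewrite ler_nat.
have t1 : 1 < re t by rewrite re_toC; lra.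
have [M hM] := pz_abs t1.
have rowE p n : prime p -> a p n = (p%:R^-1) ^+ r * expfps (- s * toC (ln p%:R)) n.
  move=> pp; rewrite /a /psum_ pp /ell /= mulNr -mulrN exprMn; exact: mulr_perm4.
apply: (@fubini_sums _ a (fun p => nm (psum_ (fun p => npow p (- t)) p)) M
   (psum_ (fun p => npow p (- (r%:R + s))))) => //.
- move=> p; rewrite /psum_; case: (boolP (prime p)) => pp; last first.
    by move=> N; rewrite big1 ?nm0 // => i _; rewrite /a /psum_ (negPf pp) nm0.
  move=> N; rewrite nm_npow reN re_toC opprB mulrBl expRD.
  under eq_bigr do rewrite (rowE p _ pp) nmM nmX nmV nm_nat.
  rewrite -mulr_sumr mulrC; apply: ler_pM.
  + by apply: sumr_ge0 => i _; apply: nm_ge0.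
  + by rewrite exprn_ge0 // invr_ge0.
  + apply: le_trans (l1_expfps _ N) _.
    by rewrite ler_expR nmM nmN nm_toC ger0_norm ?ln_nat_ge0.
  + rewrite -mulNr mulNr -mulrN -lnV ?posrE ?ltr0n ?prime_gt0 // expRM_natl lnK //.
    by rewrite posrE invr_gt0 ltr0n prime_gt0.
- move=> p; rewrite /psum_; case: (boolP (prime p)) => pp; last first.
    by apply: (sums_ext _ (@sums0 R)) => n; rewrite /a /psum_ (negPf pp).
  rewrite opprD npowD npow_nat ?prime_gt0 //.
  by apply: sums_ext (sumsZ _ (sums_expfps (- s * toC (ln p%:R)))) => n; rewrite rowE.
- move=> n; apply: sums_ext (sumsZr (s ^+ n) (Chigh_sums n r2)) => p.
  by rewrite /a /psum_; case: ifP => _; rewrite ?mul0r.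
- exact: pz_sums.
Qed.

End Npow.

Section Uniqueness.
Variable R : realType.
Notation C := (cplx R).

Lemma sums_bounded (a : nat -> C) l : sums a l -> exists2 K : R, 0 <= K & forall n, nm (a n) <= K.
Proof.
move=> /sumsP /(_ 1 ltr01) [N HN].
have S0 : 0 <= \sum_(i < N) nm (a i) by apply: sumr_ge0 => i _; apply: nm_ge0.
exists (2 + \sum_(i < N) nm (a i)); first by rewrite addr_ge0.
move=> n; have [Nn|nN] := leqP N n; last first.
  rewrite (bigD1 (Ordinal nN)) //= addrCA lerDl addr_ge0 //.
  by apply: sumr_ge0 => i _; apply: nm_ge0.
have h1 := HN n Nn; have := HN n.+1 (leqW Nn); rewrite big_ord_recr /= => h2.
have -> : a n = (\sum_(i < n) a i + a n - l) - (\sum_(i < n) a i - l).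
  by rewrite opprB addrA subrK addrC addKr.
apply: le_trans (nmB _ _) _; lra.
Qed.

Lemma sums_unshift j (c : nat -> C) l : (forall n, (n < j)%N -> c n = 0) ->
  sums c l -> sums (fun n => c (j + n)%N) l.
Proof.
elim: j c => [|j IH] c c0 h; first by apply: sums_ext h => n.
have h' : sums (fun n => c n.+1) l by apply/sums_shift; rewrite c0 // add0r.
exact: (IH (fun n => c n.+1) (fun n nj => c0 n.+1 nj) h').
Qed.

(** Only real positive points are tested, because for r = 1 the expansion is prescribed only where
    Re s > 0. The first coefficient not known to vanish is bounded by A x for all small x. *)
Lemma ps_uniq (d : nat -> C) (e : R) : 0 < e ->
  (forall x, 0 < x < e -> sums (fun n => d n * toC x ^+ n) 0) -> forall n, d n = 0.
Proof.
move=> e0 h; pose x0 := e / 2; have x00 : 0 < x0 by rewrite divr_gt0.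
have x0e : 0 < x0 < e by rewrite x00 /x0 /=; lra.
have [K K0 dK] := sums_bounded (h x0 x0e).
have dB n : nm (d n) <= K * (x0^-1) ^+ n.
  rewrite -[leLHS](@mulfK _ (x0 ^+ n)); last by rewrite expf_neq0 // lt0r_neq0.
  rewrite exprVn ler_wpM2r ?invr_ge0 ?exprn_ge0 ?(ltW x00) //.
  by have := dK n; rewrite nmM nmX nm_toC gtr0_norm.
elim/ltn_ind => n IH; apply/eqP; rewrite -nm_eq0 eq_le nm_ge0 andbT.
pose A := 2 * K * x0^-1 ^+ n.+1.
have A0 : 0 <= A by rewrite !mulr_ge0 // exprn_ge0 // invr_ge0 ltW.
have bd x : 0 < x -> x <= x0 / 2 -> nm (d n) <= A * x.
  move=> xp xx0; have xe : 0 < x < e by rewrite xp /=; move: xx0; rewrite /x0; lra.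
  have c0 m : (m < n)%N -> d m * toC x ^+ m = 0 by move=> mn; rewrite IH // mul0r.
  have h1 := sums_unshift c0 (h x xe).
  have x1 : toC x ^+ n != 0.
    by rewrite expf_neq0 // -(rmorph0 (@toC R)) (inj_eq (@toC_inj R)) lt0r_neq0.
  have h2 : sums (fun m => d (n + m.+1)%N * toC x ^+ m.+1) (- d n).
    apply/(sums_shift (fun m => d (n + m)%N * toC x ^+ m)).
    rewrite addn0 expr0 mulr1 subrr.
    have := sumsZ (toC x ^+ n)^-1 h1; rewrite mulr0; apply: sums_ext => m.
    by rewrite exprD mulrCA mulKf.
  rewrite -nmN; apply: (sums_nm_le h2) => N; apply: le_trans (nm_sum _ _ _) _.
  apply: le_trans (_ : \sum_(i < N) K * x0^-1 ^+ n.+1 * x * (1 / 2) ^+ i <= _).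
    apply: ler_sum => i _; rewrite nmM nmX nm_toC gtr0_norm //.
    apply: le_trans (ler_wpM2r _ (dB _)) _; first by rewrite exprn_ge0 // ltW.
    have -> : K * x0^-1 ^+ (n + i.+1) * x ^+ i.+1 = K * x0^-1 ^+ n.+1 * x * (x / x0) ^+ i.
      by rewrite addnS -addSn exprD [(x / x0) ^+ i]exprMn [x ^+ i.+1]exprS; ring.
    apply: ler_wpM2l.
      by rewrite !mulr_ge0 ?exprn_ge0 ?invr_ge0 // ltW.
    apply: lerXn2r; rewrite ?nnegrE ?divr_ge0 ?(ltW x00) ?(ltW xp) ?(ltW e0) //.
    by rewrite ler_pdivrMr // mulrC mul1r.
  rewrite -mulr_sumr; apply: le_trans (ler_wpM2l _ (geom_half R N)) _.
    by rewrite !mulr_ge0 ?exprn_ge0 ?invr_ge0 // ltW.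
  by rewrite /A le_eqVlt; apply/orP; left; apply/eqP; ring.
apply/ler_addgt0Pr => eps eps0; rewrite add0r.
pose x := Num.min (x0 / 2) (eps / (A + 1)).
have A1 : 0 < A + 1 by rewrite ltr_wpDl.
have xp : 0 < x by rewrite lt_min !divr_gt0.
apply: le_trans (bd x xp _) _; first by rewrite ge_min lexx.
apply: le_trans (_ : A * (eps / (A + 1)) <= _).
  by rewrite ler_wpM2l // ge_min lexx orbT.
by rewrite mulrA ler_pdivrMr // mulrC ler_wpM2l ?(ltW eps0) // lerDl.
Qed.

Lemma Ccoef_eq r (c : nat -> C) : is_prime_zeta_coefs r c -> Ccoef R r = c.
Proof.
move=> hc; have hC : is_prime_zeta_coefs r (Ccoef R r).
  exact: (@xgetPex _ (fun=> 0) [set c | is_prime_zeta_coefs r c] (ex_intro _ c hc)).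
have [e1 e10 h1] := ball_near0 hC; have [e2 e20 h2] := ball_near0 hc.
apply/funext => n; apply/eqP; rewrite -subr_eq0; apply/eqP; move: n.
apply: (@ps_uniq (fun n => Ccoef R r n - c n) (Num.min e1 e2)).
  by rewrite lt_min e10.
move=> x /andP[x0]; rewrite lt_min => /andP[xe1 xe2].
have nx : nm (toC x) = x by rewrite nm_toC gtr0_norm.
have r0 : r = 1%N -> 0 < re (toC x) by rewrite re_toC.
have k1 := h1 (toC x); rewrite nx in k1; have k2 := h2 (toC x); rewrite nx in k2.
have := sumsD (Sums (k1 xe1 r0)) (sumsN (Sums (k2 xe2 r0))); rewrite subrr.
by apply: sums_ext => n; rewrite mulrBl.
Qed.

Lemma Ccoef_high r n : (2 <= r)%N -> Ccoef R r n = Chigh R r n.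
Proof. by move=> r2; rewrite (Ccoef_eq (@Chigh_coefs R r r2)). Qed.

End Uniqueness.

(** * The zeta function near its pole *)

Section Zeta.
Variable R : realType.
Notation C := (cplx R).

Definition zeta (z : C) : C := limn (series (fun n => npow n.+1 (- z))).

Lemma zeta_abs (z : C) : 1 < re z -> exists M, bsum (fun n => nm (npow n.+1 (- z))) M.
Proof.
move=> /bsum_npow [M hM]; exists M => N; apply: le_trans (hM N.+1).
by rewrite big_ord_recl /= add0r.
Qed.

Lemma zeta_sums (z : C) : 1 < re z -> sums (fun n => npow n.+1 (- z)) (zeta z).
Proof.
by move=> /zeta_abs [M hM]; have [l hl _] := sums_abs hM; rewrite /zeta (sums_lim hl).
Qed.

Lemma expR_small (sig e : R) : 0 < sig -> 0 < e ->
  exists N, forall n, (N <= n)%N -> expR (- sig * ln (n.+1%:R)) < e.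
Proof.
move=> s0 e0; exists (Num.truncn (expR (- ln e / sig))) => n Nn.
have h : expR (- ln e / sig) < n.+1%:R.
  by apply: lt_le_trans (truncnS_gt _) _; rewrite ler_nat ltnS.
have : - ln e / sig < ln (n.+1%:R : R).
  by rewrite -[ltLHS](expRK) ltr_ln // posrE ?expR_gt0 // ltr0n.
rewrite ltr_pdivrMr // => h2; rewrite -[ltRHS](@lnK _ e) ?posrE // ltr_expR mulrC mulrN.
by rewrite ltrNl.
Qed.

Lemma npow_telescope (s : C) : 0 < re s ->
  sums (fun n => npow n.+1 (- s) - npow n.+2 (- s)) 1.
Proof.
move=> s0; apply/sumsP => e e0; have [N HN] := expR_small s0 e0.
exists N => n Nn; have -> : \sum_(i < n) (npow i.+1 (- s) - npow i.+2 (- s)) = 1 - npow n.+1 (- s).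
  elim: n {Nn} => [|n IH].
    by rewrite big_ord0 /npow ln1 rmorph0 mulr0 cexp0 subrr.
  by rewrite big_ord_recr /= IH addrA subrK.
by rewrite addrAC subrr add0r nmN nm_npow reN; apply: HN.
Qed.

(* The terms n^-s (s / n - 1 + (1 + 1 / n)^-s), as power series in s; they sum
   to s zeta(1 + s) - 1. *)
Definition zterm n : fps C :=
  expfps (- toC (ln n.+1%:R)) * (fpC (n.+1%:R^-1) * fpX - 1 + expfps (- toC (ln (n.+2%:R / n.+1%:R)))).

Lemma expfps_scale (z w : C) : fscale w (expfps z) = expfps (z * w).
Proof. by apply: fpsP => j; rewrite /= exprMn; rewrite mulrA [w ^+ j * _]mulrC. Qed.

Lemma fscale_lin (c w : C) : fscale w (fpC c * fpX - 1) = fpC (c * w) * fpX - 1.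
Proof.
apply: fpsP => j; transitivity (w ^+ j * (fpC c * fpX - 1) j) => //.
rewrite !fpnB !fpnCM !fpn1 /= !coefX; case: j => [|[|j]] /=.
- by rewrite !mulr0 expr0 mul1r.
- by rewrite !mulr1 !subr0 expr1 mulrC.
- by rewrite !mulr0 subr0 mulr0.
Qed.

Lemma sums_fps1 : sums (1 : fps C) 1.
Proof.
have := @sums_finite R (1 : fps C) 1; rewrite big_ord1 fpn1.
by apply=> -[|j] // _; rewrite fpn1.
Qed.

Lemma sums_fpX (c : C) : sums (fpC c * fpX) c.
Proof.
have := @sums_finite R (fpC c * fpX) 2; rewrite !big_ord_recl big_ord0 !fpnCM /= !coefX /=.
rewrite mulr0 add0r addr0 mulr1.
by apply=> -[|[|j]] // _; rewrite fpnCM /= coefX mulr0.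
Qed.

Lemma l1_abs (f : fps C) N (M : R) : (forall j, (N <= j)%N -> f j = 0) ->
  \sum_(j < N) nm (f j) <= M -> l1 f M.
Proof.
move=> f0 fM n; apply: le_trans fM; have [nN|/ltnW nN] := leqP n N.
  rewrite -(subnKC nN) big_split_ord /= lerDl; apply: sumr_ge0 => i _; apply: nm_ge0.
rewrite -(subnKC nN) big_split_ord /= [X in _ + X]big1 ?addr0 // => i _.
by rewrite f0 ?nm0 // leq_addr.
Qed.

Lemma zterm_scale n (w : C) : fscale w (zterm n) = expfps (- toC (ln n.+1%:R) * w)
  * (fpC (n.+1%:R^-1 * w) * fpX - 1 + expfps (- toC (ln (n.+2%:R / n.+1%:R)) * w)).
Proof.
rewrite /zterm; set f := expfps _; set g := _ - 1; set h := expfps _.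
transitivity (fscale w f * fscale w (g + h)); first exact: rmorphM.
congr (_ * _); first exact: expfps_scale.
transitivity (fscale w g + fscale w h); first exact: rmorphD.
by congr (_ + _); [exact: fscale_lin|exact: expfps_scale].
Qed.

(** The constant terms cancel, the linear term is c + z, and the rest of the exponential series is
    at most |z|^2 e^|z|. *)
Lemma l1_rem (c z : C) (y : R) : nm (c + z) <= y -> nm z ^+ 2 <= y -> nm z <= 1 ->
  l1 (fpC c * fpX - 1 + expfps z) ((1 + expR 1) * y).
Proof.
move=> h1 h2 h3 N; have y0 : 0 <= y by apply: le_trans h2; rewrite sqr_ge0.
apply: le_trans (_ : \sum_(i < N.+2) nm ((fpC c * fpX - 1 + expfps z) i) <= _).
  by rewrite 2!big_ord_recr /= -addrA lerDl addr_ge0 ?nm_ge0.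
have BE j : (fpC c * fpX - 1 + expfps z) j =
    if j is j'.+1 then (if j' is j''.+1 then z ^+ j / j`!%:R else c + z) else 0.
  rewrite fpnD fpnB fpnCM fpn1 /= coefX; case: j => [|[|j]] /=.
  - by rewrite mulr0 sub0r expr0 fact0 divr1 addNr.
  - by rewrite mulr1 subr0 expr1 divr1.
  - by rewrite mulr0 subr0 add0r.
move: BE; move: (fpC c * fpX - 1 + expfps z) => B BE.
rewrite 2!big_ord_recl !BE /= nm0 add0r mulrDl mul1r; apply: lerD => //.
apply: le_trans (_ : \sum_(i < N) y * (nm z ^+ i / i`!%:R) <= _).
  apply: ler_sum => i _; rewrite BE /= nmM nmX nmV nm_nat !exprS mulrA -expr2 -mulrA.
  apply: ler_pM => //; rewrite ?sqr_ge0 ?mulr_ge0 ?exprn_ge0 ?nm_ge0 ?invr_ge0 //.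
  rewrite ler_wpM2l ?exprn_ge0 ?nm_ge0 // lef_pV2 ?posrE ?ltr0n ?fact_gt0 //.
  by rewrite ler_nat !factS mulnA leq_pmull.
rewrite -mulr_sumr mulrC; apply: ler_wpM2r => //.
by apply: le_trans (exp_partial_le N (nm_ge0 z)) _; rewrite ler_expR.
Qed.

Lemma zterm_sums n (s : C) : sums (fun j => zterm n j * s ^+ j)
  (s * npow n.+1 (- (1 + s)) - npow n.+1 (- s) + npow n.+2 (- s)).
Proof.
have -> : (fun j => zterm n j * s ^+ j) = fpn (fscale s (zterm n)).
  by apply/funext => j /=; rewrite mulrC.
rewrite zterm_scale.
set u := - toC (ln n.+1%:R) * s; set w := - toC _ * s.
have -> : s * npow n.+1 (- (1 + s)) - npow n.+1 (- s) + npow n.+2 (- s)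
   = cexp u * (n.+1%:R^-1 * s - 1 + cexp w).
  have npu : npow n.+1 (- s) = cexp u by rewrite /npow /u mulNr mulNr mulrC.
  rewrite mulrDr mulrBr mulr1 -cexpD npu; congr (_ - _ + _).
    by rewrite opprD npowD npu -[1]/(1%:R) npow_nat // expr1 mulrA mulrC [s * _]mulrC.
  rewrite /npow /u /w -mulrDl -opprD -rmorphD lnM ?posrE ?invr_gt0 ?ltr0n //.
  by rewrite lnV ?posrE ?ltr0n // addrCA subrr addr0 mulNr mulNr mulrC.
have l1a : l1 (fpC (n.+1%:R^-1 * s) * fpX - 1) (nm (n.+1%:R^-1 * s) + 1).
  apply: (@l1_abs _ 2) => [[|[|j]] // _|].
    by rewrite fpnB fpn1 fpnCM /= coefX mulr0 subr0.
  rewrite !big_ord_recl big_ord0 !fpnB !fpn1 !fpnCM /= !coefX /=.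
  by rewrite mulr0 mulr1 sub0r subr0 nmN (nm_nat _ 1) addr0 addrC.
apply: (sumsM (l1_expfps u) (l1D l1a (l1_expfps w)) (sums_expfps u)).
exact: sumsD (sumsD (sums_fpX _) (sumsN sums_fps1)) (sums_expfps w).
Qed.

Lemma zterm0 n : zterm n 0%N = 0.
Proof.
rewrite /zterm fpnM0 [X in _ * X](_ : _ = 0) ?mulr0 //.
rewrite !fpnD; have -> : (fpC n.+1%:R^-1 * fpX : fps C) 0%N = 0 by rewrite fpnCM /= coefX mulr0.
by rewrite fpnN fpn1 /= fact0 divr1 !add0r expr0 addNr.
Qed.

(** At |s| = 1 / 2 the factor n^(-s) costs n^(1/2), and the second factor is O(n^(-2)) because ln (1
    + 1/n) lies between 1/n - 1/n^2 and 1/n. The resulting n^(-3/2) is summable. *)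
Lemma zterm_l1 n : l1 (fscale (toC (1 / 2)) (zterm n))
   ((1 + expR 1) * expR (- (1 + 1 / 2) * ln n.+1%:R)).
Proof.
set m : R := n.+1%:R; have m0 : 0 < m by rewrite ltr0n.
have m1 : 1 <= m by rewrite ler1n.
pose l : R := ln (n.+2%:R / m).
have m2 : n.+2%:R = m + 1 :> R by rewrite natr1.
have mm : n.+2%:R / m = 1 + m^-1 by rewrite m2 mulrDl mulfV ?lt0r_neq0 // mul1r.
have lle : l <= m^-1.
  by rewrite /l mm; apply: le_ln1Dx; apply: lt_trans (_ : 0 < _); rewrite ?invr_gt0 // ltrN10.
have lge : m^-1 - (m ^+ 2)^-1 <= l.
  have e : n.+2%:R / m = (1 + - (m + 1)^-1)^-1.
    by rewrite m2; field; rewrite !lt0r_neq0 //; lra.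
  have i1 : 0 < (m + 1)^-1 by rewrite invr_gt0; lra.
  have i2 : (m + 1)^-1 < 1 by rewrite invf_lt1; lra.
  rewrite /l e lnV ?posrE; last by lra.
  rewrite lerNr; apply: le_trans (le_ln1Dx _) _; first by lra.
  rewrite opprB lerBrDr -lerBrDl opprK.
  rewrite -lerBlDr.
  have -> : m^-1 - (m + 1)^-1 = (m * (m + 1))^-1.
    by field; rewrite !lt0r_neq0 //; lra.
  rewrite lef_pV2 ?posrE ?mulr_gt0 ?exprn_gt0 //; last by lra.
  by rewrite expr2 ler_wpM2l // ?(ltW m0) // lerDl.
have l0 : 0 <= l by rewrite /l mm ln_ge0 // lerDl invr_ge0 ltW.
rewrite zterm_scale.
have -> : (1 + expR 1) * expR (- (1 + 1 / 2) * ln m) = expR (1 / 2 * ln m) * ((1 + expR 1) * (m ^+ 2)^-1).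
  rewrite [RHS]mulrCA; congr (_ * _).
  have -> : (m ^+ 2)^-1 = expR (- (2 * ln m)) by rewrite expRN expRM_natl lnK.
  by rewrite -expRD; congr expR; field.
apply: l1M.
  have := l1_expfps (- toC (ln m) * toC (1 / 2)).
  have -> : nm (- toC (ln m) * toC (1 / 2)) = 1 / 2 * ln m.
    by rewrite nmM nmN !nm_toC !ger0_norm ?ln_nat_ge0 // mulrC.
  exact.
rewrite -/m -/l; have i0 : 0 <= m^-1 by rewrite invr_ge0 ltW.
have i1 : m^-1 <= 1 by rewrite invf_le1.
have nz : nm (- toC l * toC (1 / 2)) = l * (1 / 2) by rewrite nmM nmN !nm_toC !ger0_norm.
have l1' : l <= 1 := le_trans lle i1.
apply: l1_rem; last by rewrite nz; move: l0 l1'; clear; lra.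
  have -> : n.+1%:R^-1 * toC (1 / 2) + - toC l * toC (1 / 2) = toC ((m^-1 - l) * (1 / 2)).
    rewrite -mulrDl [RHS](rmorphM (@toC R)); congr (_ * _).
    by rewrite rmorphB /= fmorphV rmorph_nat.
  rewrite nm_toC ger0_norm; last by rewrite mulr_ge0 ?subr_ge0.
  have : 0 <= (m ^+ 2)^-1 by rewrite invr_ge0 sqr_ge0.
  by move: lge lle; clear; move: (m ^- 2) (m^-1) => u v; lra.
rewrite nz exprMn -exprVn; apply: le_trans (_ : l ^+ 2 <= _).
  by rewrite ler_piMr ?sqr_ge0 // expr_le1 //; lra.
by apply: lerXn2r; rewrite ?nnegrE.
Qed.

(** Sum the [zterm] over n and exchange with the powers of s, dominated at |s| = 1 / 2. The
    telescoping sum of n^(-s) - (n+1)^(-s), which is 1 for Re s > 0, accounts for the constant term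
    of Z. *)
Lemma zeta_series : exists Z : fps C, [/\ Z 0%N = 1, growth Z &
  forall s : C, nm s <= 1 / 2 -> 0 < re s -> sums (fun j => Z j * s ^+ j) (s * zeta (1 + s))].
Proof.
pose a n j : C := zterm n j * toC (1 / 2) ^+ j.
have rb n : bsum (fun j => nm (a n j)) ((1 + expR 1) * expR (- (1 + 1 / 2) * ln n.+1%:R)).
  by move=> N; have := zterm_l1 n N; rewrite /a; under eq_bigr do rewrite /= mulrC.
have h2 : (0 : R) < 1 / 2 by rewrite divr_gt0.
have e1 : (0 : R) <= 1 + expR 1 by rewrite addr_ge0 ?expR_ge0.
have bb : bsum (fun n => (1 + expR 1) * expR (- (1 + 1 / 2) * ln n.+1%:R))
   ((1 + expR 1) * (1 + (1 / 2)^-1) : R).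
  move=> N; rewrite -mulr_sumr ler_wpM2l //; apply: le_trans (bsum_pow h2 N.+1).
  by rewrite big_ord_recl /= add0r.
have cols := fubini_sums_ex rb bb.
pose l j := limn (series (a ^~ j)).
have lS j : sums (a ^~ j) (l j) /\ nm (l j) <= (1 + expR 1) * (1 + (1 / 2)^-1).
  by have [l' hl b] := cols j; rewrite /l (sums_lim hl).
have t0 : toC (1 / 2) != 0 :> C by rewrite -(rmorph0 (@toC R)) (inj_eq (@toC_inj R)) lt0r_neq0.
pose Z : fps C := Fps (fun j => (j == 0%N)%:R + l j / toC (1 / 2) ^+ j).
have Zs j : sums (fun n => zterm n j) (l j / toC (1 / 2) ^+ j).
  apply: sums_ext (sumsZr (toC (1 / 2) ^+ j)^-1 (lS j).1) => n.
  by rewrite /a mulfK // expf_neq0.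
exists Z; split.
- rewrite /= expr0 divr1 (_ : l 0%N = 0) ?addr0 //.
  apply: sums_uniq (lS 0%N).1 _; apply: (sums_ext _ (@sums0 R)) => n.
  by rewrite /a zterm0 mul0r.
- apply: growthD; first by exists 1, 1; split=> // j; rewrite expr1n mulr1 nm_nat lern1 leq_b1.
  exists ((1 + expR 1) * (1 + (1 / 2)^-1)), 2; split=> // j.
  rewrite nmM nmV nmX nm_toC gtr0_norm // div1r exprVn invrK.
  apply: ler_wpM2r; first by rewrite exprn_ge0.
  by have := (lS j).2; rewrite div1r.
move=> s s2 s0; pose a' n j : C := zterm n j * s ^+ j.
have rb' n : bsum (fun j => nm (a' n j)) ((1 + expR 1) * expR (- (1 + 1 / 2) * ln n.+1%:R)).
  apply: bsum_le (rb n) => j; rewrite /a' /a !nmM !nmX nm_toC gtr0_norm // ler_wpM2l ?nm_ge0 //.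
  by apply: lerXn2r; rewrite ?nnegrE ?nm_ge0 // ltW.
have s1 : 1 < re (1 + s) by rewrite reD re1 ltrDl.
have zS : sums (fun n => s * npow n.+1 (- (1 + s)) - npow n.+1 (- s) + npow n.+2 (- s))
    (s * zeta (1 + s) - 1).
  apply: sums_ext (sumsD (sumsZ s (zeta_sums s1)) (sumsN (npow_telescope s0))) => n.
  by rewrite opprB addrA addrAC.
have := fubini_sums rb' bb (fun n => zterm_sums n s) (fun j => _) zS.
move=> /(_ (fun j => l j / toC (1 / 2) ^+ j * s ^+ j)) h.
have {}h : sums (fun j => l j / toC (1 / 2) ^+ j * s ^+ j) (s * zeta (1 + s) - 1).
  apply: h => j; exact: sumsZr (Zs j).
have one : sums (fun j => (j == 0%N)%:R * s ^+ j) 1.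
  have := @sums_finite R (fun j => (j == 0%N)%:R * s ^+ j) 1; rewrite big_ord1 expr0 mulr1.
  by apply=> -[|j] // _; rewrite mul0r.
have := sumsD one h; rewrite addrC subrK; apply: sums_ext => j.
by rewrite /= mulrDl.
Qed.

End Zeta.

(** * Logarithms of convergent power series *)

Section FormalLog.
Variable R : realType.
Notation C := (cplx R).

Definition finv1 (u : fps C) : fps C := Fps (fun n => \sum_(j < n.+1) (u ^+ j) n).

Lemma finv1M (u : fps C) : u 0%N = 0 -> (1 - u) * finv1 u = 1.
Proof.
move=> u0; apply: fpsP => n.
have E m : (m <= n)%N -> finv1 u m = (\sum_(j < n.+1) u ^+ j) m.
  move=> mn; rewrite fpn_sum /= -(subnKC (_ : m.+1 <= n.+1)%N) // big_split_ord /=.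
  rewrite [X in _ = _ + X]big1 ?addr0 // => i _.
  by apply: fps_vanishX => //; rewrite addSn ltnS leq_addr.
transitivity (((1 - u) * \sum_(j < n.+1) u ^+ j) n).
  by rewrite !fpnM; apply: eq_bigr => i _; rewrite E // leq_subr.
have -> : (1 - u) * \sum_(j < n.+1) u ^+ j = 1 - u ^+ n.+1.
  by rewrite -[1 - u]opprB mulNr -subrX1 opprB.
by rewrite fpnB fps_vanishX // subr0.
Qed.

(** The logarithm is found by integrating L = T Z' / Z. Growth of L follows from the recursion L_n =
    n Z_n - sum_(i < n) L_i Z_(n-i). *)
Lemma flog_ex (Z : fps C) : Z 0%N = 1 -> growth Z ->
  exists c : fps C, [/\ c 0%N = 0, growth c & fexp0 c = Z].
Proof.
move=> Z0 [K [M [K0 M0 ZM]]].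
pose u := 1 - Z; have u0 : u 0%N = 0 by rewrite fpnB fpn1 Z0 subrr.
have ZE : Z = 1 - u by rewrite /u opprB addrC subrK.
pose L := feuler Z * finv1 u.
have LZ : feuler Z = L * Z.
  by rewrite /L -mulrA [finv1 u * Z]mulrC {3}ZE finv1M // mulr1.
have L0 : L 0%N = 0 by rewrite /L fpnM0 feulerE mulr0n mul0r.
pose c : fps C := Fps (fun n => L n / n%:R).
have cL : feuler c = L.
  apply: fpsP => -[|n]; rewrite feulerE /= ?mulr0n ?L0 //.
  by rewrite -[LHS]mulr_natr mulfVK // pnatr_eq0.
have c0 : c 0%N = 0 by rewrite /= invr0 mulr0.
exists c; split=> //; last first.
  apply: (@ode_uniq C L) => //; last by rewrite fexp0_0.
  by rewrite feuler_fexp0 // cL.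
pose A := K * M + M + 1.
have A1 : 1 <= A by rewrite /A lerDr addr_ge0 // mulr_ge0.
have AZ n : nm (Z n.+1) <= A ^+ n.+1.
  apply: le_trans (ZM _) _; rewrite !exprS mulrA; apply: ler_pM; rewrite ?mulr_ge0 ?exprn_ge0 //.
    by rewrite /A -addrA lerDl addr_ge0.
  by apply: lerXn2r; rewrite ?nnegrE //; [lra|rewrite /A addrAC lerDr addr_ge0 // mulr_ge0].
(* The inequality that closes the induction |L_n| <= (4 A)^n. *)
have pow3 n : n.+1%:R + \sum_(i < n) (4 : R) ^+ i.+1 <= 4 ^+ n.+1.
  elim: n => [|n IH]; first by rewrite big_ord0 addr0 expr1 ler_nat.
  rewrite big_ord_recr /= -natr1 addrAC addrA [X in X <= _]addrAC.
  have p1 : (1 : R) <= 4 ^+ n.+1 by rewrite exprn_ege1 // ler1n.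
  by rewrite [leRHS]exprS; move: IH; rewrite addrC => IH; lra.
have LB n : nm (L n) <= (4 * A) ^+ n.
  elim/ltn_ind: n => -[|n] IH; first by rewrite L0 nm0 expr0.
  have e : L n.+1 = Z n.+1 *+ n.+1 - \sum_(i < n) L i.+1 * Z (n - i)%N.
    have := congr1 (fun f : fps C => f n.+1) LZ; rewrite feulerE fpnM => ->.
    rewrite big_ord_recr big_ord_recl /= L0 mul0r add0r subnn Z0 mulr1 addrC.
    by rewrite (eq_bigr (fun i : 'I_n => L i.+1 * Z (n - i)%N)) ?addrK // => i _; rewrite subSS.
  rewrite e; apply: le_trans (nmB _ _) _.
  apply: le_trans (_ : A ^+ n.+1 *+ n.+1 + \sum_(i < n) 4 ^+ i.+1 * A ^+ n.+1 <= _); last first.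
    by rewrite -mulr_natl -mulr_suml -mulrDl exprMn ler_wpM2r ?exprn_ge0 //; lra.
  apply: lerD; first by rewrite nmMn lerMn2r AZ orbT.
  apply: le_trans (nm_sum _ _ _) _; apply: ler_sum => i _; rewrite nmM.
  have iN := ltn_ord i.
  apply: le_trans (ler_pM (nm_ge0 _) (nm_ge0 _) (IH i.+1 _) (_ : _ <= A ^+ (n - i))) _ => //.
    by rewrite -(subnSK iN) AZ.
  by rewrite exprMn -mulrA -exprD addSn subnKC // ltnW.
exists 1, (4 * A); split=> //; first by rewrite mulr_ge0 //; lra.
move=> n; rewrite mul1r /= nmM nmV nm_nat; apply: le_trans (LB n).
case: n => [|n]; first by rewrite invr0 mulr0 nm_ge0.
by rewrite ler_piMr ?nm_ge0 // invf_le1 // ler1n.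
Qed.

Lemma growth_l1 (c : fps C) : growth c -> exists2 rho : R, 0 < rho &
  forall s : C, nm s <= rho -> exists M, l1 (fscale s c) M.
Proof.
move=> [K [M [K0 M0 cM]]]; have M1 : 0 < 2 * (M + 1) by rewrite mulr_gt0 // ltr_wpDl.
exists (2 * (M + 1))^-1; first by rewrite invr_gt0.
move=> s sr; exists (K * 2) => N; apply: le_trans (ler_wpM2l K0 (geom_half R N)).
rewrite mulr_sumr; apply: ler_sum => i _ /=; rewrite nmM nmX mulrC.
apply: le_trans (ler_pM (nm_ge0 _) (exprn_ge0 _ (nm_ge0 _)) (cM i) (lexx _)) _.
rewrite -mulrA ler_wpM2l // -exprMn; apply: lerXn2r; rewrite ?nnegrE ?mulr_ge0 ?nm_ge0 ?divr_ge0 //.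
apply: le_trans (ler_wpM2l M0 sr) _; rewrite ler_pdivrMr //.
by lra.
Qed.

Lemma fscale_sums (s : C) (c : fps C) l : sums (fscale s c) l <-> sums (fun j => c j * s ^+ j) l.
Proof. by split; apply: sums_ext => j /=; rewrite mulrC. Qed.

Lemma fscale_feuler (s : C) (f : fps C) : feuler (fscale s f) = fscale s (feuler f).
Proof. by apply: fpsP => n; rewrite /= mulrnAr. Qed.

Lemma fscale_fexp0 (s : C) (c : fps C) : c 0%N = 0 -> fscale s (fexp0 c) = fexp0 (fscale s c).
Proof.
move=> c0; have sc0 : fscale s c 0%N = 0 by rewrite /= c0 mulr0.
apply: (@ode_uniq C (feuler (fscale s c))).
- by rewrite feulerE mulr0n.
- rewrite !fscale_feuler feuler_fexp0 //; exact: rmorphM.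
- by rewrite feuler_fexp0.
- by rewrite fexp0_0 [LHS]mul1r fexp0_0.
Qed.

Lemma cexp_series (c : fps C) (s : C) l M : c 0%N = 0 -> l1 (fscale s c) M ->
  sums (fun j => c j * s ^+ j) l -> sums (fun j => fexp0 c j * s ^+ j) (cexp l).
Proof.
move=> c0 cM /fscale_sums cl; apply/fscale_sums; rewrite fscale_fexp0 //.
by have [] := fexp0_sums (_ : fscale s c 0%N = 0) cM cl; rewrite //= c0 mulr0.
Qed.

End FormalLog.

(** * The Euler product of zeta by a sieve *)

Section EulerProduct.
Variable R : realType.
Notation C := (cplx R).

Definition rough N n := (0 < n)%N && all (fun q => ~~ (q %| n)%N) [seq q <- iota 0 N | prime q].

Lemma sums_multiples N (a : nat -> C) l l' : (0 < N)%N -> (forall n, ~~ (N %| n)%N -> a n = 0) ->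
  sums a l -> sums (fun m => a (N * m)%N) l' -> l = l'.
Proof.
move=> N0 aN /sumsP h1 /sumsP h2; apply/eqP; rewrite -subr_eq0 -nm_eq0 eq_le nm_ge0 andbT.
apply/ler_addgt0Pr => e e0; rewrite add0r.
have e2 : 0 < e / 2 by rewrite divr_gt0.
have [N1 H1] := h1 _ e2; have [N2 H2] := h2 _ e2.
have pE M : \sum_(i < N * M) a i = \sum_(m < M) a (N * m)%N.
  elim: M => [|M IH]; first by rewrite muln0 !big_ord0.
  rewrite mulnSr big_split_ord IH big_ord_recr /=; congr (_ + _).
  case: (N) N0 aN => // N' _ aN; rewrite big_ord_recl /= addn0 big1 ?addr0 // => i _.
  apply: aN; rewrite dvdn_addr ?dvdn_mulr // gtnNdvd //.
  by rewrite /bump leq0n add1n ltnS ltn_ord.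
pose M := maxn N1 N2.
have k1 := H1 (N * M)%N (leq_trans (leq_maxl N1 N2) (leq_pmull _ N0)).
have k2 := H2 M (leq_maxr N1 N2); rewrite pE in k1.
have -> : l - l' = (\sum_(m < M) a (N * m)%N - l') - (\sum_(m < M) a (N * m)%N - l).
  by rewrite opprB [RHS]addrC addrA subrK.
apply: le_trans (nmB _ _) _; lra.
Qed.

Lemma rough_prime N n : prime N -> rough N.+1 n = rough N n && ~~ (N %| n)%N.
Proof.
move=> pN; rewrite /rough -[N.+1]addn1 iotaD filter_cat all_cat /= add0n pN /= andbT.
by rewrite andbA.
Qed.

Lemma rough_nprime N n : ~~ prime N -> rough N.+1 n = rough N n.
Proof.
move=> /negPf pN; rewrite /rough -[N.+1]addn1 iotaD filter_cat all_cat /= add0n pN /=.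
by rewrite andbT.
Qed.

Lemma rough_mul N m : prime N -> rough N (N * m) = rough N m.
Proof.
move=> pN; rewrite /rough muln_gt0 (prime_gt0 pN) /=; congr (_ && _).
apply: eq_in_all => q; rewrite mem_filter mem_iota add0n => /andP[pq /andP[_ qN]].
by rewrite Euclid_dvdM // dvdn_prime2 // (ltn_eqF qN).
Qed.

Lemma rough_lt N n : rough N n -> n = 1%N \/ (N <= n)%N.
Proof.
move=> /andP[n0 /allP h]; case: (ltnP 1 n) => [n1|n1]; last by left; apply/eqP; rewrite eqn_leq n1.
right; rewrite leqNgt; apply/negP => nN; have := h (pdiv n).
rewrite mem_filter mem_iota add0n (pdiv_prime n1) /= pdiv_dvd.
by rewrite (leq_ltn_trans (pdiv_leq n0) nN) => /(_ isT).
Qed.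

Lemma rough1 N : rough N 1.
Proof.
apply/andP; split=> //; apply/allP => q; rewrite mem_filter => /andP[pq _].
by rewrite dvdn1; apply: contraL pq => /eqP ->.
Qed.

Variable z : C.
Hypothesis z1 : 1 < re z.

(** The sieve of Eratosthenes: multiplication by 1 - N^(-z) removes the multiples of the prime N
    from what earlier primes have left. *)
Lemma rough_sums N : sums (fun n => if rough N n then npow n (- z) else 0)
  (\prod_(p < N | prime p) (1 - npow p (- z)) * zeta z).
Proof.
elim: N => [|N IH].
  rewrite big_ord0 mul1r -[zeta z]add0r; apply/sums_shift.
  by apply: sums_ext (zeta_sums z1) => n; rewrite /rough.
rewrite big_mkcond big_ord_recr /= -big_mkcond.
case: (boolP (prime N)) => pN; last first.
  by rewrite mulr1; apply: sums_ext IH => n; rewrite rough_nprime.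
set l := _ * zeta z in IH; rewrite mulrAC -/l mulrBr mulr1.
pose a n := if rough N n && (N %| n)%N then npow n (- z) else 0.
have aN n : ~~ (N %| n)%N -> a n = 0 by rewrite /a => /negPf ->; rewrite andbF.
have h1 : sums (fun m => a (N * m)%N) (l * npow N (- z)).
  apply: sums_ext (sumsZr (npow N (- z)) IH) => m.
  rewrite /a rough_mul // dvdn_mulr // andbT; case: ifP => [/andP[m0 _]|_]; last by rewrite mul0r.
  by rewrite (npowM (- z) (prime_gt0 pN) m0) mulrC.
have [M bM] := zeta_abs z1.
have [l' h2 _] : exists2 l', sums a l' & nm l' <= M.
  apply: sums_abs => -[|n]; first by rewrite big_ord0; have := bM 0%N; rewrite big_ord0.
  rewrite big_ord_recl [X in nm X](_ : _ = 0) ?nm0 ?add0r; last by rewrite /a /rough.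
  apply: le_trans (bM n); apply: ler_sum => i _; rewrite /a; case: ifP => // _.
  by rewrite nm0 nm_ge0.
have e := sums_multiples (prime_gt0 pN) aN h2 h1.
rewrite -e; apply: sums_ext (sumsD IH (sumsN h2)) => n.
rewrite /a rough_prime //; case: (rough N n) => /=; last by rewrite subr0.
by case: (N %| n)%N; rewrite /= ?subrr ?subr0.
Qed.

(** Apart from 1, an integer without prime factor below N is at least N, so the sifted series is 1
    plus part of a tail of zeta. *)
Lemma euler_limit :
  (fun N => \prod_(p < N | prime p) (1 - npow p (- z)) * zeta z) @ \oo --> (1 : C).
Proof.
have [M bM] := zeta_abs z1; apply/cvgCP => e e0.
have e2 : 0 < e / 2 by rewrite divr_gt0.
have [N0 HN] := bsum_tail (fun n => nm_ge0 _) bM e2.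
exists N0.+2 => // N /= NN.
have h := rough_sums N.
pose b n := (if rough N n then npow n (- z) else 0) - (n == 1%N)%:R.
have one : sums (fun n => (n == 1%N)%:R : C) 1.
  have := @sums_finite R (fun n => (n == 1%N)%:R) 2; rewrite !big_ord_recl big_ord0 /= addr0 add0r.
  by apply=> -[|[|n]].
have hb := sumsD h (sumsN one).
apply: le_lt_trans (_ : e / 2 < e); last by rewrite ltr_pdivrMr // ltr_pMr // ltr1n.
apply: (sums_nm_le hb) => n; apply: le_trans (nm_sum _ _ _) _.
have b0 i : (i < N0.+1)%N -> (if rough N i then npow i (- z) else 0) - (i == 1%N)%:R = 0.
  move=> iN; have [->|i1] := eqVneq i 1%N.
    by rewrite rough1 /npow ln1 rmorph0 mulr0 cexp0 subrr.
  case: ifP => [/rough_lt [i1'|Ni]|_]; rewrite ?subr0 //; first by rewrite i1' eqxx in i1.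
  by have := leq_trans NN Ni; rewrite ltnNge ltnW // ltnW.
have [nN|/ltnW nN] := leqP n N0.+1.
  rewrite big1 ?(ltW e2) // => i _; rewrite b0 ?nm0 //.
  exact: leq_trans (ltn_ord i) nN.
rewrite -(subnKC nN) big_split_ord /= big1 ?add0r => [|i _]; last by rewrite b0 ?nm0.
apply: le_trans (ltW (HN (n - N0.+1)%N)); apply: ler_sum => i _.
rewrite addSn; have [i0|i0] := eqVneq (N0 + i)%N 0%N.
  rewrite i0 /= rough1 /npow ln1 rmorph0 mulr0 cexp0 subrr nm0; exact: nm_ge0.
rewrite eqSS (negPf i0) subr0; case: ifP => // _; rewrite nm0; exact: nm_ge0.
Qed.

End EulerProduct.

(** * Prime powers in log zeta *)

Section PrimeZeta.
Variable R : realType.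
Notation C := (cplx R).

Lemma nm_npow_lt1 (z : C) p : 0 < re z -> (1 < p)%N -> nm (npow p (- z)) < 1.
Proof.
move=> z0 p1; rewrite nm_npow reN -[ltRHS]expR0 ltr_expR nmulr_rlt0 ?ln_gt0 ?ltr1n //.
by rewrite oppr_lt0.
Qed.

Definition logser : fps C := Fps (fun m => m%:R^-1).

Lemma fexp0_logser : fexp0 logser = geo C.
Proof.
have l0 : logser 0%N = 0 by rewrite /= invr0.
have fl : feuler logser = fpX * geo C.
  apply: fpsP => -[|m]; rewrite feulerE fpnXM ?mulr0n //=.
  by rewrite -[LHS]mulr_natr mulVf // pnatr_eq0.
apply: (@ode_uniq C (fpX * geo C)).
- by rewrite fpnXM.
- by rewrite feuler_fexp0 // fl.
- apply: fpsP => n; rewrite feulerE -mulrA fpnXM /=.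
  case: n => [|n]; first by rewrite mulr0n.
  rewrite fpnM (eq_bigr (fun=> 1)) => [|i _]; last by rewrite mul1r.
  by rewrite sumr_const card_ord.
- by rewrite fexp0_0.
Qed.

Lemma logser_l1 (w : C) : nm w < 1 -> l1 (fscale w logser) (nm w / (1 - nm w)).
Proof.
move=> w1; have d0 : 0 < 1 - nm w by rewrite subr_gt0.
move=> [|N]; first by rewrite big_ord0 divr_ge0 ?nm_ge0 // ltW.
rewrite big_ord_recl /= invr0 mulr0 nm0 add0r ler_pdivlMr //.
apply: le_trans (_ : (\sum_(i < N) nm w ^+ i.+1) * (1 - nm w) <= _).
  rewrite ler_wpM2r ?(ltW d0) //; apply: ler_sum => i _.
  rewrite nmM nmX nmV nm_nat ler_piMr ?exprn_ge0 ?nm_ge0 // invf_le1 ?ltr0n // ler1n.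
  by [].
rewrite (eq_bigr (fun i : 'I_N => nm w * nm w ^+ i)) => [|i _]; last by rewrite exprS.
rewrite -mulr_sumr -mulrA ler_piMr ?nm_ge0 // mulrC -opprB mulNr -subrX1 opprB.
by rewrite gerBl exprn_ge0 ?nm_ge0.
Qed.

(** The function - log (1 - w), by its power series, so that no branch has to be chosen. *)
Definition clog1 (w : C) : C := limn (series (fscale w logser)).

Lemma clog1_sums (w : C) : nm w < 1 -> sums (fscale w logser) (clog1 w).
Proof.
by move=> /logser_l1 /sums_abs [l hl _]; rewrite /clog1 (sums_lim hl).
Qed.

Lemma cexp_clog1 (w : C) : nm w < 1 -> cexp (clog1 w) * (1 - w) = 1.
Proof.
move=> w1; have sl0 : fscale w logser 0%N = 0 by rewrite /= invr0 mulr0.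
have [h hl] := fexp0_sums sl0 (logser_l1 w1) (clog1_sums w1).
have hw : sums (1 - fpC w * fpX) (1 - w) := sumsD (sums_fps1 R) (sumsN (sums_fpX w)).
have lw : l1 (1 - fpC w * fpX) (1 + nm w).
  apply: (@l1_abs _ _ 2) => [[|[|j]] // _|]; first by rewrite fpnB fpn1 fpnCM /= coefX mulr0 subr0.
  rewrite !big_ord_recl big_ord0 !fpnB !fpn1 !fpnCM /= !coefX /=.
  by rewrite mulr0 mulr1 subr0 sub0r nmN addr0 (nm_nat _ 1).
apply: sums_uniq (sumsM hl lw h hw) _.
have l00 : logser 0%N = 0 by rewrite /= invr0.
rewrite -(fscale_fexp0 _ l00) fexp0_logser.
have -> : fscale w (geo C) * (1 - fpC w * fpX) = 1; last exact: sums_fps1.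
have e : 1 - fpC w * fpX = fscale w (fpoly (1 - 'X)).
  apply: fpsP => j; rewrite fpnB fpn1 fpnCM /= coefB coef1 coefX.
  case: j => [|[|j]] /=; rewrite ?expr0 ?mulr0 ?mulr1 ?mul1r ?subr0 ?sub0r ?expr1 ?mulrN1 //.
  by rewrite mulr0.
rewrite e; transitivity (fscale w (geo C * fpoly (1 - 'X))); first exact/esym/rmorphM.
by rewrite geo1 rmorph1.
Qed.

(* With w = p^-s this is the contribution of the powers p^m, m >= 2, to log zeta(s). *)
Definition clog2 (w : C) : C := clog1 w - w.

Lemma clog2_sums (w : C) : nm w < 1 ->
  sums (fun m => w ^+ m.+2 / m.+2%:R) (clog2 w).
Proof.
move=> w1; have h := clog1_sums w1.
have h1 := (sums_shift (fscale w logser) (clog1 w)).2; rewrite /= invr0 mulr0 add0r in h1.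
have {}h1 := h1 h.
have := (sums_shift (fun m => w ^+ m.+1 / m.+1%:R) (clog2 w)).2.
by rewrite expr1 divr1 /clog2 addrC subrK; apply.
Qed.

End PrimeZeta.

Section PrimePowers.
Variable R : realType.
Notation C := (cplx R).

(** Phases u_j with u_j c_j = |c_j| turn a finite sum of moduli into the value of one series, whose
    partial sums the rows dominate. *)
Lemma fubini_bound (a : nat -> nat -> C) (b : nat -> R) M (c : nat -> C) :
  (forall i, bsum (fun j => nm (a i j)) (b i)) -> bsum b M ->
  (forall j, sums (a ^~ j) (c j)) -> bsum (fun j => nm (c j)) M.
Proof.
move=> ab bM ac J; pose u j : C := toC (nm (c j)) / c j.
have u1 j : nm (u j) <= 1.
  rewrite /u nmM nmV nm_toC ger0_norm ?nm_ge0 //.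
  by have [->|h] := eqVneq (nm (c j)) 0; rewrite ?mul0r // mulfV.
have uc j : u j * c j = toC (nm (c j)).
  rewrite /u; have [->|h] := eqVneq (c j) 0; first by rewrite nm0 mulr0 rmorph0.
  by rewrite divfK.
have h : sums (fun i => \sum_(j < J) u j * a i j) (\sum_(j < J) u j * c j).
  by apply: (sums_finsum (index_enum 'I_J)) => j; apply: sumsZ.
have -> : \sum_(j < J) nm (c j) = nm (\sum_(j < J) u j * c j).
  rewrite (eq_bigr (fun j : 'I_J => toC (nm (c j)))) // -rmorph_sum nm_toC ger0_norm //.
  by apply: sumr_ge0 => j _; apply: nm_ge0.
apply: (sums_nm_le h) => N; apply: le_trans (nm_sum _ _ _) _.
apply: le_trans (bM N); apply: ler_sum => i _; apply: le_trans (ab i J).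
apply: le_trans (nm_sum _ _ _) _; apply: ler_sum => j _.
by rewrite nmM ler_piMl ?nm_ge0.
Qed.

Lemma clog2_series p : prime p -> exists r : fps C,
  [/\ l1 (fscale (toC (1 / 4)) r) (4 * expR (- (1 + 1 / 2) * ln p%:R)) &
   forall s : C, nm s <= 1 / 4 -> sums (fun j => r j * s ^+ j) (clog2 (npow p (- (1 + s))))].
Proof.
move=> pp; have p1 := prime_gt1 pp; set L : R := ln p%:R.
have L2 : ln 2 <= L by rewrite ler_ln ?posrE ?ltr0n ?prime_gt0 // ler_nat.
have ln2 : (1 : R) / 2 <= ln 2.
  rewrite -[leLHS]expRK ler_ln ?posrE ?expR_gt0 //.
  have h := expR_ge1Dx (- (1 / 2) : R); rewrite expRN in h.
  by rewrite -[leLHS]invrK -[leRHS]invrK lef_pV2 ?posrE ?invr_gt0 ?expR_gt0 //; lra.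
(* For |s| <= 1 / 4 the modulus of p^-(1 + s) is at most q = p^(-3/4) <= 3 / 4, so that 1 / (1 - q)
   <= 4. *)
pose q : R := expR (- (3 / 4) * L).
have q0 : 0 < q by exact: expR_gt0.
have q34 : q <= 3 / 4.
  rewrite /q mulNr expRN -[leRHS]invrK lef_pV2 ?posrE ?expR_gt0 //.
  by have := expR_ge1Dx (3 / 4 * L); lra.
pose a m j : C := (toC (p%:R^-1)) ^+ m.+2 / m.+2%:R * (- toC (m.+2%:R * L)) ^+ j / j`!%:R.
have aE m (s : C) j : a m j * s ^+ j = (toC (p%:R^-1)) ^+ m.+2 / m.+2%:R * expfps (- toC (m.+2%:R * L) * s) j.
  by rewrite /a /= exprMn; exact: mulr_perm5.
have pE : toC (p%:R^-1 : R) = npow p (- 1).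
  transitivity (p%:R^-1 ^+ 1 : C); first by rewrite expr1 fmorphV rmorph_nat.
  exact: esym (npow_nat R 1 (prime_gt0 pp)).
have rowb m (s : C) : nm s <= 1 / 4 -> bsum (fun j => nm (a m j * s ^+ j)) (q ^+ m.+2).
  move=> s4 N; under eq_bigr do rewrite aE nmM.
  rewrite -mulr_sumr nmM nmX nm_toC nmV nm_nat ger0_norm ?invr_ge0 //.
  apply: le_trans (_ : (p%:R^-1) ^+ m.+2 * expR (m.+2%:R * L * (1 / 4)) <= _).
    apply: ler_pM.
    - by rewrite divr_ge0 // exprn_ge0 // invr_ge0.
    - by apply: sumr_ge0 => i _; apply: nm_ge0.
    - by rewrite ler_piMr ?exprn_ge0 ?invr_ge0 // invf_le1 // ler1n.
    apply: le_trans (l1_expfps _ N) _; rewrite ler_expR nmM nmN nm_toC.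
    by rewrite ger0_norm ?mulr_ge0 ?ler_wpM2l ?mulr_ge0 ?ln_nat_ge0.
  rewrite /q -expRM_natl -[p%:R^-1](@lnK _) ?posrE ?invr_gt0 ?ltr0n ?prime_gt0 //.
  by rewrite lnV ?posrE ?ltr0n ?prime_gt0 // -expRM_natl -expRD ler_expR -/L; lra.
have geoq : bsum (fun m => q ^+ m.+2) (4 * q ^+ 2).
  move=> N; rewrite (eq_bigr (fun m : 'I_N => q ^+ 2 * q ^+ m)) => [|i _]; last by rewrite -exprD.
  rewrite -mulr_sumr mulrC; apply: ler_wpM2r; first by rewrite exprn_ge0 // ltW.
  have d0 : 0 < 1 - q by lra.
  rewrite -(ler_pM2l d0) -opprB mulNr -subrX1 opprB; apply: le_trans (_ : 1 <= _); last by lra.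
  by rewrite opprB gerBl exprn_ge0 // ltW.
have q2E : q ^+ 2 = expR (- (1 + 1 / 2) * L).
  by rewrite /q -expRM_natl; congr expR; field.
have t4 : nm (toC (1 / 4) : C) <= 1 / 4 by rewrite nm_toC ger0_norm.
have cols := fubini_sums_ex (fun m => rowb m _ t4) geoq.
have t0 : toC (1 / 4) != 0 :> C by rewrite -(rmorph0 (@toC R)) (inj_eq (@toC_inj R)) lt0r_neq0.
pose r : fps C := Fps (fun j => limn (series (a ^~ j))).
have rS j : sums (a ^~ j) (r j).
  have [l hl _] := cols j; have h : sums (a ^~ j) (l / toC (1 / 4) ^+ j).
    by apply: sums_ext (sumsZr (toC (1 / 4) ^+ j)^-1 hl) => m; rewrite mulfK // expf_neq0.
  by rewrite /= (sums_lim h).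
exists r; split.
  rewrite -q2E => N; under eq_bigr do rewrite /= mulrC.
  exact: (fubini_bound (fun m => rowb m _ t4) geoq (fun j => sumsZr _ (rS j)) N).
move=> s s4; have w1 : nm (npow p (- (1 + s))) < 1.
  apply: nm_npow_lt1 p1; rewrite reD re1.
  by have := re_le_nm s; rewrite ler_norml => /andP[h _]; lra.
apply: (fubini_sums (fun m => rowb m s s4) geoq _ (fun j => sumsZr (s ^+ j) (rS j)) (clog2_sums w1)).
move=> m; apply: sums_ext (fun j => esym (aE m s j)) _.
have -> : npow p (- (1 + s)) ^+ m.+2 / m.+2%:R
    = toC p%:R^-1 ^+ m.+2 / m.+2%:R * cexp (- toC (m.+2%:R * L) * s).
  rewrite opprD npowD -pE exprMn mulrAC; congr (_ * _).
  rewrite /npow -cexpMn; congr cexp.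
  by rewrite -[LHS]mulr_natl mulNr [s * _]mulrC mulrN mulrA -(rmorph_nat (@toC R)) -rmorphM mulNr.
exact: sumsZ (sums_expfps _).
Qed.

End PrimePowers.

Section PrimeZetaOne.
Variable R : realType.
Notation C := (cplx R).

Lemma clog2_total : exists r : fps C, [/\ (exists M, l1 (fscale (toC (1 / 4)) r) M) &
  forall s : C, nm s <= 1 / 4 -> exists2 v,
    sums (psum_ (fun p => clog2 (npow p (- (1 + s))))) v & sums (fun j => r j * s ^+ j) v].
Proof.
have ex p : exists r : fps C, prime p ->
  l1 (fscale (toC (1 / 4)) r) (4 * expR (- (1 + 1 / 2) * ln p%:R)) /\
   forall s : C, nm s <= 1 / 4 -> sums (fun j => r j * s ^+ j) (clog2 (npow p (- (1 + s)))).
  by case: (boolP (prime p)) => [/(@clog2_series R) [r [h1 h2]]|_]; [exists r|exists 0].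
have [r rP] := boolp.choice ex.
pose a p j : C := if prime p then r p j else 0.
pose b p : R := if (0 < p)%N then 4 * expR (- (1 + 1 / 2) * ln p%:R) else 0.
have h2 : (0 : R) < 1 / 2 by rewrite divr_gt0.
have bM : bsum b (4 * (1 + (1 / 2)^-1)).
  move=> N; apply: le_trans (ler_wpM2l _ (bsum_pow h2 N)) => //.
  rewrite mulr_sumr; apply: ler_sum => p _; rewrite /b; case: ifP => //.
have rowb p (s : C) : nm s <= 1 / 4 -> bsum (fun j => nm (a p j * s ^+ j)) (b p).
  move=> s4; rewrite /a /b; case: (boolP (prime p)) => pp; last first.
    move=> N; rewrite big1 => [|i _]; last by rewrite mul0r nm0.
    by case: ifP => // _; rewrite mulr_ge0 // expR_ge0.
  rewrite prime_gt0 //; have [h _] := rP p pp; apply: bsum_le h => j /=.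
  rewrite !nmM !nmX nm_toC ger0_norm // [leRHS]mulrC ler_wpM2l ?nm_ge0 //.
  by apply: lerXn2r; rewrite ?nnegrE ?nm_ge0.
have t4 : nm (toC (1 / 4) : C) <= 1 / 4 by rewrite nm_toC ger0_norm.
have t0 : toC (1 / 4) != 0 :> C by rewrite -(rmorph0 (@toC R)) (inj_eq (@toC_inj R)) lt0r_neq0.
have cols := fubini_sums_ex (fun p => rowb p _ t4) bM.
pose f : fps C := Fps (fun j => limn (series (a ^~ j))).
have fS j : sums (a ^~ j) (f j).
  have [l hl _] := cols j; have h : sums (a ^~ j) (l / toC (1 / 4) ^+ j).
    by apply: sums_ext (sumsZr (toC (1 / 4) ^+ j)^-1 hl) => m; rewrite mulfK // expf_neq0.
  by rewrite /= (sums_lim h).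
exists f; split.
  exists (4 * (1 + (1 / 2)^-1)) => N; under eq_bigr do rewrite /= mulrC.
  exact: (fubini_bound (fun p => rowb p _ t4) bM (fun j => sumsZr _ (fS j)) N).
move=> s s4.
have rowS p : sums (fun j => a p j * s ^+ j) (psum_ (fun p => clog2 (npow p (- (1 + s)))) p).
  rewrite /a /psum_; case: (boolP (prime p)) => pp; first exact: (rP p pp).2.
  by apply: (sums_ext _ (@sums0 R)) => j; rewrite mul0r.
have [v hv _] : exists2 v, sums (psum_ (fun p => clog2 (npow p (- (1 + s))))) v & nm v <= 4 * (1 + (1 / 2)^-1).
  apply: sums_abs => N; apply: le_trans (bM N); apply: ler_sum => p _.
  by apply: (sums_nm_le (rowS p)) => n; apply: le_trans (nm_sum _ _ _) (rowb p s s4 n).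
by exists v => //; exact: fubini_sums (fun p => rowb p s s4) bM rowS (fun j => sumsZr _ (fS j)) hv.
Qed.

Lemma cexp_clog (s : C) : 0 < re s -> cexp (clog s) = s.
Proof.
move=> s0; set x := re s; set y := im s.
have m0 : 0 < x ^+ 2 + y ^+ 2 by rewrite ltr_wpDr ?sqr_ge0 // exprn_gt0.
pose h := ln (Num.sqrt (x ^+ 2 + y ^+ 2)).
have -> : cexp (clog s) = toC (expR h) * (toC (cos (atan (y / x))) + ciunit R * toC (sin (atan (y / x)))).
  by rewrite cexpE.
rewrite /h lnK ?posrE ?sqrtr_gt0 //.
have c2 : 0 < cos (atan (y / x)) by apply: cos_gt0_pihalf; rewrite atan_gtNpi2 atan_ltpi2.
have t := atanK (y / x); rewrite /tan in t.
have sE : sin (atan (y / x)) = y / x * cos (atan (y / x)).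
  by move: t => /(congr1 (fun z => z * cos (atan (y / x)))); rewrite mulfVK ?lt0r_neq0.
have q0 : Num.sqrt (x ^+ 2 + y ^+ 2) != 0 by rewrite lt0r_neq0 // sqrtr_gt0.
have cE : cos (atan (y / x)) = x / Num.sqrt (x ^+ 2 + y ^+ 2).
  have c1 : cos (atan (y / x)) ^+ 2 * (x ^+ 2 + y ^+ 2) = x ^+ 2.
    have := cos2Dsin2 (atan (y / x)); rewrite sE exprMn => h1.
    rewrite -[RHS]mulr1 -h1; field; exact: lt0r_neq0.
  have e : (cos (atan (y / x)) * Num.sqrt (x ^+ 2 + y ^+ 2)) ^+ 2 = x ^+ 2.
    by rewrite exprMn sqr_sqrtr ?(ltW m0).
  move/eqP: e; rewrite eqf_sqr => /orP[/eqP e|/eqP h1]; first exact: (canRL (mulfK q0)).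
  have : 0 < cos (atan (y / x)) * Num.sqrt (x ^+ 2 + y ^+ 2) by rewrite mulr_gt0 // sqrtr_gt0.
  by rewrite h1 oppr_gt0 ltNge (ltW s0).
rewrite sE cE [RHS]complexEI -/x -/y mulrDr mulrCA -!rmorphM.
have -> : Num.sqrt (x ^+ 2 + y ^+ 2) * (x / Num.sqrt (x ^+ 2 + y ^+ 2)) = x by rewrite mulrC divfK.
congr (_ + _ * toC _).
by field; rewrite q0 lt0r_neq0.
Qed.

End PrimeZetaOne.

(** * The branch of log zeta and the constants C_1(n) *)

Section Branch.
Variable R : realType.
Notation C := (cplx R).

Lemma cvg_pseries (c : fps C) (rho : R) M (T : Type) (F : set_system T) {FF : Filter F}
    (s : T -> C) (s0 : C) (v : T -> C) v0 :
  l1 (fscale (toC rho) c) M -> 0 < rho -> s @ F --> s0 ->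
  (\forall x \near F, nm (s x) <= rho /\ sums (fun j => c j * s x ^+ j) (v x)) ->
  nm s0 <= rho -> sums (fun j => c j * s0 ^+ j) v0 -> v @ F --> v0.
Proof.
move=> cM r0 ss hv s0r hv0.
apply: (@tannery R T F FF (fun j x => c j * s x ^+ j) (fun j => c j * s0 ^+ j)
   (fun j => nm (fscale (toC rho) c j)) M v v0 (fun j => nm_ge0 _) cM).
- apply: filterS hv => x [sx hx]; split=> // j /=.
  rewrite nmM nmX nmM nmX nm_toC gtr0_norm // mulrC ler_wpM2r ?nm_ge0 //.
  by apply: lerXn2r; rewrite ?nnegrE ?nm_ge0 ?(ltW r0).
- move=> j /=; rewrite !nmM !nmX nm_toC gtr0_norm // mulrC ler_wpM2r ?nm_ge0 //.
  by apply: lerXn2r; rewrite ?nnegrE ?nm_ge0 ?(ltW r0).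
- move=> j; have hX : (fun x => s x ^+ j) @ F --> s0 ^+ j.
    elim: j => [|j IH]; first exact (@cvgK_cst _ _ F FF (1 : C)).
    rewrite (_ : (fun x => s x ^+ j.+1) = fun x => s x * s x ^+ j); last first.
      by apply/funext => x; rewrite exprS.
    by rewrite exprS; exact (cvgKM ss IH).
  exact (cvgKM (@cvgK_cst _ _ F FF (c j)) hX).
- exact: hv0.
Qed.

Lemma cos_eq1 (v : R) : 0 < `|v| < pi -> cos v != 1.
Proof.
move=> /andP[v0 vpi]; rewrite -cos_norm.
have := cos2Dsin2 `|v|; have : 0 < sin `|v| by apply: sin_gt0_pi; rewrite v0.
move=> s0 h; apply/eqP => c1; move: h; rewrite c1 expr1n => /eqP.
by rewrite -subr_eq0 addrAC subrr add0r sqrf_eq0 (gt_eqF s0).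
Qed.

(** A continuous function with values in 2 pi Z is constant on a segment. Otherwise the intermediate
    value theorem yields v = f y / (1 + |f y|), for which 0 < |v| < 1 < pi and cos v is not 1. *)
Lemma branch_const (f : R -> R) (y : R) : f 0 = 0 ->
  (forall t : R, `|t| <= `|y| -> f x @[x --> t] --> f t) ->
  (forall t, `|t| <= `|y| -> cos (f t) = 1) -> f y = 0.
Proof.
move=> f0 fc f1; apply/eqP; apply: contraT => fy.
pose v := f y / (1 + `|f y|).
have d0 : 0 < 1 + `|f y| by rewrite ltr_wpDr.
have v1 : `|v| < 1.
  by rewrite /v normrM normfV (gtr0_norm d0) ltr_pdivrMr // mul1r ltrDr.
have v0 : 0 < `|v| by rewrite normr_gt0 mulf_neq0 // invr_neq0 // lt0r_neq0.
have vb : Num.min 0 (f y) <= v <= Num.max 0 (f y).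
  have i1 : (1 + `|f y|)^-1 <= 1 by rewrite invf_le1 // lerDl.
  have i0 : 0 <= (1 + `|f y|)^-1 by rewrite invr_ge0 ltW.
  rewrite ge_min le_max /v; case: (leP 0 (f y)) => [y0|/ltW y0].
    by rewrite mulr_ge0 //= ler_piMr ?orbT.
  by rewrite ler_niMr ?orbT //= mulr_le0_ge0.
have pi1 : 1 < pi :> R by have := pi_ge2 R; lra.
have [t ty tv] : exists2 t, `|t| <= `|y| & f t = v.
  have [y0|y0] := leP 0 y.
    have [||t tI tv] := @IVT _ f 0 y v y0; rewrite ?f0 //.
      apply: continuous_in_subspaceT => t /set_mem /=; rewrite in_itv /= => /andP[t0 ty].
      by apply: fc; rewrite !ger0_norm.
    by exists t => //; move: tI; rewrite in_itv /= => /andP[t0 ty]; rewrite !ger0_norm.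
  have [||t tI tv] := @IVT _ f y 0 v (ltW y0); rewrite ?f0 //.
  - apply: continuous_in_subspaceT => t /set_mem /=; rewrite in_itv /= => /andP[t0 ty].
    by apply: fc; rewrite !ler0_norm ?lerN2 ?(ltW y0).
  - by rewrite minC maxC.
  - by exists t => //; move: tI; rewrite in_itv /= => /andP[t0 ty]; rewrite !ler0_norm ?lerN2 ?(ltW y0).
have := f1 t ty; rewrite tv => /eqP; rewrite (negPf (cos_eq1 _)) // v0 /=.
exact: lt_trans v1 pi1.
Qed.

Lemma cexp_eq1 (w : C) : cexp w = 1 -> re w = 0 /\ cos (im w) = 1.
Proof.
move=> e; have r0 : re w = 0.
  by apply: expR_inj; rewrite expR0 -nm_cexp e (nm_nat _ 1).
split=> //; have /(congr1 (@re R)) := e.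
by rewrite cexpE r0 expR0 rmorph1 mul1r re1 reD re_toC reI im_toC oppr0 addr0.
Qed.

Lemma cvgCN T (F : set_system T) {FF : Filter F} (f : T -> C) (l : C) :
  f @ F --> l -> (fun x => - f x) @ F --> - l.
Proof.
move=> h; rewrite -[- l]sub0r (_ : (fun x => - f x) = fun x => 0 - f x).
  exact (cvgKB (@cvgK_cst _ _ F FF (0 : C)) h).
by apply/funext => x; rewrite sub0r.
Qed.

Lemma cvg_npow T (F : set_system T) {FF : Filter F} p (f : T -> C) (l : C) :
  f @ F --> l -> (fun x => npow p (f x)) @ F --> npow p l.
Proof. by move=> h; exact (cvg_cexp (cvgKM h (@cvgK_cst _ _ F FF (toC (ln p%:R) : C)))). Qed.

Definition vline (eta t : R) : C := toC eta + ciunit R * toC t.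

Lemma re_vline eta t : re (vline eta t) = eta.
Proof. by rewrite /vline reD re_toC reI im_toC oppr0 addr0. Qed.

Lemma re1_vline (eta t : R) : re (1 + vline eta t) = re (1 + toC eta : C).
Proof. by rewrite [LHS]reD re_vline [RHS]reD re_toC. Qed.

Lemma im_vline eta t : im (vline eta t) = t.
Proof. by rewrite /vline imD im_toC imI re_toC add0r. Qed.

Lemma cvg_vline eta t : vline eta x @[x --> t] --> vline eta t.
Proof.
apply: cvgC_reim.
  rewrite re_vline (_ : (fun x => _) = fun=> eta); first exact: cvg_cst.
  by apply/funext => x; rewrite re_vline.
rewrite im_vline (_ : (fun x => _) = id); first exact: cvg_id.
by apply/funext => x; rewrite im_vline.
Qed.

Lemma cvg_npow_vline eta t p :
  npow p (- (1 + vline eta x)) @[x --> t] --> npow p (- (1 + vline eta t)).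
Proof.
have h1 : (fun=> 1 : C) @ t --> (1 : C) by exact: cvgK_cst.
have h2 : 1 + vline eta x @[x --> t] --> 1 + vline eta t by exact (cvgKD h1 (@cvg_vline eta t)).
have h3 : - (1 + vline eta x) @[x --> t] --> - (1 + vline eta t) by exact (cvgCN h2).
exact (cvg_npow h3).
Qed.

Lemma nm_vline eta t : nm (vline eta t) ^+ 2 = eta ^+ 2 + t ^+ 2.
Proof. by rewrite nm_sqr re_vline im_vline. Qed.

Lemma sums_im0 (a : nat -> C) l : sums a l -> (forall n, im (a n) = 0) -> im l = 0.
Proof.
move=> [h] a0; have h1 : (fun n => im (series a n)) @ \oo --> im l by exact (cvgC_im h).
have h2 : (fun n => im (series a n)) @ \oo --> (0 : R).
  rewrite (_ : (fun n => _) = fun=> 0); first exact: cvg_cst.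
  by apply/funext => n; rewrite seriesE im_sum big1.
exact: (cvg_unique _ h1 h2).
Qed.

Lemma npow_real p (x : R) : exists y, npow p (toC x) = toC y.
Proof. by exists (expR (x * ln p%:R)); rewrite /npow -rmorphM cexp_toC. Qed.

Lemma euler_exp (z E : C) : 1 < re z ->
  sums (psum_ (fun p => clog1 (npow p (- z)))) E -> zeta z = cexp E.
Proof.
move=> z1 [hE]; have h1 := euler_limit z1.
have NE : (fun N => - series (psum_ (fun p => clog1 (npow p (- z)))) N) @ \oo --> - E.
  exact (cvgCN hE).
have h2 : (fun N => cexp (- series (psum_ (fun p => clog1 (npow p (- z)))) N) * zeta z) @ \oo
    --> cexp (- E) * zeta z.
  exact (cvgKM (cvg_cexp NE) (@cvgK_cst _ _ \oo _ (zeta z))).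
have e : cexp (- E) * zeta z = 1.
  have eqf : (fun N => cexp (- series (psum_ (fun p => clog1 (npow p (- z)))) N) * zeta z)
      = fun N => \prod_(p < N | prime p) (1 - npow p (- z)) * zeta z.
    apply/funext => N; congr (_ * _); rewrite seriesE -sumrN cexp_sum [RHS]big_mkcond.
    apply: eq_bigr => p _; rewrite /psum_; case: (boolP (prime p)) => pp; last by rewrite oppr0 cexp0.
    rewrite cexpN; apply: mulr1_eq; apply: cexp_clog1; apply: nm_npow_lt1; last exact: prime_gt1.
    exact: lt_trans z1.
  by apply: (cvgC_unique (F := \oo) h2); rewrite eqf; exact h1.
by rewrite -[LHS]mul1r -(cexp0 R) -(subrr E) cexpD -mulrA e mulr1.
Qed.

(** Near 0, s zeta(1 + s) = exp c(s) for a power series c, and zeta(1 + s) = exp (P(1 + s) + r(s))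
    by the Euler product, with P the prime zeta function and r the analytic contribution of prime
    powers. Once the branches are seen to agree, P(1 + s) + log s = c(s) - r(s). *)
Lemma zeta_one_coefs : exists c : nat -> C, is_prime_zeta_coefs 1 c.
Proof.
have [Z [Z0 gZ ZS]] := zeta_series R.
have [c [c0 gc cZ]] := flog_ex Z0 gZ.
have [rho rho0 rhoP] := growth_l1 gc.
have [r [[M2 rM] rP]] := clog2_total R.
have nrho : nm (toC rho) <= rho by rewrite nm_toC gtr0_norm.
have [M1 cM] := rhoP (toC rho) nrho.
have M10 : 0 <= M1 := bsum_ge0 cM.
pose cv s := limn (series (fun j => c j * s ^+ j)).
have cS s : nm s <= rho -> sums (fun j => c j * s ^+ j) (cv s).
  move=> /rhoP [M hM]; have [l hl _] := sums_abs hM.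
  have {}hl : sums (fun j => c j * s ^+ j) l by apply/fscale_sums.
  by rewrite /cv (sums_lim hl).
have cB s : nm s <= rho -> nm (cv s) <= nm s / rho * M1.
  move=> sr; have := (sums_shift (fun j => c j * s ^+ j) (cv s)).2.
  rewrite c0 mul0r add0r => /(_ (cS s sr)) h; apply: (sums_nm_le h) => N.
  apply: le_trans (nm_sum _ _ _) _.
  apply: le_trans (ler_wpM2l _ (cM N.+1)); last by rewrite divr_ge0 ?nm_ge0 // ltW.
  rewrite big_ord_recl mulrDr mulr_sumr -[leLHS]add0r; apply: lerD.
    by rewrite mulr_ge0 ?nm_ge0 // divr_ge0 ?nm_ge0 // ltW.
  apply: ler_sum => i _; rewrite [leRHS](_ : _ = nm (c i.+1) * (nm s * rho ^+ i)); last first.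
    rewrite /= /bump leq0n add1n nmM nmX nm_toC gtr0_norm // exprS; field.
    exact: lt0r_neq0.
  rewrite nmM nmX.
  rewrite ler_wpM2l ?nm_ge0 // exprS ler_wpM2l ?nm_ge0 //.
  by apply: lerXn2r; rewrite ?nnegrE ?nm_ge0 // ltW.
pose rv s := limn (series (fun j => r j * s ^+ j)).
have rS s : nm s <= 1 / 4 -> sums (fun j => r j * s ^+ j) (rv s) /\
    sums (psum_ (fun p => clog2 (npow p (- (1 + s))))) (rv s).
  by move=> /rP [v h1 h2]; rewrite /rv (sums_lim h2).
(* The last bound forces |c(s)| < 1, so that Im c(s) stays strictly between - pi and pi. *)
pose e := Num.min (Num.min rho (1 / 4)) (rho / (M1 + 1)).
have M11 : 0 < M1 + 1 by rewrite ltr_wpDl.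
have e0 : 0 < e by rewrite !lt_min rho0 !divr_gt0.
have er s : nm s < e -> [/\ nm s <= rho, nm s <= 1 / 4 & nm s / rho * M1 < 1].
  rewrite !lt_min => /andP[/andP[h1 h2] h3]; split; try exact: ltW.
  move: h3; rewrite ltr_pdivlMr // => h3; rewrite mulrAC ltr_pdivrMr // mul1r.
  by apply: le_lt_trans h3; rewrite ler_wpM2l ?nm_ge0 // lerDl.
have s11 (s : C) : 0 < re s -> 1 < re (1 + s) by move=> s0; rewrite reD re1 ltrDl.
have F1 (s : C) : nm s < e -> 0 < re s -> cexp (cv s) = s * zeta (1 + s).
  move=> /er [h1 h2 _] s0; have [M hM] := rhoP s h1.
  have := cexp_series c0 hM (cS s h1); rewrite cZ => h.
  by apply: sums_uniq h (ZS s _ s0); lra.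
have F2 (s : C) : nm s < e -> 0 < re s -> zeta (1 + s) = cexp (prime_zeta (1 + s) + rv s).
  move=> /er [_ h2 _] s0; apply: euler_exp; first exact: s11.
  apply: sums_ext (sumsD (pz_sums (s11 s s0)) (rS s h2).2) => p; rewrite /psum_.
  by case: ifP => _; rewrite ?addr0 // /clog2 addrC subrK.
(* The difference of two logarithms of s zeta(1 + s), so far known only to lie in 2 pi i Z. To see
   that it vanishes, s is joined to its real part by a vertical segment. *)
pose D s := clog s + (prime_zeta (1 + s) + rv s) - cv s.
have F3 (s : C) : nm s < e -> 0 < re s -> cexp (D s) = 1.
  move=> se s0; rewrite /D cexpD cexpN cexpD cexp_clog // -(F2 s se s0) -(F1 s se s0).
  by rewrite mulfV // cexp_neq0.
have F4 (s : C) : nm s < e -> 0 < re s -> D s = 0.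
  move=> se s0; have [h1 _] := cexp_eq1 (F3 s se s0).
  apply: complex_eq; first by rewrite h1.
  set eta := re s; set y := im s.
  pose f t := atan (t / eta) + im (prime_zeta (1 + vline eta t) + rv (vline eta t) - cv (vline eta t)).
  have fD t : f t = im (D (vline eta t)).
    rewrite /D /f -[clog _ + _ - _]addrA [RHS]imD; congr (_ + _).
    have -> : im (clog (vline eta t)) = atan (im (vline eta t) / re (vline eta t)) by [].
    by rewrite re_vline im_vline.
  have ve t : `|t| <= `|y| -> nm (vline eta t) < e.
    move=> ty; apply: le_lt_trans se; rewrite -(ler_pXn2r (n := 2)) ?nnegrE ?nm_ge0 //.
    rewrite nm_vline nm_sqr -/eta -/y lerD2l -(ler_pXn2r (n := 2)) ?nnegrE // in ty *.
    by rewrite -(real_normK (num_real t)) -(real_normK (num_real y)).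
  have sv : s = vline eta y by apply: complex_eq; rewrite ?re_vline ?im_vline.
  have v0 t : 0 < re (vline eta t) by rewrite re_vline.
  suff : f y = 0 by rewrite fD -sv => ->; rewrite -[0 : C]/(0%:R) im_nat.
  apply: branch_const.
  (* At the real point P and r are real, and so is exp c = eta zeta(1 + eta); hence sin (Im c) = 0,
     and |Im c| < 1 leaves only Im c = 0. *)
  - have y0 : `|0 : R| <= `|y| by rewrite normr0.
    have v00 : vline eta 0 = toC eta by rewrite /vline rmorph0 mulr0 addr0.
    have [k1 k2 k3] := er _ (ve 0 y0); have k4 := F1 _ (ve 0 y0) (v0 0).
    have npr p : im (npow p (- (1 + toC eta))) = 0.
      have [x] := npow_real p (- (1 + eta)); rewrite rmorphN rmorphD rmorph1 => ->.
      exact: im_toC.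
    rewrite v00 in k1 k2 k3 k4; rewrite /f v00 mul0r atan0 add0r imB imD.
    have -> : im (prime_zeta (1 + toC eta)) = 0.
      apply: (sums_im0 (pz_sums (s11 _ _))); first by rewrite re_toC.
      by move=> p; rewrite /psum_; case: ifP.
    have -> : im (rv (toC eta)) = 0.
      apply: (sums_im0 (rS _ k2).2) => p; rewrite /psum_; case: (boolP (prime p)) => // pp.
      rewrite /clog2 imB npr subr0; apply: (sums_im0 (clog1_sums _)).
        by apply: nm_npow_lt1 (prime_gt1 pp); rewrite reD re1 re_toC; lra.
      move=> n; have -> : npow p (- (1 + toC eta)) = toC (re (npow p (- (1 + toC eta)))).
        by apply: complex_eq; rewrite ?re_toC // im_toC npr.
      by rewrite /= -rmorphXn -(rmorph_nat (@toC R)) -fmorphV -rmorphM im_toC.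
    have zi : im (zeta (1 + toC eta)) = 0.
      apply: (sums_im0 (zeta_sums (s11 _ _))); first by rewrite re_toC.
      by move=> n; exact: npr.
    rewrite addr0 sub0r; apply/eqP; rewrite oppr_eq0; apply/eqP.
    set w := cv (toC eta) in k4 *.
    have sw : sin (im w) = 0.
      have /(congr1 (@im R)) := k4; rewrite imM zi im_toC mul0r mulr0 addr0 => /eqP.
      rewrite cexpE imM im_toC mul0r addr0 imD im_toC add0r imI re_toC re_toC.
      by rewrite mulf_eq0 (gt_eqF (expR_gt0 _)) /= => /eqP.
    have w1 : `|im w| < 1.
      by apply: le_lt_trans (im_le_nm w) _; apply: le_lt_trans (cB _ k1) k3.
    have [w0|w0] := eqVneq (im w) 0; first by [].
    have : 0 < sin `|im w|.
      apply: sin_gt0_pi; rewrite normr_gt0 w0 /=; apply: lt_trans w1 _.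
      by have := pi_ge2 R; lra.
    have [h|h] := leP 0 (im w); rewrite ?(ger0_norm h) ?(ltr0_norm h) ?sinN sw ?oppr0 ltxx //.
  (* Continuity in t: the prime zeta series is dominated by its moduli at 1 + eta, and the other two
     functions are power series. *)
  - move=> t ty; have [k1 k2 k3] := er _ (ve t ty).
    have := ve t ty; rewrite !lt_min => /andP[/andP[q1 q2] q3].
    have cn : nm (vline eta x) @[x --> t] --> nm (vline eta t) by exact (cvg_nm (@cvg_vline eta t)).
    have a0 : x / eta @[x --> t] --> t / eta by apply: cvgM; [exact: cvg_id|exact: cvg_cst].
    have a1 : atan (x / eta) @[x --> t] --> atan (t / eta).
      exact (cvg_comp _ _ a0 (@continuous_atan R (t / eta))).
    have nvl p (x : R) : nm (npow p (- (1 + vline eta x))) = nm (npow p (- (1 + toC eta))).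
      by rewrite [LHS]nm_npow [RHS]nm_npow !reN re1_vline.
    have h_1 : prime_zeta (1 + vline eta x) @[x --> t] --> prime_zeta (1 + vline eta t).
      have t1 : 1 < re (1 + toC eta) by apply: s11; rewrite re_toC.
      have [M hM] := pz_abs t1.
      apply: (@tannery R R (nbhs t) _ (fun p x => psum_ (fun p => npow p (- (1 + vline eta x))) p)
         (psum_ (fun p => npow p (- (1 + vline eta t))))
         (fun p => nm (psum_ (fun p => npow p (- (1 + toC eta))) p)) M _ _ (fun p => nm_ge0 _) hM).
      + apply: nearW => x; split; last exact: pz_sums (s11 _ (v0 x)).
        by move=> p; rewrite /psum_; case: ifP => // _; rewrite nvl.
      + by move=> p; rewrite /psum_; case: ifP => // _; rewrite nvl.
      + move=> p; rewrite /psum_; case: (prime p); last exact (@cvgK_cst _ _ (nbhs t) _ (0 : C)).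
        exact: cvg_npow_vline.
      + exact: pz_sums (s11 _ (v0 t)).
    have h_2 : rv (vline eta x) @[x --> t] --> rv (vline eta t).
      have h4 : (0 : R) < 1 / 4 by rewrite divr_gt0.
      have nr : \forall x \near t, nm (vline eta x) <= 1 / 4 /\
          sums (fun j => r j * vline eta x ^+ j) (rv (vline eta x)).
        apply: filterS (cvgr_lt (nm (vline eta t)) cn _ q2) => x /ltW hx.
        by split; [exact: hx|exact: (rS _ hx).1].
      exact (cvg_pseries rM h4 (@cvg_vline eta t) nr k2 (rS _ k2).1).
    have h_3 : cv (vline eta x) @[x --> t] --> cv (vline eta t).
      have nr : \forall x \near t, nm (vline eta x) <= rho /\
          sums (fun j => c j * vline eta x ^+ j) (cv (vline eta x)).
        apply: filterS (cvgr_lt (nm (vline eta t)) cn _ q1) => x /ltW hx.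
        by split; [exact: hx|exact: cS _ hx].
      exact (cvg_pseries cM rho0 (@cvg_vline eta t) nr k1 (cS _ k1)).
    have a2 : im (prime_zeta (1 + vline eta x) + rv (vline eta x) - cv (vline eta x)) @[x --> t]
        --> im (prime_zeta (1 + vline eta t) + rv (vline eta t) - cv (vline eta t)).
      exact (cvgC_im (cvgKB (cvgKD h_1 h_2) h_3)).
    exact (cvgD a1 a2).
  - move=> t ty; rewrite fD; exact: (cexp_eq1 (F3 _ (ve t ty) (v0 t))).2.
exists (fun j => c j - r j); apply: near0_ball; exists e => // s se /(_ erefl) s0.
have [k1 k2 k3] := er s se.
have h : sums (fun j => (c j - r j) * s ^+ j) (cv s - rv s).
  by apply: sums_ext (sumsD (cS s k1) (sumsN (rS s k2).1)) => j; rewrite mulrBl.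
have -> : prime_zeta (1 + s) + clog s = cv s - rv s; last by case: h.
have /eqP := F4 s se s0; rewrite /D subr_eq0 => /eqP <-.
by rewrite addrA addrK addrC.
Qed.

Lemma Ccoef_one : exists2 e : R, 0 < e & forall s : C, nm s < e -> 0 < re s ->
  sums (fun n => Ccoef R 1 n * s ^+ n) (prime_zeta (1 + s) + clog s).
Proof.
have [c hc] := zeta_one_coefs; rewrite (Ccoef_eq hc).
have [e e0 h] := ball_near0 hc; exists e => // s se s0.
by have := h s se (fun _ => s0); split.
Qed.

Lemma growth_sums (a : nat -> C) (x : R) l : 0 < x -> sums (fun n => a n * toC x ^+ n) l -> growth a.
Proof.
move=> x0 /sums_bounded [K K0 aK]; exists K, x^-1; split=> // [|n]; first by rewrite invr_ge0 ltW.
rewrite -[leLHS](@mulfK _ (x ^+ n)); last by rewrite expf_neq0 // lt0r_neq0.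
rewrite exprVn ler_wpM2r ?invr_ge0 ?exprn_ge0 ?(ltW x0) //.
by have := aK n; rewrite nmM nmX nm_toC gtr0_norm.
Qed.

Lemma growth_Ccoef1 : growth (Ccoef R 1).
Proof.
have [e e0 h] := Ccoef_one; have e2 : 0 < e / 2 by rewrite divr_gt0.
apply: (growth_sums e2 (h (toC (e / 2)) _ _)); last by rewrite re_toC.
by rewrite nm_toC gtr0_norm // ltr_pdivrMr // ltr_pMr // ltr1n.
Qed.

End Branch.

(** * The regularised Euler product along a complex line *)

Section FpsNorms.
Variable R : realType.
Notation C := (cplx R).
Implicit Types f g : fps C.

Lemma l1_ext f g M : f =1 g -> l1 f M -> l1 g M.
Proof. by move=> fg h N; have := h N; under eq_bigr do rewrite fg. Qed.

Lemma l1_weak f M M' : M <= M' -> l1 f M -> l1 f M'.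
Proof. by move=> MM h N; apply: le_trans (h N) MM. Qed.

Lemma l1N f M : l1 f M -> l1 (- f) M.
Proof. by move=> h N; have := h N; under [X in _ -> X <= _]eq_bigr do rewrite fpnN nmN. Qed.

Lemma l1_fpC (c : C) : l1 (fpC c) (nm c).
Proof.
apply: (@l1_abs _ _ 1) => [[|j] // _|]; first by rewrite fpnC.
by rewrite big_ord1 fpnC.
Qed.

Lemma l1_1 : l1 (1 : fps C) 1.
Proof. by have := l1_fpC 1; rewrite rmorph1 (nm_nat _ 1). Qed.

Lemma l1_sum I (r : seq I) (F : I -> fps C) (M : I -> R) :
  (forall i, l1 (F i) (M i)) -> l1 (\sum_(i <- r) F i) (\sum_(i <- r) M i).
Proof.
move=> h; elim: r => [|i r IH]; last by rewrite !big_cons; apply: l1D.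
by rewrite !big_nil => N; rewrite big1 // => j _; rewrite fpn0 nm0.
Qed.

Lemma l1_prod I (r : seq I) (F : I -> fps C) (M : I -> R) :
  (forall i, l1 (F i) (M i)) -> l1 (\prod_(i <- r) F i) (\prod_(i <- r) M i).
Proof.
move=> h; elim: r => [|i r IH]; last by rewrite !big_cons; apply: l1M.
by rewrite !big_nil; exact: l1_1.
Qed.

Lemma sums_prod I (r : seq I) (F : I -> fps C) (M : I -> R) (v : I -> C) :
  (forall i, l1 (F i) (M i)) -> (forall i, sums (F i) (v i)) ->
  sums (\prod_(i <- r) F i) (\prod_(i <- r) v i).
Proof.
move=> hM hv; elim: r => [|i r IH]; first by rewrite !big_nil; exact: sums_fps1.
by rewrite !big_cons; apply: sumsM (hM i) (l1_prod r hM) (hv i) IH.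
Qed.

Lemma l1_coef f M n : l1 f M -> nm (f n) <= M.
Proof. by move=> h; apply: (bsum_comp n _ h) => j; apply: nm_ge0. Qed.

Lemma l1_fscale_le (s : C) (rho : R) f M : nm s <= rho -> l1 (fscale (toC rho) f) M -> l1 (fscale s f) M.
Proof.
move=> sr; have r0 : 0 <= rho := le_trans (nm_ge0 s) sr.
apply: bsum_le => n /=; rewrite !nmM !nmX nm_toC (ger0_norm r0) ler_wpM2r ?nm_ge0 //.
by apply: lerXn2r; rewrite ?nnegrE ?nm_ge0.
Qed.

(** With a nonzero constant term each coefficient is an infinite sum over v, obtained as a product
    of the series for e^(f_0) with the finite one for the rest. It serves to estimate remainders in
    norm. *)
Lemma fexp_series f n : sums (fun v => v`!%:R^-1 * (f ^+ v) n) (fexp f n).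
Proof.
pose g := f - fpC (f 0%N); have g0 : g 0%N = 0 := fexp_sub0 f.
have fE : f = g + fpC (f 0%N) by rewrite /g subrK.
pose G : fps C := Fps (fun j => j`!%:R^-1 * (g ^+ j) n).
have G0 j : (n < j)%N -> G j = 0 by move=> nj; rewrite /= fps_vanishX // mulr0.
have GM : l1 G (\sum_(j < n.+1) nm (G j)).
  by apply: (@l1_abs _ G n.+1) => // j; exact: G0.
have GS : sums G (\sum_(j < n.+1) G j) by apply: sums_finite.
have := sumsM (l1_expfps (f 0%N)) GM (sums_expfps (f 0%N)) GS.
have -> : cexp (f 0%N) * \sum_(j < n.+1) G j = fexp f n.
  rewrite /fexp fpnCM; congr (_ * _); rewrite -/g /= /expsum fpn_sum.
  by apply: eq_bigr => j _; rewrite fpnCM.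
apply: sums_ext => v; rewrite fpnM {2}fE exprDn fpn_sum mulr_sumr.
apply: eq_bigr => i _; have iv : (i <= v)%N by rewrite -ltnS.
rewrite -rmorphXn [g ^+ _ * _]mulrC fpnMn fpnCM /=.
have := bin_fact iv => /(congr1 (fun j => j%:R : C)); rewrite !natrM => <-.
have h1 : (i`!%:R : C) != 0 by rewrite pnatr_eq0 -lt0n fact_gt0.
have h2 : ((v - i)`!%:R : C) != 0 by rewrite pnatr_eq0 -lt0n fact_gt0.
have h3 : ('C(v, i)%:R : C) != 0 by rewrite pnatr_eq0 -lt0n bin_gt0.
rewrite -[X in _ = _ * X]mulr_natl.
move: ('C(v, i)%:R) ((v - i)`!%:R) (i`!%:R) (f 0%N ^+ i) h1 h2 h3 => x y z c h1 h2 h3.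
by rewrite -!mulrA; field; rewrite h1 h2 h3.
Qed.

Lemma l1_fexp_rem f M : l1 f M -> l1 (fexp f - 1 - f) (M ^+ 2 * expR M).
Proof.
move=> fM; have M0 := bsum_ge0 fM.
pose a v n : C := v.+2`!%:R^-1 * (f ^+ v.+2) n.
have rows v : bsum (fun n => nm (a v n)) (M ^+ 2 * (M ^+ v / v`!%:R)).
  move=> N; apply: le_trans (_ : v.+2`!%:R^-1 * M ^+ v.+2 <= _).
    rewrite -(@nm_nat R) -nmV; apply: le_trans (ler_wpM2l (nm_ge0 _) (l1X v.+2 fM N)).
    by rewrite mulr_sumr; apply: ler_sum => i _; rewrite nmM.
  rewrite !exprS expr0 mulr1 mulrA mulrC -!mulrA ler_wpM2l // ler_wpM2l // ler_wpM2l ?exprn_ge0 //.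
  rewrite lef_pV2 ?posrE ?ltr0n ?fact_gt0 // ler_nat.
  by rewrite !factS mulnA leq_pmull.
have bb : bsum (fun v => M ^+ 2 * (M ^+ v / v`!%:R)) (M ^+ 2 * expR M).
  by move=> N; rewrite -mulr_sumr ler_wpM2l ?exprn_ge0 // exp_partial_le.
have cols n : sums (a ^~ n) ((fexp f - 1 - f) n).
  rewrite !fpnB; pose F v := v`!%:R^-1 * (f ^+ v) n.
  have h := fexp_series f n.
  have h1 := (sums_shift F (fexp f n - F 0%N)).2.
  have h2 := (sums_shift (fun v => F v.+1) (fexp f n - F 0%N - F 1%N)).2.
  have F0 : F 0%N = (1 : fps C) n by rewrite /F expr0 fact0 invr1 mul1r.
  have F1 : F 1%N = f n by rewrite /F expr1 invr1 mul1r.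
  rewrite F0 F1 in h1 h2; apply: h2; rewrite addrC subrK; apply: h1.
  by rewrite addrC subrK.
exact: (fubini_bound rows bb cols).
Qed.

(** The partial products telescope, with increments P_N (B_N - 1) of norm at most e^M b_N. As a
    double series they give the limits of the coefficients and of the values at t = 1 together. *)
Lemma inf_prod (B : nat -> fps C) (b : nat -> R) M (v : nat -> C) :
  (forall n, l1 (B n - 1) (b n)) -> bsum b M ->
  exists P : fps C, [/\ l1 P (1 + expR M * M),
    forall D, (fun N => (\prod_(n < N) B n) D) @ \oo --> P D &
    (forall n, sums (B n) (v n)) -> exists2 w, sums P w & (fun N => \prod_(n < N) v n) @ \oo --> w].
Proof.
move=> Bb bM.
have b0 n : 0 <= b n := bsum_ge0 (Bb n).
pose P N := \prod_(n < N) B n.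
have Pb N : l1 (P N) (expR M).
  have h : l1 (P N) (\prod_(n < N) expR (b n)).
    apply: (l1_prod (index_enum 'I_N)) => n.
    have -> : B n = 1 + (B n - 1) by rewrite addrC subrK.
    by apply: l1_weak (l1D l1_1 (Bb n)); exact: expR_ge1Dx.
  apply: l1_weak h; rewrite -(big_morph _ (@expRD R) (@expR0 R)) ler_expR.
  exact: bM.
pose a N D := (P N * (B N - 1)) D.
have rows N : bsum (fun D => nm (a N D)) (expR M * b N) by exact: l1M (Pb N) (Bb N).
have bb : bsum (fun N => expR M * b N) (expR M * M).
  by move=> N; rewrite -mulr_sumr ler_wpM2l ?expR_ge0.
have cols := fubini_sums_ex rows bb.
pose c D := limn (series (a ^~ D)).
have cS D : sums (a ^~ D) (c D) by have [l hl _] := cols D; rewrite /c (sums_lim hl).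
have PE N : P N = 1 + \sum_(n < N) (P n * (B n - 1)).
  elim: N => [|N IH]; first by rewrite /P !big_ord0 addr0.
  by rewrite [P N.+1]big_ord_recr /= big_ord_recr /= addrA -IH -/(P N) mulrBr mulr1 addrC subrK.
exists (1 + Fps c); split.
- by apply: l1D; [exact: l1_1|exact: (fubini_bound rows bb cS)].
- move=> D; rewrite fpnD.
  rewrite (_ : (fun N => _) = fun N => (1 : fps C) D + series (a ^~ D) N).
    exact (cvgKD (@cvgK_cst _ _ \oo _ _) (sums_cvg (cS D))).
  by apply/funext => N; rewrite -/(P N) PE fpnD fpn_sum seriesE.
move=> Bv; pose q N := \prod_(n < N) v n.
have Pv N : sums (P N) (q N).
  have Bn n : l1 (B n) (1 + b n).
    have -> : B n = 1 + (B n - 1) by rewrite addrC subrK.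
    exact: l1D l1_1 (Bb n).
  exact: (sums_prod (index_enum 'I_N) (fun n : 'I_N => Bn n) (fun n : 'I_N => Bv n)).
have rv N : sums (a N) (q N * (v N - 1)).
  exact: sumsM (Pb N) (Bb N) (Pv N) (sumsD (Bv N) (sumsN (sums_fps1 R))).
have [w hw _] : exists2 w, sums (fun N => q N * (v N - 1)) w & nm w <= expR M * M.
  apply: sums_abs => N; apply: le_trans (bb N); apply: ler_sum => n _.
  by apply: (sums_nm_le (rv n)) => D; apply: le_trans (nm_sum _ _ _) (rows n D).
exists (1 + w).
  exact: sumsD (sums_fps1 R) (fubini_sums rows bb rv cS hw).
rewrite (_ : (fun N => _) = fun N => 1 + series (fun N => q N * (v N - 1)) N).
  exact (cvgKD (@cvgK_cst _ _ \oo _ _) (sums_cvg hw)).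
apply/funext => N; rewrite seriesE; elim: N => [|N IH]; first by rewrite !big_ord0 addr0.
by rewrite big_ord_recr /= big_ord_recr /= addrA -IH -/(q N) mulrBr mulr1 addrC subrK.
Qed.

(** A majorant: the recursion has nonnegative coefficients, so the h_u are dominated by those of m +
    1 variables equal to Q. *)
Lemma newton_l1 (P H : nat -> fps C) m (Q : R) : newton P H -> 0 <= Q ->
  (forall r, (0 < r)%N -> l1 (P r) (m.+1%:R * Q ^+ r)) ->
  forall u, l1 (H u) ('C(u + m, u)%:R * Q ^+ u).
Proof.
move=> [H0 HP] Q0 PQ; elim/ltn_ind => -[|u] IH.
  by rewrite H0 bin0 expr0 mulr1; exact: l1_1.
have h : l1 (H u.+1 *+ u.+1) (u.+1%:R * ('C(u.+1 + m, u.+1)%:R * Q ^+ u.+1)).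
  rewrite HP big_add1 /= big_mkord.
  have hb : ('C(u.+1 + m, u.+1)%:R : R^o) *+ u.+1 = _ := (@newton_bin R (R^o : comAlgType R) m).2 u.+1.
  rewrite mulrA mulr_natl [X in X * _]hb big_add1 /= big_mkord mulr_suml.
  apply: (l1_weak _ (l1_sum (index_enum 'I_u.+1) (M := fun i : 'I_u.+1 => m.+1%:R * Q ^+ i.+1 * ('C(u - i + m, u - i)%:R * Q ^+ (u - i))) _)).
    apply: ler_sum => i _; have iu : (i <= u)%N by rewrite -ltnS.
    rewrite subSS (_ : Q ^+ u.+1 = Q ^+ i.+1 * Q ^+ (u - i)); last by rewrite -exprD addSn subnKC.
    by rewrite mulrACA.
  move=> i; rewrite subSS; apply: l1M; first exact: PQ.
  by apply: IH; rewrite ltnS leq_subr.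
move=> N; have := h N; under eq_bigr do rewrite fpnMn nmMn.
by rewrite sumrMnl -[X in X <= _]mulr_natl ler_pM2l ?ltr0n.
Qed.

End FpsNorms.

Lemma newton_sums (R : realType) (P H : nat -> fps (cplx R)) (pv hv : nat -> cplx R) (MP MH : nat -> R) :
  newton P H -> newton pv hv -> (forall r, (0 < r)%N -> l1 (P r) (MP r)) ->
  (forall u, l1 (H u) (MH u)) -> (forall r, (0 < r)%N -> sums (P r) (pv r)) ->
  forall u, sums (H u) (hv u).
Proof.
move=> [H0 HP] [h0 hp] PM HM Ps; elim/ltn_ind => -[|u] IH.
  by rewrite H0 h0; apply: sums_fps1.
have h : sums (H u.+1 *+ u.+1) (hv u.+1 *+ u.+1).
  rewrite HP hp !big_add1 /= !big_mkord.
  have h1 (i : 'I_u.+1) : sums (P i.+1 * H (u.+1 - i.+1)%N) (pv i.+1 * hv (u.+1 - i.+1)%N).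
    by apply: (sumsM (PM i.+1 isT) (HM _) (Ps i.+1 isT)); apply: IH; rewrite subSS ltnS leq_subr.
  by apply: sums_ext (sums_finsum (index_enum 'I_u.+1) h1) => n; rewrite fpn_sum.
have u0 : (u.+1%:R : cplx R) != 0 by rewrite pnatr_eq0.
have := sumsZ (u.+1%:R^-1) h; rewrite -[X in sums _ (_ * X)]mulr_natl mulKf //.
by apply: sums_ext => n; rewrite fpnMn -[X in _ * X]mulr_natl mulKf.
Qed.

Lemma newton1 (B : comNzRingType) (P H : nat -> B) : newton P H -> H 1%N = P 1%N.
Proof. by case=> H0 /(_ 1%N); rewrite big_nat1 subnn H0 mulr1 mulr1n. Qed.

Section BinomialSums.
Variable R : realType.
Implicit Types x y : R.

Lemma bin_bsum m x : 0 <= x < 1 ->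
  bsum (fun u => 'C(u + m, u)%:R * x ^+ u) ((1 - x)^-1 ^+ m.+1).
Proof.
move=> /andP[x0 x1]; have d0 : 0 < 1 - x by rewrite subr_gt0.
have E0 N : (1 - x) * (\sum_(u < N) 'C(u + 0, u)%:R * x ^+ u) + x ^+ N = 1.
  elim: N => [|N IH]; first by rewrite big_ord0 mulr0 add0r.
  rewrite big_ord_recr /= addn0 binn exprS mulrDr -[RHS]IH; ring.
have ES n N : (1 - x) * (\sum_(u < N) 'C(u + n.+1, u)%:R * x ^+ u) + 'C(N + n, n.+1)%:R * x ^+ N
    = \sum_(u < N) 'C(u + n, u)%:R * x ^+ u.
  elim: N => [|N IH]; first by rewrite !big_ord0 mulr0 add0r add0n bin_small ?mul0r.
  rewrite 2!big_ord_recr /= -IH addnS -addSn.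
  have -> : 'C(N.+1 + n, N) = 'C(N.+1 + n, n.+1).
    by rewrite -[in LHS]bin_sub ?addSnnS ?leq_addr // addKn.
  have -> : 'C(N + n, N) = 'C(N + n, n) by rewrite -[in LHS]bin_sub ?leq_addr // addKn.
  by rewrite addSn binS natrD exprS; ring.
elim: m => [|m IH] N.
  rewrite -[leRHS]mulr1 -[X in _ <= _ * X](E0 N) mulrDr mulrA expr1 mulVf ?lt0r_neq0 // mul1r lerDl.
  by rewrite mulr_ge0 ?invr_ge0 ?exprn_ge0 // ltW.
rewrite -(ler_pM2l d0) [leRHS](_ : _ = (1 - x)^-1 ^+ m.+1); last first.
  by rewrite [_^-1 ^+ _.+2]exprS mulrA mulfV ?mul1r ?lt0r_neq0.
apply: le_trans (IH N); rewrite -(ES m N) lerDl.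
by rewrite mulr_ge0 ?exprn_ge0.
Qed.

Lemma bin2_bsum m x : 0 <= x < 1 ->
  bsum (fun u => 'C(u + m, u)%:R ^+ 2 * (x ^+ 2) ^+ u) (((1 - x)^-1 ^+ m.+1) ^+ 2).
Proof.
move=> hx N; have /andP[x0 x1] := hx; pose a u : R := 'C(u + m, u)%:R * x ^+ u.
have a0 u : 0 <= a u by rewrite mulr_ge0 ?exprn_ge0.
have S := bin_bsum m hx N.
apply: le_trans (_ : (\sum_(u < N) a u) ^+ 2 <= _); last first.
  by apply: lerXn2r; rewrite ?nnegrE ?sumr_ge0 ?exprn_ge0 ?invr_ge0 ?subr_ge0 ?(ltW x1).
rewrite [leRHS]expr2 mulr_suml; apply: ler_sum => i _.
rewrite exprAC -exprMn -/(a i) [leLHS]expr2 ler_wpM2l //.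
by rewrite (bigD1 i) //= lerDl sumr_ge0.
Qed.

(** From u = 2 on, x^(2u) <= (x / y)^4 y^(2u). A fixed y yields a bound O(x^4) uniform in x. *)
Lemma bin2_tail m x y : 0 <= x <= y -> 0 < y < 1 ->
  bsum (fun u => 'C(u.+2 + m, u.+2)%:R ^+ 2 * (x ^+ 2) ^+ u.+2)
    ((x / y) ^+ 4 * ((1 - y)^-1 ^+ m.+1) ^+ 2).
Proof.
move=> /andP[x0 xy] /andP[y0 y1] N.
have k0 : 0 <= (x / y) ^+ 4 by apply: exprn_ge0; apply: divr_ge0 => //; exact: ltW.
have nn a b : 0 <= (x / y) ^+ 4 * ('C(a, b)%:R ^+ 2 * (y ^+ 2) ^+ b).
  by apply: mulr_ge0 => //; apply: mulr_ge0; apply: exprn_ge0 => //; apply: exprn_ge0; exact: ltW.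
have h := @bin2_bsum m y _ N.+2; apply: le_trans (ler_wpM2l _ (h _)); last by rewrite (ltW y0) y1.
  rewrite 2!big_ord_recl !mulrDr mulr_sumr.
  apply: le_trans (_ : \sum_(i < N) (x / y) ^+ 4 * ('C(i.+2 + m, i.+2)%:R ^+ 2 * (y ^+ 2) ^+ i.+2) <= _).
    apply: ler_sum => i _; rewrite [leRHS]mulrCA; apply: ler_wpM2l; first by rewrite exprn_ge0.
    have yi : (x / y) ^+ 4 * (y ^+ 2) ^+ i.+2 = x ^+ 4 * (y ^+ 2) ^+ i.
      have yn : y != 0 by rewrite gt_eqF.
      by rewrite expr_div_n -!exprM mulnSr mulnSr -addnA exprD mulrA mulrAC divfK ?expf_neq0 // mulrC.
    rewrite yi [leLHS](_ : _ = x ^+ 4 * (x ^+ 2) ^+ i); last by rewrite -!exprM -exprD; congr (x ^+ _); lia.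
    by rewrite ler_wpM2l ?exprn_ge0 // lerXn2r ?nnegrE ?exprn_ge0 ?(ltW y0) // lerXn2r ?nnegrE ?(ltW y0).
  by rewrite addrA lerDr; apply: addr_ge0; exact: nn.
exact: k0.
Qed.

End BinomialSums.

(** * The constants W as sums over the primes *)

Section WValues.
Variables (R : realType) (m : nat).
Notation C := (cplx R).
Notation V r mu nu := (ratr (Vcoef r mu nu m.+1) : C).

Definition Vser mu nu : fps C := Fps (fun r => if r is 0 then 0 else V r mu nu).

Lemma toC_invn p : toC p%:R^-1 = (p%:R^-1 : C).
Proof. by rewrite (fmorphV (@toC R)) rmorph_nat. Qed.

Lemma primeV_half p : prime p -> 0 < (p%:R^-1 : R) /\ (p%:R^-1 : R) <= 1 / 2.
Proof.
move=> pp; have p2 := prime_gt1 pp; rewrite invr_gt0 ltr0n prime_gt0 //; split=> //.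
by rewrite div1r lef_pV2 ?posrE ?ltr0n ?prime_gt0 // ler_nat.
Qed.

Lemma V_growth mu nu : is_part mu -> is_part nu -> growth (fun r => V r.+1 mu nu).
Proof.
move=> pm pn; have [e0|e0] := posnP (sumn mu + sumn nu).
  have [-> ->] : mu = [::] /\ nu = [::].
    move/eqP: e0; rewrite addn_eq0 => /andP[/eqP m0 /eqP n0].
    by split; apply/nilP; rewrite /nilp -leqn0; [rewrite -m0|rewrite -n0]; apply: part_size.
  have [rho [_ _ VE]] := Vcoef00 R m.
  apply: (@growth_ext _ (fun r => r.+1%:R^-1 * ((2 * m).+1%:R - \sum_(x <- rho) toC x * toC x ^+ r))).
    move=> r; rewrite -(eq_bigr _ (fun x _ => exprS (toC x) r)) -VE // -[X in _ * X]mulr_natl mulKf //.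
  apply: growth_mul.
    exists 1, 1; split=> // r; rewrite expr1n mulr1 nmV nm_nat invf_le1 ?ltr0n // ler1n //.
  apply: growthD; first exact: growth_cst.
  apply: growth_ext (growthZ (-1) (growth_sum rho (fun x => growthZ (toC x) (growth_exp (toC x))))).
  by move=> r; rewrite mulN1r.
have [l [_ [N lN]]] := Vcoef_rational R m pm pn e0.
exact: growth_shift (growth_quot lN).
Qed.

Lemma V_value mu nu : is_part mu -> is_part nu -> (0 < sumn mu + sumn nu)%N ->
  exists v : nat -> C, forall p, prime p -> rval (p%:R^-1) (Vser mu nu) (v p).
Proof.
move=> pm pn e0; have [l [l1 [N lN]]] := Vcoef_rational R m pm pn e0.
by exists (fun p => N.[toC p%:R^-1] / (Dpoly l).[toC p%:R^-1]) => p pp; exists l, N.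
Qed.

Lemma V_avg mu nu p v : prime p -> rval (p%:R^-1) (Vser mu nu) v ->
  avg (fun n => \sum_(i < n.+1) V i.+1 mu nu * (p%:R^-1) ^+ i.+1) v.
Proof.
move=> pp h; have [x0 xpow_two] := primeV_half pp; have := @rval_avgS R _ x0 xpow_two (Vser mu nu) _ erefl h.
by apply: avg_ext => n; rewrite toC_invn.
Qed.

(** In degree 0 the mean is a combination of logarithms at 1 / p and at rho / p <= 0, where
    [avg_log] reaches beyond the disc of convergence. Its exponential is the value of the rational
    function U_0 at 1 / p. *)
Lemma V00_value : exists v : nat -> C, forall p, prime p ->
  avg (fun n => \sum_(i < n.+1) V i.+1 [::] [::] * (p%:R^-1) ^+ i.+1) (v p) /\
  rval (p%:R^-1) (Fps (fun n => ('C(n + m, n) ^ 2)%:R)) (cexp (v p)).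
Proof.
have [rho [rho0 rhoE VE]] := Vcoef00 R m.
pose v (p : nat) : C := (2 * m).+1%:R * toC (- ln (1 - p%:R^-1))
   - \sum_(x <- rho) toC (- ln (1 - x / p%:R)).
exists v => p pp; have [x0 xpow_two] := primeV_half pp; split.
  pose g x n : C := toC (logpoly R n).[x / p%:R].
  have av : avg (fun n => (2 * m).+1%:R * g 1 n + -1 * \sum_(x <- rho) g x n) (v p).
    rewrite /v -[X in avg _ (_ + X)]mulN1r; apply: avgD; apply: avgZ.
      by rewrite /g div1r; apply: avg_log.
    elim: rho rho0 {rhoE VE v} => [_|x rho IH /= /andP[hx /IH h]].
      by rewrite big_nil; apply: avg_ext (avg_cst 0) => n; rewrite big_nil.
    rewrite big_cons; apply: (@avg_ext _ (fun n => g x n + \sum_(y <- rho) g y n)).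
      by move=> n; rewrite big_cons.
    apply: avgD h; apply: avg_log; apply: le_trans (_ : 0 <= _); last by rewrite divr_ge0.
    by rewrite pmulr_lle0.
  apply: avg_ext av => n; rewrite mulN1r /g div1r.
  transitivity (\sum_(i < n.+1) ((2 * m).+1%:R * (toC (p%:R^-1) ^+ i.+1 / i.+1%:R)
     - \sum_(x <- rho) toC (x / p%:R) ^+ i.+1 / i.+1%:R)).
    have hl (z : R) : toC (logpoly R n).[z] = \sum_(i < n.+1) toC z ^+ i.+1 / i.+1%:R.
      rewrite /logpoly horner_sum rmorph_sum /=; apply: eq_bigr => i _.
      by rewrite hornerZ hornerXn (rmorphM (@toC R)) mulrC rmorphXn (fmorphV (@toC R)) rmorph_nat.
    rewrite sumrB -mulr_sumr -hl exchange_big /=; congr (_ - _).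
    by apply: eq_bigr => x _; rewrite hl.
  apply: eq_bigr => i _; have i0 : (i.+1%:R : C) != 0 by rewrite pnatr_eq0.
  apply: (mulfI i0); rewrite mulrBr mulr_sumr mulrA.
  have hV : V i.+1 [::] [::] *+ i.+1 = _ := VE i.+1 isT.
  rewrite [RHS]mulrA (_ : i.+1%:R * V i.+1 [::] [::] = V i.+1 [::] [::] *+ i.+1); last first.
    exact: mulr_natl.
  rewrite hV mulrBl mulr_suml; congr (_ - _).
    by rewrite toC_invn mulrC divfK.
  apply: eq_bigr => x _; rewrite mulrCA mulfV // mulr1 (rmorphM (@toC R)) exprMn_comm; last exact: mulrC.
  by congr (_ * _ ^+ _); exact: toC_invn.
exists (nseq (2 * m).+1 1), (Dpoly rho); split.
- exact: all_nseq1.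
- by rewrite Dpoly_nseq rhoE.
have ec y : y < 1 -> cexp (toC (- ln (1 - y)) : C) = (1 - toC y)^-1.
  move=> y1; rewrite cexp_toC expRN lnK ?posrE ?subr_gt0 //.
  by rewrite (fmorphV (@toC R)) rmorphB rmorph1.
have lt1 : (p%:R^-1 : R) < 1 by apply: le_lt_trans xpow_two _; lra.
rewrite /v cexpD cexpN cexp_sum mulr_natl cexpMn ec // Dpoly_nseq mulrC /Dpoly horner_prod.
congr (_ * _).
  elim: rho rho0 {rhoE VE v} => [_|x rho IH /= /andP[hx /IH h]]; first by rewrite !big_nil invr1.
  rewrite !big_cons invfM h; congr (_ * _).
  have xp : x / p%:R < 1 by apply: le_lt_trans ltr01; rewrite pmulr_lle0.
  by rewrite ec // invrK (rmorphM (@toC R)) hornerD hornerN hornerZ hornerX hornerC.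
by rewrite horner_exp hornerD hornerN hornerX hornerC exprVn.
Qed.

(** Once the term r = 1 is subtracted, the Borel sum over r becomes a convergent sum over p of Borel
    means. *)
Lemma Wcoef_value mu nu v : is_part mu -> is_part nu ->
  (forall p, prime p -> avg (fun n => \sum_(i < n.+1) V i.+1 mu nu * (p%:R^-1) ^+ i.+1) (v p)) ->
  let e := (sumn mu + sumn nu)%N in
  sums (psum_ (fun p => ell R e p * (v p - V 1%N mu nu / p%:R)))
    (Wcoef R m.+1 mu nu - V 1%N mu nu * Ccoef R 1 e).
Proof.
move=> pm pn av e; have [M2 hM] := bsum_ell R e.
have hc r : (0 < r)%N ->
    sums (fun p => if prime p then ell R e p * (p%:R^-1) ^+ r.+1 else 0) (Ccoef R r.+1 e).
  by move=> r0; rewrite Ccoef_high //; apply: Chigh_sums.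
have [S sS aS] := borel_primes (V_growth pm pn) hM hc av.
by rewrite /Wcoef (avg_borel aS) addrC addKr.
Qed.

End WValues.

(** * The local factor at a prime *)

Section LocalFactor.
Variables (R : realType) (m : nat).
Notation C := (cplx R).
Variables (x y : 'rV[C]_m.+1) (p : nat).
Hypothesis pp : prime p.
Hypotheses (xr : forall i, nm (x ord0 i) <= 1 / 16) (yr : forall i, nm (y ord0 i) <= 1 / 16).

Let a : nat -> (C^o : comAlgType C) := power_sum x.
Let b : nat -> (C^o : comAlgType C) := power_sum y.
Let lam : C := - toC (ln p%:R).
Let T : C := p%:R^-1.
Definition ppow (z : seq nat * seq nat) : C := pprod a z.1 * pprod b z.2.

Lemma power_sum0 (u : 'rV[C]_m.+1) : power_sum u 0%N = m.+1%:R.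
Proof.
rewrite /power_sum (eq_bigr (fun=> 1)) => [|i _]; last by rewrite expr0.
by rewrite sumr_const card_ord.
Qed.

Lemma psum_fps_power (u : 'rV[C]_m.+1) r :
  psum_fps (power_sum u : nat -> (C^o : comAlgType C)) r = \sum_i expfps (u ord0 i) ^+ r.
Proof.
apply: fpsP => n; rewrite [RHS]fpn_sum.
have eX (z : C) : expfps z ^+ r = expfps (z *+ r).
  elim: r => [|r IH]; last by rewrite exprS IH mulrS expfpsD.
  by apply: fpsP => -[|j] /=; rewrite ?expr0 ?mulr0n ?fact0 ?divr1 // exprS !mul0r.
transitivity (((r ^ n)%:R / n`!%:R : C) * \sum_i (u ord0 i) ^+ n); first by [].
rewrite mulr_sumr; apply: eq_bigr => i _; rewrite eX /=.
by rewrite exprMn_n -[in RHS]mulr_natl mulrAC.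
Qed.

(** The function h_u of the alphabet p^(-x_i t): [hserX] belongs to e^(x_i t), and t is rescaled by
    - log p. *)
Definition lX u : fps C := fscale lam (hserX a b u).
Definition lY u : fps C := fscale lam (hserY a b u).

Lemma newton_lX : newton (fun r => \sum_i expfps (lam * x ord0 i) ^+ r) lX.
Proof.
apply: newton_ext (newton_morph (@fscale C lam) (newton_hserX a b)) => // r _ /=.
rewrite psum_fps_power rmorph_sum /=; apply: eq_bigr => i _.
by rewrite rmorphXn /= expfps_scale mulrC.
Qed.

Lemma newton_lY : newton (fun r => \sum_i expfps (lam * y ord0 i) ^+ r) lY.
Proof.
apply: newton_ext (newton_morph (@fscale C lam) (newton_hserY a b)) => // r _ /=.
rewrite psum_fps_power rmorph_sum /=; apply: eq_bigr => i _.
by rewrite rmorphXn /= expfps_scale mulrC.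
Qed.

Let Q : R := expR (ln p%:R / 16).

Lemma l1_powers (u : 'rV[C]_m.+1) r : (forall i, nm (u ord0 i) <= 1 / 16) ->
  l1 (\sum_i expfps (lam * u ord0 i) ^+ r) (m.+1%:R * Q ^+ r).
Proof.
move=> ur; have h i : l1 (expfps (lam * u ord0 i) ^+ r) (Q ^+ r).
  apply: l1X; apply: l1_weak (l1_expfps _); rewrite ler_expR nmM nmN nm_toC.
  rewrite ger0_norm ?ln_nat_ge0 //; apply: ler_wpM2l; first exact: ln_nat_ge0.
  by rewrite -div1r.
have := l1_sum (index_enum 'I_m.+1) h.
by rewrite sumr_const card_ord mulr_natl.
Qed.

Lemma l1_lX u : l1 (lX u) ('C(u + m, u)%:R * Q ^+ u).
Proof. by apply: (newton_l1 newton_lX) => [|r _]; [exact: expR_ge0|exact: l1_powers]. Qed.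

Lemma l1_lY u : l1 (lY u) ('C(u + m, u)%:R * Q ^+ u).
Proof. by apply: (newton_l1 newton_lY) => [|r _]; [exact: expR_ge0|exact: l1_powers]. Qed.

(* For exponents of modulus at most 1/16 the u-th term of the local factor at p
   is O(p^(-u (1 - 2/16))) = O(xpow^(2 u)). *)
Definition xpow : R := expR (- (7 / 16) * ln p%:R).
Let term u : fps C := fpC (T ^+ u) * (lX u * lY u).

Lemma l1_term u : l1 (term u) ('C(u + m, u)%:R ^+ 2 * (xpow ^+ 2) ^+ u).
Proof.
have h := l1M (l1_fpC (T ^+ u)) (l1M (l1_lX u) (l1_lY u)); apply: l1_weak h.
have -> : xpow ^+ 2 = p%:R^-1 * (Q * Q).
  rewrite /xpow /Q expr2 -!expRD -{3}[p%:R]lnK ?posrE ?ltr0n ?prime_gt0 // -expRN -expRD.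
  by congr expR; field.
rewrite nmX nmV nm_nat !exprMn; move: (p%:R^-1 ^+ u) (Q ^+ u) ('C(_, _)%:R) => s t w.
by rewrite (_ : s * (w * t * (w * t)) = w ^+ 2 * (s * (t * t))) //; ring.
Qed.

Lemma xpow_bounds : 0 < xpow /\ xpow <= expR (- (7 / 16) * ln 2).
Proof.
split; first exact: expR_gt0.
have p2 : (2 : R) <= p%:R by rewrite ler_nat prime_gt1.
have h : ln (2 : R) <= ln p%:R by rewrite ler_ln ?posrE ?ltr0n ?prime_gt0.
by rewrite ler_expR; lra.
Qed.

(** The value of [xpow] at p = 2, the largest over the primes; it makes the bounds uniform in p. *)
Definition xpow_two : R := expR (- (7 / 16) * ln 2).

Lemma x2_lt1 : 0 < xpow_two < 1.
Proof.
rewrite expR_gt0 expR_lt1 mulNr oppr_lt0 mulr_gt0 ?ln_gt0 ?ltr1n //; lra.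
Qed.

Definition KT : R := ((1 - xpow_two)^-1 ^+ m.+1) ^+ 2.

Lemma rows_term : bsum (fun u => 'C(u + m, u)%:R ^+ 2 * (xpow ^+ 2) ^+ u) (((1 - xpow)^-1 ^+ m.+1) ^+ 2).
Proof.
have [x0 xx] := xpow_bounds; have /andP[_ x21] := x2_lt1.
by apply: bin2_bsum; rewrite (ltW x0) (le_lt_trans xx).
Qed.

Definition locU : fps C := Fps (fun D => limn (series (fun u => term u D))).

Lemma sums_locU D : sums (fun u => term u D) (locU D).
Proof.
have [l hl _] := fubini_sums_ex (a := fun u j => term u j) l1_term rows_term D.
by rewrite /= (sums_lim hl).
Qed.

Let w : fps C := term 1.

Lemma term0 : term 0 = 1.
Proof. by rewrite /term expr0 rmorph1 mul1r newton_lX.1 newton_lY.1 mul1r. Qed.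

Lemma l1_locU : l1 (locU - 1 - w) ((xpow / xpow_two) ^+ 4 * KT).
Proof.
have [x0 xx] := xpow_bounds.
have h := @bin2_tail R m xpow xpow_two _ x2_lt1.
apply: (fubini_bound (a := fun u j => term u.+2 j) _ (h _)).
- by move=> u; exact: l1_term.
- by rewrite (ltW x0).
move=> D; rewrite !fpnB -term0.
have h1 := (sums_shift (fun u => term u D) (locU D - term 0 D)).2.
have h2 := (sums_shift (fun u => term u.+1 D) (locU D - term 0 D - term 1 D)).2.
by apply: h2; rewrite addrC subrK; apply: h1; rewrite addrC subrK; apply: sums_locU.
Qed.

(** The local factor divided by the exponential of its term u = 1, whose value at t = 1 is the sum
    of p^-(1 + x_i + y_j). What remains is 1 + O(xpow^4) = 1 + O(p^(-7/4)), hence summable over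
    p. *)
Definition locB : fps C := fexp (- w) * locU.

(** For E near 1 - v and U near 1 + v: the terms of first order in v cancel, and each summand on the
    right is of second order. The three summands of [KB] bound them. *)
Lemma locB_alg (B : comNzRingType) (E U v : B) :
  E * U - 1 = - (v * v) + (E - 1 - - v) * (1 + v) + E * (U - 1 - v).
Proof. ring. Qed.

Definition KB : R := m.+1%:R ^+ 4 + m.+1%:R ^+ 4 * expR (m.+1%:R ^+ 2) * (1 + m.+1%:R ^+ 2)
   + expR (m.+1%:R ^+ 2) * (KT / xpow_two ^+ 4).

Lemma l1_locB : l1 (locB - 1) (KB * xpow ^+ 4).
Proof.
have [x0 xx] := xpow_bounds; have /andP[x20 x21] := x2_lt1.
have x1 : xpow ^+ 2 <= 1 by rewrite exprn_ile1 ?ltW // (le_lt_trans xx).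
set k2 : R := m.+1%:R ^+ 2; have k0 : 0 <= k2 by rewrite exprn_ge0.
have wM : l1 w (k2 * xpow ^+ 2).
  by have := l1_term 1; rewrite expr1 add1n bin1.
have wM' := l1N wM.
have W1 : k2 * xpow ^+ 2 <= k2 by rewrite -[leRHS]mulr1 ler_wpM2l.
rewrite /locB (locB_alg _ _ w).
have e0 : 0 <= expR (k2 * xpow ^+ 2) <= expR k2 by rewrite expR_ge0 ler_expR.
have h := l1D (l1D (l1N (l1M wM wM)) (l1M (l1_fexp_rem wM') (l1D (@l1_1 R) wM)))
   (l1M (l1_fexp wM') l1_locU).
apply: l1_weak h; rewrite /KB mulrDl mulrDl; apply: lerD; [apply: lerD|].
- rewrite (_ : m.+1%:R ^+ 4 = k2 * k2); last by rewrite /k2 -exprD.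
  by rewrite (_ : k2 * k2 * xpow ^+ 4 = k2 * xpow ^+ 2 * (k2 * xpow ^+ 2)) //; ring.
- rewrite (_ : m.+1%:R ^+ 4 = k2 * k2); last by rewrite /k2 -exprD.
  rewrite [leRHS](_ : _ = (k2 * xpow ^+ 2) ^+ 2 * expR k2 * (1 + k2)); last by rewrite -/k2; move: (expR k2) => E; ring.
  move/andP: e0 => [e0 e1]; apply: ler_pM => //.
  - by rewrite mulr_ge0 ?exprn_ge0 // mulr_ge0 ?exprn_ge0 ?ltW.
  - by rewrite addr_ge0 // mulr_ge0 ?exprn_ge0 ?ltW.
  - by apply: ler_wpM2l => //; rewrite exprn_ge0 // mulr_ge0 ?exprn_ge0 ?ltW.
  - by rewrite lerD2l.
- rewrite expr_div_n mulrA [leRHS](_ : _ = expR k2 * (xpow ^+ 4 / xpow_two ^+ 4) * KT); last by rewrite -/k2; move: (expR k2) (xpow_two ^+ 4)^-1 => E z; ring.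
  rewrite [leLHS]mulrA; apply: ler_wpM2r.
    by apply: exprn_ge0; apply: exprn_ge0; rewrite invr_ge0 subr_ge0 ltW.
  apply: ler_wpM2r; last by move/andP: e0 => [].
  by apply: divr_ge0; apply: exprn_ge0; exact: ltW.
Qed.

Lemma power_sumE (u : 'rV[C]_m.+1) r : power_sum u r = \sum_i u ord0 i ^+ r.
Proof. by []. Qed.

Let gx u : C := hsym (power_sum (\row_i npow p (- x ord0 i)) : nat -> (C^o : comAlgType C)) u.
Let gy u : C := hsym (power_sum (\row_i npow p (- y ord0 i)) : nat -> (C^o : comAlgType C)) u.

Lemma sums_powers (u : 'rV[C]_m.+1) r :
  sums (\sum_i expfps (lam * u ord0 i) ^+ r) (power_sum (\row_i npow p (- u ord0 i)) r).
Proof.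
have h i : sums (expfps (lam * u ord0 i) ^+ r) (npow p (- u ord0 i) ^+ r).
  rewrite /npow mulNr -mulrN mulrC; elim: r => [|r IH]; first exact: sums_fps1.
  rewrite !exprS; apply: (sumsM (l1_expfps _) (l1X r (l1_expfps _)) _ IH).
  exact: sums_expfps.
have -> : power_sum (\row_i npow p (- u ord0 i)) r = \sum_i npow p (- u ord0 i) ^+ r :> C.
  by rewrite power_sumE; apply: eq_bigr => i _; rewrite mxE.
by apply: sums_ext (sums_finsum (index_enum 'I_m.+1) h) => n; rewrite fpn_sum.
Qed.

Lemma sums_lX u : sums (lX u) (gx u).
Proof.
apply: (newton_sums newton_lX (hsym_newton _) (fun r _ => l1_powers r xr) l1_lX) => r _.
exact: sums_powers.
Qed.

Lemma sums_lY u : sums (lY u) (gy u).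
Proof.
apply: (newton_sums newton_lY (hsym_newton _) (fun r _ => l1_powers r yr) l1_lY) => r _.
exact: sums_powers.
Qed.

Lemma sums_term u : sums (term u) (T ^+ u * (gx u * gy u)).
Proof.
apply: sums_ext (sumsZ (T ^+ u) (sumsM (l1_lX u) (l1_lY u) (sums_lX u) (sums_lY u))) => n.
by rewrite fpnCM.
Qed.

Lemma sums_locU1 : sums locU (local_factor p x (- y)).
Proof.
have h : bsum (fun u => nm (T ^+ u * (gx u * gy u))) (((1 - xpow)^-1 ^+ m.+1) ^+ 2).
  move=> N; apply: le_trans (rows_term N); apply: ler_sum => i _.
  apply: (sums_nm_le (sums_term i)) => D; apply: le_trans (nm_sum _ _ _) _.
  exact: l1_term.
have [l hl _] := sums_abs h.
have -> : local_factor p x (- y) = l.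
  rewrite /local_factor; apply: sums_lim; apply: sums_ext hl => u.
  rewrite mulrC exprVn; congr (_ * _ / _); congr (hsym (power_sum _) u).
  by apply/rowP => i; rewrite !mxE.
exact: (fubini_sums (a := fun u j => term u j) l1_term rows_term sums_term sums_locU hl).
Qed.

Lemma sums_locB : exists2 M, l1 locB M & sums locB
  (cexp (- (\sum_i \sum_j npow p (- (1 + (x ord0 i + y ord0 j))))) * local_factor p x (- y)).
Proof.
have wM := l1N (l1_term 1).
have UM : exists M, l1 locU M.
  have h := l1D (l1D l1_locU (l1_term 1)) (@l1_1 R).
  by eexists; apply: l1_ext h => n; rewrite -/w !subrK.
have [MU hU] := UM.
exists (expR ('C(1 + m, 1)%:R ^+ 2 * (xpow ^+ 2) ^+ 1) * MU).
  exact: l1M (l1_fexp wM) hU.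
apply: (sumsM (l1_fexp wM) hU _ sums_locU1).
apply: (sums_fexp wM).
have -> : \sum_i \sum_j npow p (- (1 + (x ord0 i + y ord0 j))) = T ^+ 1 * (gx 1 * gy 1).
  rewrite /gx /gy (newton1 (hsym_newton _)) (newton1 (hsym_newton _)) !power_sumE.
  rewrite expr1 mulr_suml mulr_sumr; apply: eq_bigr => i _.
  rewrite mulr_sumr mulr_sumr; apply: eq_bigr => j _.
  have p0 := prime_gt0 pp; rewrite !mxE !expr1 opprD opprD npowD npowD.
  by congr (_ * _); have := npow_nat R 1 p0; rewrite expr1.
by apply: sums_ext (sumsN (sums_term 1)) => n; rewrite fpnN.
Qed.

Variable vv : seq nat * seq nat -> C.
Hypothesis rvv : forall z, is_part2 z -> (0 < sumn z.1 + sumn z.2)%N ->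
  rval (p%:R^-1) (Vser R m z.1 z.2) (vv z).

Let a0 : a 0%N = m.+1%:R := power_sum0 x.
Let b0 : b 0%N = m.+1%:R := power_sum0 y.
Let lv e : C := \sum_(z <- pairs_tot e) (ppow z / e`!%:R) * vv z.

Lemma rval_lcol e : rval (p%:R^-1) (lcol a b e.+1) (lv e.+1).
Proof.
have [q0 q2] := primeV_half R pp.
have -> : lcol a b e.+1 = \sum_(z <- pairs_tot e.+1) fpC (ppow z / (e.+1)`!%:R : C) * Vser R m z.1 z.2.
  apply: fpsP => -[|n]; rewrite [RHS]fpn_sum.
    by rewrite big1 // => z _; rewrite fpnCM mulr0.
  rewrite -[LHS]/(lser a b n.+1 e.+1).
  rewrite (lser_coef a0 b0); apply: eq_bigr => z _; rewrite fpnCM /=.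
  transitivity ((ratr (Vcoef n.+1 z.1 z.2 m.+1) / (e.+1)`!%:R) * ppow z : C); first by [].
  by move: (ppow z) => q; rewrite mulrC mulrA mulrAC.
rewrite /lv big_seq [X in rval _ _ X]big_seq; apply: rval_sum => // z.
rewrite mem_pairs_tot => /andP[z2 /eqP ze]; apply: rvalZ => //.
by apply: rvv => //; rewrite ze.
Qed.

Lemma rval_useq D : exists v, rval (p%:R^-1) (Fps (useq a b ^~ D) : fps C) v.
Proof.
have [l [N lN]] := polyseq_rat (@polyseq_useq _ _ a b m a0 b0 D).
exists (N.[toC p%:R^-1] / (Dpoly (nseq l 1)).[toC p%:R^-1]).
by exists (nseq l 1), N; split; [exact: all_nseq1|rewrite Dpoly_nseq|].
Qed.

(** The sum over u converges, and [rval_sums] identifies it with the value at 1 / p of the rational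
    function that it expands. *)
Lemma rval_locU D v : rval (p%:R^-1) (Fps (useq a b ^~ D) : fps C) v -> locU D = lam ^+ D * v.
Proof.
have [q0 q2] := primeV_half R pp; move=> rv.
apply/esym; apply: (rval_sums q0 q2 (rvalZ (lam ^+ D) rv)).
apply: sums_ext (sums_locU D) => u; rewrite /term !fpnCM toC_invn mulrC; congr (_ * _).
by rewrite /lX /lY -rmorphM.
Qed.

(** The formal identity [useq_lcol] evaluated at T = 1 / p. The Borel values [lv] thus are the
    coefficients of the logarithmic derivative of the local factor, even where the series in r
    diverges. *)
Lemma feuler_locU : feuler locU = Fps (fun e => (lam ^+ e * lv e) *+ e) * locU.
Proof.
have [q0 q2] := primeV_half R pp.
apply: fpsP => e; rewrite fpnM feulerE.
have [v hv] := choice rval_useq.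
have -> : locU e *+ e = lam ^+ e * (v e *+ e) by rewrite (rval_locU (hv e)) -mulrnAr.
have -> : v e *+ e = \sum_(j < e.+1) lv j *+ j * v (e - j)%N.
  have h1 : rval (p%:R^-1) (Fps (useq a b ^~ e) *+ e : fps C) (v e *+ e).
    have := rvalZ (e%:R) (hv e).
    by rewrite rmorph_nat mulr_natl [_ * v e]mulr_natl.
  apply: (rval_uniq q0 q2 h1); rewrite useq_lcol; apply: rval_sum => // -[[|j] jl] _ /=.
    by rewrite !mulr0n !mul0r; have := rval_fpoly (p%:R^-1 : R) (0 : {poly C}); rewrite (rmorph0 (@fpoly C)) horner0.
  apply: rvalM => //; have := rvalZ (j.+1%:R) (rval_lcol j).
  by rewrite rmorph_nat mulr_natl [_ * lv j.+1]mulr_natl.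
rewrite mulr_sumr; apply: eq_bigr => j _; have je : (j <= e)%N by rewrite -ltnS.
rewrite (rval_locU (hv (e - j)%N)) (_ : lam ^+ e = lam ^+ j * lam ^+ (e - j)); last by rewrite -exprD subnKC.
have alg (s t u' w' : C) n : s * t * (u' *+ n * w') = s * u' *+ n * (t * w').
  by rewrite mulrACA -mulrnAr.
exact: alg.
Qed.

Lemma term1E e : w e = lam ^+ e * (T * (lser a b 1 e)).
Proof.
rewrite /w /term fpnCM expr1 mulrCA; congr (_ * _).
rewrite /lX /lY -rmorphM /=; congr (_ * _).
have := newton1 (newton_lser a b); rewrite mulr1n => <- //.
Qed.

Lemma feuler_locB : feuler locB =
  Fps (fun e => \sum_(z <- pairs_tot e) ppow z * (ell R e p * (vv z - ratr (Vcoef 1 z.1 z.2 m.+1) / p%:R)) *+ e) * locB.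
Proof.
rewrite /locB feulerM feuler_fexp feuler_locU raddfN.
have alg (B : comNzRingType) (W E L U : B) : - W * E * U + E * (L * U) = (L - W) * (E * U) by ring.
rewrite alg; congr (_ * _); have fE (f : nat -> C) n : Fps f n = f n by [].
apply: fpsP => -[|e]; rewrite fpnB feulerE term1E !fE.
  by rewrite !mulr0n subrr big1.
rewrite -mulrnBl sumrMnl (lser_coef a0 b0); congr (_ *+ _).
rewrite -mulrBr [T * _]mulr_sumr -sumrB mulr_sumr; apply: eq_bigr => z _.
have sc (c d : C) : (c *: (d : C^o) : C^o) = c * d by [].
rewrite sc /ell -/lam -/T -/(ppow z).
move: (ppow z) (lam ^+ _) (_`!%:R^-1) (ratr _) (vv z) => u s t q v; ring.
Qed.

Lemma locB0 v : rval (p%:R^-1) (Fps (fun n => ('C(n + m, n) ^ 2)%:R)) (cexp v) ->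
  locB 0%N = cexp (v - ratr (Vcoef 1 [::] [::] m.+1) / p%:R).
Proof.
move=> rv; rewrite /locB fpnM0 fexp_coef0 cexpD mulrC; congr (_ * _).
  rewrite (@rval_locU 0 (cexp v)) ?expr0 ?mul1r //.
  rewrite (_ : Fps (useq a b ^~ 0%N) = Fps (fun n => ('C(n + m, n) ^ 2)%:R)) //.
  by apply: fpsP => n; apply: useq0.
rewrite fpnN term1E expr0 mul1r (lser_coef a0 b0); congr (cexp (- _)).
rewrite /pairs_tot /= cats0 /pairs2 parts0 /= big_seq1 /= fact0 divr1 /pprod !big_nil mulr1 mulrC.
by congr (_ / _); exact: mulr1.
Qed.

End LocalFactor.

(** * The product over the primes *)

Section LinearCombinations.
Variables (R : realType).
Notation C := (cplx R).
Variables a b : nat -> (C^o : comAlgType C).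

Definition pp2 (z : seq nat * seq nat) : C := pprod a z.1 * pprod b z.2.
Definition weight (z : seq nat * seq nat) := (sumn z.1 + sumn z.2)%N.

(** Elements built from the monomials p_mu p_nu of partitions alone, in particular free of p_0;
    [pcoef] sees all of such an element. *)
Definition lincomb (Y : symXY C) := exists2 s : seq (C * (seq nat * seq nat)),
  all (fun t => is_part2 t.2) s & Y = \sum_(t <- s) t.1 *: ppXY C t.2.

Lemma lincombD Y Z : lincomb Y -> lincomb Z -> lincomb (Y + Z).
Proof.
move=> [s hs ->] [t ht ->]; exists (s ++ t); first by rewrite all_cat hs.
by rewrite big_cat.
Qed.

Lemma lincomb0 : lincomb 0.
Proof. by exists [::]; rewrite ?big_nil. Qed.

Lemma lincombZ c z : is_part2 z -> lincomb (c *: ppXY C z).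
Proof. by move=> hz; exists [:: (c, z)]; rewrite /= ?hz // big_seq1. Qed.

Lemma lincombZ' c Y : lincomb Y -> lincomb (c *: Y).
Proof.
move=> [s hs ->]; exists [seq (c * t.1, t.2) | t <- s]; first by rewrite all_map.
by rewrite big_map scaler_sumr; apply: eq_bigr => t _; rewrite scalerA.
Qed.

Lemma lincomb_sum I (r : seq I) (P : pred I) (F : I -> symXY C) :
  (forall i, P i -> lincomb (F i)) -> lincomb (\sum_(i <- r | P i) F i).
Proof. by move=> h; elim/big_ind: _ => //; [exact: lincomb0|exact: lincombD]. Qed.

Lemma lincombM Y Z : lincomb Y -> lincomb Z -> lincomb (Y * Z).
Proof.
move=> [s /allP hs ->] [t /allP ht ->]; rewrite mulr_suml big_seq.
apply: lincomb_sum => i /hs hi; rewrite mulr_sumr big_seq.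
apply: lincomb_sum => j /ht hj.
rewrite -scalerAl -scalerAr scalerA ppXY_merge2; apply: lincombZ.
exact: is_part2_merge2.
Qed.

Lemma lincombX Y n : lincomb Y -> lincomb (Y ^+ n).
Proof.
move=> h; elim: n => [|n IH]; last by rewrite exprS; apply: lincombM.
rewrite expr0 -(pprod_nil2 (@pX C) (@pY C)) -[X in lincomb X]scale1r.
exact: (@lincombZ 1 ([::], [::])).
Qed.

Let phi : {rmorphism C -> fps C} := [the {rmorphism C -> fps C} of @fpC C].
(** The variable t records the total degree. *)
Definition evt : symXY C -> fps C :=
  evXY phi (fun n => fpC (a n : C) * fpX ^+ n) (fun n => fpC (b n : C) * fpX ^+ n).
HB.instance Definition _ := GRing.RMorphism.copy evt evt.

Lemma evtZ c Y : evt (c *: Y) = fpC c * evt Y.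
Proof. exact: evXYZ. Qed.

Lemma evt_ppXY z : evt (ppXY C z) = fpC (pp2 z) * fpX ^+ weight z.
Proof.
have -> : evt (ppXY C z) = evt (pprod (@pX C) z.1) * evt (pprod (@pY C) z.2).
  exact: (rmorphM evt).
have -> : fpC (pp2 z) = fpC (\prod_(i <- z.1) (a i : C)) * fpC (\prod_(i <- z.2) (b i : C)).
  exact: (rmorphM (@fpC C)).
transitivity ((\prod_(i <- z.1) (fpC (a i : C) * fpX ^+ i)) * \prod_(i <- z.2) (fpC (b i : C) * fpX ^+ i)).
  by congr (_ * _); [exact: evXY_pprodX|exact: evXY_pprodY].
rewrite /weight exprD [RHS]mulrACA.
have h (c : nat -> C) (s : seq nat) :
    \prod_(i <- s) (fpC (c i) * fpX ^+ i) = fpC (\prod_(i <- s) c i) * fpX ^+ sumn s.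
  by rewrite big_split /= (rmorph_prod (@fpC C)) -expr_sum /= sumnE.
by congr (_ * _); exact: h.
Qed.

Lemma fpXn_coef (n D : nat) : (fpX ^+ n : fps C) D = (n == D)%:R.
Proof. by rewrite -rmorphXn /= coefXn eq_sym. Qed.

Lemma evt_coef Y D : lincomb Y ->
  evt Y D = \sum_(z <- pairs_tot D) pcoef z.1 z.2 Y * pp2 z.
Proof.
move=> [s hs ->]; rewrite rmorph_sum /= fpn_sum.
under [RHS]eq_bigr do rewrite pcoef_sum mulr_suml.
rewrite exchange_big /=; rewrite big_seq [RHS]big_seq; apply: eq_bigr => t ts.
have ht := allP hs _ ts; rewrite evtZ evt_ppXY !fpnCM fpXn_coef.
transitivity (\sum_(z <- pairs_tot D) t.1 * (pp2 z * (z == t.2)%:R)); last first.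
  rewrite big_seq [RHS]big_seq; apply: eq_bigr => z; rewrite mem_pairs_tot => /andP[hz _].
  by rewrite pcoefZ pcoef_ppXY // [LHS]mulrA [LHS]mulrAC.
rewrite -mulr_sumr; congr (_ * _).
have [tD|tD] := boolP (t.2 \in pairs_tot D).
  rewrite (bigD1_seq t.2) ?pairs_tot_uniq //= eqxx big1 => [|z /negPf ->]; last by rewrite mulr0.
  by move: tD; rewrite mem_pairs_tot ht /weight /= => ->; rewrite addr0.
rewrite big_seq big1 => [|z hz]; last first.
  by case: eqP => [E|_]; [rewrite E (negPf tD) in hz|rewrite mulr0].
by move: tD; rewrite mem_pairs_tot ht /weight /= => /negPf ->; rewrite mulr0.
Qed.

Lemma fps_agreeX (f g : fps C) D j n : (forall i, (i <= D)%N -> f i = g i) -> (n <= D)%N ->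
  (f ^+ j) n = (g ^+ j) n.
Proof.
move=> fg; elim: j n => [|j IH] n nD; first by rewrite !expr0.
rewrite !exprS !fpnM; apply: eq_bigr => i _.
by rewrite fg ?IH // ?(leq_trans (leq_subr _ _)) // (leq_trans _ nD) // -ltnS.
Qed.

Variable k : nat.
Definition gser : fps C := Fps (fun e => if e is 0 then 0 else
  \sum_(z <- pairs_tot e) Wcoef R k z.1 z.2 * pp2 z).

Lemma big_pairs_tot (F : seq nat -> seq nat -> C) e :
  \sum_(z <- pairs_tot e) F z.1 z.2 =
  \sum_(c < e.+1) \sum_(mu <- parts c) \sum_(nu <- parts (e - c)) F mu nu.
Proof.
rewrite /pairs_tot big_flatten big_map -[iota 0 e.+1]/(index_iota 0 e.+1) big_mkord.
by apply: eq_bigr => c _; rewrite /pairs2 big_allpairs_dep.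
Qed.

Lemma W_trunc_lincomb D : lincomb (W_trunc R k D).
Proof.
rewrite /W_trunc; apply: lincomb_sum => e _; apply: lincomb_sum => c _.
rewrite big_seq; apply: lincomb_sum => mu; rewrite mem_parts => /andP[pm _].
rewrite big_seq; apply: lincomb_sum => nu; rewrite mem_parts => /andP[pn _].
by apply: (@lincombZ _ (mu, nu)); rewrite /is_part2 pm.
Qed.

Lemma evt_W_trunc D n : (n <= D)%N -> evt (W_trunc R k D) n = gser n.
Proof.
move=> nD; rewrite /W_trunc rmorph_sum /= fpn_sum.
have E e : evt (\sum_(c < e.+1) \sum_(mu <- parts c) \sum_(nu <- parts (e - c))
      Wcoef R k mu nu *: (pprod (@pX C) mu * pprod (@pY C) nu)) n
    = (e == n)%:R * \sum_(z <- pairs_tot e) Wcoef R k z.1 z.2 * pp2 z.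
  rewrite (big_pairs_tot (fun mu nu => Wcoef R k mu nu * pp2 (mu, nu))) mulr_sumr.
  rewrite rmorph_sum fpn_sum; apply: eq_bigr => -[c ce] _ /=.
  rewrite rmorph_sum fpn_sum mulr_sumr; apply: eq_parts => mu _ sm; rewrite rmorph_sum fpn_sum mulr_sumr.
  apply: eq_parts => nu _ sn.
  rewrite /= evtZ (evt_ppXY (mu, nu)) !fpnCM fpXn_coef /weight /= sm sn subnKC //.
  by rewrite mulrA mulrC.
transitivity (\sum_(1 <= e < D.+1) (e == n)%:R * \sum_(z <- pairs_tot e) Wcoef R k z.1 z.2 * pp2 z).
  by apply: eq_bigr => e _; exact: E.
case: n nD {E} => [|n] nD.
  by rewrite big_nat big1 // => e /andP[e0 _]; rewrite (gtn_eqF e0) mul0r.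
rewrite (bigD1_seq n.+1) ?iota_uniq ?mem_index_iota //= eqxx mul1r -[RHS]addr0; congr (_ + _).
by rewrite big1 // => e /negPf ->; rewrite mul0r.
Qed.

Lemma exp_W_series D :
  \sum_(z <- pairs_tot D) exp_W_coef R k z.1 z.2 * pp2 z
  = (fpC (cexp (Wcoef R k [::] [::])) * fexp0 gser) D.
Proof.
rewrite fpnCM /=.
pose Y := \sum_(j < D.+1) (j`!)%:R^-1 *: W_trunc R k D ^+ j : symXY C.
have lY : lincomb Y.
  by apply: lincomb_sum => j _; apply: lincombZ'; apply: lincombX; apply: W_trunc_lincomb.
transitivity (cexp (Wcoef R k [::] [::]) * evt Y D).
  rewrite evt_coef // mulr_sumr big_seq [RHS]big_seq; apply: eq_bigr => z.
  rewrite mem_pairs_tot => /andP[_ /eqP zD].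
  by rewrite /exp_W_coef zD -[LHS]mulrA.
congr (_ * _); rewrite rmorph_sum fpn_sum /= /expsum fpn_sum; apply: eq_bigr => j _.
rewrite evtZ rmorphXn !fpnCM /=; congr (_ * _).
exact: (fps_agreeX (D := D) _ (fun i iD => evt_W_trunc iD)).
Qed.

End LinearCombinations.

Section GlobalSeries.
Variables (R : realType) (m : nat).
Notation C := (cplx R).

Lemma sums_finsum_in (I : eqType) (r : seq I) (f : I -> nat -> C) (l : I -> C) :
  {in r, forall i, sums (f i) (l i)} -> sums (fun n => \sum_(i <- r) f i n) (\sum_(i <- r) l i).
Proof.
elim: r => [|i r IH] h.
  by rewrite big_nil; apply: sums_ext (sums0 R) => n; rewrite big_nil.
rewrite big_cons; apply: (@sums_ext _ (fun n => f i n + \sum_(j <- r) f j n)).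
  by move=> n; rewrite big_cons.
apply: sumsD; first by apply: h; rewrite mem_head.
by apply: IH => j jr; apply: h; rewrite in_cons jr orbT.
Qed.

Lemma feuler_prod I (r : seq I) (F L : I -> fps C) : (forall i, feuler (F i) = L i * F i) ->
  feuler (\prod_(i <- r) F i) = (\sum_(i <- r) L i) * \prod_(i <- r) F i.
Proof.
move=> h; elim: r => [|i r IH]; first by rewrite !big_nil feuler1 mul0r.
by rewrite !big_cons feulerM IH h mulrDl mulrCA !mulrA.
Qed.

Lemma primes_choice : exists vv : seq nat * seq nat -> nat -> C, forall z, is_part2 z ->
  (0 < sumn z.1 + sumn z.2)%N -> forall p, prime p -> rval (p%:R^-1) (Vser R m z.1 z.2) (vv z p).
Proof.
have h (z : seq nat * seq nat) : exists v : nat -> C, is_part2 z ->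
    (0 < sumn z.1 + sumn z.2)%N -> forall p, prime p -> rval (p%:R^-1) (Vser R m z.1 z.2) (v p).
  have [/andP[h1 h2]|h] := boolP (is_part2 z); last by exists (fun=> 0).
  have [z0|z0] := posnP (sumn z.1 + sumn z.2); first by exists (fun=> 0).
  by have [v hv] := V_value R m h1 h2 z0; exists v.
by have [vv hvv] := choice h; exists vv.
Qed.

Variables (x y : 'rV[C]_m.+1).
Hypotheses (xr : forall i, nm (x ord0 i) <= 1 / 16) (yr : forall i, nm (y ord0 i) <= 1 / 16).

Let C1 : fps C := Fps (Ccoef R 1).
Let a : nat -> (C^o : comAlgType C) := power_sum x.
Let b : nat -> (C^o : comAlgType C) := power_sum y.
Let a0 : a 0%N = m.+1%:R := power_sum0 x.
Let b0 : b 0%N = m.+1%:R := power_sum0 y.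
Let V1 (z : seq nat * seq nat) : C := ratr (Vcoef 1 z.1 z.2 m.+1).
Let Wz (z : seq nat * seq nat) : C := Wcoef R m.+1 z.1 z.2.
Let B n : fps C := if prime n then locB x y n else 1.
Let bn n : R := if prime n then KB R m * xpow R n ^+ 4 else 0.

Lemma KB_ge0 : 0 <= KB R m.
Proof.
have /andP[h0 h1] := x2_lt1 R.
rewrite /KB addr_ge0 // ?mulr_ge0 ?addr_ge0 ?mulr_ge0 ?exprn_ge0 ?expR_ge0 ?divr_ge0 ?exprn_ge0 //.
- by rewrite invr_ge0 subr_ge0 ltW.
- by rewrite invr_ge0 subr_ge0 ltW.
- by rewrite invr_ge0 exprn_ge0 // ltW.
Qed.

Lemma bsum_bn : bsum bn (KB R m * (1 + (3 / 4)^-1)).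
Proof.
have e0 : 0 < (3 / 4 : R) by lra.
move=> N; apply: le_trans (ler_wpM2l KB_ge0 (bsum_pow e0 N)).
rewrite mulr_sumr; apply: ler_sum => n _; rewrite /bn.
case: ifP => pn; last by rewrite mulr_ge0 ?KB_ge0 //; case: ifP => _ //; exact: expR_ge0.
rewrite prime_gt0 // ler_wpM2l ?KB_ge0 // /xpow -expRM_natl ler_expR.
by rewrite (_ : 4%:R * _ = - (1 + 3 / 4) * ln n%:R) //; field.
Qed.

Lemma l1_B n : l1 (B n - 1) (bn n).
Proof.
rewrite /B /bn; case: ifP => pn; first exact: l1_locB.
by rewrite subrr => N; rewrite big1 // => j _; rewrite fpn0 nm0.
Qed.

(** At r = 1 the logarithm is p_1(X) p_1(Y), here the sum of the exp ((x_i + y_j) t); so V_1 gives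
    the coefficients of sum (x_i + y_j)^e in products of power sums. *)
Lemma C1_exponent e :
  (\sum_i \sum_j fscale (x ord0 i + y ord0 j) C1) e
  = \sum_(z <- pairs_tot e) pp2 a b z * (V1 z * Ccoef R 1 e).
Proof.
have h : lser a b 1 e = (\sum_i \sum_j (x ord0 i + y ord0 j) ^+ e) / e`!%:R.
  have -> : lser a b 1 = \sum_i \sum_j expfps (x ord0 i + y ord0 j) :> fps C.
    have := newton1 (newton_lser a b); rewrite mulr1n => <-.
    rewrite (newton1 (newton_hserX a b)) (newton1 (newton_hserY a b)) !psum_fps_power.
    rewrite mulr_suml; apply: eq_bigr => i _; rewrite mulr_sumr; apply: eq_bigr => j _.
    by rewrite !expr1 expfpsD.
  rewrite fpn_sum mulr_suml; apply: eq_bigr => i _.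
  by rewrite fpn_sum mulr_suml; apply: eq_bigr => j _.
have h2 : \sum_i \sum_j (x ord0 i + y ord0 j) ^+ e = \sum_(z <- pairs_tot e) V1 z * pp2 a b z.
  have f0 : (e`!%:R : C) != 0 by rewrite pnatr_eq0 -lt0n fact_gt0.
  have -> : \sum_i \sum_j (x ord0 i + y ord0 j) ^+ e = e`!%:R * lser a b 1 e :> C.
    by rewrite h mulrC divfK.
  rewrite (lser_coef a0 b0) mulr_sumr; apply: eq_bigr => z _.
  have sc (c d : C) : (c *: (d : C^o) : C^o) = c * d by [].
  by rewrite sc /V1 -/(pp2 a b z) mulrA; congr (_ * _); rewrite mulrC divfK.
rewrite fpn_sum; under eq_bigr do rewrite fpn_sum.
transitivity ((\sum_i \sum_j (x ord0 i + y ord0 j) ^+ e) * Ccoef R 1 e).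
  by rewrite mulr_suml; apply: eq_bigr => i _; rewrite mulr_suml; apply: eq_bigr.
rewrite h2 mulr_suml; apply: eq_bigr => z _.
by rewrite mulrC mulrCA mulrA mulrC mulrA.
Qed.

Definition series_h : fps C := Fps (fun D => 
  \sum_(z <- pairs_tot D) exp_W_coef R m.+1 z.1 z.2 * pp2 a b z).

(** Both sides solve the same first order equation in t. The logarithmic derivative of P is the sum
    over the primes of those of [B n], which is W without its terms r = 1; the series of the C_1(n)
    restores these. The constant terms agree by [Wcoef_value] in degree 0. *)
Lemma series_hE (P : fps C) :
  (forall D, (fun N => (\prod_(n < N) B n) D) @ \oo --> P D) ->
  fexp (\sum_i \sum_j fscale (x ord0 i + y ord0 j) C1) * P = series_h.
Proof.
move=> PC; have [vv hvv] := primes_choice.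
set f1 := \sum_i _.
have -> : series_h = fpC (cexp (Wz ([::], [::]))) * fexp0 (gser a b m.+1).
  by apply: fpsP => D; rewrite -exp_W_series.
pose LB n : fps C := if prime n then Fps (fun e => \sum_(z <- pairs_tot e)
   pp2 a b z * (ell R e n * (vv z n - V1 z / n%:R)) *+ e) else 0.
pose LP : fps C := Fps (fun e => \sum_(z <- pairs_tot e)
   pp2 a b z * (Wz z - V1 z * Ccoef R 1 e) *+ e).
have LBs e : sums (fun n => LB n e) (LP e).
  case: e => [|e].
    have -> : LP 0%N = 0 by rewrite [LHS]big1.
    by apply: sums_ext (sums0 R) => n; rewrite /LB; case: ifP => // _; rewrite [RHS]big1.
  apply: (@sums_ext _ (fun n => \sum_(z <- pairs_tot e.+1)
     pp2 a b z *+ e.+1 * psum_ (fun p => ell R e.+1 p * (vv z p - V1 z / p%:R)) n)).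
    move=> n; rewrite /psum_ /LB; case: ifP => _; last by rewrite big1 // => z _; rewrite mulr0.
    by apply: eq_bigr => z _; rewrite mulrnAl.
  rewrite [X in sums _ X](_ : _ = \sum_(z <- pairs_tot e.+1)
     pp2 a b z *+ e.+1 * (Wz z - V1 z * Ccoef R 1 e.+1)); last first.
    by apply: eq_bigr => z _; rewrite mulrnAl.
  apply: sums_finsum_in => z; rewrite mem_pairs_tot => /andP[hz /eqP ze]; apply: sumsZ.
  have /andP[h1 h2] := hz.
  have := Wcoef_value h1 h2 (fun p pp => V_avg pp (hvv z hz _ p pp)).
  by rewrite ze => h; apply: h.
have dB n : feuler (B n) = LB n * B n.
  rewrite /B /LB; case: ifP => pn; last by rewrite feuler1 mul0r.
  by apply: feuler_locB => // z hz z0; apply: hvv.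
have dP : feuler P = LP * P.
  apply: fpsP => e; rewrite feulerE fpnM.
  have l1 : (fun N => ((\sum_(n < N) LB n) * \prod_(n < N) B n) e) @ \oo
      --> \sum_(j < e.+1) LP j * P (e - j)%N.
    under eq_fun do rewrite fpnM.
    apply: cvgK_sum => j; apply: cvgKM; last exact: PC.
    have -> : (fun N => (\sum_(n < N) LB n) j) = series (fun n => LB n j).
      by apply/funext => N; rewrite fpn_sum seriesE.
    exact: sums_cvg.
  have l2 : (fun N => ((\sum_(n < N) LB n) * \prod_(n < N) B n) e) @ \oo --> P e *+ e.
    rewrite (_ : (fun N => _) = fun N => e%:R * (\prod_(n < N) B n) e); last first.
      apply/funext => N; rewrite -(feuler_prod (index_enum 'I_N)) // feulerE.
      by rewrite mulr_natl.
    have -> : P e *+ e = e%:R * P e by rewrite mulr_natl.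
    exact (cvgKM (@cvgK_cst _ _ \oo _ _) (PC e)).
  exact: (cvgK_unique l2 l1).
have P0 : P 0%N = cexp (Wz ([::], [::]) - V1 ([::], [::]) * Ccoef R 1 0).
  have [v0 hv0] := V00_value R m.
  have S0 := Wcoef_value (erefl : is_part [::]) (erefl : is_part [::]) (fun p pp => (hv0 p pp).1).
  apply: (cvgK_unique (PC 0%N)).
  rewrite (_ : (fun N => _) = fun N => cexp (series (psum_ (fun p => v0 p - V1 ([::], [::]) / p%:R)) N)).
    apply: cvg_cexp; apply: sums_cvg; apply: sums_ext S0 => n; rewrite /psum_; case: ifP => // _.
    by rewrite /ell /= expr0 fact0 divr1 mul1r.
  apply/funext => N; rewrite seriesE cexp_sum fpn_prod0; apply: eq_bigr => n _.
  rewrite /B /psum_; case: ifP => pn; last by rewrite cexp0.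
  by apply: locB0 => //; exact: (hv0 n pn).2.
have df1 : feuler f1 = Fps (fun e => \sum_(z <- pairs_tot e) pp2 a b z * (V1 z * Ccoef R 1 e) *+ e).
  by apply: fpsP => e; rewrite feulerE C1_exponent -sumrMnl.
apply: (@ode_uniq _ (feuler (gser a b m.+1))).
- by rewrite feulerE mulr0n.
- rewrite feulerM feuler_fexp dP [X in _ + X]mulrCA -mulrA -mulrDl; congr (_ * _).
  rewrite df1; apply: fpsP => e; rewrite fpnD feulerE.
  case: e => [|e]; first by rewrite mulr0n /= !big1 ?addr0.
  rewrite /= -big_split /= -sumrMnl; apply: eq_bigr => z _.
  by rewrite -mulrnDl -mulrDr addrC subrK mulrC.
- by rewrite feulerM feuler_fpC mul0r add0r feuler_fexp0 // mulrCA.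
rewrite fpnM0 fexp_coef0 P0 C1_exponent fpnCM fexp0_0 mulr1 -cexpD.
rewrite /pairs_tot /= cats0 /pairs2 parts0 /= big_seq1 /pp2 /pprod !big_nil mul1r mul1r.
by rewrite addrC subrK.
Qed.

Variables (r1 M1 e1 : R).
Hypothesis C1M : l1 (fscale (toC r1) C1) M1.
Hypothesis C1s : forall s : C, nm s < e1 -> 0 < re s ->
  sums (fun n => Ccoef R 1 n * s ^+ n) (prime_zeta (1 + s) + clog s).
Hypothesis sr : forall i j, nm (x ord0 i + y ord0 j) <= r1.

Let Mf : R := \sum_(i < m.+1) \sum_(j < m.+1) M1.

Lemma l1_f1 : l1 (\sum_i \sum_j fscale (x ord0 i + y ord0 j) C1) Mf.
Proof.
apply: l1_sum => i; apply: l1_sum => j; exact: l1_fscale_le (sr i j) C1M.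
Qed.

Definition Mh : R := expR Mf * (1 + expR (KB R m * (1 + (3 / 4)^-1)) * (KB R m * (1 + (3 / 4)^-1))).

Lemma l1_series_h : l1 series_h Mh.
Proof.
have [P [PM Pc _]] := @inf_prod R B bn _ (fun=> 0) l1_B bsum_bn.
rewrite -(series_hE Pc); exact: l1M (l1_fexp l1_f1) PM.
Qed.

(** At t = 1 the removed exponentials multiply to exp (sum P(1 + x_i + y_j)), P being the prime zeta
    function. The series of the C_1(n) puts this factor back together with exp (sum log (x_i +
    y_j)), which is the polar product. *)
Lemma sums_series_h : (forall i j, nm (x ord0 i + y ord0 j) < e1) ->
  (forall i j, 0 < re (x ord0 i + y ord0 j)) ->
  sums series_h (polar_product x (- y) * euler_product x (- y)).
Proof.
move=> se sp.
pose S n := \sum_i \sum_j npow n (- (1 + (x ord0 i + y ord0 j))).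
pose v n : C := if prime n then cexp (- S n) * local_factor n x (- y) else 1.
have [P [PM Pc Pv]] := @inf_prod R B bn _ v l1_B bsum_bn.
have Bv n : sums (B n) (v n).
  rewrite /B /v; case: ifP => pn; last exact: sums_fps1.
  by have [] := sums_locB pn xr yr.
have [w Pw vw] := Pv Bv.
pose Z := \sum_i \sum_j prime_zeta (1 + (x ord0 i + y ord0 j)).
have SZ : sums (psum_ S) Z.
  have h i j : sums (psum_ (fun n => npow n (- (1 + (x ord0 i + y ord0 j)))))
      (prime_zeta (1 + (x ord0 i + y ord0 j))).
    by apply: pz_sums; rewrite reD re1 ltrDl.
  apply: sums_ext (sums_finsum (index_enum 'I_m.+1) (fun i => sums_finsum (index_enum 'I_m.+1) (h i))) => n.
  rewrite /psum_; case: ifP => // _.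
  by rewrite big1 // => i _; rewrite big1.
have eu : euler_product x (- y) = w * cexp Z.
  apply: cvgK_lim.
  rewrite (_ : (fun N => _) = fun N => (\prod_(n < N) v n) * cexp (series (psum_ S) N)).
    exact (cvgKM vw (cvg_cexp (sums_cvg SZ))).
  apply/funext => N; rewrite seriesE cexp_sum -big_split /= big_mkcond; apply: eq_bigr => n _.
  rewrite /v /psum_; case: ifP => _; last by rewrite cexp0 mulr1.
  by rewrite mulrAC cexpN_mul mul1r.
rewrite -(series_hE Pc).
have f1s : sums (\sum_i \sum_j fscale (x ord0 i + y ord0 j) C1)
    (Z + \sum_i \sum_j clog (x ord0 i + y ord0 j)).
  rewrite -big_split /=.
  have h i j : sums (fscale (x ord0 i + y ord0 j) C1)
      (prime_zeta (1 + (x ord0 i + y ord0 j)) + clog (x ord0 i + y ord0 j)).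
    by apply/fscale_sums; apply: C1s.
  have h2 i := sums_finsum (index_enum 'I_m.+1) (h i).
  rewrite (eq_bigr (fun i => \sum_j (prime_zeta (1 + (x ord0 i + y ord0 j)) + clog (x ord0 i + y ord0 j)))).
    apply: sums_ext (sums_finsum (index_enum 'I_m.+1) h2) => n.
    by rewrite fpn_sum; apply: eq_bigr => i _; rewrite fpn_sum.
  by move=> i _; rewrite big_split.
have := sumsM (l1_fexp l1_f1) PM (sums_fexp l1_f1 f1s) Pw.
have -> : cexp (Z + \sum_i \sum_j clog (x ord0 i + y ord0 j)) * w =
    polar_product x (- y) * euler_product x (- y); last by [].
have -> : polar_product x (- y) = cexp (\sum_i \sum_j clog (x ord0 i + y ord0 j)).
  rewrite cexp_sum /polar_product; apply: eq_bigr => i _; rewrite cexp_sum; apply: eq_bigr => j _.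
  by rewrite cexp_clog // mxE opprK.
by rewrite cexpD eu [LHS]mulrC [RHS]mulrCA; congr (_ * _); rewrite [LHS]mulrC.
Qed.

End GlobalSeries.

Lemma series_h_props (R : realType) m : exists rho M : R, 0 < rho /\
  forall x y : 'rV[cplx R]_m.+1, (forall i, nm (x ord0 i) <= rho) -> (forall i, nm (y ord0 i) <= rho) ->
  l1 (series_h x y) M /\
  ((forall i j, 0 < re (x ord0 i + y ord0 j)) ->
    sums (series_h x y) (polar_product x (- y) * euler_product x (- y))).
Proof.
have [r1 r10 C1M] := growth_l1 (growth_Ccoef1 R : growth (Fps (Ccoef R 1))).
have [e1 e10 C1s] := Ccoef_one R.
have [M1 hM1] := C1M (toC r1) ltac:(by rewrite nm_toC gtr0_norm).
pose rho := Num.min (1 / 16) (Num.min (r1 / 2) (e1 / 3)).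
have rho0 : 0 < rho by rewrite !lt_min !divr_gt0.
exists rho, (Mh m M1); split=> // x y xr yr.
have bnd (z : 'rV[cplx R]_m.+1) : (forall i, nm (z ord0 i) <= rho) -> forall i,
    [/\ nm (z ord0 i) <= 1 / 16, nm (z ord0 i) <= r1 / 2 & nm (z ord0 i) <= e1 / 3].
  by move=> h i; have := h i; rewrite !le_min => /and3P[].
have x16 i : nm (x ord0 i) <= 1 / 16 by have [] := bnd x xr i.
have y16 i : nm (y ord0 i) <= 1 / 16 by have [] := bnd y yr i.
have sr i j : nm (x ord0 i + y ord0 j) <= r1.
  apply: le_trans (nmD _ _) _; have [_ h _] := bnd x xr i; have [_ h' _] := bnd y yr j; lra.
have se i j : nm (x ord0 i + y ord0 j) < e1.
  apply: le_lt_trans (nmD _ _) _; have [_ _ h] := bnd x xr i; have [_ _ h'] := bnd y yr j; lra.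
split; first exact (l1_series_h x16 y16 hM1 sr).
by move=> sp; apply: (sums_series_h x16 y16 hM1 C1s sr).
Qed.

(** * Homogeneous polynomials and holomorphy *)

Section Homogeneous.
Variables (R : realType) (n : nat).
Notation C := (cplx R).
Notation mon := {ffun 'I_n -> nat}.
Implicit Types (f g : 'rV[C]_n -> C) (z : 'rV[C]_n) (m : mon).

Definition mdeg m := (\sum_i m i)%N.
Definition hom D f := exists2 s : seq (C * mon),
  all (fun t => mdeg t.2 == D) s & forall z, f z = \sum_(t <- s) t.1 * cmonomial t.2 z.

Lemma hom_ext D f g : f =1 g -> hom D f -> hom D g.
Proof. by move=> fg [s sD sE]; exists s => // z; rewrite -fg. Qed.

Lemma hom0 D : hom D (fun=> 0).
Proof. by exists [::] => // z; rewrite big_nil. Qed.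

Lemma homD D f g : hom D f -> hom D g -> hom D (fun z => f z + g z).
Proof.
move=> [s sD sE] [t tD tE]; exists (s ++ t); first by rewrite all_cat sD.
by move=> z; rewrite big_cat /= sE tE.
Qed.

Lemma homZ D c f : hom D f -> hom D (fun z => c * f z).
Proof.
move=> [s sD sE]; exists [seq (c * t.1, t.2) | t <- s]; first by rewrite all_map.
by move=> z; rewrite sE mulr_sumr big_map; apply: eq_bigr => t _; rewrite mulrA.
Qed.

Lemma hom_sum D (I : Type) (r : seq I) (P : pred I) (F : I -> 'rV[C]_n -> C) :
  (forall i, P i -> hom D (F i)) -> hom D (fun z => \sum_(i <- r | P i) F i z).
Proof.
move=> h; elim: r => [|i r IH].
  by apply: hom_ext (hom0 D) => z; rewrite big_nil.
have [Pi|Pi] := boolP (P i).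
  by apply: hom_ext (homD (h i Pi) IH) => z; rewrite big_cons Pi.
by apply: hom_ext IH => z; rewrite big_cons (negPf Pi).
Qed.

Definition addm m m' : mon := [ffun i => (m i + m' i)%N].

Lemma cmonomialM m m' z : cmonomial (addm m m') z = cmonomial m z * cmonomial m' z.
Proof. by rewrite /cmonomial -big_split; apply: eq_bigr => i _; rewrite ffunE exprD. Qed.

Lemma homM D E f g : hom D f -> hom E g -> hom (D + E) (fun z => f z * g z).
Proof.
move=> [s /allP sD sE] [t /allP tD tE].
exists [seq (a.1 * b.1, addm a.2 b.2) | a <- s, b <- t].
  apply/allP => _ /allpairsP[[a b] /= [/sD /eqP aD /tD /eqP bD ->]] /=.
  rewrite -aD -bD /mdeg -big_split /=; apply/eqP; apply: eq_bigr => i _.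
  by rewrite ffunE.
move=> z; rewrite sE tE mulr_suml big_allpairs_dep; apply: eq_bigr => a _.
by rewrite mulr_sumr; apply: eq_bigr => b _; rewrite cmonomialM mulrACA.
Qed.

Lemma hom_cst c : hom 0 (fun=> c).
Proof.
exists [:: (c, [ffun=> 0%N])]; first by rewrite /= /mdeg big1 // => i _; rewrite ffunE.
by move=> z; rewrite big_seq1 /cmonomial big1 ?mulr1 // => i _; rewrite ffunE expr0.
Qed.

Lemma hom_power i r : hom r (fun z => z ord0 i ^+ r).
Proof.
exists [:: (1, [ffun j => if j == i then r else 0%N])].
  rewrite /= andbT /mdeg (bigD1 i) //= ffunE eqxx big1 ?addn0 // => j /negPf h.
  by rewrite ffunE h.
move=> z; rewrite big_seq1 mul1r /cmonomial (bigD1 i) //= ffunE eqxx big1 ?mulr1 // => j /negPf h.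
by rewrite ffunE h expr0.
Qed.

Lemma hom_prod (I : Type) (r : seq I) (D : I -> nat) (F : I -> 'rV[C]_n -> C) :
  (forall i, hom (D i) (F i)) -> hom (\sum_(i <- r) D i) (fun z => \prod_(i <- r) F i z).
Proof.
move=> h; elim: r => [|i r IH].
  by rewrite big_nil; apply: hom_ext (hom_cst 1) => z; rewrite big_nil.
by rewrite big_cons; apply: hom_ext (homM (h i) IH) => z; rewrite big_cons.
Qed.

Lemma hom_homog D f (l : C) z : hom D f -> f (l *: z) = l ^+ D * f z.
Proof.
move=> [s /allP sD sE]; rewrite !sE mulr_sumr big_seq [RHS]big_seq.
apply: eq_bigr => t /sD /eqP <-; rewrite mulrCA; congr (_ * _).
rewrite /cmonomial /mdeg expr_sum -big_split /=; apply: eq_bigr => i _.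
by rewrite mxE exprMn_comm //; exact: mulrC.
Qed.

Lemma hom_line D f z w : hom D f -> exists p : {poly C}, forall s : C, f (z + s *: w) = p.[s].
Proof.
move=> [s _ sE].
exists (\sum_(t <- s) t.1 *: \prod_i (z ord0 i *: 1 + w ord0 i *: 'X) ^+ t.2 i) => l.
rewrite sE horner_sum; apply: eq_bigr => t _; rewrite hornerZ horner_prod; congr (_ * _).
apply: eq_bigr => i _; rewrite !mxE horner_exp hornerD !hornerZ hornerX hornerC mulr1.
by rewrite [l * _]mulrC.
Qed.

Lemma hom_cvg0 D f : hom D.+1 f -> exists2 K : R, 0 <= K &
  forall z (e : R), 0 <= e <= 1 -> (forall i, nm (z ord0 i) <= e) -> nm (f z) <= K * e.
Proof.
move=> [s /allP sD sE]; exists (\sum_(t <- s) nm t.1); first by rewrite sumr_ge0 // => t _; exact: nm_ge0.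
move=> z e /andP[e0 e1] ze; rewrite sE; apply: le_trans (nm_sum _ _ _) _.
rewrite mulr_suml big_seq [leRHS]big_seq; apply: ler_sum => t /sD /eqP tD.
rewrite nmM ler_wpM2l ?nm_ge0 // /cmonomial nm_prod.
apply: le_trans (_ : \prod_i e ^+ t.2 i <= _).
  apply: ler_prod => i _; rewrite nmX exprn_ge0 ?nm_ge0 //=.
  by apply: lerXn2r; rewrite ?nnegrE ?nm_ge0.
by rewrite -expr_sum -/(mdeg t.2) tD exprS ler_piMr ?exprn_ile1.
Qed.

Definition natf d (w : {ffun 'I_n -> 'I_d}) : mon := [ffun i => w i : nat].

Lemma hom_coefs D f : hom D f -> exists c : mon -> C, (forall m, mdeg m != D -> c m = 0) /\
  forall d z, (D < d)%N -> f z = \sum_(w : {ffun 'I_n -> 'I_d}) c (natf w) * cmonomial (natf w) z.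
Proof.
move=> [s /allP sD sE]; exists (fun m => \sum_(t <- s | t.2 == m) t.1); split.
  move=> m mD; rewrite big_seq_cond big1 // => t /andP[/sD /eqP tD /eqP tm].
  by rewrite -tm tD eqxx in mD.
case=> // d z Dd; rewrite sE.
under [RHS]eq_bigr do rewrite mulr_suml.
rewrite (exchange_big_dep xpredT) //= big_seq [RHS]big_seq; apply: eq_bigr => t /sD /eqP tD.
have ti i : (t.2 i < d.+1)%N.
  by apply: leq_ltn_trans Dd; rewrite -tD /mdeg (bigD1 i) //= leq_addr.
pose w0 : {ffun 'I_n -> 'I_d.+1} := [ffun i => Ordinal (ti i)].
have w0E : natf w0 = t.2 by apply/ffunP => i; rewrite !ffunE.
rewrite (big_pred1 w0) ?w0E // => w /=; apply/eqP/eqP => [tw|->]; last by rewrite w0E.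
by apply/ffunP => i; apply: val_inj; rewrite ffunE /= tw ffunE.
Qed.

Lemma unity_ex N : (0 < N)%N -> exists w : C, [/\ nm w = 1, w ^+ N = 1 &
  forall e, (0 < e < N)%N -> w ^+ e != 1].
Proof.
move=> N0; have N0' : (N%:R : R) != 0 by rewrite pnatr_eq0 -lt0n.
have E (e : nat) : cexp (ciunit R * toC (2 * pi / N%:R)) ^+ e = cexp (ciunit R * toC (2 * pi / N%:R * e%:R)).
  rewrite -cexpMn; congr cexp.
  by rewrite (rmorphM (@toC R) (2 * pi / N%:R)) (rmorph_nat (@toC R)) mulrA mulr_natr.
exists (cexp (ciunit R * toC (2 * pi / N%:R))); split.
- by rewrite nm_cexp reI im_toC oppr0 expR0.
- rewrite E divfK // cexpE reI imI im_toC re_toC oppr0 expR0 mulr_natl cos2pi sin2pi.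
  by rewrite !(rmorph0 (@toC R), rmorph1 (@toC R)) mulr0 addr0 mulr1.
move=> e /andP[e0 eN]; rewrite E; apply/eqP => /cexp_eq1 [_].
rewrite imI re_toC; pose t : R := pi / N%:R * e%:R.
have -> : 2 * pi / N%:R * e%:R = t *+ 2 by rewrite /t -[RHS]mulr_natl; ring.
have s0 : 0 < sin t.
  apply: sin_gt0_pi; rewrite /t mulr_gt0 ?divr_gt0 ?pi_gt0 ?ltr0n //=.
  by rewrite -mulrA gtr_pMr ?pi_gt0 // mulrC ltr_pdivrMr ?ltr0n // mul1r ltr_nat.
rewrite mulr2n cosD -!expr2 => h; have := cos2Dsin2 t; have : 0 < sin t ^+ 2 by rewrite exprn_gt0.
lra.
Qed.

Lemma unity_sum N (w : C) a b : w ^+ N = 1 -> (forall e, (0 < e < N)%N -> w ^+ e != 1) ->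
  (a < N)%N -> (b < N)%N ->
  \sum_(j < N) (w ^+ j) ^+ a * (w ^+ j) ^+ (N - b) = (if a == b then N%:R else 0).
Proof.
move=> wN we aN bN; pose v := w ^+ (a + (N - b)).
rewrite (eq_bigr (fun j : 'I_N => v ^+ j)) => [|j _]; last by rewrite -exprD /v -!exprM mulnC.
have vN : v ^+ N = 1 by rewrite /v -exprM mulnC exprM wN expr1n.
case: eqP => [ab|/eqP ab].
  have -> : v = 1 by rewrite /v ab subnKC // ltnW.
  by rewrite (eq_bigr (fun=> 1)) => [|j _]; rewrite ?expr1n // sumr_const card_ord.
have v1 : v != 1.
  apply/eqP => v1; have wb : w ^+ a = w ^+ b.
    by rewrite -[RHS]mul1r -v1 /v -exprD -addnA subnK ?(ltnW bN) // exprD wN mulr1.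
  have w0 : w != 0 by apply/eqP => w0; move: wN; rewrite w0 expr0n; case: (N) aN => // ? _ /esym/eqP; rewrite oner_eq0.
  wlog lt : a b ab aN bN wb {v vN v1} / (a < b)%N.
    by move=> H; case: (ltngtP a b) => [l|l|e]; [apply: (H a b)|apply: (H b a); rewrite // eq_sym|rewrite e eqxx in ab].
  have : w ^+ (b - a) = 1.
    apply: (mulfI (expf_neq0 a w0)); rewrite -exprD subnKC ?mulr1 // ltnW //.
  by apply/eqP; apply: we; rewrite subn_gt0 lt (leq_ltn_trans (leq_subr _ _)).
apply: (mulfI (_ : v - 1 != 0)); first by rewrite subr_eq0.
by rewrite mulr0 -subrX1 vN subrr.
Qed.

(* Cauchy's estimates, by averaging over the N-th roots of unity *)
Lemma cauchy D (c : mon -> C) f (r : 'I_n -> R) B m :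
  (forall z, f z = \sum_(w : {ffun 'I_n -> 'I_D.+1}) c (natf w) * cmonomial (natf w) z) ->
  (forall i, 0 <= r i) -> (forall z, (forall i, nm (z ord0 i) = r i) -> nm (f z) <= B) ->
  mdeg m = D -> nm (c m) * \prod_i r i ^+ m i <= B.
Proof.
move=> fE r0 fB mD; have [w [w1 wN we]] := unity_ex (ltn0Sn D).
have mi i : (m i < D.+1)%N by rewrite ltnS -mD /mdeg (bigD1 i) //= leq_addr.
pose m0 : {ffun 'I_n -> 'I_D.+1} := [ffun i => Ordinal (mi i)].
have m0E : natf m0 = m by apply/ffunP => i; rewrite !ffunE.
pose zz (v : {ffun 'I_n -> 'I_D.+1}) : 'rV[C]_n := \row_i (toC (r i) * w ^+ v i).
have wv j : nm (w ^+ j) = 1 by rewrite nmX w1 expr1n.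
have E : \sum_(v : {ffun 'I_n -> 'I_D.+1}) (\prod_i (w ^+ v i) ^+ (D.+1 - m i)) * f (zz v)
    = D.+1%:R ^+ n * (c m * \prod_i toC (r i) ^+ m i).
  transitivity (\sum_(u : {ffun 'I_n -> 'I_D.+1}) c (natf u) * (\prod_i toC (r i) ^+ u i)
      * \prod_i (if (u i : nat) == m i then D.+1%:R else 0)).
    under eq_bigr do rewrite fE mulr_sumr.
    rewrite exchange_big /=; apply: eq_bigr => u _.
    rewrite -(eq_bigr _ (fun i _ => unity_sum wN we (ltn_ord (u i)) (mi i))).
    rewrite bigA_distr_bigA /= mulr_sumr; apply: eq_bigr => v _.
    rewrite mulrCA -mulrA; congr (_ * _); rewrite /cmonomial -!big_split /=.
    apply: eq_bigr => i _; rewrite !mxE ffunE exprMn_comm; last exact: mulrC.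
    by rewrite mulrC mulrA.
  rewrite (bigD1 m0) //= [X in _ + X]big1 => [|u um].
    rewrite addr0 m0E [X in _ * X](eq_bigr (fun=> D.+1%:R)) => [|i _]; last by rewrite ffunE eqxx.
    rewrite prodr_const card_ord mulrC; congr (_ * (_ * _)).
    by apply: eq_bigr => i _; rewrite ffunE.
  have [i hi] : exists i, (u i : nat) != m i.
    apply/existsP; rewrite -negb_forall; apply: contra um => /forallP h.
    by apply/eqP/ffunP => i; apply: val_inj; rewrite ffunE /= (eqP (h i)).
  by rewrite [X in _ * X](bigD1 i) //= (negPf hi) mul0r mulr0.
have : nm (D.+1%:R ^+ n * (c m * \prod_i toC (r i) ^+ m i)) <= D.+1%:R ^+ n * B.
  rewrite -E; apply: le_trans (nm_sum _ _ _) _.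
  apply: le_trans (_ : \sum_(v : {ffun 'I_n -> 'I_D.+1}) B <= _); last first.
    by rewrite sumr_const card_ffun !card_ord -natrX mulr_natl.
  apply: ler_sum => v _; rewrite nmM nm_prod big1 ?mul1r => [|i _]; last by rewrite nmX wv expr1n.
  apply: fB => i; rewrite mxE nmM wv mulr1 nm_toC ger0_norm //.
rewrite nmM nmX nm_nat ler_pM2l ?exprn_gt0 ?ltr0n // nmM nm_prod.
rewrite (eq_bigr (fun i => r i ^+ m i)) // => i _.
by rewrite nmX nm_toC ger0_norm.
Qed.

End Homogeneous.

Section Holomorphy.
Variables (R : realType) (n : nat).
Notation C := (cplx R).
Notation mon := {ffun 'I_n -> nat}.
Implicit Types (f g : 'rV[C]_n -> C) (z : 'rV[C]_n) (m : mon).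

Lemma near_rV0 (P : 'rV[C]_n -> Prop) :
  (\forall z \near (0 : 'rV[C]_n), P z) <->
  exists2 e : R, 0 < e & forall z, (forall i, nm (z ord0 i) < e) -> P z.
Proof.
have bE (e : R) (z : 'rV[C]_n) i : ball ((0 : 'rV[C]_n) ord0 i) (toC e) (z ord0 i) <-> nm (z ord0 i) < e.
  by rewrite -ball_normE /= mxE sub0r normrN normE toC_lt.
split.
  move=> /nbhs_ballP [e /= e0 h]; have ee : e = toC (nm e) by rewrite -normE gtr0_norm.
  have e1 : 0 < nm e by rewrite -(@toC_lt R) -ee (rmorph0 (@toC R)).
  exists (nm e) => // z ze; apply: h; rewrite ee; split; first by rewrite -ee.
  by move=> i j; rewrite (ord1 i); apply/bE.
move=> [e e0 h]; apply/nbhs_ballP; exists (toC e).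
  by rewrite /= -(rmorph0 (@toC R)) toC_lt.
by move=> z [_ bz]; apply: h => i; apply/bE; apply: bz.
Qed.

Lemma half_small (K e : R) : 0 < e -> exists N, forall d, (N <= d)%N -> K * (1 / 2) ^+ d < e.
Proof.
move=> e0; have h := archi_boundP (normr_ge0 (K / e)).
exists (Num.bound `|K / e|) => d Nd; rewrite div1r exprVn ltr_pdivrMr ?exprn_gt0 //.
rewrite mulrC -ltr_pdivrMr //; apply: le_lt_trans (ler_norm _) (lt_le_trans h _).
by rewrite -natrX ler_nat (leq_trans Nd) // ltnW // ltn_expl.
Qed.

Lemma box_change (F : mon -> C) D d : (D < d)%N ->
  \sum_(w : {ffun 'I_n -> 'I_d} | mdeg (natf w) == D) F (natf w)
  = \sum_(w : {ffun 'I_n -> 'I_D.+1} | mdeg (natf w) == D) F (natf w).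
Proof.
move=> Dd; pose h (w : {ffun 'I_n -> 'I_D.+1}) : {ffun 'I_n -> 'I_d} := [ffun i => widen_ord Dd (w i)].
pose h' (w : {ffun 'I_n -> 'I_d}) : {ffun 'I_n -> 'I_D.+1} := [ffun i => inord (w i)].
have hE w : natf (h w) = natf w by apply/ffunP => i; rewrite !ffunE.
rewrite (reindex_onto h h') => [|w /eqP wD].
  apply: eq_big => w; rewrite hE // [X in _ && X](_ : _ = true) ?andbT //.
  by apply/eqP/ffunP => i; apply: val_inj; rewrite !ffunE /= inordK.
apply/ffunP => i; apply: val_inj; rewrite !ffunE /= inordK // ltnS -wD /mdeg (bigD1 i) //= ffunE.
exact: leq_addr.
Qed.

(** The cube of exponents below d contains all monomials of degree below d. This links the cubes in
    the definition of holomorphy to homogeneous components. *)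
Lemma box_split (F : mon -> C) d : \sum_(w : {ffun 'I_n -> 'I_d}) F (natf w) =
  \sum_(D < d) \sum_(w : {ffun 'I_n -> 'I_D.+1} | mdeg (natf w) == D) F (natf w)
  + \sum_(w : {ffun 'I_n -> 'I_d} | (d <= mdeg (natf w))%N) F (natf w).
Proof.
rewrite (bigID (fun w : {ffun 'I_n -> 'I_d} => (mdeg (natf w) < d)%N)) /=.
congr (_ + _); last by apply: eq_bigl => w; rewrite -leqNgt.
rewrite -(eq_bigr _ (fun (D : 'I_d) _ => box_change F (ltn_ord D))).
rewrite (exchange_big_dep (fun w : {ffun 'I_n -> 'I_d} => (mdeg (natf w) < d)%N)) /=.
  by apply: eq_bigr => w wd; rewrite (big_pred1 (Ordinal wd)).
by move=> D w _ /eqP ->.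
Qed.

Lemma geom_sum_le (q : R) d : 0 <= q -> q <= 1 / 2 -> \sum_(j < d) q ^+ j <= 2.
Proof.
move=> q0 q2; apply: le_trans (geom_half R d); apply: ler_sum => i _.
by apply: lerXn2r; rewrite ?nnegrE //; lra.
Qed.

Lemma box_sum_le (q : R) d : 0 <= q -> q <= 1 / 2 ->
  \sum_(w : {ffun 'I_n -> 'I_d}) q ^+ mdeg (natf w) <= 2 ^+ n.
Proof.
move=> q0 q2.
rewrite (eq_bigr (fun w : {ffun 'I_n -> 'I_d} => \prod_i q ^+ w i)) => [|w _]; last first.
  by rewrite /mdeg expr_sum; apply: eq_bigr => i _; rewrite ffunE.
rewrite -(bigA_distr_bigA (fun (i : 'I_n) (j : 'I_d) => q ^+ j)) prodr_const card_ord.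
by apply: lerXn2r; rewrite ?nnegrE ?geom_sum_le ?sumr_ge0 // => i _; exact: exprn_ge0.
Qed.

Lemma nm_cmonomial_le m z (e : R) : 0 <= e -> (forall i, nm (z ord0 i) <= e) ->
  nm (cmonomial m z) <= e ^+ mdeg m.
Proof.
move=> e0 ze; rewrite /cmonomial nm_prod /mdeg expr_sum; apply: ler_prod => i _.
by rewrite nmX exprn_ge0 ?nm_ge0 //=; apply: lerXn2r; rewrite ?nnegrE ?nm_ge0.
Qed.

Lemma cauchy_term D (c : mon -> C) f (r : R) (B : R) m z : 0 < r ->
  (forall z, f z = \sum_(w : {ffun 'I_n -> 'I_D.+1}) c (natf w) * cmonomial (natf w) z) ->
  (forall z, (forall i, nm (z ord0 i) = r) -> nm (f z) <= B) ->
  mdeg m = D -> (forall i, nm (z ord0 i) <= r / 4) ->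
  nm (c m * cmonomial m z) <= B * (1 / 4) ^+ D.
Proof.
move=> r0 fE fB mD zr; rewrite nmM.
have h := cauchy fE (fun=> ltW r0) fB mD.
apply: le_trans (ler_wpM2l (nm_ge0 _) (nm_cmonomial_le m _ zr)) _; first by rewrite divr_ge0 // ltW.
rewrite mD exprMn_comm; last exact: mulrC.
rewrite mulrA [4^-1](_ : _ = 1 / 4) ?mul1r // ler_wpM2r ?exprn_ge0 ?invr_ge0 //.
by move: h; rewrite -expr_sum -/(mdeg m) mD.
Qed.

(** By Cauchy's estimate on the torus of radii r_i each monomial is at most B 4^(-D). One factor
    2^(-D) pays for the number of monomials and the other remains. *)
Lemma hom_bound D f (r : 'I_n -> R) (r0 B : R) : 0 < r0 -> (forall i, r0 <= r i) -> hom D f ->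
  (forall z, (forall i, nm (z ord0 i) = r i) -> nm (f z) <= B) ->
  forall z, (forall i, nm (z ord0 i) <= r0 / 4) -> nm (f z) <= B * 2 ^+ n * (1 / 2) ^+ D.
Proof.
move=> r00 rr hf fB z zr; have [c [c0 cE]] := hom_coefs hf.
have rp i : 0 < r i by apply: lt_le_trans (rr i).
have B0 : 0 <= B.
  apply: le_trans (fB (\row_i toC (r i)) _); first exact: nm_ge0.
  by move=> i; rewrite mxE nm_toC gtr0_norm.
rewrite (cE D.+1) //; apply: le_trans (nm_sum _ _ _) _.
apply: le_trans (_ : \sum_(w : {ffun 'I_n -> 'I_D.+1}) B * (1 / 2) ^+ D * (1 / 2) ^+ mdeg (natf w) <= _); last first.
  rewrite -mulr_sumr mulrAC ler_wpM2r ?exprn_ge0 //.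
  by rewrite ler_wpM2l // box_sum_le //; lra.
apply: ler_sum => w _; have [wD|wD] := eqVneq (mdeg (natf w)) D; last first.
  by rewrite c0 // mul0r nm0 !mulr_ge0 ?exprn_ge0.
have h := cauchy (fun z => cE D.+1 z (ltnSn D)) (fun i => ltW (rp i)) fB wD.
rewrite wD nmM -mulrA -exprMn_comm; last exact: mulrC.
apply: le_trans (_ : nm (c (natf w)) * (\prod_i r i ^+ natf w i * (1 / 4) ^+ D) <= _).
  rewrite ler_wpM2l ?nm_ge0 // /cmonomial nm_prod -[X in _ ^+ X]wD /mdeg expr_sum -big_split /=.
  apply: ler_prod => i _; rewrite nmX exprn_ge0 ?nm_ge0 //= -exprMn_comm; last exact: mulrC.
  apply: lerXn2r; rewrite ?nnegrE ?nm_ge0 ?mulr_ge0 ?(ltW (rp i)) //.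
  by apply: le_trans (zr i) _; rewrite mul1r ler_wpM2r.
by rewrite mulrA (_ : 1 / 2 * (1 / 2) = 1 / 4); [rewrite ler_wpM2r ?exprn_ge0|field].
Qed.

Lemma hom_series_holomorphic (f : nat -> 'rV[C]_n -> C) (H : 'rV[C]_n -> C) (r M : R) : 0 < r ->
  (forall D, hom D (f D)) ->
  (forall D z, (forall i, nm (z ord0 i) = r) -> nm (f D z) <= M) ->
  (forall z, (forall i, nm (z ord0 i) < r / 4) -> sums (f ^~ z) (H z)) ->
  holomorphic_near0 H.
Proof.
move=> r0 hf fM fH.
have [c hc] := choice (fun D => hom_coefs (hf D)).
exists (fun m => c (mdeg m) m); apply/near_rV0; exists (r / 4); first by rewrite divr_gt0.
move=> z zr; pose term m := c (mdeg m) m * cmonomial m z.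
have M0 : 0 <= M.
  apply: le_trans (fM 0%N (const_mx (toC r)) _); first exact: nm_ge0.
  by move=> i; rewrite mxE nm_toC gtr0_norm.
have tB m : nm (term m) <= M * (1 / 4) ^+ mdeg m.
  apply: (cauchy_term r0 (fun z => (hc (mdeg m)).2 _ z (ltnSn _)) (fM _)) => // i.
  exact: ltW.
split.
  exists (toC (M * 2 ^+ n)) => d.
  rewrite (eq_bigr (fun w : {ffun 'I_n -> 'I_d} => toC (nm (term (natf w))))) => [|w _]; last exact: normE.
  rewrite -(rmorph_sum (@toC R)) toC_le.
  apply: le_trans (_ : \sum_(w : {ffun 'I_n -> 'I_d}) M * (1 / 4) ^+ mdeg (natf w) <= _).
    by apply: ler_sum => w _; exact: tB.
  by rewrite -mulr_sumr ler_wpM2l // box_sum_le //; lra.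
have E d : \sum_(w : {ffun 'I_n -> 'I_d}) term (natf w) = series (f ^~ z) d
    + \sum_(w : {ffun 'I_n -> 'I_d} | (d <= mdeg (natf w))%N) term (natf w).
  rewrite box_split seriesE; congr (_ + _); apply: eq_bigr => D _.
  rewrite ((hc D).2 D.+1 z (ltnSn D)) [RHS](bigID (fun w : {ffun 'I_n -> 'I_D.+1} => mdeg (natf w) == D)) /=.
  rewrite [X in _ = _ + X]big1 ?addr0 => [|w /negPf wD]; last by rewrite ((hc D).1 _ _) ?mul0r ?wD.
  by apply: eq_bigr => w /eqP wD; rewrite /term wD.
have -> : (fun d => \sum_(w : {ffun 'I_n -> 'I_d}) term (natf w)) = fun d => series (f ^~ z) d +
    \sum_(w : {ffun 'I_n -> 'I_d} | (d <= mdeg (natf w))%N) term (natf w) by apply/funext.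
rewrite -[H z]addr0; apply: cvgKD; first exact: sums_cvg (fH z zr).
apply/cvgCP => e e0.
have [N hN] := half_small (M * 2 ^+ n) e0.
exists N => // d /= Nd; rewrite subr0; apply: le_lt_trans (hN d Nd).
apply: le_trans (nm_sum _ _ _) _.
apply: le_trans (_ : \sum_(w : {ffun 'I_n -> 'I_d}) M * (1 / 2) ^+ d * (1 / 2) ^+ mdeg (natf w) <= _); last first.
  rewrite -mulr_sumr mulrAC ler_wpM2r ?exprn_ge0 //.
  by rewrite ler_wpM2l // box_sum_le //; lra.
rewrite big_mkcond; apply: ler_sum => w _; case: ifP => dw; last by rewrite !mulr_ge0 ?exprn_ge0.
apply: le_trans (tB _) _; rewrite -mulrA; apply: ler_wpM2l => //.
rewrite (_ : 1 / 4 = 1 / 2 * (1 / 2)); last by field.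
rewrite exprMn_comm; last exact: mulrC.
have h1 : 0 <= (1 / 2 : R) by lra.
have h2 : (1 / 2 : R) <= 1 by lra.
by apply: ler_wpM2r; [exact: exprn_ge0|exact: ler_wiXn2l].
Qed.

(** Half of the radius is given up: absolute convergence at 2 z bounds the part of degree at least d
    at z by M 2^(-d), so cubes may be replaced by homogeneous components. *)
Lemma holomorphic_hom_series (H : 'rV[C]_n -> C) : holomorphic_near0 H ->
  exists f : nat -> 'rV[C]_n -> C, (forall D, hom D (f D)) /\
    exists2 e : R, 0 < e & forall z, (forall i, nm (z ord0 i) < e) -> sums (f ^~ z) (H z).
Proof.
move=> [a /near_rV0 [e e0 ha]].
pose f D z := \sum_(w : {ffun 'I_n -> 'I_D.+1} | mdeg (natf w) == D) a (natf w) * cmonomial (natf w) z.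
exists f; split.
  move=> D; apply: hom_sum => w wD; exists [:: (a (natf w), natf w)]; first by rewrite /= wD.
  by move=> z; rewrite big_seq1.
exists (e / 2); first by rewrite divr_gt0.
move=> z ze; pose term y m := a m * cmonomial m y.
have e2 : e / 2 < e by lra.
have [_ hz] := ha z (fun i => lt_trans (ze i) e2).
have [[M hM] _] : (exists M : R, forall d, \sum_(w : {ffun 'I_n -> 'I_d}) nm (term (2 *: z) (natf w)) <= M) /\ True.
  have z2 i : nm ((2 *: z) ord0 i) < e by rewrite mxE nmM (nm_nat R 2); have := ze i; lra.
  have [[M hM] _] := ha _ z2; split=> //; exists (re M) => d.
  have h0 : \sum_(w : {ffun 'I_n -> 'I_d}) toC (nm (term (2 *: z) (natf w))) <= M.
    by have := hM d; under eq_bigr do rewrite normE.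
  move: h0; rewrite -(rmorph_sum (@toC R)) -subr_ge0 => h0.
  by rewrite -subr_ge0 -[X in _ - X](re_toC) -reB -(ger0_norm h0) nm_ge0.
have t2 m : nm (term (2 *: z) m) = 2 ^+ mdeg m * nm (term z m).
  rewrite /term !nmM mulrCA; congr (_ * _); rewrite /cmonomial !nm_prod /mdeg expr_sum -big_split /=.
  by apply: eq_bigr => i _; rewrite mxE !nmX nmM (nm_nat R 2) exprMn_comm //; exact: mulrC.
split; have -> : series (f ^~ z) = fun d => \sum_(w : {ffun 'I_n -> 'I_d}) term z (natf w) -
    \sum_(w : {ffun 'I_n -> 'I_d} | (d <= mdeg (natf w))%N) term z (natf w).
  by apply/funext => d; rewrite box_split addrK seriesE.
rewrite -[H z]subr0; apply: cvgKB; first exact: hz.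
apply/cvgCP => e1 e10; have [N hN] := half_small M e10.
exists N => // d /= Nd; rewrite subr0; apply: le_lt_trans (hN d Nd).
apply: le_trans (nm_sum _ _ _) _.
apply: le_trans (_ : \sum_(w : {ffun 'I_n -> 'I_d}) nm (term (2 *: z) (natf w)) * (1 / 2) ^+ d <= _); last first.
  by rewrite -mulr_suml ler_wpM2r // exprn_ge0.
rewrite big_mkcond; apply: ler_sum => w _; case: ifP => dw; last by rewrite mulr_ge0 ?nm_ge0 ?exprn_ge0.
rewrite t2 div1r exprVn ler_pdivlMr ?exprn_gt0 // mulrC ler_wpM2r ?nm_ge0 //.
by rewrite ler_weXn2l // ler1n.
Qed.

End Holomorphy.

Lemma poly_zeros (F : idomainType) (p : {poly F}) (s : nat -> F) : injective s ->
  (forall i, p.[s i] = 0) -> p = 0.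
Proof.
move=> si ps; apply/eqP/negPn/negP => p0.
have := max_poly_roots p0 (rs := [seq s i | i <- iota 0 (size p)]).
rewrite size_map size_iota ltnn map_inj_uniq // iota_uniq => h; suff : false by [].
by apply: h => //; apply/allP => _ /mapP[i _ ->]; apply/rootP.
Qed.

(** * The numerator of F_k near 0 *)

Section Continuation.
Variables (R : realType) (m : nat).
Notation C := (cplx R).
Notation k := m.+1.
Implicit Types (z : 'rV[C]_(k + k)).

Definition hser2 D z : C := series_h (lsubmx z) (- rsubmx z) D.

Lemma hom_hser2 D : hom D (hser2 D).
Proof.
have hl i : hom i (fun z : 'rV[C]_(k + k) => power_sum (lsubmx z) i : C).
  apply: hom_ext (hom_sum (index_enum 'I_k) (P := xpredT) (fun j _ => hom_power R (lshift k j) i)) => z.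
  by apply: eq_bigr => j _; rewrite mxE.
have hr i : hom i (fun z : 'rV[C]_(k + k) => power_sum (- rsubmx z) i : C).
  apply: hom_ext (homZ ((-1) ^+ i) (hom_sum (index_enum 'I_k) (P := xpredT) (fun j _ => hom_power R (rshift k j) i))) => z.
  by rewrite mulr_sumr; apply: eq_bigr => j _; rewrite !mxE [in RHS]exprNn.
have hp (s : seq nat) (f : nat -> 'rV[C]_(k + k) -> C) : (forall i, hom i (f i)) -> hom (sumn s) (fun z => \prod_(i <- s) f i z).
  by move=> h; have := hom_prod s h; rewrite -sumnE.
apply: (@hom_ext _ _ _ (fun z => \sum_(w <- pairs_tot D | w \in pairs_tot D) exp_W_coef R k w.1 w.2 *
   ((\prod_(i <- w.1) power_sum (lsubmx z) i : C) * (\prod_(i <- w.2) power_sum (- rsubmx z) i : C)))).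
  by move=> z; rewrite -big_seq.
apply: hom_sum => w; rewrite mem_pairs_tot => /andP[_ /eqP <-].
by apply: homZ; apply: homM; apply: hp.
Qed.

Definition cone z := forall i j, 0 < re (lsubmx z ord0 i - rsubmx z ord0 j).

Lemma polar_neq0 (x y : 'rV[C]_k) : (forall i j, 0 < re (x ord0 i - y ord0 j)) -> polar_product x y != 0.
Proof.
move=> h; apply/prodf_neq0 => i _; apply/prodf_neq0 => j _.
by apply/eqP => E; have := h i j; rewrite E -(rmorph0 (@toC R)) re_toC ltxx.
Qed.

(** Adding a large multiple of (1, ..., 1, 0, ..., 0) moves any z into the cone, and homogeneity
    allows scaling into the small ball. So g is zero at infinitely many points of a line through z,
    along which it is a polynomial. *)
Lemma hom_cone0 D (g : 'rV[C]_(k + k) -> C) (e : R) : hom D g -> 0 < e ->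
  (forall z, (forall i, nm (z ord0 i) < e) -> cone z -> g z = 0) -> forall z, g z = 0.
Proof.
move=> hg e0 gc z; pose z0 : 'rV[C]_(k + k) := row_mx (const_mx 1) 0.
have [p pE] := hom_line z z0 hg.
pose S := \sum_i nm (z ord0 i); have S0 : 0 <= S by rewrite sumr_ge0 // => i _; exact: nm_ge0.
have zS i : nm (z ord0 i) <= S.
  by rewrite /S (bigD1 i) //= lerDl sumr_ge0 // => j _; exact: nm_ge0.
suff p0 : p = 0 by have := pE 0; rewrite scale0r addr0 p0 horner0.
pose t n : R := S *+ 2 + n.+1%:R.
apply: (poly_zeros (s := fun n => toC (t n))) => [a b /toC_inj /addrI /eqP|n].
  by rewrite eqr_nat => /eqP [].
rewrite -pE; have t0 : 0 < t n by rewrite /t ltr_wpDl ?mulrn_wge0 ?ltr0n.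
pose l : R := e / (2 * (S + t n)); have l0 : 0 < l by rewrite divr_gt0 // mulr_gt0 // ltr_wpDl.
set w := z + _.
have lw : toC l ^+ D * g w = 0.
  rewrite -(hom_homog _ _ hg); apply: gc => [i|i j].
    rewrite mxE nmM nm_toC gtr0_norm //.
    have wi : nm (w ord0 i) <= S + t n.
      rewrite !mxE; apply: le_trans (nmD _ _) _; apply: lerD; first exact: zS.
      rewrite nmM nm_toC gtr0_norm // -[leRHS]mulr1 ler_wpM2l ?(ltW t0) //.
      by case: splitP => j _; rewrite !mxE ?nm0 ?ler01 // (nm_nat R 1).
    apply: le_lt_trans (ler_wpM2l (ltW l0) wi) _.
    have St : S + t n != 0 by rewrite gt_eqF // ltr_wpDl.
    have -> : l * (S + t n) = e / 2 by rewrite /l; field.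
    by move: e0; clear; lra.
  have -> : lsubmx (toC l *: w) ord0 i - rsubmx (toC l *: w) ord0 j
      = toC l * (z ord0 (lshift k i) - z ord0 (rshift k j) + toC (t n)).
    have z0l : z0 ord0 (lshift k i) = 1 by rewrite /z0 row_mxEl mxE.
    have z0r : z0 ord0 (rshift k j) = 0 by rewrite /z0 row_mxEr mxE.
    have wl : w ord0 (lshift k i) = z ord0 (lshift k i) + toC (t n) * 1 by rewrite /w mxE [X in _ + X]mxE z0l.
    have wr : w ord0 (rshift k j) = z ord0 (rshift k j) + toC (t n) * 0 by rewrite /w mxE [X in _ + X]mxE z0r.
    have sl : lsubmx (toC l *: w) ord0 i = toC l * w ord0 (lshift k i) by rewrite mxE mxE.
    have sr : rsubmx (toC l *: w) ord0 j = toC l * w ord0 (rshift k j) by rewrite mxE mxE.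
    by rewrite sl sr wl wr; ring.
  rewrite mulrC reM_toC mulr_gt0 // reD re_toC reB.
  have h1 := zS (lshift k i); have h2 := zS (rshift k j).
  have h3 := le_trans (re_le_nm _) h1; have h4 := le_trans (re_le_nm _) h2.
  move: h3 h4; rewrite !ler_norml => /andP[h3 _] /andP[_ h4].
  have n0 : (0 : R) < n.+1%:R by rewrite ltr0n.
  have alg (u v c S' : R) : - S' <= u -> v <= S' -> 0 < c -> 0 < u - v + (S' + S' + c) by move=> *; lra.
  rewrite /t mulr2n; exact: alg h3 h4 n0.
move/eqP: lw; rewrite mulf_eq0 expf_eq0 => /orP[/andP[_ /eqP l00]|/eqP //].
by move: l0; rewrite -(re_toC l) l00 -(rmorph0 (@toC R)) re_toC ltxx.
Qed.

Lemma continuation_ex : exists H : 'rV[C]_(k + k) -> C, holomorphic_near0 H /\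
  exists rho M : R, 0 < rho /\ (forall z, (forall i, nm (z ord0 i) < rho) ->
  [/\ l1 (series_h (lsubmx z) (- rsubmx z)) M, sums (hser2 ^~ z) (H z) &
    cone z -> H z = polar_product (lsubmx z) (rsubmx z) * euler_product (lsubmx z) (rsubmx z)]).
Proof.
have [rho [M [rho0 h]]] := series_h_props R m.
have hz z : (forall i, nm (z ord0 i) <= rho) -> l1 (series_h (lsubmx z) (- rsubmx z)) M /\
    (cone z -> sums (hser2 ^~ z) (polar_product (lsubmx z) (rsubmx z) * euler_product (lsubmx z) (rsubmx z))).
  move=> zr; have [||h1 h2] := h (lsubmx z) (- rsubmx z).
  - by move=> i; rewrite mxE.
  - by move=> i; rewrite !mxE nmN.
  split=> // cz; move: h2; rewrite opprK; apply => i j.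
  by have := cz i j; rewrite !mxE.
pose H z : C := limn (series (hser2 ^~ z)).
have Hs z : (forall i, nm (z ord0 i) <= rho) -> sums (hser2 ^~ z) (H z).
  move=> zr; have [l hl _] := sums_abs (hz z zr).1.
  by rewrite /H (sums_lim hl).
exists H; split.
  apply: (hom_series_holomorphic rho0 hom_hser2 (M := M)) => [D z zr|z zr].
    by apply: l1_coef; apply: (hz z _).1 => i; rewrite zr.
  by apply: Hs => i; apply: le_trans (ltW (zr i)) _; lra.
exists rho, M; split=> // z zr; have zr' i := ltW (zr i); split.
- exact: (hz z zr').1.
- exact: Hs.
- by move=> cz; apply: sums_lim; apply: (hz z zr').2.
Qed.

(** [Fk] is some continuation, with some numerator H'. On the cone H' agrees with the series
    constructed above, hence by [ps_uniq] along rays so do the homogeneous components there, and by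
    [hom_cone0] everywhere. *)
Lemma Fk_series : exists rho M : R, 0 < rho /\ forall x y : 'rV[C]_k,
  (forall i, nm (x ord0 i) < rho) -> (forall i, nm (y ord0 i) < rho) ->
  l1 (series_h x (- y)) M /\
  (polar_product x y != 0 -> sums (series_h x (- y)) (polar_product x y * Fk x y)).
Proof.
have [H [hH [rho [M [rho0 HM]]]]] := continuation_ex.
have [F1 F2] : is_continuation (@Fk R k).
  apply: (@xgetPex _ (fun _ _ => 0) [set F | is_continuation F]).
  exists (fun x y => H (row_mx x y) / polar_product x y); split.
    apply/near_rV0; exists rho => // z zr cz; rewrite hsubmxK.
    have [_ _ ->] := HM z zr; last exact: cz.
    by rewrite mulrC mulKf // polar_neq0.
  exists H => //; apply/near_rV0; exists rho => // z zr pz.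
  by rewrite hsubmxK mulrC divfK.
have [e1 e10 Fe] := (near_rV0 _).1 F1.
case: F2 => H' hH' /near_rV0 [e2 e20 FH].
have [f [hf [e3 e30 fH]]] := holomorphic_hom_series hH'.
pose e := Num.min (Num.min rho e1) (Num.min e2 e3).
have e0 : 0 < e by rewrite !lt_min rho0 e10 e20 e30.
have le z : (forall i, nm (z ord0 i) < e) -> [/\ forall i, nm (z ord0 i) < rho,
    forall i, nm (z ord0 i) < e1, forall i, nm (z ord0 i) < e2 & forall i, nm (z ord0 i) < e3].
  by move=> ze; split=> i; have := ze i; rewrite !lt_min => /andP[/andP[? ?] /andP[? ?]].
have fE D z : f D z = hser2 D z.
  apply/eqP; rewrite -subr_eq0; apply/eqP; move: z.
  apply: (@hom_cone0 D (fun z => f D z - hser2 D z) e _ e0).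
    apply: hom_ext (homD (hf D) (homZ (-1) (hom_hser2 D))) => z.
    by rewrite mulN1r.
  move=> z ze cz.
  apply: (ps_uniq (d := fun D => f D z - hser2 D z) ltr01) => t /andP[t0 t1].
  have tz i : nm ((toC t *: z) ord0 i) < e.
    rewrite mxE nmM nm_toC gtr0_norm //; apply: le_lt_trans (ze i).
    by rewrite ler_piMl ?nm_ge0 // ltW.
  have ctz : cone (toC t *: z).
    move=> i j; have := cz i j; rewrite !mxE -mulrBr mulrC reM_toC => h.
    by rewrite mulr_gt0.
  have [h1 h2 h3 h4] := le _ tz.
  have [_ s1 /(_ ctz) HE] := HM _ h1; have s2 := fH _ h4.
  have E : H' (toC t *: z) = H (toC t *: z) by rewrite -FH ?polar_neq0 // HE Fe.
  have := sumsD s2 (sumsN s1); rewrite E subrr; apply: sums_ext => n.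
  by rewrite (hom_homog _ _ (hf n)) (hom_homog _ _ (hom_hser2 n)) -mulrBr mulrC.
exists e, M; split=> // x y xe ye.
have ze i : nm ((row_mx x y) ord0 i) < e by rewrite mxE; case: splitP => j _.
have [h1 _ h3 h4] := le _ ze.
have [l1h _ _] := HM _ h1; move: l1h; rewrite row_mxKl row_mxKr => l1h; split=> // pz.
have := FH _ h3; rewrite row_mxKl row_mxKr => -> //.
apply: sums_ext (fH _ h4) => D; rewrite fE /hser2 row_mxKl row_mxKr //.
Qed.

End Continuation.

Local Close Scope classical_set_scope.
(** * Sums over subsets of a family of variables *)

Section Vandermonde.
Variable K : numFieldType.

Lemma alternant_expand n (x : 'I_n -> K) M :
  alternant x M = \sum_(s : 'S_n) (-1) ^+ s * \prod_j x (s j) ^+ M j.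
Proof.
rewrite /alternant -det_tr; apply: eq_bigr => s _; congr (_ * _).
by apply: eq_bigr => j _; rewrite !mxE.
Qed.

Lemma alternant_perm n (x : 'I_n -> K) M (s : 'S_n) :
  alternant (x \o s) M = (-1) ^+ s * alternant x M.
Proof.
rewrite /alternant -[X in X * _](det_perm K) -det_mulmx -row_permE; congr (\det _).
by apply/matrixP => i j; rewrite !mxE.
Qed.

Lemma vander_prod n (x : 'I_n -> K) :
  vander x = \prod_(i < n) \prod_(j < n | (i < j)%N) (x i - x j).
Proof.
pose r : 'S_n := perm (@rev_ord_inj n).
have rE i : r i = rev_ord i by rewrite permE.
pose y : 'rV[K]_n := \row_i x (rev_ord i).
have -> : vander x = \det (Vandermonde n y).
  pose A : 'M[K]_n := \matrix_(l, j) x l ^+ staircase j; rewrite -det_tr [LHS](_ : _ = \det A) //.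
  have -> : (Vandermonde n y)^T = row_perm r (col_perm r A).
    apply/matrixP => l j; rewrite !mxE !rE /staircase /=; congr (_ ^+ _).
    by have := ltn_ord j; lia.
  by rewrite row_permE col_permE !det_mulmx !det_perm odd_permV mulrCA -signr_addb addbb mulr1.
rewrite det_Vandermonde.
under eq_bigr do under eq_bigr do rewrite !mxE.
rewrite (exchange_big_dep xpredT) //= (reindex_inj rev_ord_inj) /=; apply: eq_bigr => i _.
rewrite (reindex_inj rev_ord_inj) /=; apply: eq_big => j; last by rewrite !rev_ordK.
by have := ltn_ord i; have := ltn_ord j; lia.
Qed.

Lemma vander_neq0 n (x : 'I_n -> K) : injective x -> vander x != 0.
Proof.
move=> xi; rewrite vander_prod; apply/prodf_neq0 => i _; apply/prodf_neq0 => j ij.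
by rewrite subr_eq0; apply: contraTneq ij => /xi ->; rewrite ltnn.
Qed.

Variable k : nat.
Implicit Types x : 'I_(k + k) -> K.
Notation lo := (@lshift k k).
Notation hi := (@rshift k k).

Lemma vander_split x : vander x =
  vander (x \o lo) * vander (x \o hi) * \prod_i \prod_j (x (lo i) - x (hi j)).
Proof.
rewrite !vander_prod big_split_ord /= [RHS]mulrAC -[in RHS]big_split /=; congr (_ * _).
  apply: eq_bigr => i _; rewrite big_split_ord /=; congr (_ * _).
  by apply: eq_big => // j; rewrite /= (leq_trans (ltn_ord i)) ?leq_addr.
apply: eq_bigr => i _; rewrite big_split_ord /= big_pred0 => [|j]; last first.
  by rewrite ltnNge ltnW // (leq_trans (ltn_ord j)) ?leq_addr.
by rewrite mul1r; apply: eq_bigl => j; rewrite ltn_add2l.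
Qed.

Definition same_side (l j : 'I_(k + k)) := (l < k)%N == (j < k)%N.
(** The Young subgroup S_k x S_k. *)
Definition blocky : {set 'S_(k + k)} := [set s : 'S_(k + k) | [forall l, same_side l (s l)]].

Lemma lo_lt i : (lo i < k)%N. Proof. exact: (ltn_ord i). Qed.
Lemma hi_lt i : (hi i < k)%N = false. Proof. by rewrite ltnNge leq_addr. Qed.

Lemma alternant_blocks x M : alternant (x \o lo) (M \o lo) * alternant (x \o hi) (M \o hi)
  = \sum_(t in blocky) (-1) ^+ t * \prod_j x (t j) ^+ M j.
Proof.
rewrite /alternant -(det_ublock _ 0) -det_tr.
transitivity (\sum_(t : 'S_(k + k)) (-1) ^+ t * \prod_j
    (if same_side j (t j) then x (t j) ^+ M j else 0)).
  apply: eq_bigr => t _; congr (_ * _); apply: eq_bigr => j _; rewrite mxE.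
  move: (t j) => l; rewrite /same_side.
  case: (split_ordP l) => l' ->; case: (split_ordP j) => j' ->;
    by rewrite ?(block_mxEul, block_mxEur, block_mxEdl, block_mxEdr) ?lo_lt ?hi_lt mxE.
rewrite [RHS]big_mkcond; apply: eq_bigr => t _; rewrite inE.
case: ifP => [/forallP h|/negbT].
  by congr (_ * _); apply: eq_bigr => j _; rewrite h.
rewrite negb_forall => /existsP [j /negPf h].
by rewrite (bigD1 j) //= h mul0r mulr0.
Qed.

(** Laplace expansion along the two halves of the columns, summed over the whole symmetric group:
    every term is met once for each element of the Young subgroup. No representatives of cosets and
    no signs of subsets are needed. *)
Lemma sum_alternant_blocks x M :
  \sum_(s : 'S_(k + k)) (-1) ^+ s *
     (alternant (x \o s \o lo) (M \o lo) * alternant (x \o s \o hi) (M \o hi))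
  = #|blocky|%:R * alternant x M.
Proof.
under eq_bigr do rewrite alternant_blocks mulr_sumr.
rewrite exchange_big /= mulr_natl -sumr_const; apply: eq_bigr => t _.
rewrite alternant_expand (reindex_inj (mulgI t^-1)%g) /=; apply: eq_bigr => s _.
rewrite odd_permM odd_permV signr_addb [LHS]mulrACA -signr_addb addbb mul1r; congr (_ * _).
by apply: eq_bigr => j _; rewrite permM permK.
Qed.

Definition lset (s : 'S_(k + k)) : {set 'I_(k + k)} := [set s (lo i) | i : 'I_k].

Lemma lset_lo (s : 'S_(k + k)) (l : 'I_(k + k)) : (s l \in lset s) = (l < k)%N.
Proof.
apply/imsetP/idP => [[i _ /perm_inj ->]|lk]; first exact: lo_lt.
by exists (Ordinal lk) => //; congr (s _); apply: val_inj.
Qed.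

Lemma card_lset s : #|lset s| = k.
Proof. by rewrite card_imset ?card_ord // => i j /perm_inj /lshift_inj. Qed.

Lemma lset_hi s : ~: lset s = [set s (hi i) | i : 'I_k].
Proof.
apply/setP => l; rewrite inE -[l](permKV s) lset_lo; apply/idP/imsetP => [h|[i _ /perm_inj ->]].
  have [i E|i E] := split_ordP (s^-1 l)%g; first by rewrite E lo_lt in h.
  by exists i => //; rewrite E.
by rewrite hi_lt.
Qed.

Lemma lset_ex (S : {set 'I_(k + k)}) : #|S| = k -> exists s : 'S_(k + k), lset s = S.
Proof.
move=> Sk; have Sck : #|~: S| = k by rewrite cardsCs finset.setCK Sk card_ord addnK.
pose f (l : 'I_(k + k)) : 'I_(k + k) := match fintype.split l with
  | inl i => enum_val (cast_ord (esym Sk) i) | inr i => enum_val (cast_ord (esym Sck) i) end.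
have fi : injective f.
  move=> l l'; rewrite /f; case: splitP => i li; case: splitP => j lj E.
  - by apply: val_inj; rewrite /= li lj; move/enum_val_inj/(congr1 val): E => /= ->.
  - by have := enum_valP (cast_ord (esym Sk) i); rewrite E; have := enum_valP (cast_ord (esym Sck) j); rewrite inE => /negPf ->.
  - by have := enum_valP (cast_ord (esym Sk) j); rewrite -E; have := enum_valP (cast_ord (esym Sck) i); rewrite inE => /negPf ->.
  - by apply: val_inj; rewrite /= li lj; move/enum_val_inj/(congr1 val): E => /= ->.
exists (perm fi); apply/eqP; rewrite eqEcard card_lset Sk leqnn andbT.
apply/fintype.subsetP => _ /imsetP [i _ ->]; rewrite permE /f (unsplitK (inl i)).
exact: enum_valP.
Qed.

Lemma card_lset_fiber (S : {set 'I_(k + k)}) : #|S| = k -> #|[set s | lset s == S]| = #|blocky|.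
Proof.
move=> /lset_ex [s0 <-]; rewrite -[RHS](card_imset _ (mulIg s0)); apply: eq_card => s.
rewrite inE; apply/eqP/imsetP => [sE|[t]]; last first.
  rewrite inE => /forallP ht ->; apply/setP => l; rewrite -[l](permKV s0).
  rewrite lset_lo -[(s0^-1)%g l](permKV t) -permM lset_lo.
  have := ht (t^-1 (s0^-1 l))%g; rewrite /same_side permKV => /eqP ->.
  by [].
exists (s * s0^-1)%g; last by apply/permP => l; rewrite !permM permKV.
rewrite inE; apply/forallP => l; rewrite /same_side -(lset_lo s l) sE.
by rewrite -(lset_lo s0) permM permKV.
Qed.

Lemma sum_lset (F : {set 'I_(k + k)} -> K) :
  \sum_(s : 'S_(k + k)) F (lset s) = #|blocky|%:R * \sum_(S : {set 'I_(k + k)} | #|S| == k) F S.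
Proof.
rewrite (partition_big lset (fun S => #|S| == k)) => [|s _]; last by rewrite card_lset.
rewrite mulr_sumr; apply: eq_bigr => S /eqP Sk.
rewrite (eq_bigr (fun=> F S)) => [|s /eqP -> //].
rewrite (eq_bigl (mem [set s | lset s == S])) => [|s]; last by rewrite /= inE.
by rewrite sumr_const (card_lset_fiber Sk) mulr_natl.
Qed.

Definition psumS x (S : {set 'I_(k + k)}) : nat -> (K^o : comAlgType K) := fun r => \sum_(j in S) x j ^+ r.
Definition polarS x (S : {set 'I_(k + k)}) : K := \prod_(i in S) \prod_(j in ~: S) (x i - x j).

Definition beta (s : seq nat) (i : nat) := (nth 0 s i + (k.-1 - i))%N.
Definition Mbeta (kap nu : seq nat) (l : 'I_(k + k)) : nat :=
  match fintype.split l with inl i => beta kap i | inr j => beta nu j end.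

Lemma MbetaL kap nu i : Mbeta kap nu (lo i) = beta kap i.
Proof. by rewrite /Mbeta (unsplitK (inl i)). Qed.
Lemma MbetaR kap nu i : Mbeta kap nu (hi i) = beta nu i.
Proof. by rewrite /Mbeta (unsplitK (inr i)). Qed.

(** By [vander_split] the full Vandermonde over the polar product is the product of those of S and
    of its complement, and these turn the two Schur functions into alternants. *)
Lemma schur_subsets x H kap nu : injective x -> newton (fun r => \sum_i x i ^+ r) H ->
  (size kap <= k)%N -> (size nu <= k)%N ->
  \sum_(S : {set 'I_(k + k)} | #|S| == k)
     (schur (psumS x S) kap : K) * (schur (psumS x (~: S)) nu : K) / polarS x S
  = \det (hmat H (Mbeta kap nu)).
Proof.
move=> xi nH sk sn; have V0 := vander_neq0 xi.
have B0 : (#|blocky|%:R : K) != 0.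
  rewrite pnatr_eq0 -lt0n; apply/card_gt0P; exists 1%g; rewrite inE; apply/forallP => l.
  by rewrite perm1 /same_side eqxx.
apply: (mulfI B0); rewrite -sum_lset.
apply: (mulfI V0); rewrite [RHS]mulrCA -(alternant_hmat nH) -sum_alternant_blocks mulr_sumr.
apply: eq_bigr => s _.
have lin : injective (s \o lo) by move=> i j /perm_inj /lshift_inj.
have hin : injective (s \o hi) by move=> i j /perm_inj /rshift_inj.
have pL : psumS x (lset s) = fun r => \sum_i (x \o s \o lo) i ^+ r.
  by apply/funext => r; rewrite /psumS /lset big_imset //= => i j _ _; apply: lin.
have pR : psumS x (~: lset s) = fun r => \sum_i (x \o s \o hi) i ^+ r.
  by apply/funext => r; rewrite /psumS lset_hi big_imset //= => i j _ _; apply: hin.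
have pp : polarS x (lset s) = \prod_i \prod_j ((x \o s) (lo i) - (x \o s) (hi j)).
  rewrite /polarS lset_hi /lset big_imset /=; last by move=> i j _ _; apply: lin.
  by apply: eq_bigr => i _; rewrite big_imset //= => i' j _ _; apply: hin.
have VE : vander x = (-1) ^+ s * vander (x \o s) by rewrite /vander alternant_perm signrMK.
have Vs : vander (x \o s) != 0 by apply: vander_neq0 => i j /xi /perm_inj.
rewrite pL pR pp VE -[LHS]mulrA; congr (_ * _); rewrite vander_split in Vs *.
have a1 := schur_alternant (x \o s \o lo) sk; have a2 := schur_alternant (x \o s \o hi) sn.
have -> : alternant (x \o s \o lo) (Mbeta kap nu \o lo) = alternant (x \o s \o lo) (fun j => (nth 0 kap j + staircase j)%N).
  by congr (\det _); apply/matrixP => i j; rewrite !mxE /= MbetaL.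
have -> : alternant (x \o s \o hi) (Mbeta kap nu \o hi) = alternant (x \o s \o hi) (fun j => (nth 0 nu j + staircase j)%N).
  by congr (\det _); apply/matrixP => i j; rewrite !mxE /= MbetaR.
rewrite -a1 -a2; move: Vs; rewrite !mulf_eq0 !negb_or => /andP[_ p0].
have alg (v1 v2 s1 s2 P : K) : P != 0 -> v1 * v2 * P * (s1 * s2 / P) = v1 * s1 * (v2 * s2).
  by move=> P0; field.
exact: alg p0.
Qed.

End Vandermonde.

(** * The extreme degree of the determinant, and complements in a square *)

Section DetHmat.
Variables (K : numFieldType) (n : nat) (H : nat -> K).

Lemma det_hmat_expand (m : 'I_n -> nat) : \det (hmat H m) =
  \sum_(s : 'S_n) (-1) ^+ s * \prod_l hshift H (m (s l)) (n.-1 - l).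
Proof.
by apply: eq_bigr => s _; congr (_ * _); apply: eq_bigr => l _; rewrite mxE.
Qed.

Lemma sum_perm (m : 'I_n -> nat) (s : 'S_n) : (\sum_l m (s l) = \sum_l m l)%N.
Proof. by rewrite [RHS](reindex_inj (@perm_inj _ s)). Qed.

(** In each term of the expansion some h has a negative index, by comparison of sums. *)
Lemma det_hmat_small (m : 'I_n -> nat) : (\sum_l m l < \sum_(l < n) (n.-1 - l))%N ->
  \det (hmat H m) = 0.
Proof.
move=> lt; rewrite det_hmat_expand big1 // => s _.
have [l hl] : exists l, (m (s l) < n.-1 - l)%N.
  apply/existsP; apply: contraLR lt; rewrite negb_exists => /forallP h.
  rewrite -leqNgt -(sum_perm m s); apply: leq_sum => l _.
  by rewrite leqNgt h.
by rewrite (bigD1 l) //= /hshift leqNgt hl mul0r mulr0.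
Qed.

(** The indices of the h's in a term now add up to 0; so one is negative or all are 0. *)
Lemma det_hmat_top (m : 'I_n -> nat) : (\sum_l m l = \sum_(l < n) (n.-1 - l))%N -> H 0%N = 1 ->
  \det (hmat H m) = \sum_(s : 'S_n) (-1) ^+ s * [forall l, m (s l) == (n.-1 - l)%N]%:R.
Proof.
move=> eqm H0; rewrite det_hmat_expand; apply: eq_bigr => s _; congr (_ * _).
case: (boolP [forall l, m (s l) == (n.-1 - l)%N]) => [/forallP h|h].
  by rewrite big1 // => l _; rewrite /hshift (eqP (h l)) leqnn subnn.
have [l hl] : exists l, (m (s l) < n.-1 - l)%N.
  apply/existsP; apply: contraR h; rewrite negb_exists => /forallP h.
  have h' (l : 'I_n) : true -> (n.-1 - l <= m (s l) ?= iff ((n.-1 - l)%N == m (s l)))%N.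
    by move=> _; split=> //; rewrite leqNgt h.
  have := (leqif_sum h').2; rewrite sum_perm eqm eqxx => /esym /forallP h2.
  by apply/forallP => l; rewrite eq_sym; exact: h2.
by rewrite (bigD1 l) //= /hshift leqNgt hl mul0r.
Qed.

End DetHmat.

Section Complements.
Local Open Scope nat_scope.

Lemma sum_nth s k : size s <= k -> \sum_(i < k) nth 0 s i = sumn s.
Proof.
elim: s k => [|a s IH] [|k] //= sk; first by rewrite big_ord0.
  by rewrite big1 // => i _; rewrite nth_nil.
by rewrite big_ord_recl /= -(IH k).
Qed.

Lemma part_nth_mono s i j : is_part s -> i <= j -> nth 0 s j <= nth 0 s i.
Proof.
move=> /andP[ss _] ij; have [js|js] := ltnP j (size s); last by rewrite nth_default.
by apply: (sorted_leq_nth geq_trans leqnn 0 ss) => //; rewrite inE // (leq_ltn_trans ij).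
Qed.

Lemma part_nth_gt0 s i : is_part s -> (0 < nth 0 s i) = (i < size s).
Proof.
move=> /andP[_ s0]; have [iz|iz] := ltnP i (size s); last by rewrite nth_default.
by rewrite lt0n; apply: contraNneq s0 => <-; apply: mem_nth.
Qed.

Lemma part_nth_eq s t : is_part s -> is_part t -> nth 0 s =1 nth 0 t -> s = t.
Proof.
move=> ps pt st; have sz : size s = size t.
  have h i : (i < size s) = (i < size t) by rewrite -!part_nth_gt0 // st.
  by apply/eqP; rewrite eqn_leq leqNgt h ltnn leqNgt -h ltnn.
by apply: (eq_from_nth (x0 := 0) sz) => i _.
Qed.

Lemma nth_conj s j : sorted geq s -> nth 0 (conj_part s) j = count (fun x => j < x) s.
Proof.
move=> ss; rewrite /conj_part; have [jh|jh] := ltnP j (head 0 s); first by rewrite nth_mkseq.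
rewrite nth_default ?size_mkseq //; apply/esym/eqP; rewrite -leqn0 leqNgt -has_count.
apply/hasPn => x xs; rewrite -leqNgt; apply: leq_trans jh.
case: s ss xs => [//|a s] /= ss; rewrite in_cons => /orP[/eqP -> //|xs].
by have /allP := order_path_min geq_trans ss; exact.
Qed.

Lemma conj_is_part s : sorted geq s -> is_part (conj_part s).
Proof.
move=> ss; apply/andP; split.
  apply/(sortedP 0) => i; rewrite size_mkseq => ih; rewrite /= !nth_conj //.
  by apply: sub_count => x /= /ltnW.
apply/negP => z0; have := nth_index 0 z0; move: z0; rewrite -index_mem size_mkseq.
move: (index _ _) => i ih; rewrite nth_conj // => /eqP.
rewrite -leqn0 leqNgt -has_count => /negP; apply.
by case: s ss ih => [//|a s] _ /= ->.
Qed.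

Definition colheight k kap j := \sum_(i < k) (nth 0 kap i + j < k).

Lemma compl_sorted k kap : is_part kap ->
  sorted geq [seq x <- mkseq (fun i => k - nth 0 kap (k.-1 - i)) k | x != 0].
Proof.
move=> pk; apply: (sorted_filter geq_trans); apply/(sortedP 0) => i; rewrite size_mkseq => ik.
rewrite /= !nth_mkseq //; last exact: ltnW.
by apply: leq_sub2l; apply: part_nth_mono => //; lia.
Qed.

Lemma compl_is_part k kap : is_part kap -> is_part (compl_part k kap).
Proof. by move=> pk; apply: conj_is_part; apply: compl_sorted. Qed.

Lemma nth_compl k kap j : is_part kap -> nth 0 (compl_part k kap) j = colheight k kap j.
Proof.
move=> pk; rewrite /compl_part nth_conj ?compl_sorted // /mkseq count_filter count_map.
have -> : iota 0 k = index_iota 0 k by rewrite /index_iota subn0.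
rewrite -sum1_count big_mkcond big_mkord (reindex_inj rev_ord_inj) /=.
apply: eq_bigr => i _; rewrite (_ : k.-1 - (k - i.+1) = i); last by have := ltn_ord i; lia.
by case: ifP => h1; case: (ltnP (_ + j) k) => h2 //; lia.
Qed.

Lemma sum_geq_ord k i : \sum_(j < k) (i <= j) = k - i.
Proof.
by elim: k => [|k IH]; [rewrite big_ord0|rewrite big_ord_recr /= IH; case: leqP => ?; lia].
Qed.

Lemma final_segment k (P : pred nat) : (forall i i', P i -> i <= i' < k -> P i') ->
  forall i, i < k -> P i = (k - \sum_(j < k) P j <= i).
Proof.
move=> Pm i ik; set q := \sum_(j < k) _.
have [Pi|/negbTE Pi] := boolP (P i).
  have : k - i <= q.
    rewrite -sum_geq_ord; apply: leq_sum => j _; case: (leqP i j) => // ij.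
    by have -> : P j by apply: (Pm i) => //; rewrite ij ltn_ord.
  by move=> h; apply/esym; lia.
have : q <= k - i.+1.
  rewrite -sum_geq_ord; apply: leq_sum => j _; case: ltnP => // ji; first by case: (P j).
  by case Pj : (P j) => //; rewrite (Pm j i) // ji in Pi.
by move=> h; apply/esym/negbTE; lia.
Qed.

Lemma beta_decr k s i j : is_part s -> i < j -> j < k -> beta k s j < beta k s i.
Proof. by move=> ps ij jk; have := part_nth_mono ps (ltnW ij); rewrite /beta; lia. Qed.

Lemma beta_inj k s i j : is_part s -> i < k -> j < k -> beta k s i = beta k s j -> i = j.
Proof.
by move=> ps ik jk E; have [ij|ij|//] := ltngtP i j; [have := beta_decr ps ij jk|have := beta_decr ps ij ik]; rewrite E ltnn.
Qed.

Variables (k : nat) (kap nu : seq nat).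
Hypotheses (pk : is_part kap) (pn : is_part nu) (sk : size kap <= k) (sn : size nu <= k).
Notation M := (@Mbeta k kap nu).

Lemma colheight_seg i j : i < k -> j < k ->
  (nth 0 kap i + j < k) = (k - colheight k kap j <= i).
Proof.
move=> ik jk; apply: (@final_segment k (fun i => nth 0 kap i + j < k)) => // a b h /andP[ab bk].
by apply: leq_ltn_trans h; rewrite leq_add2r part_nth_mono.
Qed.

Lemma colheight_le j : colheight k kap j <= k.
Proof. by rewrite -[leqRHS]card_ord -sum1_card; apply: leq_sum => i _; case: ltnP. Qed.

(** The beta numbers of kap and of its complement together are 0, ..., 2 k - 1. A coincidence would
    read kap_i + j = c_j + i with c_j = [colheight k kap j], but by [colheight_seg] one side is
    below k exactly when the other is not. *)
Lemma Mbeta_perm : fits k kap -> nu = compl_part k kap ->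
  exists s : 'S_(k + k), forall l, M (s l) = (k + k).-1 - l.
Proof.
move=> /andP[_ hk] nE.
have qE j : nth 0 nu j = colheight k kap j by rewrite nE nth_compl.
have kk i : nth 0 kap i <= k by apply: leq_trans (part_nth_mono pk (leq0n i)) _; rewrite nth0.
have ML l : M l < k + k.
  rewrite /Mbeta; case: splitP => i _; rewrite /beta; have := ltn_ord i.
    by have := kk i; lia.
  by rewrite qE; have := colheight_le i; lia.
have ne (i j : 'I_k) : beta k kap i <> beta k nu j.
  rewrite /beta qE; have := colheight_seg (ltn_ord i) (ltn_ord j); have := colheight_le j.
  have := ltn_ord i; have := ltn_ord j; move: (colheight _ _ _) (nth _ _ _) => c a.
  by case: (ltnP (a + j) k) => ? ? ? ? /esym ?; lia.
have Mi : injective (fun l => rev_ord (Ordinal (ML l))).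
  move=> l l' /rev_ord_inj /(congr1 val) /=.
  case: (split_ordP l) => i ->; case: (split_ordP l') => j ->; rewrite ?MbetaL ?MbetaR.
  - by move=> /(beta_inj pk (ltn_ord i) (ltn_ord j)) /val_inj ->.
  - by move/ne.
  - by move/esym/ne.
  - by move=> /(beta_inj pn (ltn_ord i) (ltn_ord j)) /val_inj ->.
pose t := perm Mi; exists (t^-1)%g => l; set l' := (t^-1)%g l.
have : t l' = l by rewrite permKV.
by rewrite permE => /(congr1 val) /= <-; have := ML l'; lia.
Qed.

Section Converse.
Variable s : 'S_(k + k).
Hypothesis Ms : forall l, M (s l) = (k + k).-1 - l.

Lemma Mbeta_lt l : M l < k + k.
Proof. by rewrite -[l](permKV s) Ms; have := ltn_ord l; lia. Qed.

Lemma Mbeta_inj : injective M.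
Proof.
move=> l l'; rewrite -[l](permKV s) -[l'](permKV s) !Ms => e; congr (s _); apply: val_inj => /=.
by move: e; have := ltn_ord ((s^-1)%g l); have := ltn_ord ((s^-1)%g l'); lia.
Qed.

Lemma Mbeta_count v : v <= k + k -> \sum_l (M l < v) = v.
Proof.
move=> vk; rewrite (reindex_inj (@perm_inj _ s)) /=.
under eq_bigr do rewrite Ms.
have -> : \sum_(l < k + k) ((k + k).-1 - l < v) = \sum_(l < k + k) (k + k - v <= l).
  by apply: eq_bigr => l _; have ll := ltn_ord l; congr (nat_of_bool _); lia.
by rewrite sum_geq_ord subKn.
Qed.

(** The beta numbers fill 0, ..., 2 k - 1, so nu_j + k - 1 - j of them lie below the j-th of nu. Of
    these k - 1 - j belong to nu, and the others to kap. *)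
Lemma Mbeta_cross (j : 'I_k) : \sum_(i < k) (beta k kap i < beta k nu j) = nth 0 nu j.
Proof.
have Bk : beta k nu j < k + k by have := Mbeta_lt (rshift k j); rewrite MbetaR.
have := Mbeta_count (ltnW Bk); rewrite big_split_ord /=.
under eq_bigr do rewrite MbetaL; under [X in _ + X]eq_bigr do rewrite MbetaR.
have -> : \sum_(i < k) (beta k nu i < beta k nu j) = k - j.+1.
  rewrite -sum_geq_ord; apply: eq_bigr => i _; congr (nat_of_bool _).
  have [ij|ij|ij] := ltngtP i j.
  - by have := beta_decr pn ij (ltn_ord j); lia.
  - by rewrite beta_decr.
  - by rewrite ij ltnn.
by rewrite /beta; have := ltn_ord j; lia.
Qed.

(** By [Mbeta_cross] the rows i of kap with a beta number below the j-th of nu form a final segment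
    of length nu_j. At its boundary the inequality between beta numbers is strict, by injectivity,
    and turns into kap_i + j < k. *)
Lemma Mbeta_compl : fits k kap /\ nu = compl_part k kap.
Proof.
have fk : fits k kap.
  rewrite /fits sk; case: (posnP k) => [k0|k0]; first by move: sk; rewrite k0 leqn0 => /nilP ->.
  have := Mbeta_lt (lshift k (Ordinal k0)); rewrite MbetaL /beta /= nth0; lia.
split=> //; apply: part_nth_eq => // [|j]; first exact: compl_is_part.
rewrite nth_compl //; have [jk|jk] := ltnP j k; last first.
  rewrite nth_default ?(leq_trans sn) //; apply/esym; rewrite /colheight big1 // => i _.
  by apply/eqP; rewrite eqb0 -leqNgt (leq_trans jk) ?leq_addl.
have cE := Mbeta_cross (Ordinal jk); rewrite /= in cE.
rewrite -{1}cE; apply: eq_bigr => i _; congr (nat_of_bool _).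
have mono a b : beta k kap a < beta k nu j -> a <= b < k -> beta k kap b < beta k nu j.
  move=> h /andP[ab bk]; move: ab; rewrite leq_eqVlt => /orP[/eqP <- //|ab].
  by apply: ltn_trans h; apply: beta_decr.
have sg a (ak : a < k) := final_segment mono ak; rewrite cE in sg.
have ck : nth 0 nu j <= k by rewrite -cE -[leqRHS]card_ord -sum1_card; apply: leq_sum => b _; case: ltnP.
have ik := ltn_ord i; rewrite sg //; set c := nth 0 nu j in sg ck *.
case: (leqP (k - c) i) => h; apply/esym; [|apply/negbTE; rewrite -leqNgt].
  have kc : k - c < k by lia.
  have := sg _ kc; rewrite leqnn /beta -/c => h1.
  have := part_nth_mono pk h; lia.
have kc : (k - c).-1 < k by lia.
have h0 : i <= (k - c).-1 by lia.
have hn : (k - c <= (k - c).-1) = false by lia.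
have := sg _ kc; rewrite hn => /negbT; rewrite -leqNgt /beta -/c => h1.
have ne : nth 0 kap (k - c).-1 + (k.-1 - (k - c).-1) <> c + (k.-1 - j).
  move=> E; pose b := Ordinal kc.
  have E' : M (lshift k b) = M (rshift k (Ordinal jk)) by rewrite MbetaL MbetaR /beta /= E.
  by have /(congr1 val) /= := Mbeta_inj E'; have := ltn_ord b; rewrite /=; lia.
have := part_nth_mono pk h0; lia.
Qed.

(** The sign of s is that of the Vandermonde product at the exponents M. Within each half these
    decrease, so only pairs across the halves count; for each j exactly nu_j of them are
    inverted. *)
Lemma Mbeta_sign : (-1) ^+ s = (-1) ^+ sumn nu :> rat.
Proof.
pose y (l : 'I_(k + k)) : rat := ((k + k).-1 - l)%:R%R.
pose My (l : 'I_(k + k)) : rat := (M l)%:R%R.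
have decr_pos n (x : 'I_n -> rat) : (forall i j : 'I_n, i < j -> (x j < x i)%R) -> (0 < vander x)%R.
  move=> h; rewrite vander_prod; apply: prodr_gt0 => i _; apply: prodr_gt0 => j ij.
  by rewrite subr_gt0; apply: h.
have yE : My \o s = y by apply/funext => l; rewrite /My /= Ms.
have V : (vander y = (-1) ^+ s * vander My)%R by rewrite -yE /vander alternant_perm.
have y0 : (0 < vander y)%R.
  by apply: decr_pos => i j ij; rewrite ltr_nat; have := ltn_ord j; lia.
have a0 : (0 < vander (My \o @lshift k k))%R.
  by apply: decr_pos => i j ij; rewrite /My /= !MbetaL ltr_nat; apply: beta_decr.
have b0 : (0 < vander (My \o @rshift k k))%R.
  by apply: decr_pos => i j ij; rewrite /My /= !MbetaR ltr_nat; apply: beta_decr.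
have P : (Num.sg (\prod_(i < k) \prod_(j < k) (My (lshift k i) - My (rshift k j))) = (-1) ^+ sumn nu)%R.
  have sg1 i j : Num.sg (My (lshift k i) - My (rshift k j))%R = ((-1) ^+ (beta k kap i < beta k nu j))%R.
    rewrite /My MbetaL MbetaR; case: ltngtP => h.
    - by rewrite ltr0_sg ?expr1 // subr_lt0 ltr_nat.
    - by rewrite gtr0_sg ?expr0 // subr_gt0 ltr_nat.
    - have E : M (lshift k i) = M (rshift k j) by rewrite MbetaL MbetaR.
      by have /(congr1 val) /= := Mbeta_inj E; have := ltn_ord i; lia.
  rewrite exchange_big /= (big_morph Num.sg (@sgrM _) (@sgr1 _)) -(sum_nth sn) expr_sum.
  apply: eq_bigr => j _; rewrite (big_morph Num.sg (@sgrM _) (@sgr1 _)) -Mbeta_cross expr_sum.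
  by apply: eq_bigr => i _; rewrite sg1.
have := congr1 Num.sg V; rewrite gtr0_sg // sgrM vander_split !sgrM (gtr0_sg a0) (gtr0_sg b0) P !mul1r.
rewrite sgrX sgrN1 => h.
by rewrite -[LHS]mulr1 -[X in (_ * X)%R](sqrr_sign rat (sumn nu)) expr2 mulrA -h mul1r.
Qed.

End Converse.
End Complements.

Section TopDegree.
Local Open Scope nat_scope.
Variables (k : nat).
Implicit Types kap nu : seq nat.

Lemma sum_Mbeta kap nu : size kap <= k -> size nu <= k ->
  \sum_l @Mbeta k kap nu l = sumn kap + sumn nu + (\sum_(i < k) (k.-1 - i)).*2.
Proof.
move=> sk sn; rewrite big_split_ord /=.
under eq_bigr do rewrite MbetaL; under [X in _ + X]eq_bigr do rewrite MbetaR.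
by rewrite /beta !big_split /= !sum_nth // addnACA addnn.
Qed.

Lemma sum_staircase : \sum_(l < k + k) ((k + k).-1 - l) = k * k + (\sum_(i < k) (k.-1 - i)).*2.
Proof.
rewrite big_split_ord /= (eq_bigr (fun i : 'I_k => k + (k.-1 - i))); last first.
  by move=> i _; have := ltn_ord i; lia.
rewrite big_split /= sum_nat_const card_ord -addnA -addnn; congr (_ + (_ + _)).
by apply: eq_bigr => i _; have := ltn_ord i; lia.
Qed.

Lemma size_compl kap : is_part kap -> size (compl_part k kap) <= k.
Proof.
move=> pk; rewrite leqNgt -part_nth_gt0 ?compl_is_part // nth_compl // /colheight big1 // => i _.
by apply/eqP; rewrite eqb0 -leqNgt leq_addl.
Qed.

Lemma sumn_compl kap : is_part kap -> fits k kap -> sumn kap + sumn (compl_part k kap) = k * k.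
Proof.
move=> pk fk; have /andP[sk _] := fk.
have [s Ms] := Mbeta_perm pk (compl_is_part k pk) sk (size_compl pk) fk erefl.
have := sum_Mbeta sk (size_compl pk); rewrite -(sum_perm _ s) (eq_bigr _ (fun l _ => Ms l)).
by rewrite sum_staircase => /addIn ->.
Qed.

Lemma det_Mbeta_top (K : numFieldType) (H : nat -> K) kap nu : is_part kap -> is_part nu ->
  size kap <= k -> size nu <= k -> sumn kap + sumn nu = k * k -> H 0 = 1%R ->
  (\det (hmat H (@Mbeta k kap nu)) = (-1) ^+ sumn nu * (fits k kap && (nu == compl_part k kap))%:R)%R.
Proof.
move=> pk pn sk sn E H0; rewrite det_hmat_top //; last by rewrite sum_Mbeta // sum_staircase E.
have [/existsP [s /forallP Ms]|] := boolP [exists s : 'S_(k + k), [forall l, @Mbeta k kap nu (s l) == (k + k).-1 - l]].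
  have Ms' l : @Mbeta k kap nu (s l) = (k + k).-1 - l by apply/eqP.
  have [fk nE] := Mbeta_compl pk pn sk sn Ms'.
  rewrite fk -nE eqxx (bigD1 s) //= big1 => [|t ts].
    rewrite addr0 (_ : [forall l, _] = true) ?mulr1; last by apply/forallP => l; rewrite Ms.
    have h (b c : bool) : ((-1) ^+ b = (-1) ^+ c :> rat)%R -> b = c by case: b; case: c.
    rewrite (h (odd_perm s) (odd (sumn nu))) ?signr_odd //.
    exact: (Mbeta_sign pk pn sk sn Ms').
  rewrite (_ : [forall l, _] = false) ?mulr0 //; apply: contraNF ts => /forallP Mt.
  by apply/eqP/permP => l; apply: (Mbeta_inj pk pn sk sn Ms'); rewrite Ms' (eqP (Mt l)).
rewrite negb_exists => /forallP h; rewrite big1 => [|s _]; last by rewrite (negPf (h s)) mulr0.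
case: (boolP (fits k kap && _)) => [/andP[fk /eqP nE]|_]; last by rewrite mulr0.
have [s Ms] := Mbeta_perm pk pn sk sn fk nE.
by have /negP := h s; case; apply/forallP => l; rewrite Ms.
Qed.

End TopDegree.

(** * Expansion in Schur functions *)

Section SchurExpansion.
Variable K : numFieldType.
Implicit Types (mu nu lam kap : seq nat).

Definition scoef mu lam : K := pcoef mu [::] (schur (@pX K) lam).

Lemma spanned_prodX n (F : 'I_n -> symXY K) (d : 'I_n -> nat) (s : seq 'I_n) :
  (forall i, spanned (pairs2 (d i) 0) (F i)) ->
  spanned (pairs2 (\sum_(i <- s) d i) 0) (\prod_(i <- s) F i).
Proof.
move=> h; elim: s => [|i s IH]; first by rewrite !big_nil; exact: spanned21.
by rewrite !big_cons; exact: (spanned2M (h i) IH).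
Qed.

Lemma spanned_schurX lam : is_part lam -> spanned (pairs2 (sumn lam) 0) (schur (@pX K) lam).
Proof.
move=> pl; rewrite /schur; apply: spanned_sum => s _.
have [/forallP h|] := boolP [forall i : 'I_(size lam), (i <= nth 0 lam i + s i)%N]; last first.
  rewrite negb_forall => /existsP [i /negPf hi].
  have -> : \prod_i (\matrix_(i < size lam, j < size lam) if (i <= nth 0 lam i + j)%N
      then hsym (@pX K) (nth 0 lam i + j - i) else 0) i (s i) = 0.
    by rewrite (bigD1 i) //= mxE hi mul0r.
  by rewrite mulr0 /spanned big1 // => x _; rewrite pcoef0 scale0r.
rewrite -sign_scale; apply: spannedZ.
rewrite (eq_bigr (fun i : 'I_(size lam) => hsym (@pX K) (nth 0 lam i + s i - i)%N)); last first.
  by move=> i _; rewrite mxE h.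
have -> : sumn lam = (\sum_(i < size lam) (nth 0 lam i + s i - i))%N.
  have e : (\sum_(i < size lam) s i = \sum_(i < size lam) i)%N by rewrite [RHS](reindex_inj (@perm_inj _ s)).
  rewrite -(sum_nth (leqnn (size lam))); apply/eqP; rewrite -(eqn_add2r (\sum_(i < size lam) i)) -{1}e.
  by rewrite -!big_split /=; apply/eqP; apply: eq_bigr => i _; rewrite subnK.
by apply: spanned_prodX => i; apply: spanned_hsymX.
Qed.

Section Universal.
Variables (A : comAlgType K) (p : nat -> A).
Let ev : {rmorphism symXY K -> A} :=
  [the {rmorphism symXY K -> A} of evXY [the {rmorphism K -> A} of in_alg A] p p].

Lemma ev_pprodX mu : ev (pprod (@pX K) mu) = pprod p mu.
Proof. exact: evXY_pprodX. Qed.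

Lemma evZ c g : ev (c *: g) = c *: ev g.
Proof. by rewrite -[RHS]mulr_algl; exact: evXYZ. Qed.

Lemma ev_hsymX n : ev (hsym (@pX K) n) = hsym p n.
Proof.
rewrite /hsym (raddf_sum ev); apply: eq_bigr => mu _.
transitivity ((zpart mu)%:R^-1 *: ev (pprod (@pX K) mu)); first exact: evZ.
by rewrite ev_pprodX.
Qed.

Lemma ev_schurX lam : ev (schur (@pX K) lam) = schur p lam.
Proof.
rewrite /schur -det_map_mx; congr (\det _); apply/matrixP => i j; rewrite !mxE.
by case: ifP => _; rewrite ?ev_hsymX ?(raddf0 ev).
Qed.

Lemma schur_universal lam : is_part lam ->
  schur p lam = \sum_(mu <- parts (sumn lam)) scoef mu lam *: pprod p mu.
Proof.
move=> pl; rewrite -ev_schurX {1}(spanned_schurX pl) (raddf_sum ev) /pairs2 big_allpairs_dep.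
apply: eq_bigr => mu _; rewrite parts0 big_seq1.
transitivity (scoef mu lam *: ev (ppXY K (mu, [::]))); first exact: evZ.
congr (_ *: _).
by rewrite /ppXY /= /pprod big_nil mulr1; exact: ev_pprodX.
Qed.

End Universal.

Lemma compl_inj k kap lam : is_part kap -> is_part lam -> fits k kap -> fits k lam ->
  compl_part k kap = compl_part k lam -> kap = lam.
Proof.
move=> pk pl /andP[sk hk] /andP[sl hl] E; apply: part_nth_eq => // i.
have [ik|ik] := ltnP i k; last by rewrite !nth_default ?(leq_trans _ ik).
have ka : (nth 0 kap i <= k)%N by apply: leq_trans (part_nth_mono pk (leq0n i)) _; rewrite nth0.
have la : (nth 0 lam i <= k)%N by apply: leq_trans (part_nth_mono pl (leq0n i)) _; rewrite nth0.
have same j : (j < k)%N -> (nth 0 kap i + j < k)%N = (nth 0 lam i + j < k)%N.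
  by move=> jk; rewrite !colheight_seg // -!nth_compl // E.
have [lt|lt|//] := ltngtP (nth 0%N kap i) (nth 0%N lam i).
  by have := same (k - nth 0 lam i)%N; lia.
by have := same (k - nth 0 kap i)%N; lia.
Qed.

Lemma part_fits n lam : lam \in parts n -> fits n lam.
Proof.
rewrite mem_parts => /andP[pl /eqP <-]; rewrite /fits part_size //=.
by case: lam {pl} => //= a s; apply: leq_addr.
Qed.

(** Independence through a pairing: in 2 n variables, multiply by s_nu of the complementary
    variables, divide by the polar product and sum over subsets. With nu the complement of [lam0] in
    the n x n square, only the term of [lam0] survives. *)
Lemma schur_free n (c : seq nat -> K) :
  (forall mu, mu \in parts n -> \sum_(lam <- parts n) c lam * scoef mu lam = 0) ->
  forall lam, lam \in parts n -> c lam = 0.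
Proof.
move=> c0 lam0 l0.
have sum0 (A : comAlgType K) (p : nat -> A) : \sum_(lam <- parts n) c lam *: schur p lam = 0.
  transitivity (\sum_(mu <- parts n) (\sum_(lam <- parts n) c lam * scoef mu lam) *: pprod p mu).
    under [RHS]eq_bigr do rewrite scaler_suml.
    rewrite exchange_big /=; apply: eq_parts => lam pl ln; rewrite (schur_universal _ pl) ln scaler_sumr.
    by apply: eq_bigr => mu _; rewrite scalerA.
  by rewrite big_seq big1 // => mu /c0 ->; rewrite scale0r.
pose x (l : 'I_(n + n)) : K := l%:R.
have xi : injective x by move=> i j /eqP; rewrite eqr_nat => /eqP /val_inj.
have nH : newton (fun r => \sum_i x i ^+ r) (hsym (fun r => \sum_i x i ^+ r : K^o)).
  exact: hsym_newton.
have [pl0 /eqP ln0] : is_part lam0 /\ sumn lam0 == n by move: l0; rewrite mem_parts => /andP.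
have f0 := part_fits l0; set nu := compl_part n lam0.
have : \sum_(lam <- parts n) c lam * \det (hmat (hsym (fun r => \sum_i x i ^+ r : K^o)) (@Mbeta n lam nu)) = 0.
  rewrite big_seq (eq_bigr (fun lam => \sum_(S : {set 'I_(n + n)} | #|S| == n)
     c lam * ((schur (psumS x S) lam : K) * (schur (psumS x (~: S)) nu : K) / polarS x S))); last first.
    move=> lam /part_fits /andP[sl _].
    by rewrite -(schur_subsets xi nH sl (size_compl n pl0)) mulr_sumr.
  rewrite exchange_big /= big1 // => S _.
  transitivity ((\sum_(lam <- parts n) c lam *: schur (psumS x S) lam : K) * ((schur (psumS x (~: S)) nu : K) / polarS x S)).
    rewrite -big_seq mulr_suml; apply: eq_bigr => lam _.
    have sc (a b : K) : (a *: (b : K^o) : K^o) = a * b by [].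
    by rewrite sc !mulrA.
  by rewrite sum0 mul0r.
rewrite (bigD1_seq lam0) ?parts_uniq //= big_seq_cond big1 => [|lam /andP[ll ne]].
  have /andP[s0 _] := f0.
  rewrite addr0 (det_Mbeta_top pl0 (compl_is_part n pl0) s0 (size_compl n pl0)) ?sumn_compl ?hsym0 //.
  by rewrite f0 eqxx mulr1 => /eqP; rewrite mulf_eq0 signr_eq0 orbF => /eqP.
have [pl /eqP ln] : is_part lam /\ sumn lam == n by move: ll; rewrite mem_parts => /andP.
have fl := part_fits ll; have /andP[sl _] := fl.
rewrite (det_Mbeta_top pl (compl_is_part n pl0) sl (size_compl n pl0)) ?hsym0 //; last first.
  by rewrite -(sumn_compl pl0 f0) ln ln0.
rewrite fl /= (_ : _ == _ = false) ?mulr0 //; apply: contraNF ne => /eqP e.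
by apply/eqP; apply: (compl_inj (k := n)).
Qed.

(** The transition matrix from Schur functions to power sums is square, so [schur_free] makes it
    invertible. *)
Lemma pprod_schur mu : is_part mu -> exists f : seq nat -> K, forall (A : comAlgType K) (p : nat -> A),
  pprod p mu = \sum_(lam <- parts (sumn mu)) f lam *: schur p lam.
Proof.
move=> pm; set n := sumn mu; set L := parts n; pose N := size L.
have bigL (V : nmodType) (F : seq nat -> V) : \sum_(lam <- L) F lam = \sum_(j < N) F (nth [::] L j).
  by rewrite (big_nth [::]) big_mkord.
pose S : 'M[K]_N := \matrix_(i, j) scoef (nth [::] L j) (nth [::] L i).
have Lj (j : 'I_N) : nth [::] L j \in L by apply: mem_nth.
pose e (v : 'rV[K]_N) lam := \sum_(j < N | nth [::] L j == lam) v ord0 j.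
have eE v (j : 'I_N) : e v (nth [::] L j) = v ord0 j.
  rewrite /e (big_pred1 j) // => i /=; apply/eqP/eqP => [E|-> //].
  by apply: val_inj => /=; apply/eqP; rewrite -(nth_uniq [::] _ _ (parts_uniq n)) ?E.
have Su : S \in unitmx.
  rewrite -row_free_unit -kermx_eq0; apply/eqP/row_matrixP => i; rewrite row0.
  set v := row i _; have vS : v *m S = 0 by rewrite -row_mul mulmx_ker row0.
  apply/rowP => j; rewrite [RHS]mxE -eE; apply: (@schur_free n (e v)) => // mu' mL.
  rewrite -/L bigL; have im : (index mu' L < N)%N by rewrite index_mem.
  transitivity ((v *m S) ord0 (Ordinal im)); last by rewrite vS mxE.
  rewrite mxE.
  by apply: eq_bigr => l _; rewrite eE [S _ _]mxE /= nth_index.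
have mL : mu \in L by rewrite mem_parts pm eqxx.
have im : (index mu L < N)%N by rewrite index_mem.
exists (e (row (Ordinal im) (invmx S))) => A p; rewrite -/L bigL.
transitivity (\sum_(l < N) ((invmx S *m S) (Ordinal im) l) *: pprod p (nth [::] L l)).
  rewrite mulVmx // (bigD1 (Ordinal im)) //= big1 => [|l /negPf li]; last by rewrite mxE eq_sym li scale0r.
  by rewrite mxE eqxx scale1r addr0 nth_index.
under eq_bigr do rewrite mxE scaler_suml.
rewrite exchange_big /=; apply: eq_bigr => j _; rewrite eE mxE.
have := Lj j; rewrite mem_parts => /andP[pj /eqP sj].
rewrite (schur_universal _ pj) sj -/n -/L bigL scaler_sumr; apply: eq_bigr => l _.
by rewrite scalerA mxE.
Qed.

Lemma sums_mul_scale (B : comAlgType K) (r1 r2 : seq (seq nat)) (f g : seq nat -> K)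
    (u v : seq nat -> B) (x y : B) :
  x = \sum_(a <- r1) f a *: u a -> y = \sum_(b <- r2) g b *: v b ->
  x * y = \sum_(a <- r1) \sum_(b <- r2) (f a * g b) *: (u a * v b).
Proof.
move=> -> ->; rewrite mulr_suml; apply: eq_bigr => a _; rewrite mulr_sumr.
by apply: eq_bigr => b _; rewrite -scalerAl -scalerAr scalerA.
Qed.

Lemma eq_big_seq2 (B : nmodType) (r1 r2 : seq (seq nat)) (F G : seq nat -> seq nat -> B) :
  (forall a b, a \in r1 -> b \in r2 -> F a b = G a b) ->
  \sum_(a <- r1) \sum_(b <- r2) F a b = \sum_(a <- r1) \sum_(b <- r2) G a b.
Proof.
move=> h; rewrite big_seq [RHS]big_seq; apply: eq_bigr => a ar.
by rewrite big_seq [RHS]big_seq; apply: eq_bigr => b br; apply: h.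
Qed.

Lemma exchange_scale (B : lmodType K) (r1 r2 : seq (seq nat)) (E f g : seq nat -> seq nat -> K)
    (F : seq nat -> seq nat -> B) :
  \sum_(mu <- r1) \sum_(nu <- r2) E mu nu *: (\sum_(kap <- r1) \sum_(lam <- r2) (f mu kap * g nu lam) *: F kap lam)
  = \sum_(kap <- r1) \sum_(lam <- r2) (\sum_(mu <- r1) \sum_(nu <- r2) E mu nu * (f mu kap * g nu lam)) *: F kap lam.
Proof.
transitivity (\sum_(mu <- r1) \sum_(nu <- r2) \sum_(kap <- r1) \sum_(lam <- r2)
   (E mu nu * (f mu kap * g nu lam)) *: F kap lam).
  apply: eq_bigr => mu _; apply: eq_bigr => nu _; rewrite scaler_sumr; apply: eq_bigr => kap _.
  by rewrite scaler_sumr; apply: eq_bigr => lam _; rewrite scalerA.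
under eq_bigr do rewrite exchange_big /=.
rewrite exchange_big /=; apply: eq_bigr => kap _.
under eq_bigr do rewrite exchange_big /=.
rewrite exchange_big /=; apply: eq_bigr => lam _.
by rewrite scaler_suml; apply: eq_bigr => mu _; rewrite scaler_suml.
Qed.

Lemma pcoef_schur mu nu kap lam : is_part mu -> is_part nu -> is_part kap -> is_part lam ->
  sumn mu = sumn kap -> sumn nu = sumn lam ->
  pcoef mu nu (schur (@pX K) kap * schur (@pY K) lam) = scoef mu kap * scoef nu lam.
Proof.
move=> pm pn pk pl mk nl.
have -> : schur (@pX K) kap * schur (@pY K) lam = \sum_(a <- parts (sumn kap)) \sum_(b <- parts (sumn lam))
    (scoef a kap * scoef b lam) *: ppXY K (a, b).
  exact: (sums_mul_scale (schur_universal (@pX K) pk) (schur_universal (@pY K) pl)).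
rewrite pcoef_sum (bigD1_seq mu) ?parts_uniq ?mem_parts ?pm ?mk ?eqxx //=.
rewrite [X in _ + X]big_seq_cond [X in _ + X]big1 ?addr0; last first.
  move=> a /andP[]; rewrite mem_parts => /andP[pa _] /negPf ne.
  rewrite pcoef_sum big_seq big1 // => b; rewrite mem_parts => /andP[pb _].
  by rewrite pcoefZ (@pcoef_ppXY _ (mu, nu)) /is_part2 ?pm ?pa //= xpair_eqE eq_sym ne mulr0.
rewrite pcoef_sum (bigD1_seq nu) ?parts_uniq ?mem_parts ?pn ?nl ?eqxx //=.
rewrite [X in _ + X]big_seq_cond [X in _ + X]big1 ?addr0; last first.
  move=> b /andP[]; rewrite mem_parts => /andP[pb _] /negPf ne.
  by rewrite pcoefZ (@pcoef_ppXY _ (mu, nu)) /is_part2 ?pm ?pb //= xpair_eqE [nu == b]eq_sym ne andbF mulr0.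
by rewrite pcoefZ (@pcoef_ppXY _ (mu, nu)) /is_part2 ?pm //= eqxx mulr1.
Qed.

End SchurExpansion.

Section DCoefs.
Variable R : realType.
Notation C := (cplx R).
Variable k : nat.
Implicit Types (mu nu lam kap : seq nat).

(** The coefficients chi of power sum products in Schur functions, applied in X and in Y
    separately. *)
Lemma schur_expansion_ex : exists d, is_schur_expansion (R := R) k d.
Proof.
have h mu : exists f : seq nat -> C, is_part mu -> forall (A : comAlgType C) (p : nat -> A),
    pprod p mu = \sum_(lam <- parts (sumn mu)) f lam *: schur p lam.
  have [pm|pm] := boolP (is_part mu); last by exists (fun=> 0).
  by have [f hf] := pprod_schur C pm; exists f.
have [chi hchi] := choice h.
pose E mu nu := exp_W_coef R k mu nu.
exists (fun kap lam => \sum_(mu <- parts (sumn kap)) \sum_(nu <- parts (sumn lam)) E mu nu * (chi mu kap * chi nu lam)).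
move=> mu0 nu0 pm0 pn0; rewrite -/(E mu0 nu0).
set a := sumn mu0; set b := sumn nu0.
transitivity (pcoef mu0 nu0 (\sum_(mu <- parts a) \sum_(nu <- parts b) E mu nu *: ppXY C (mu, nu))).
  rewrite pcoef_sum (bigD1_seq mu0) ?parts_uniq ?mem_parts ?pm0 ?eqxx //=.
  rewrite [X in _ + X]big_seq_cond [X in _ + X]big1 ?addr0; last first.
    move=> mu /andP[]; rewrite mem_parts => /andP[pm _] /negPf ne.
    rewrite pcoef_sum big_seq big1 // => nu; rewrite mem_parts => /andP[pn _].
    by rewrite pcoefZ (@pcoef_ppXY _ (mu0, nu0)) /is_part2 ?pm0 ?pm //= xpair_eqE eq_sym ne mulr0.
  rewrite pcoef_sum (bigD1_seq nu0) ?parts_uniq ?mem_parts ?pn0 ?eqxx //=.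
  rewrite [X in _ + X]big_seq_cond [X in _ + X]big1 ?addr0; last first.
    move=> nu /andP[]; rewrite mem_parts => /andP[pn _] /negPf ne.
    by rewrite pcoefZ (@pcoef_ppXY _ (mu0, nu0)) /is_part2 ?pm0 ?pn //= xpair_eqE [nu0 == nu]eq_sym ne andbF mulr0.
  by rewrite pcoefZ (@pcoef_ppXY _ (mu0, nu0)) /is_part2 ?pm0 //= eqxx mulr1.
transitivity (pcoef mu0 nu0 (\sum_(kap <- parts a) \sum_(lam <- parts b)
   (\sum_(mu <- parts a) \sum_(nu <- parts b) E mu nu * (chi mu kap * chi nu lam)) *:
     (schur (@pX C) kap * schur (@pY C) lam))); last first.
  rewrite pcoef_sum; apply: eq_parts => kap _ ->.
  rewrite pcoef_sum; apply: eq_parts => lam _ ->.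
  by rewrite pcoefZ.
apply: (congr1 (pcoef mu0 nu0)).
transitivity (\sum_(mu <- parts a) \sum_(nu <- parts b) E mu nu *:
   (\sum_(kap <- parts a) \sum_(lam <- parts b) (chi mu kap * chi nu lam) *: (schur (@pX C) kap * schur (@pY C) lam))).
  apply: eq_big_seq2 => mu nu; rewrite !mem_parts => /andP[pm /eqP sm] /andP[pn /eqP sn].
  apply: (congr1 (fun y => E mu nu *: y)).
  have e1 := hchi mu pm _ (@pX C); have e2 := hchi nu pn _ (@pY C); rewrite sm in e1; rewrite sn in e2.
  exact: (sums_mul_scale e1 e2).
exact: exchange_scale.
Qed.

Lemma dcoef_expansion (a b : nat -> (C^o : comAlgType C)) D :
  \sum_(z <- pairs_tot D) exp_W_coef R k z.1 z.2 * pp2 a b z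
  = \sum_(c < D.+1) \sum_(kap <- parts c) \sum_(lam <- parts (D - c))
      dcoef R k kap lam * ((schur a kap : C) * (schur b lam : C)).
Proof.
have dE : is_schur_expansion k (dcoef R k).
  by apply: (@xgetPex _ (fun _ _ => 0) (is_schur_expansion (R := R) k)); exact: schur_expansion_ex.
rewrite (big_pairs_tot (fun mu nu => exp_W_coef R k mu nu * pp2 a b (mu, nu))).
apply: eq_bigr => c _; set e := (D - c)%N.
transitivity (\sum_(mu <- parts c) \sum_(nu <- parts e) \sum_(kap <- parts c) \sum_(lam <- parts e)
   dcoef R k kap lam * ((scoef C mu kap * (pprod a mu : C)) * (scoef C nu lam * (pprod b nu : C)))).
  apply: eq_parts => mu pm sm.
  apply: eq_parts => nu pn sn.
  rewrite dE // sm sn mulr_suml; apply: eq_parts => kap pk sk; rewrite mulr_suml.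
  apply: eq_parts => lam pl sl; rewrite pcoef_schur ?sk ?sl // /pp2 /=.
  by rewrite -mulrA; congr (_ * _); rewrite mulrACA.
under eq_bigr do rewrite exchange_big /=.
rewrite exchange_big /=; apply: eq_parts => kap pk sk.
under eq_bigr do rewrite exchange_big /=.
rewrite exchange_big /=; apply: eq_parts => lam pl sl.
have sc (u v : C) : (u *: (v : C^o) : C^o) = u * v by [].
have -> : (schur a kap : C) = \sum_(mu <- parts c) scoef C mu kap * (pprod a mu : C).
  by rewrite (schur_universal a pk) sk; apply: eq_bigr.
have -> : (schur b lam : C) = \sum_(nu <- parts e) scoef C nu lam * (pprod b nu : C).
  by rewrite (schur_universal b pl) sl; apply: eq_bigr.
rewrite mulr_suml mulr_sumr; apply: eq_bigr => mu _.
by rewrite !mulr_sumr.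
Qed.

End DCoefs.

Section SchurMore.
Variable K : numFieldType.

Lemma schur_scale (A : comAlgType K) (p : nat -> A) (c : K) lam : is_part lam ->
  schur (fun r => c ^+ r *: p r) lam = c ^+ sumn lam *: schur p lam.
Proof.
move=> pl; rewrite !schur_universal // scaler_sumr; apply: eq_parts => mu _ <-.
rewrite !scalerA mulrC -scalerA; congr (_ *: _).
rewrite /pprod; elim: mu => [|a mu IH]; first by rewrite !big_nil scale1r.
by rewrite !big_cons IH /= exprD -scalerAl -scalerAr scalerA.
Qed.

Lemma sumn_incr_nth lam i : sumn (incr_nth lam i) = (sumn lam).+1.
Proof.
elim: lam i => [|a lam IH] [|i] //=; last by rewrite IH addnS.
by elim: i => //= i ->.
Qed.

Variables (n : nat) (y : 'I_n -> K).
Hypothesis yi : injective y.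
Notation psum := (fun r => \sum_i y i ^+ r : K^o).

(** Distinct variables allow the Vandermonde in [schur_pieri] to be cancelled; each further factor
    p_1 adds one box to the chains. *)
Lemma pieri_iter j lam : is_part lam ->
  (\sum_i y i) ^+ j * (schur psum lam : K)
  = \sum_(nu <- parts (sumn lam + j)) (nb_chains j lam nu)%:R * (schur psum nu : K).
Proof.
elim: j lam => [|j IH] lam pl.
  rewrite expr0 mul1r addn0 (bigD1_seq lam) ?parts_uniq ?mem_parts ?pl ?eqxx //= eqxx mul1r.
  by rewrite big1 ?addr0 // => nu /negPf ne; rewrite eq_sym ne mul0r.
have V0 := vander_neq0 yi.
have P : (\sum_i y i) * (schur psum lam : K) =
    \sum_(i < (size lam).+1 | is_part (incr_nth lam i)) (schur psum (incr_nth lam i) : K).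
  apply: (mulfI V0); rewrite mulrCA schur_pieri // mulr_sumr.
  by apply: eq_bigr.
rewrite exprSr -mulrA P mulr_sumr.
rewrite (eq_bigr (fun i : 'I_(size lam).+1 => \sum_(nu <- parts (sumn lam + j.+1))
   (nb_chains j (incr_nth lam i) nu)%:R * (schur psum nu : K))); last first.
  by move=> i pi; rewrite IH // sumn_incr_nth addSnnS.
rewrite exchange_big /=; apply: eq_bigr => nu _.
by rewrite natr_sum mulr_suml.
Qed.

End SchurMore.

Section Subfamily.
Variables (R : realType) (k n : nat).
Notation C := (cplx R).

Lemma big_subfamily (T : Type) (idx : T) (op : Monoid.com_law idx) (F : C -> T)
    (S : {set 'I_n}) (delta : 'rV[C]_n) : #|S| = k ->
  \big[op/idx]_(i < k) F (subfamily k S delta ord0 i) = \big[op/idx]_(j in S) F (delta ord0 j).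
Proof.
move=> Sk; transitivity (\big[op/idx]_(y <- [seq delta ord0 j | j <- enum S]) F y); last by rewrite big_map big_enum.
rewrite (big_nth 0) size_map -cardE Sk big_mkord; apply: eq_bigr => i _.
by rewrite mxE.
Qed.

Lemma subfamily_inj (S : {set 'I_n}) (delta : 'rV[C]_n) : #|S| = k -> injective (delta ord0) ->
  injective (subfamily k S delta ord0).
Proof.
move=> Sk di; have E i : subfamily k S delta ord0 i = delta ord0 (enum_val (cast_ord (esym Sk) i)).
  by rewrite mxE (nth_map (enum_default (cast_ord (esym Sk) i))) // -cardE Sk.
by move=> i j; rewrite !E => /di /enum_val_inj /(congr1 val) /= /val_inj.
Qed.

End Subfamily.

(** * The limit of Q_k *)

Section Moments.
Variables (R : realType) (m : nat).
Notation C := (cplx R).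
Notation k := m.+1.
Notation n := (k + k)%N.
Implicit Types (z delta : 'rV[C]_n) (S : {set 'I_n}) (kap nu lam : seq nat).

(** The sum over S of s_kap s_nu over the polar product, as a polynomial. With more than k parts a
    Schur function in k variables vanishes, hence the value 0. *)
Definition efun kap nu z : C := if (size kap <= k)%N && (size nu <= k)%N
  then \det (hmat (hsym (power_sum z : nat -> (C^o : comAlgType C)) : nat -> C) (@Mbeta k kap nu)) else 0.

Lemma card_setC_half S : #|S| = k -> #|~: S| = k.
Proof. by move=> Sk; rewrite cardsCs finset.setCK Sk card_ord addnK. Qed.

Lemma psumS_subfamily delta S : #|S| = k ->
  psumS (fun l => delta ord0 l) S = power_sum (subfamily k S delta) :> (nat -> C).
Proof.
move=> Sk; apply/funext => r; rewrite /psumS /power_sum.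
by rewrite -(big_subfamily _ (fun x => x ^+ r) delta Sk).
Qed.

Lemma polarS_subfamily delta S : #|S| = k -> polarS (fun l => delta ord0 l) S =
  polar_product (subfamily k S delta) (subfamily k (~: S) delta).
Proof.
move=> Sk; rewrite /polarS /polar_product.
rewrite -(big_subfamily _ (fun x => \prod_(j in ~: S) (x - delta ord0 j)) delta Sk).
apply: eq_bigr => i _.
by rewrite -(big_subfamily _ (fun x => _ - x) delta (card_setC_half Sk)).
Qed.

Lemma efun_subsets kap nu delta : is_part kap -> is_part nu -> injective (delta ord0) ->
  \sum_(S : {set 'I_n} | #|S| == k)
     (schur (power_sum (subfamily k S delta) : nat -> (C^o : comAlgType C)) kap : C)
     * (schur (power_sum (subfamily k (~: S) delta) : nat -> (C^o : comAlgType C)) nu : C)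
     / polar_product (subfamily k S delta) (subfamily k (~: S) delta)
  = efun kap nu delta.
Proof.
move=> pk pn di; rewrite /efun; case: ifP => [/andP[sk sn]|/negbT].
  rewrite -(schur_subsets (x := fun l => delta ord0 l) di _ sk sn); last exact: hsym_newton.
  have gen (f f' g g' : nat -> (C^o : comAlgType C)) (d d' : C) : f = f' -> g = g' -> d = d' ->
      (schur f kap : C) * (schur g nu : C) / d = (schur f' kap : C) * (schur g' nu : C) / d'.
    by move=> -> -> ->.
  apply: eq_bigr => S /eqP Sk; apply: gen; apply: esym.
  - exact: psumS_subfamily.
  - exact: psumS_subfamily (card_setC_half Sk).
  - exact: polarS_subfamily.
rewrite negb_and -!ltnNge => h; rewrite big1 // => S _; case/orP: h => h.
  have -> : (schur (power_sum (subfamily k S delta) : nat -> (C^o : comAlgType C)) kap : C) = 0.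
    exact: (schur_gt_vars (fun i => subfamily k S delta ord0 i) pk h).
  by rewrite !mul0r.
have -> : (schur (power_sum (subfamily k (~: S) delta) : nat -> (C^o : comAlgType C)) nu : C) = 0.
  exact: (schur_gt_vars (fun i => subfamily k (~: S) delta ord0 i) pn h).
by rewrite mulr0 mul0r.
Qed.

Lemma hom_hsym r : hom r (fun z => hsym (power_sum z : nat -> (C^o : comAlgType C)) r : C).
Proof.
apply: (@hom_ext _ _ _ (fun z => \sum_(mu <- parts r | mu \in parts r) (zpart mu)%:R^-1 * \prod_(i <- mu) (power_sum z i : C))).
  by move=> z; rewrite -big_seq.
apply: hom_sum => mu; rewrite mem_parts => /andP[_ /eqP <-]; apply: homZ; rewrite sumnE.
apply: (hom_prod mu (D := id)) => i.
exact: (hom_sum (index_enum 'I_n) (P := xpredT) (fun j _ => hom_power R j i)).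
Qed.

Lemma hom_efun kap nu : hom (sumn kap + sumn nu - k * k)%N (efun kap nu).
Proof.
have [/andP[sk sn]|/negPf h] := boolP ((size kap <= k)%N && (size nu <= k)%N); last first.
  by apply: hom_ext (hom0 _ _ _) => z; rewrite /efun h.
apply: (@hom_ext _ _ _ (fun z => \sum_(s : 'S_n) (-1) ^+ s * \prod_l
   hshift (hsym (power_sum z : nat -> (C^o : comAlgType C)) : nat -> C) (@Mbeta k kap nu (s l)) (n.-1 - l))).
  by move=> z; rewrite /efun sk sn -det_hmat_expand.
apply: hom_sum => s _; apply: homZ.
have [/forallP h|] := boolP [forall l : 'I_n, (n.-1 - l <= @Mbeta k kap nu (s l))%N]; last first.
  rewrite negb_forall => /existsP [l hl]; apply: hom_ext (hom0 _ _ _) => z.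
  by rewrite (bigD1 l) //= /hshift (negPf hl) mul0r.
have -> : (sumn kap + sumn nu - k * k = \sum_(l < n) (@Mbeta k kap nu (s l) - (n.-1 - l)))%N.
  have := sum_Mbeta sk sn; have := sum_staircase k; rewrite -(sum_perm _ s).
  have -> : (\sum_l @Mbeta k kap nu (s l) = \sum_(l < n) (@Mbeta k kap nu (s l) - (n.-1 - l)) + \sum_(l < n) (n.-1 - l))%N.
    by rewrite -big_split /=; apply: eq_bigr => l _; rewrite subnK.
  by lia.
apply: hom_prod => l; rewrite /hshift h; exact: hom_hsym.
Qed.

Lemma efun_small kap nu z : (sumn kap + sumn nu < k * k)%N -> efun kap nu z = 0.
Proof.
move=> lt; rewrite /efun; case: ifP => // /andP[sk sn]; apply: det_hmat_small.
by rewrite sum_Mbeta // sum_staircase ltn_add2r.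
Qed.

Lemma efun_top kap nu z : is_part kap -> is_part nu -> (sumn kap + sumn nu = k * k)%N ->
  efun kap nu z = (-1) ^+ sumn nu * (fits k kap && (nu == compl_part k kap))%:R.
Proof.
move=> pk pn E; rewrite /efun; case: ifP => [/andP[sk sn]|/negbT].
  by apply: det_Mbeta_top => //; rewrite hsym0.
rewrite negb_and => h; case: (boolP (fits k kap && _)) => [/andP[fk /eqP nE]|_]; last by rewrite mulr0.
by move: h; rewrite nE size_compl // orbF; move: fk => /andP[->].
Qed.

Variable x : R.

(** The contribution of numerators of degree D; after division by the polar products its degree is D
    - k^2. The sign comes from evaluating Schur functions at the negatives of the delta_j with j
    outside S. *)
Definition QD D z : C := \sum_(j < D.+1) toC x ^+ j / j`!%:R *
  \sum_(c < (D - j).+1) \sum_(kap <- parts c) \sum_(lam <- parts (D - j - c))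
    dcoef R k kap lam * \sum_(nu <- parts (sumn lam + j)) (nb_chains j lam nu)%:R *
       ((-1) ^+ sumn nu * efun kap nu z).

(** Its value at t = 1 is the summand of S in Q_k, multiplied by the polar product. *)
Definition GS delta S : fps C :=
  expfps (- toC x * \sum_(j in ~: S) delta ord0 j)
  * series_h (subfamily k S delta) (- subfamily k (~: S) delta).

Lemma QD_subsets D delta : injective (delta ord0) ->
  QD D delta = \sum_(S : {set 'I_n} | #|S| == k)
    GS delta S D / polar_product (subfamily k S delta) (subfamily k (~: S) delta).
Proof.
move=> di.
pose P S : C := polar_product (subfamily k S delta) (subfamily k (~: S) delta).
pose sc (v : 'rV[C]_k) lam : C := schur (power_sum v : nat -> (C^o : comAlgType C)) lam.
have GE S : #|S| = k -> GS delta S D = \sum_(j < D.+1) toC x ^+ j / j`!%:R *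
  \sum_(c < (D - j).+1) \sum_(kap <- parts c) \sum_(lam <- parts (D - j - c))
    dcoef R k kap lam * \sum_(nu <- parts (sumn lam + j)) (nb_chains j lam nu)%:R *
       ((-1) ^+ sumn nu * (sc (subfamily k S delta) kap * sc (subfamily k (~: S) delta) nu)).
  move=> Sk; have Sck := card_setC_half Sk.
  set v := subfamily k (~: S) delta.
  have vi : injective (fun i => (- v) ord0 i).
    by move=> i j; rewrite ![(- v) ord0 _]mxE => /oppr_inj; apply: subfamily_inj.
  (* The exponent becomes x p_1 in the variables -v of s_lambda, so its powers act by the Pieri
     rule. *)
  have v1 : \sum_(j in ~: S) delta ord0 j = - \sum_i (- v) ord0 i.
    rewrite -(big_subfamily _ id delta Sck) -sumrN; apply: eq_bigr => i _.
    by rewrite [(- v) ord0 i]mxE opprK.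
  rewrite /GS fpnM; apply: eq_bigr => j _.
  rewrite /= v1 mulrNN -/(pp2 _ _ _) dcoef_expansion exprMn_comm; last exact: mulrC.
  rewrite [X in X * _]mulrAC -[LHS]mulrA; congr (_ * _); rewrite mulr_sumr; apply: eq_bigr => c _.
  rewrite mulr_sumr; apply: eq_bigr => kap _.
  rewrite mulr_sumr; apply: eq_parts => lam pl _.
  rewrite mulrCA; congr (_ * _).
  transitivity (sc (subfamily k S delta) kap * ((\sum_i (- v) ord0 i) ^+ j * sc (- v) lam)).
    by rewrite mulrCA.
  rewrite (pieri_iter vi j pl) mulr_sumr; apply: eq_parts => nu pn _.
  have -> : (schur (fun r => \sum_i (- v) ord0 i ^+ r : C^o) nu : C) = (-1) ^+ sumn nu * sc v nu.
    transitivity (schur (fun r => (-1) ^+ r *: (power_sum v r : C^o)) nu : C).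
      congr (schur _ nu); apply/funext => r.
      rewrite /power_sum scaler_sumr; apply: eq_bigr => i _.
      by rewrite [(- v) ord0 i]mxE; exact: exprNn.
    exact: schur_scale.
  by rewrite mulrCA; congr (_ * _); rewrite mulrCA.
pose phi (f : {set 'I_n} -> C) : C := \sum_(S : {set 'I_n} | #|S| == k) f S / P S.
have phi_sum I (r : seq I) (F : I -> {set 'I_n} -> C) :
    phi (fun S => \sum_(i <- r) F i S) = \sum_(i <- r) phi (F i).
  rewrite /phi exchange_big /=; apply: eq_bigr => S _; by rewrite mulr_suml.
have phi_scale c f : phi (fun S => c * f S) = c * phi f.
  by rewrite /phi mulr_sumr; apply: eq_bigr => S _; rewrite mulrA.
transitivity (phi (fun S => \sum_(j < D.+1) toC x ^+ j / j`!%:R *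
  \sum_(c < (D - j).+1) \sum_(kap <- parts c) \sum_(lam <- parts (D - j - c))
    dcoef R k kap lam * \sum_(nu <- parts (sumn lam + j)) (nb_chains j lam nu)%:R *
       ((-1) ^+ sumn nu * (sc (subfamily k S delta) kap * sc (subfamily k (~: S) delta) nu)))); last first.
  by apply: eq_bigr => S /eqP Sk; rewrite GE.
rewrite phi_sum; apply: eq_bigr => j _; rewrite phi_scale; congr (_ * _).
rewrite phi_sum; apply: eq_bigr => c _; rewrite phi_sum.
apply: eq_parts => kap pk _; rewrite phi_sum.
apply: eq_bigr => lam _; rewrite phi_scale; congr (_ * _); rewrite phi_sum.
apply: eq_parts => nu pn _; rewrite !phi_scale; congr (_ * (_ * _)).
by rewrite -efun_subsets.
Qed.

Lemma hom_QD D : hom (D - k * k)%N (QD D).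
Proof.
apply: hom_sum => j _; apply: homZ; apply: hom_sum => c _.
have jD : (j <= D)%N by rewrite -ltnS.
have cD : (c <= D - j)%N by rewrite -ltnS.
apply: (@hom_ext _ _ _ (fun z => \sum_(kap <- parts c | kap \in parts c)
  \sum_(lam <- parts (D - j - c) | lam \in parts (D - j - c))
    dcoef R k kap lam * \sum_(nu <- parts (sumn lam + j) | nu \in parts (sumn lam + j)) (nb_chains j lam nu)%:R *
       ((-1) ^+ sumn nu * efun kap nu z))).
  move=> z; rewrite [RHS]big_seq; apply: eq_bigr => kap _; rewrite [RHS]big_seq; apply: eq_bigr => lam _.
  by rewrite -big_seq.
apply: hom_sum => kap; rewrite mem_parts => /andP[_ /eqP sk]; apply: hom_sum => lam; rewrite mem_parts => /andP[_ /eqP sl].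
apply: homZ; apply: hom_sum => nu; rewrite mem_parts => /andP[_ /eqP sn]; do 2 apply: homZ.
have -> : D = (sumn kap + sumn nu)%N by rewrite sk sn sl; lia.
exact: hom_efun.
Qed.

Lemma QD_small D z : (D < k * k)%N -> QD D z = 0.
Proof.
move=> Dk; rewrite /QD big1 // => j _; rewrite big1 ?mulr0 // => c _.
have jD : (j <= D)%N by rewrite -ltnS.
have cD : (c <= D - j)%N by rewrite -ltnS.
rewrite big_seq big1 // => kap; rewrite mem_parts => /andP[_ /eqP sk].
rewrite big_seq big1 // => lam; rewrite mem_parts => /andP[_ /eqP sl].
rewrite big_seq big1 ?mulr0 // => nu; rewrite mem_parts => /andP[_ /eqP sn].
by rewrite efun_small ?mulr0 //; lia.
Qed.

Definition cN N : C := (((k * k - N)%N)`!)%:R^-1 * \sum_(a < N.+1) \sum_(kap <- parts a | fits k kap)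
   \sum_(lam <- parts (N - a)) dcoef R k kap lam * (dim_skew lam (compl_part k kap))%:R.

(** Only nu = the complement of kap contributes, with (-1)^|nu| twice. Its chains from lam have
    length j exactly when |kap| + |lam| = k^2 - j. *)
Lemma QD_top z : QD (k * k) z = \sum_(j < (k * k).+1) cN (k * k - j) * toC x ^+ j.
Proof.
apply: eq_bigr => j _; have jD : (j <= k * k)%N by rewrite -ltnS.
rewrite /cN subKn // [RHS]mulrC mulrA; congr (_ * _); apply: eq_bigr => c _.
have cD : (c <= k * k - j)%N by rewrite -ltnS.
rewrite [RHS]big_mkcond; apply: eq_parts => kap pk sk.
case: ifP => fk; last first.
  rewrite big_seq big1 // => lam; rewrite mem_parts => /andP[_ /eqP sl].
  rewrite big_seq big1 ?mulr0 // => nu; rewrite mem_parts => /andP[pn /eqP sn].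
  by rewrite efun_top ?fk ?mulr0 //; rewrite sk sn sl; lia.
apply: eq_parts => lam pl sl; congr (_ * _).
have sc := sumn_compl pk fk.
rewrite (bigD1_seq (compl_part k kap)) ?parts_uniq //=; last first.
  by rewrite mem_parts compl_is_part //=; apply/eqP; lia.
rewrite big_seq_cond big1 ?addr0 => [|nu /andP[]]; last first.
  rewrite mem_parts => /andP[pn /eqP sn] /negPf ne.
  by rewrite efun_top ?ne ?andbF ?mulr0 //; rewrite sk sn sl; lia.
rewrite efun_top ?compl_is_part // fk eqxx mulr1 -expr2 sqrr_sign mulr1 /dim_skew.
by rewrite (_ : (sumn (compl_part k kap) - sumn lam)%N = j) //; lia.
Qed.

(* The polynomials Q_D are bounded on a torus whose radii are distinct, where
   the entries of delta stay apart. *)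
Variables (rho M : R).
Hypothesis rho0 : 0 < rho.
Hypothesis FkM : forall u v : 'rV[C]_k, (forall i, nm (u ord0 i) < rho) -> (forall i, nm (v ord0 i) < rho) ->
  l1 (series_h u (- v)) M /\
  (polar_product u v != 0 -> sums (series_h u (- v)) (polar_product u v * Fk u v)).

Definition Qgen delta : C := \sum_(S : {set 'I_n} | #|S| == k)
    cexp (- toC x * \sum_(j in ~: S) delta ord0 j)
    * Fk (subfamily k S delta) (subfamily k (~: S) delta).

Lemma subfamily_all (P : C -> Prop) S delta : #|S| = k -> (forall i, P (delta ord0 i)) ->
  forall i, P (subfamily k S delta ord0 i).
Proof. by move=> Sk h i; rewrite mxE (nth_map (enum_default (cast_ord (esym Sk) i))) // -cardE Sk. Qed.

Lemma polar_subfamily_neq0 S delta : #|S| = k -> injective (delta ord0) ->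
  polar_product (subfamily k S delta) (subfamily k (~: S) delta) != 0.
Proof.
move=> Sk di; rewrite -polarS_subfamily //; apply/prodf_neq0 => i iS; apply/prodf_neq0 => j.
by rewrite inE => jS; rewrite subr_eq0; apply: contra jS => /eqP /di <-.
Qed.

Lemma sums_QD delta : injective (delta ord0) -> (forall i, nm (delta ord0 i) < rho) ->
  sums (fun D => QD D delta) (Qgen delta).
Proof.
move=> di dr.
apply: (@sums_ext _ (fun D => \sum_(S : {set 'I_n} | #|S| == k)
    GS delta S D / polar_product (subfamily k S delta) (subfamily k (~: S) delta))).
  by move=> D; rewrite QD_subsets.
rewrite /Qgen; under eq_fun do rewrite -big_filter; rewrite -big_filter; apply: sums_finsum_in => S.
rewrite mem_filter => /andP[/eqP Sk _]; have p0 := polar_subfamily_neq0 Sk di.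
have Sck := card_setC_half Sk.
have [h1 h2] := FkM (subfamily_all (P := fun c => nm c < rho) Sk dr) (subfamily_all (P := fun c => nm c < rho) Sck dr).
have := sumsZr ((polar_product (subfamily k S delta) (subfamily k (~: S) delta))^-1)
   (sumsM (l1_expfps _) h1 (sums_expfps (- toC x * \sum_(j in ~: S) delta ord0 j)) (h2 p0)).
by rewrite -mulrA [_ * _ / _]mulrAC mulfV // mul1r.
Qed.

Definition rad (i : 'I_n) : R := rho / 2 * (i.+1%:R / n%:R).

Lemma QD_bound : exists2 B : R, 0 <= B &
  forall D z, (forall i, nm (z ord0 i) <= rho / (8 * n%:R)) -> nm (QD D z) <= B * (1 / 2) ^+ D.
Proof.
have n0 : 0 < (n%:R : R) by rewrite ltr0n.
(* The gap between consecutive radii, a lower bound for |delta_i - delta_j| on the torus. *)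
pose g : R := rho / (2 * n%:R); have g0 : 0 < g by rewrite divr_gt0 // mulr_gt0.
have radE i : rad i = g * i.+1%:R by rewrite /rad /g; field; rewrite gt_eqF.
pose B1 : R := \sum_(S : {set 'I_n} | #|S| == k) (expR (`|x| * (n%:R * rho)) * M / g ^+ (k * k)).
have torus D z : (forall i, nm (z ord0 i) = rad i) -> nm (QD D z) <= B1.
  move=> zr.
  have gap i j : i != j -> g <= nm (z ord0 i - z ord0 j).
    move=> ij; apply: le_trans (nm_dist _ _); rewrite !zr !radE -mulrBr normrM gtr0_norm //.
    rewrite ler_peMr ?(ltW g0) //.
    have [lt|lt|e] := ssrnat.ltngtP i j; last by case/eqP: ij; apply: val_inj.
      rewrite distrC ger0_norm ?subr_ge0 ?ler_nat ?ltnS ?(ltnW lt) //.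
      by rewrite -natrB ?ltnS ?(ltnW lt) // ler1n subSS subn_gt0.
    rewrite ger0_norm ?subr_ge0 ?ler_nat ?ltnS ?(ltnW lt) //.
    by rewrite -natrB ?ltnS ?(ltnW lt) // ler1n subSS subn_gt0.
  have di : injective (z ord0).
    move=> i j e; apply/eqP; apply: contraTT isT => ij; have := gap i j ij.
    by rewrite e subrr nm0 leNgt g0.
  have zrho i : nm (z ord0 i) < rho.
    have i1 : (i.+1%:R : R) <= n%:R by rewrite ler_nat ltn_ord.
    rewrite zr /rad; have : i.+1%:R / n%:R <= 1 :> R by rewrite ler_pdivrMr ?mul1r.
    move: (_ / n%:R) => t t1; apply: le_lt_trans (_ : rho / 2 < rho); last first.
      by rewrite ltr_pdivrMr ?ltr0n // mulr_natr mulr2n ltrDl.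
    by rewrite ler_piMr // divr_ge0 // ltW.
  rewrite QD_subsets //; apply: le_trans (nm_sum _ _ _) _; apply: ler_sum => S /eqP Sk.
  have Sck := card_setC_half Sk.
  have [h1 _] := FkM (subfamily_all (P := fun c => nm c < rho) Sk zrho) (subfamily_all (P := fun c => nm c < rho) Sck zrho).
  rewrite nmM nmV; apply: ler_pM; rewrite ?nm_ge0 ?invr_ge0 ?nm_ge0 //.
    apply: l1_coef; apply: l1M h1; apply: l1_weak (l1_expfps _).
    rewrite ler_expR nmM nmN nm_toC ler_wpM2l //; apply: le_trans (nm_sum _ _ _) _.
    apply: le_trans (_ : \sum_(j : 'I_n) rho <= _); last by rewrite sumr_const card_ord mulr_natl.
    rewrite big_mkcond; apply: ler_sum => j _; case: ifP => _; [exact: ltW|exact: ltW].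
  rewrite lef_pV2 ?posrE ?exprn_gt0 //; last by rewrite lt_def nm_ge0 nm_eq0 polar_subfamily_neq0.
  rewrite -polarS_subfamily // /polarS nm_prod.
  apply: le_trans (_ : \prod_(i in S) g ^+ k <= _); first by rewrite prodr_const Sk exprM.
  apply: ler_prod => i iS; rewrite exprn_ge0 ?(ltW g0) //= nm_prod -[X in g ^+ X]Sck -prodr_const.
  apply: ler_prod => j; rewrite inE => jS; rewrite (ltW g0) /=; apply: gap.
  by apply: contra jS => /eqP <-.
have B10 : 0 <= B1.
  apply: le_trans (torus 0%N (\row_i toC (rad i)) _); first exact: nm_ge0.
  by move=> i; rewrite mxE nm_toC ger0_norm // radE mulr_ge0 // ltW.
(* [hom_bound] gives (1/2)^(D - k^2) with truncated subtraction; the factor 2^(k^2) makes up for the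
   shift. *)
exists (B1 * 2 ^+ n * 2 ^+ (k * k)); first by rewrite !mulr_ge0 ?exprn_ge0.
move=> D z zr.
have h := @hom_bound R n (D - k * k)%N (QD D) rad g B1 g0 _ (hom_QD D) (torus D) z _.
apply: le_trans (h _ _) _.
- by move=> i; rewrite radE ler_peMr ?(ltW g0) // ler1n.
- move=> i; apply: le_trans (zr i) _; rewrite /g -mulrA ler_wpM2l ?(ltW rho0) //.
  by have -> : (2 * n%:R)^-1 / 4 = (8 * n%:R)^-1 :> R by field; rewrite gt_eqF.
rewrite -!mulrA ler_wpM2l // ler_wpM2l ?exprn_ge0 //.
rewrite div1r !exprVn ler_pdivlMr ?exprn_gt0 // mulrC ler_pdivrMr ?exprn_gt0 // -exprD.
by rewrite ler_weXn2l ?ler1n //; lia.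
Qed.

Lemma near_within_rV0 (P : 'rV[C]_n -> Prop) :
  (exists2 e : R, 0 < e & forall delta, injective (delta ord0) -> (forall i, nm (delta ord0 i) < e) -> P delta) ->
  \forall delta \near within [set delta : 'rV[C]_n | injective (delta ord0)]%classic (nbhs (0 : 'rV[C]_n)), P delta.
Proof. by move=> [e e0 h]; apply/near_rV0; exists e => // z ze di; apply: h. Qed.

Local Open Scope classical_set_scope.
Lemma Qgen_cvg : Qgen delta @[delta --> within [set delta : 'rV[C]_n | injective (delta ord0)]
    (nbhs (0 : 'rV[C]_n))] --> (\sum_(j < (k * k).+1) cN (k * k - j) * toC x ^+ j : C).
Proof.
have [B B0 QB] := QD_bound.
set top := \sum_(j < (k * k).+1) _.
have n0 : 0 < (n%:R : R) by rewrite ltr0n.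
have e0 : 0 < rho / (8 * n%:R) by rewrite divr_gt0 // mulr_gt0.
pose b D : R := B * (1 / 2) ^+ D.
have b0 D : 0 <= b D by rewrite mulr_ge0 ?exprn_ge0.
have bM : bsum b (B * 2) by move=> N; rewrite -mulr_sumr ler_wpM2l // geom_half.
apply: (@tannery R _ _ _ (fun D delta => QD D delta) (fun D => if D == (k * k)%N then top else 0) b (B * 2)
  Qgen top b0 bM).
- apply: near_within_rV0; exists (rho / (8 * n%:R)) => // delta di dr; split=> [D|].
    by apply: QB => i; exact: ltW.
  apply: sums_QD => // i; apply: lt_le_trans (dr i) _.
  rewrite ler_pdivrMr ?mulr_gt0 // ler_peMr ?(ltW rho0) // -natrM ler1n muln_gt0 //.
- move=> D; case: eqP => [->|_]; last by rewrite nm0.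
  rewrite /top -(QD_top 0); apply: QB => i; rewrite mxE nm0; exact: ltW.
- move=> D; case: (ltngtP D (k * k)%N) => Dk.
  + rewrite (_ : QD D = fun=> 0); first exact: cvgK_cst.
    by apply/funext => z; rewrite QD_small.
  + apply/cvgCP => e e1; apply: near_within_rV0.
    have [|K K0 hK] := @hom_cvg0 R n (D - k * k).-1 (QD D).
      by rewrite prednK ?subn_gt0 //; exact: hom_QD.
    exists (Num.min 1 (e / (K + 1))); first by rewrite lt_min ltr01 divr_gt0 // ltr_wpDl.
    move=> delta _ dr; rewrite subr0.
    have h i : nm (delta ord0 i) <= Num.min 1 (e / (K + 1)) := ltW (dr i).
    apply: le_lt_trans (hK _ (Num.min 1 (e / (K + 1))) _ h) _.
      by rewrite ge_min lexx le_min ler01 divr_ge0 // ?(ltW e1) // addr_ge0.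
    apply: le_lt_trans (_ : K * (e / (K + 1)) < e).
      by rewrite ler_wpM2l // ge_min lexx orbT.
    by rewrite mulrCA gtr_pMr // ltr_pdivrMr ?mul1r ?ltrDl // ltr_wpDl.
  + rewrite (_ : QD D = fun=> top); first exact: cvgK_cst.
    by apply/funext => z; rewrite Dk QD_top.
have h := @sums_finite R (fun D => if D == (k * k)%N then top else 0) (k * k).+1.
have E : top = \sum_(i < (k * k).+1) (if (i : nat) == (k * k)%N then top else 0).
  rewrite (bigD1 ord_max) //= eqxx big1 ?addr0 // => i /negPf ne.
  by case: eqP => // e; move: ne; rewrite -(inj_eq val_inj) /= e eqxx.
by rewrite [X in sums _ X]E; apply: h => D Dk; rewrite gtn_eqF.
Qed.

End Moments.

(** * Identification of the moment polynomial *)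

Section FinalLimit.
Local Open Scope classical_set_scope.
Variables (R : realType) (m : nat).
Notation C := (cplx R).
Notation k := m.+1.

Definition moment_poly : {poly C} := \poly_(j < (k ^ 2).+1) cN R m (k ^ 2 - j).

Lemma Qk_cvg (x : R) : Qk x delta @[delta --> within [set delta : 'rV[C]_(2 * k) | injective (delta ord0)]%classic
    (nbhs (0 : 'rV[C]_(2 * k)))] --> (moment_poly.[toC x] : C).
Proof.
have [rho [M [rho0 h]]] := Fk_series R m.
(* The dimensions 2 * k and k + k are equal but not convertible, so the statement is transported
   along an equation. *)
have gen n (e : n = (k + k)%N) :
   (fun delta : 'rV[C]_n => \sum_(S : {set 'I_n} | #|S| == k)
      cexp (- toC x * \sum_(j in ~: S) delta ord0 j) * Fk (subfamily k S delta) (subfamily k (~: S) delta))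
   delta @[delta --> within [set delta : 'rV[C]_n | injective (delta ord0)]%classic (nbhs (0 : 'rV[C]_n))]
   --> (moment_poly.[toC x] : C).
  subst n; have := @Qgen_cvg R m x rho M rho0 h.
  by rewrite /moment_poly horner_poly.
by apply: gen; rewrite mul2n addnn.
Qed.

(** Points with distinct coordinates accumulate at 0, whence limits along the restricted filter are
    unique. *)
Lemma injective_seq : exists u : nat -> 'rV[C]_(2 * k), (forall N, injective (u N ord0)) /\
  forall e : R, 0 < e -> exists N0, forall N, (N0 <= N)%N -> forall i, nm (u N ord0 i) < e.
Proof.
exists (fun N => \row_i ((i : nat)%:R / N.+1%:R)); split.
  move=> N i j; rewrite !mxE => /(mulIf _) h; apply: val_inj; apply/eqP.
  by rewrite -(eqr_nat C); apply/eqP; apply: h; rewrite invr_neq0 // pnatr_eq0.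
move=> e e0; have hb := archi_boundP (divr_ge0 (ler0n R (2 * k)) (ltW e0)).
exists (Num.bound ((2 * k)%:R / e)) => N hN i; rewrite mxE nmM nmV !nm_nat ltr_pdivrMr ?ltr0n //.
apply: lt_le_trans (_ : (2 * k)%:R <= _); first by rewrite ltr_nat.
rewrite mulrC -ler_pdivrMr //; apply: le_trans (ltW hb) _.
by rewrite ler_nat (leq_trans hN).
Qed.

Lemma within_cvg_unique (f : 'rV[C]_(2 * k) -> C) (l l' : C) :
  let F := within [set delta : 'rV[C]_(2 * k) | injective (delta ord0)]%classic (nbhs (0 : 'rV[C]_(2 * k))) in
  f @ F --> l -> f @ F --> l' -> l = l'.
Proof.
move=> F; have [u [ui u0]] := injective_seq.
have sub (l0 : C) : f @ F --> l0 -> f \o u @ \oo --> l0.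
  move=> /cvgCP h; apply/cvgCP => e e0; have /near_rV0 [e1 e10 h1] := h e e0.
  have [N0 hN] := u0 e1 e10; exists N0 => // N /= NN; apply: h1; last exact: ui.
  exact: hN.
by move=> /sub h1 /sub h2; apply: (cvgK_unique h1 h2).
Qed.

Lemma moment_poly_spec : is_moment_poly k moment_poly.
Proof. by split; [exact: size_poly|exact: Qk_cvg]. Qed.

(** Uniqueness of the limit makes any two admissible polynomials agree at every natural number. *)
Lemma Pk_eq : Pk R k = moment_poly.
Proof.
have [_ h] : is_moment_poly k (Pk R k).
  by apply: (@xgetPex _ 0 (is_moment_poly (R := R) k)); exists moment_poly; exact: moment_poly_spec.
apply/eqP; rewrite -subr_eq0; apply/eqP; apply: (poly_zeros (s := fun i => toC i%:R)).
  by move=> i j /toC_inj /eqP; rewrite eqr_nat => /eqP.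
move=> i; rewrite hornerD hornerN; apply/eqP; rewrite subr_eq0; apply/eqP.
exact: (within_cvg_unique (h i%:R) (@Qk_cvg i%:R)).
Qed.

Lemma moment_coefE N : (N <= k ^ 2)%N -> moment_coef R k N = cN R m N.
Proof. by move=> Nk; rewrite /moment_coef Pk_eq coef_poly ltnS leq_subr subKn. Qed.

End FinalLimit.

Theorem theorem1p3 (R : realType) :
  (forall k N : nat, (1 <= k)%N -> (N <= k ^ 2)%N ->
     moment_coef R k N =
     ((k ^ 2 - N)`!)%:R^-1
     * \sum_(a < N.+1) \sum_(kap <- parts a | fits k kap)
         \sum_(lam <- parts (N - a))
           dcoef R k kap lam * (dim_skew lam (compl_part k kap))%:R)
  /\
  (forall (r : nat) (mu nu : seq nat),
     (1 <= r)%N -> is_part mu -> is_part nu ->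
     exists2 q : {poly rat}, (size q <= (2 * r).+1)%N &
       forall k : nat, (1 <= k)%N -> Vcoef r mu nu k = q.[k%:R]).
Proof.
split=> [[//|m] N _ Nk|r mu nu _ _ _]; first exact: moment_coefE.
have [q sq qE] := Vcoef_poly r mu nu.
by exists q => // k _; apply: qE.
Qed.
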